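(* Let $p:\mathbb{R}^n\to\mathbb{R}^m$ be a pseudo-immersion and let $X\subseteq\mathbb{R}^d$ be $\mathcal{A}^\infty$-admissible. Then for every continuous map $f:X\to\mathbb{R}^n$ with $p\circ f\in\mathcal{C}^\infty(X,\mathbb{R}^m)$ we have $f\in\mathcal{C}^\infty(X,\mathbb{R}^n)$. In particular, this holds when $X$ is a H\''older set or a simple fat closed subanalytic subset of $\mathbb{R}^d$.
   Context: A smooth map $p:N\to M$ between smooth manifolds is a pseudo-immersion if for every smooth manifold $P$ and every continuous map $f:P\to N$, $p\circ f$ smooth implies $f$ smooth. For $X\subseteq\mathbb{R}^d$: $\mathcal{C}^\infty(X,\mathbb{R}^k)$ is the set of maps $f:X\to\mathbb{R}^k$ such that each $x\in X$ has an open neighborhood $V$ in $\mathbb{R}^d$ and a smooth $F:V\to\mathbb{R}^k$ with $F=f$ on $V\cap X$; $\mathcal{A}^\infty(X)$ is the set of $f:X\to\mathbb{R}$ with $f\circ c$ smooth for every smooth $c:\mathbb{R}\to\mathbb{R}^d$ with $c(\mathbb{R})\subseteq X$; $X$ is $\mathcal{A}^\infty$-admissible if $\mathcal{A}^\infty(X)=\mathcal{C}^\infty(X,\mathbb{R})$. A closed set $X$ is fat if $X=\overline{\mathrm{int}(X)}\neq\emptyset$; simple if each $x\in X$ has a basis of neighborhoods $\mathscr U$ with $U\cap\mathrm{int}(X)$ connected for all $U\in\mathscr U$. H\''older set: a fat closed set whose interior $U$ has, for some $\alpha\in(0,1]$, the property that for every $x\in\partial U$ there are $\epsilon>0$, $r,h>0$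 and $A\in O(d)$ with $y+A\Gamma^\alpha_d(r,h)\subseteq U$ for all $y\in\overline U\cap B(x,\epsilon)$, where $\Gamma^\alpha_d(r,h)=\{(x',x_d)\in\mathbb{R}^{d-1}\times\mathbb{R}:|x'|<r,\ h(|x'|/r)^\alpha<x_d<h\}$. Subanalytic is meant in the sense of real analytic geometry. *)

(* Defs.v *)
From HB Require Import structures.
From mathcomp Require Import all_boot all_order all_algebra.
From mathcomp Require Import all_classical all_reals all_analysis.
Set Implicit Arguments. Unset Strict Implicit. Unset Printing Implicit Defensive.
Import Order.TTheory GRing.Theory Num.Theory.
Import numFieldNormedType.Exports.
Local Open Scope classical_set_scope.
Local Open Scope ring_scope.

Section Defs.
Variable R : realType.

Definition Diter {U V : normedModType R} (vs : seq U) (f : U -> V) : U -> V :=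
  foldr (fun v g => fun x => derive g x v) f vs.

Definition smooth_on {U V : normedModType R} (A : set U) (f : U -> V) : Prop :=
  forall vs : seq U,
    (forall x, A x -> {for x, continuous (Diter vs f)}) /\
    (forall v x, A x -> derivable (Diter vs f) x v).

Definition Cinf {U V : normedModType R} (X : set U) (f : U -> V) : Prop :=
  forall x, X x -> exists (W : set U) (F : U -> V),
    [/\ open W, W x, smooth_on W F & forall y, W y -> X y -> F y = f y].

Definition Ainf {d : nat} (X : set 'rV[R]_d) (f : 'rV[R]_d -> R) : Prop :=
  forall c : R -> 'rV[R]_d, smooth_on setT c -> (forall t, X (c t)) ->
    smooth_on setT (f \o c).

Definition Ainf_admissible {d : nat} (X : set 'rV[R]_d) : Prop :=
  forall f : 'rV[R]_d -> R, Ainf X f <-> Cinf X f.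

(** Pseudo-immersion p : R^n -> R^m.  Smooth manifolds P are tested
    through their charts, i.e. open subsets of R^k (smoothness is local). *)
Definition pseudo_immersion {n m : nat} (p : 'rV[R]_n -> 'rV[R]_m) : Prop :=
  smooth_on setT p /\
  forall (k : nat) (P : set 'rV[R]_k) (f : 'rV[R]_k -> 'rV[R]_n),
    open P -> {within P, continuous f} ->
    smooth_on P (p \o f) -> smooth_on P f.

Definition fat_closed {d : nat} (X : set 'rV[R]_d) : Prop :=
  closed X /\ X = closure (interior X) /\ X !=set0.

Definition head_norm {d : nat} (z : 'rV[R]_d.+1) : R :=
  Num.sqrt (\sum_(i < d.+1 | i != ord_max) z 0 i ^+ 2).
Definition last_coord {d : nat} (z : 'rV[R]_d.+1) : R := z 0 ord_max.

Definition Gamma {d : nat} (alpha r h : R) : set 'rV[R]_d.+1 :=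
  [set z | head_norm z < r /\
           h * powR (head_norm z / r) alpha < last_coord z < h].

Definition orthogonal_mx {d : nat} (A : 'M[R]_d) : Prop := A *m A^T = 1%:M.

Definition holder_set {d : nat} (X : set 'rV[R]_d.+1) : Prop :=
  fat_closed X /\
  let U := interior X in
  exists alpha : R, 0 < alpha <= 1 /\
  forall x, closure U x -> ~ U x ->
    exists eps r h : R, [/\ 0 < eps, 0 < r, 0 < h &
      exists A : 'M[R]_d.+1, orthogonal_mx A /\
        forall y, closure U y -> ball x eps y ->
          forall z, Gamma alpha r h z -> U (y + z *m A)].

Definition simple_set {d : nat} (X : set 'rV[R]_d) : Prop :=
  forall x, X x -> forall W, nbhs x W ->
    exists U, [/\ nbhs x U, U `<=` W & connected (U `&` interior X)].

(** Real analytic functions on an open set V of R^d: locally the sum of an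
    absolutely convergent power series (summed by total degree). *)
Definition monomial {d : nat} (a : 'I_d -> nat) (y : 'rV[R]_d) : R :=
  \prod_(i < d) y 0 i ^+ a i.

Definition psum_trunc {d : nat} (c : ('I_d -> nat) -> R) (N : nat)
    (y : 'rV[R]_d) : R :=
  \sum_(a : {ffun 'I_d -> 'I_N.+1} | (\sum_i (a i : nat) <= N)%N)
     c (fun i => a i : nat) * monomial (fun i => a i : nat) y.

Definition analytic_on {d : nat} (V : set 'rV[R]_d) (g : 'rV[R]_d -> R) : Prop :=
  forall x, V x -> exists (r : R) (c : ('I_d -> nat) -> R), 0 < r /\
    forall y, ball x r y ->
      cvg ((fun N => psum_trunc (fun a => `|c a|) N
                       (\row_i `|y 0 i - x 0 i|)) @ \oo) /\
      (fun N => psum_trunc c N (y - x)) @ \oo --> g y.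

Definition semianalytic {d : nat} (S : set 'rV[R]_d) : Prop :=
  forall x, exists V, [/\ open V, V x &
    exists (fs : seq (('rV[R]_d -> R) * seq ('rV[R]_d -> R))),
      (forall fg, fg \in fs -> analytic_on V fg.1 /\
                                 forall g, g \in fg.2 -> analytic_on V g) /\
      S `&` V = [set y | V y /\ exists2 fg, fg \in fs &
                  fg.1 y = 0 /\ forall g, g \in fg.2 -> 0 < g y]].

Definition proj_first {d e : nat} (z : 'rV[R]_(d + e)) : 'rV[R]_d := lsubmx z.

Definition subanalytic {d : nat} (S : set 'rV[R]_d) : Prop :=
  forall x, exists V, [/\ open V, V x &
    exists (e : nat) (B : set 'rV[R]_(d + e)),
      [/\ semianalytic B, bounded_set B &
          S `&` V = proj_first @` B]].

End Defs.

(* Main.v *)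
Require Import Defs.
From HB Require Import structures.
From mathcomp Require Import all_boot all_order all_algebra.
From mathcomp Require Import all_classical all_reals all_analysis.
From mathcomp Require Import ring lra zify perm.
Set Implicit Arguments. Unset Strict Implicit. Unset Printing Implicit Defensive.
Import Order.TTheory GRing.Theory Num.Theory.
Import numFieldNormedType.Exports.
Local Open Scope classical_set_scope.
Local Open Scope ring_scope.

(** Testing on smooth maps c into X turns the hypothesis on p into: every component of f is smooth along every
such c.  Let U be the interior of X.  In the last two cases f is smooth on U and U is dense in X, so by a
Whitney-type extension theorem it suffices to estimate the Taylor remainders of f on U near a point of X.

Near a point of a Hoelder set all derivatives of f are bounded, because f is smooth along a single map gluing
together cusps attached to an arbitrary sequence of points; two points are then joined inside U through cusps.

For X subanalytic, analytic functions are locally monomial times unit after finitely many blow-ups, ramifications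
and implicit-function translations.  This covers X near a point by analytic sheets E(t, w); those of rank < dim X
everywhere have nowhere dense image and are dropped, the others lie in U for t <> 0.  Testing f along
E(t, w) + kap t^k u shows that the derivatives of f extend smoothly along the sheets.  On a fibre of the sheets
they take finitely many values, hence only one since X is simple, and the Lojasiewicz inequality between two
sheets gives the remainder estimates. *)

Lemma le_normD (R : numDomainType) (V : normedZmodType R) (x y : V) (c : R) : `|x| + `|y| <= c -> `|x + y| <= c.
Proof. exact: le_trans (ler_normD x y). Qed.

Lemma lt_normD (R : numDomainType) (V : normedZmodType R) (x y : V) (c : R) : `|x| + `|y| < c -> `|x + y| < c.
Proof. exact: le_lt_trans (ler_normD x y). Qed.

Lemma le_normB (R : numDomainType) (V : normedZmodType R) (x y : V) (c : R) : `|x| + `|y| <= c -> `|x - y| <= c.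
Proof. exact: le_trans (ler_normB x y). Qed.

Lemma norm_sum_le (R : realType) n (F : 'I_n -> R) (C : R) : (forall i, `|F i| <= C) -> `|\sum_i F i| <= n%:R * C.
Proof.
move=> FC; apply: le_trans (ler_norm_sum _ _ _) _; apply: (@le_trans _ _ (\sum_(i < n) C)); first exact: ler_sum.
by rewrite sumr_const card_ord -[leLHS]mulr_natl.
Qed.

Lemma row_norm_le (R : realType) d (x : 'rV[R]_d) (r : R) : 0 <= r -> (forall i, `|x 0 i| <= r) -> `|x| <= r.
Proof. by move=> r0 xr; rewrite [leLHS]mx_normrE; apply: bigmax_le => // -[a i] _ /=; rewrite ord1. Qed.

Lemma row_norm_lt (R : realType) d (x : 'rV[R]_d) (r : R) : 0 < r -> (forall i, `|x 0 i| < r) -> `|x| < r.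
Proof. by move=> r0 xr; rewrite [ltLHS]mx_normrE; apply: bigmax_lt => // -[a i] _ /=; rewrite ord1. Qed.

Lemma delta_norm_le1 (R : realType) d (i : 'I_d) : `|delta_mx 0 i : 'rV[R]_d| <= 1.
Proof. by apply: row_norm_le => // j; rewrite mxE; case: (_ && _); rewrite ?normr1 ?normr0. Qed.

Lemma ball0E {R : realType} {V : normedModType R} (r : R) (x : V) : ball 0 r x = (`|x| < r) :> Prop.
Proof. by rewrite -ball_normE /ball_ /= sub0r normrN. Qed.

Lemma ball0P {R : realType} {V : normedModType R} (r : R) (x : V) : ball 0 r x <-> `|x| < r.
Proof. by rewrite ball0E. Qed.

Lemma ballE {R : realType} {V : normedModType R} (r : R) (x y : V) : ball x r y = (`|y - x| < r) :> Prop.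
Proof. by rewrite -ball_normE /ball_ /= distrC. Qed.

Lemma le_eq (R : realType) (x y : R) : x = y -> x <= y.
Proof. by move=> ->. Qed.

Lemma limit_eq {R : realType} {V : normedModType R} (a b : V -> R) x : {for x, continuous a} -> {for x, continuous b} ->
 (forall e : R, 0 < e -> exists2 x', `|x' - x| < e & a x' = b x') -> a x = b x.
Proof.
move=> ca cb H; apply/subr0_eq/eqP; rewrite -normr_le0; apply/ler_addgt0Pr => e e0; rewrite add0r.
have e20 : 0 < e / 2 by rewrite divr_gt0.
have /cvgrPdist_lt /(_ _ e20) /nbhs_ballP [ra /= ra0 raP] := ca.
have /cvgrPdist_lt /(_ _ e20) /nbhs_ballP [rb /= rb0 rbP] := cb.
have [|x' x'x E] := H (Num.min ra rb); first by rewrite lt_min ra0.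
move: x'x; rewrite lt_min distrC => /andP[xa xb].
have ha := raP x' (ltac:(by rewrite -ball_normE)); have hb := rbP x' (ltac:(by rewrite -ball_normE)).
rewrite -[a x - b x](subrKA (a x')); apply: le_normD.
by rewrite {2}E [`|b x' - _|]distrC; move: ha hb => /=; lra.
Qed.

Section FiniteSmoothness.
Context {R : realType}.

Fixpoint Cn {U V : normedModType R} (n : nat) (A : set U) (f : U -> V) : Prop :=
 (forall x, A x -> {for x, continuous f}) /\
 if n is n'.+1 then
  forall v, (forall x, A x -> derivable f x v) /\
       Cn n' A (fun x => derive f x v)
 else True.

Lemma Cn_continuous {U V : normedModType R} n (A : set U) (f : U -> V) :
 Cn n A f -> forall x, A x -> {for x, continuous f}.
Proof. by case: n => [|n] []. Qed.

Lemma CnW {U V : normedModType R} n (A : set U) (f : U -> V) :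
 Cn n.+1 A f -> Cn n A f.
Proof.
elim: n f => [|n IHn] f [cf df]; first by split.
split=> // v; split; first by case: (df v).
exact/IHn/(df v).2.
Qed.

Lemma Cn_sub {U V : normedModType R} n (A B : set U) (f : U -> V) :
 B `<=` A -> Cn n A f -> Cn n B f.
Proof.
move=> BA; elim: n f => [|n IHn] f [cf df]; split=> //; try by move=> x /BA /cf.
move=> v; have [dfv Df] := df v; split; last exact: IHn.
by move=> x /BA /dfv.
Qed.

Lemma smooth_onP {U V : normedModType R} (A : set U) (f : U -> V) :
 smooth_on A f <-> forall n, Cn n A f.
Proof.
split=> [sf n|Cf vs].
 elim: n f sf => [|n IHn] f sf.
  by split=> //; exact: (sf [::]).1.
 split; first exact: (sf [::]).1.
 move=> v; split; first by move=> x; exact: (sf [::]).2.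
 apply: IHn => vs; have := sf (rcons vs v).
 by rewrite /Diter foldr_rcons.
elim/last_ind: vs f Cf => [|vs v IHvs] f Cf.
 split; first by case: (Cf 0).
 by move=> v x Ax; have [_ /(_ v) [+ _]] := Cf 1; apply.
rewrite /Diter foldr_rcons; apply: IHvs => n.
by have [_ /(_ v) []] := Cf n.+1.
Qed.

Lemma near_open_eq {U V : normedModType R} (A : set U) (f g : U -> V) x :
 open A -> (forall y, A y -> f y = g y) -> A x -> \near x, f x = g x.
Proof. by move=> oA fg Ax; apply: filterS (open_nbhs_nbhs (conj oA Ax)). Qed.

Lemma near_eq_continuous_at {U V : normedModType R} (f g : U -> V) x :
 (\near x, f x = g x) -> {for x, continuous f} -> {for x, continuous g}.
Proof.
move=> fg cf; have fgx : f x = g x := nbhs_singleton fg.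
suff : g @ x --> g x by [].
rewrite -fgx; apply: cvg_trans cf; exact: near_eq_cvg.
Qed.

Lemma Cn_ext {U V : normedModType R} n (A : set U) (f g : U -> V) :
 open A -> (forall x, A x -> f x = g x) -> Cn n A f -> Cn n A g.
Proof.
move=> oA; elim: n f g => [|n IHn] f g fg [cf df].
 split=> // x Ax.
 exact: (near_eq_continuous_at (near_open_eq oA fg Ax)) (cf _ Ax).
split=> [x Ax|v].
 exact: (near_eq_continuous_at (near_open_eq oA fg Ax)) (cf _ Ax).
have [dfv Df] := df v; split.
 move=> x Ax; apply: near_eq_derivable (dfv _ Ax); exact: (near_open_eq oA).
apply: IHn Df => x Ax; apply: near_eq_derive; exact: (near_open_eq oA).
Qed.

Lemma Cn_cst {U V : normedModType R} n (A : set U) (a : V) : Cn n A (cst a).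
Proof.
elim: n a => [|n IHn] a; split=> //; try by move=> x _; exact: cst_continuous.
move=> v; split=> [x _|]; first exact: derivable_cst.
rewrite (_ : (fun x => _) = cst 0) //.
by apply/funext => x; exact: derive_cst.
Qed.

Lemma CnD {U V : normedModType R} n (A : set U) (f g : U -> V) :
 open A -> Cn n A f -> Cn n A g -> Cn n A (fun x => f x + g x).
Proof.
move=> oA; elim: n f g => [|n IHn] f g [cf df] [cg dg].
 by split=> // x Ax; apply: cvgD; [exact: cf | exact: cg].
split=> [x Ax|v]; first by apply: cvgD; [exact: cf | exact: cg].
have [dfv Df] := df v; have [dgv Dg] := dg v; split.
 by move=> x Ax; apply: derivableD; [exact: dfv | exact: dgv].
apply: Cn_ext (IHn _ _ Df Dg) => // x Ax.
by rewrite -deriveD //; [exact: dfv | exact: dgv].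
Qed.

Lemma CnM {U : normedModType R} n (A : set U) (f g : U -> R) :
 open A -> Cn n A f -> Cn n A g -> Cn n A (fun x => f x * g x).
Proof.
move=> oA; elim: n f g => [|n IHn] f g Cf Cg.
 have [[cf _] [cg _]] := (Cf, Cg).
 by split=> // x Ax; apply: cvgM; [exact: cf | exact: cg].
have [[cf df] [cg dg]] := (Cf, Cg).
split=> [x Ax|v]; first by apply: cvgM; [exact: cf | exact: cg].
have [dfv Df] := df v; have [dgv Dg] := dg v; split.
 by move=> x Ax; apply: derivableM; [exact: dfv | exact: dgv].
apply: Cn_ext (CnD oA (IHn _ _ (CnW Cf) Dg) (IHn _ _ (CnW Cg) Df)) => // x Ax.
by rewrite -[LHS]deriveM //; [exact: dfv | exact: dgv].
Qed.

Lemma Cn_sum {U V : normedModType R} n (A : set U) d (f : 'I_d -> U -> V) :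
 open A -> (forall i, Cn n A (f i)) -> Cn n A (fun x => \sum_(i < d) f i x).
Proof.
move=> oA; elim: d f => [|d IHd] f Cf.
 rewrite (_ : (fun x => _) = cst 0); first exact: Cn_cst.
 by apply/funext => x; rewrite big_ord0.
rewrite (_ : (fun x => _) =
 fun x => \sum_(i < d) f (widen_ord (leqnSn d) i) x + f ord_max x).
 by apply: CnD => //; apply: IHd.
by apply/funext => x; rewrite big_ord_recr.
Qed.

Lemma continuous_row {U : normedModType R} d (f : U -> 'rV[R]_d) x :
 {for x, continuous f} <-> forall i, {for x, continuous (fun y => f y 0 i)}.
Proof.
split=> [cf i|cf].
 exact: (@continuous_comp _ _ _ f (fun M : 'rV[R]_d => M 0 i)) cf
  (@coord_continuous _ _ _ _ _ _).
apply/cvgrPdist_lt => e e0.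
have : \forall y \near x, forall i, `|f x 0 i - f y 0 i| < e.
 by apply: filter_forall => i; move/cvgrPdist_lt : (cf i); exact.
by apply: filterS => y fxy; apply: row_norm_lt => // i; rewrite !mxE fxy.
Qed.

Lemma Cn_row {U : normedModType R} n (A : set U) d (f : U -> 'rV[R]_d) :
 open A -> Cn n A f <-> forall i, Cn n A (fun x => f x 0 i).
Proof.
move=> oA; elim: n f => [|n IHn] f; split.
- by move=> [cf _] i; split=> // x Ax; have /continuous_row := cf _ Ax; exact.
- by move=> cf; split=> // x Ax; apply/continuous_row => i; have [+ _] := cf i; exact.
- move=> [cf df] i; split=> [x Ax|v].
  by have /continuous_row := cf _ Ax; exact.
 have [dfv Df] := df v; split=> [x Ax|].
  by have /derivable_mxP := dfv _ Ax; exact.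
 move/IHn : Df => /(_ i); apply: Cn_ext => // x Ax.
 by rewrite derive_mx ?mxE //; exact: dfv.
- move=> Cf; split=> [x Ax|v].
  by apply/continuous_row => i; exact: (Cn_continuous (Cf i)).
 have dfv x : A x -> derivable f x v.
  move=> Ax; apply/derivable_mxP => i j; rewrite ord1.
  by have [_ /(_ v) [+ _]] := Cf j; exact.
 split=> //; apply/IHn => i; have [_ /(_ v) [_]] := Cf i.
 by apply: Cn_ext => // x Ax; rewrite derive_mx ?mxE //; exact: dfv.
Qed.

Lemma Cn_comp_linear {U U' V : normedModType R} n (F : U' -> V) (l : U -> U') :
 linear l -> continuous l -> Cn n setT F -> Cn n setT (F \o l).
Proof.
move=> ll cl; elim: n F => [|n IHn] F [cF dF].
 by split=> // x _; apply: continuous_comp; [exact: cl | exact: cF].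
split=> [x _|v]; first by apply: continuous_comp; [exact: cl | exact: cF].
have E x : (fun h : R => h^-1 *: (((F \o l) \o shift x) (h *: v) - (F \o l) x)) =
      (fun h => h^-1 *: ((F \o shift (l x)) (h *: l v) - F (l x))).
 by apply/funext => h /=; rewrite ll.
have [dFv DF] := dF (l v); split=> [x _|].
 by rewrite /derivable E; exact: dFv.
have := IHn _ DF; apply: Cn_ext; first exact: openT.
by move=> x _; rewrite /derive E.
Qed.

Lemma mean_value_dist (g dg : R -> R) (L e b : R) :
 (forall s : R, `|s| <= `|b| -> is_derive s 1 g (dg s)) ->
 (forall s, `|s| <= `|b| -> `|dg s - L| <= e) ->
 `|g b - g 0 - b * L| <= e * `|b|.
Proof.
move=> dgP dgL.
have cg (i : interval R) : (forall s, s \in i -> `|s| <= `|b|) ->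
  {within [set` i], continuous g}.
 by move=> ib; apply: derivable_within_continuous => s /ib /dgP [].
have [b0|b0] := leP 0 b.
 have ib s : s \in `[0, b]%R -> `|s| <= `|b|.
  by rewrite in_itv /= => /andP[s0 sb]; rewrite !ger0_norm.
 have ib' s : s \in `]0, b[%R -> `|s| <= `|b|.
  by move=> /subset_itv_oo_cc /ib.
 have [c /ib cb ->] := MVT_segment b0 (fun s si => dgP s (ib' s si)) (cg _ ib).
 rewrite subr0 [dg c * b]mulrC -mulrBr normrM mulrC.
 by apply: ler_wpM2r => //; exact: dgL.
have ib s : s \in `[b, 0]%R -> `|s| <= `|b|.
 by rewrite in_itv /= => /andP[bs s0]; rewrite !ler0_norm ?lerN2 // ltW.
have ib' s : s \in `]b, 0[%R -> `|s| <= `|b|.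
 by move=> /subset_itv_oo_cc /ib.
have [c /ib cb E] :=
 MVT_segment (ltW b0) (fun s si => dgP s (ib' s si)) (cg _ ib).
rewrite -(opprB (g 0)) E sub0r mulrN opprK [dg c * b]mulrC -mulrBr normrM mulrC.
by apply: ler_wpM2r => //; exact: dgL.
Qed.

Lemma is_derive_line {U V : normedModType R} (F : U -> V) (a v : U) (s : R) :
 derivable F (s *: v + a) v ->
 is_derive s 1 (fun t : R => F (t *: v + a)) (derive F (s *: v + a) v).
Proof.
move=> dF.
have E : (fun h : R => h^-1 *: (((fun t => F (t *: v + a)) \o shift s) (h *: 1)
                - F (s *: v + a))) =
     (fun h => h^-1 *: ((F \o shift (s *: v + a)) (h *: v)
                - F (s *: v + a))).
 by apply/funext => h /=; rewrite [h *: 1]mulr1 scalerDl addrA.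
by split; [rewrite /derivable E | rewrite /derive E].
Qed.

Definition row_trunc d (k : nat) (h : 'rV[R]_d) : 'rV[R]_d :=
 \row_j (if (j < k)%N then h 0 j else 0).

Lemma row_truncS d (k : 'I_d) (h : 'rV[R]_d) :
 row_trunc k.+1 h = h 0 k *: delta_mx 0 k + row_trunc k h.
Proof.
apply/rowP => j; rewrite !mxE eqxx /= ltnS leq_eqVlt val_eqE.
by have [->|_] := eqVneq j k; rewrite ?ltnn ?mulr1 ?mulr0 ?addr0 ?add0r.
Qed.

Lemma coord_le_norm d (h : 'rV[R]_d) i : `|h 0 i| <= `|h|.
Proof. by rewrite [leRHS]mx_normrE; exact: (le_bigmax _ _ (0, i)). Qed.

Lemma row_trunc_line_norm d (k : 'I_d) (h : 'rV[R]_d) (s : R) :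
 `|s| <= `|h 0 k| -> `|s *: delta_mx 0 k + row_trunc k h| <= `|h|.
Proof.
move=> sh; rewrite [leLHS]mx_normrE; apply: bigmax_le => // -[i j] _ /=.
rewrite !mxE ord1 eqxx /=.
have [->|_] := eqVneq j k.
 by rewrite ltnn mulr1 addr0 (le_trans sh) // coord_le_norm.
by rewrite mulr0 add0r; case: ifP => _; rewrite ?normr0 // coord_le_norm.
Qed.

Definition gradient_form d (F : 'rV[R]_d -> R) (y h : 'rV[R]_d) : R :=
 \sum_(i < d) h 0 i * derive F y (delta_mx 0 i).

Lemma gradient_form_is_linear d (F : 'rV[R]_d -> R) y :
 linear (gradient_form F y).
Proof.
move=> a u v; rewrite /gradient_form scaler_sumr -big_split /=.
by apply: eq_bigr => i _; rewrite !mxE mulrDl [a *: _]mulrA.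
Qed.
HB.instance Definition _ d (F : 'rV[R]_d -> R) y :=
 GRing.isLinear.Build R 'rV[R]_d R _ (gradient_form F y)
  (gradient_form_is_linear F y).

Lemma gradient_form_continuous d (F : 'rV[R]_d -> R) y :
 continuous (gradient_form F y).
Proof.
move=> x.
have CF : Cn 0 [set: 'rV[R]_d] (gradient_form F y).
 apply: Cn_sum => [|i]; first exact: openT.
 apply: CnM; [exact: openT| |exact: Cn_cst].
 by split=> // z _; exact: coord_continuous.
exact: (Cn_continuous CF).
Qed.

Lemma continuous_partials_differentiable d (F : 'rV[R]_d -> R)
  (W : set 'rV[R]_d) y :
 open W -> W y -> (forall x i, W x -> derivable F x (delta_mx 0 i)) ->
 (forall i, {for y, continuous (fun x => derive F x (delta_mx 0 i))}) ->
 differentiable F y /\ forall v, derive F y v = gradient_form F y v.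
Proof.
move=> oW Wy dF cF.
have oFy : F \o shift y = cst (F y) + gradient_form F y +o_ (0 : 'rV[R]_d) id.
 apply/eqaddoP => e e0.
 have d0 : 0 < e / d.+1%:R by rewrite divr_gt0.
 have part : \forall x \near y, forall i : 'I_d,
   `|derive F x (delta_mx 0 i) - derive F y (delta_mx 0 i)| <= e / d.+1%:R.
  have near_i (i : 'I_d) : nbhs y [set x : 'rV[R]_d |
   `|derive F x (delta_mx 0 i) - derive F y (delta_mx 0 i)| <= e / d.+1%:R].
   have /cvgrPdist_le /(_ _ d0) := cF i.
   by apply: filterS => x /=; rewrite distrC.
  exact: filter_forall near_i.
 have : nbhs y (W `&` [set x | forall i : 'I_d,
   `|derive F x (delta_mx 0 i) - derive F y (delta_mx 0 i)| <= e / d.+1%:R]).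
  by apply: filterI => //; exact: open_nbhs_nbhs.
 move=> /nbhs_ballP [r /= r0 rP].
 near=> h; rewrite /= !fctE /cst.
 have hr : `|h| < r.
  near: h; have := @nbhsx_ballx _ _ (0 : 'rV[R]_d) _ r0.
  by apply: filterS => h; rewrite ball0E.
 pose G (k : nat) := F (row_trunc k h + y).
 have Gd : G d = F (h + y).
  congr (F (_ + _)); apply/rowP => j; by rewrite mxE ltn_ord.
 have G0 : G 0 = F y.
  by rewrite /G (_ : row_trunc 0 h = 0) ?add0r //; apply/rowP => j; rewrite !mxE.
 rewrite -Gd opprD addrA -G0 -telescope_sumr // big_mkord /gradient_form -sumrB.
 apply: le_trans (ler_norm_sum _ _ _) _.
 apply: (@le_trans _ _ (\sum_(i < d) (e / d.+1%:R * `|h|))).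
  apply: ler_sum => i _.
  have Wi s : `|s| <= `|h 0 i| ->
    ball y r (s *: delta_mx 0 i + (row_trunc i h + y)).
   move=> sh; rewrite addrA -ball_normE /ball_ /= opprD addrCA subrr addr0 normrN.
   exact: le_lt_trans (row_trunc_line_norm sh) hr.
  have := @mean_value_dist
   (fun t => F (t *: delta_mx 0 i + (row_trunc i h + y)))
   (fun t => derive F (t *: delta_mx 0 i + (row_trunc i h + y)) (delta_mx 0 i))
   (derive F y (delta_mx 0 i)) (e / d.+1%:R) (h 0 i).
  rewrite scale0r add0r addrA -row_truncS => /(_ _ _)/le_trans; apply.
  - by move=> s sh; apply: is_derive_line; apply: dF; exact: (rP _ (Wi _ sh)).1.
  - by move=> s sh; exact: (rP _ (Wi _ sh)).2.
  - by apply: ler_wpM2l; [exact: ltW | exact: coord_le_norm].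
 rewrite sumr_const card_ord -[leLHS]mulr_natl mulrA; apply: ler_wpM2r => //.
 rewrite mulrCA ger_pMr // ler_pdivrMr // mul1r ler_nat.
 exact: leqnSn.
have cg := @gradient_form_continuous d F y.
have E := diff_unique cg oFy.
have dFy : differentiable F y.
 by apply/diff_locallyP; rewrite E.
by split=> // v; rewrite deriveE // E.
Unshelve. all: by end_near. Qed.

Lemma is_derive_comp {U : normedModType R} d (F : 'rV[R]_d -> R)
  (k : U -> 'rV[R]_d) (W : set 'rV[R]_d) x v :
 open W -> W (k x) -> (forall x i, W x -> derivable F x (delta_mx 0 i)) ->
 (forall i, {for k x, continuous (fun x => derive F x (delta_mx 0 i))}) ->
 derivable k x v ->
 is_derive x v (F \o k)
  (\sum_(i < d) derive k x v 0 i * derive F (k x) (delta_mx 0 i)).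
Proof.
move=> oW Wkx dF cF dk.
have [dFk DF] := continuous_partials_differentiable oW Wkx dF cF.
have k0 : k (0 *: v + x) = k x by rewrite scale0r add0r.
pose l := fun h : R => k (h *: v + x).
have [dl Dl] : is_derive (0 : R) 1 l (derive k x v).
 have /is_derive_line : derivable k (0 *: v + x) v by rewrite scale0r add0r.
 by rewrite scale0r add0r.
have dl' : differentiable l 0 by apply/derivable1_diffP.
have dFl : differentiable F (l 0) by rewrite /l k0.
have dFkl : differentiable (F \o l) 0 by exact: differentiable_comp.
have dFkx : derivable (F \o k) x v.
 by apply/derivable1P; apply/derivable1_diffP.
split=> //.
have /is_derive_line : derivable (F \o k) (0 *: v + x) v by rewrite scale0r add0r.
rewrite scale0r add0r => -[_ <-].
rewrite -[fun t => _]/(F \o l) deriveE // diff_comp //= -(deriveE (1 : R) dl') Dl.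
by rewrite /l k0 -deriveE // DF.
Qed.

Lemma Cn_comp {U : normedModType R} n d (F : 'rV[R]_d -> R) (k : U -> 'rV[R]_d)
  (W : set 'rV[R]_d) (A : set U) :
 open W -> open A -> (forall x, A x -> W (k x)) ->
 Cn n W F -> Cn n A k -> Cn n A (F \o k).
Proof.
move=> oW oA AW; elim: n F => [|n IHn] F CF Ck.
 split=> // x Ax; apply: continuous_comp; first exact: (Cn_continuous Ck).
 exact: (Cn_continuous CF (AW _ Ax)).
have [[cF dF] [ck dk]] := (CF, Ck).
have D x v : A x -> is_derive x v (F \o k)
  (\sum_(i < d) derive k x v 0 i * derive F (k x) (delta_mx 0 i)).
 move=> Ax; apply: (is_derive_comp oW) => //.
 - exact: AW.
 - by move=> z i; exact: (dF _).1.
 - by move=> i; exact: (Cn_continuous (dF _).2 (AW _ Ax)).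
 - exact: (dk v).1.
split=> [x Ax|v].
 by apply: continuous_comp; [exact: ck | exact: cF (AW _ Ax)].
split=> [x Ax|]; first by case: (D x v Ax).
have : Cn n A (fun x =>
  \sum_(i < d) derive k x v 0 i * (derive F ^~ (delta_mx 0 i) \o k) x).
 apply: Cn_sum => // i; apply: CnM => //.
  by move/(Cn_row _ _ oA): (dk v).2; exact.
 by apply: IHn; [exact: (dF _).2 | exact: CnW].
by apply: Cn_ext => // x Ax; case: (D x v Ax).
Qed.

End FiniteSmoothness.

Section AdmissibleSets.
Context {R : realType}.

Lemma smooth_on_row {U : normedModType R} (A : set U) d (f : U -> 'rV[R]_d) :
 open A -> smooth_on A f <-> forall i, smooth_on A (fun x => f x 0 i).
Proof.
move=> oA; split=> [/smooth_onP Cf i|Cf]; apply/smooth_onP => n.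
 by move/(Cn_row _ _ oA): (Cf n); exact.
by apply/(Cn_row _ _ oA) => i; have /smooth_onP := Cf i; exact.
Qed.

Lemma smooth_on_ext {U V : normedModType R} (A : set U) (f g : U -> V) :
 open A -> (forall x, A x -> f x = g x) -> smooth_on A f -> smooth_on A g.
Proof.
by move=> oA fg /smooth_onP Cf; apply/smooth_onP => n; exact: Cn_ext (Cf n).
Qed.

Lemma smooth_on_sub {U V : normedModType R} (A B : set U) (f : U -> V) :
 B `<=` A -> smooth_on A f -> smooth_on B f.
Proof. by move=> BA /smooth_onP Cf; apply/smooth_onP => n; exact: Cn_sub (Cf n). Qed.

Lemma smooth_on_comp {U : normedModType R} d m (F : 'rV[R]_d -> 'rV[R]_m)
  (k : U -> 'rV[R]_d) (W : set 'rV[R]_d) (A : set U) :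
 open W -> open A -> (forall x, A x -> W (k x)) ->
 smooth_on W F -> smooth_on A k -> smooth_on A (F \o k).
Proof.
move=> oW oA AW sF /smooth_onP sk; apply/(smooth_on_row _ oA) => i.
move/(smooth_on_row _ oW) : sF => /(_ i) /smooth_onP sFi; apply/smooth_onP => n.
exact: (Cn_comp oW oA AW (sFi n) (sk n)).
Qed.

Lemma smooth_on_locally {U V : normedModType R} (A : set U) (f : U -> V) :
 (forall x, A x -> exists2 B, open B /\ B x & smooth_on B f) -> smooth_on A f.
Proof.
move=> sf vs; split=> [x Ax|v x Ax]; have [B [_ Bx] sB] := sf x Ax; first exact: (sB vs).1.
exact: (sB vs).2.
Qed.

Lemma smooth_on_comp_linear {U U' V : normedModType R} (F : U' -> V)
  (l : U -> U') :
 linear l -> continuous l -> smooth_on setT F -> smooth_on setT (F \o l).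
Proof.
move=> ll cl /smooth_onP CF; apply/smooth_onP => n; exact: Cn_comp_linear.
Qed.

Lemma const_row_continuous : continuous (const_mx : R -> 'rV[R]_1).
Proof.
move=> t; apply/continuous_row => i.
rewrite (_ : (fun y => _) = id) //.
by apply/funext => y; rewrite mxE.
Qed.

Lemma pseudo_immersion_curve n m (p : 'rV[R]_n -> 'rV[R]_m) (g : R -> 'rV[R]_n) :
 pseudo_immersion p -> continuous g -> smooth_on setT (p \o g) ->
 smooth_on setT g.
Proof.
move=> [_ pP] cg sg.
have ccoord : continuous (fun u : 'rV[R]_1 => u 0 0) by exact: coord_continuous.
have sh : smooth_on setT (g \o (fun u : 'rV[R]_1 => u 0 0)).
 apply: pP; first exact: openT.
  apply: continuous_subspaceT => u.
  by apply: continuous_comp; [exact: ccoord | exact: cg].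
 apply: (smooth_on_comp_linear (F := p \o g)) => //.
 by move=> a u v; rewrite !mxE.
have : smooth_on setT ((g \o (fun u : 'rV[R]_1 => u 0 0)) \o
            (const_mx : R -> 'rV[R]_1)).
 apply: smooth_on_comp_linear => //; last exact: const_row_continuous.
 by move=> a u v; apply/rowP => i; rewrite !mxE.
rewrite (_ : _ \o _ = g) //.
by apply/funext => t /=; rewrite mxE.
Qed.

Lemma admissible_Cinf n m (p : 'rV[R]_n -> 'rV[R]_m) d (X : set 'rV[R]_d)
  (f : 'rV[R]_d -> 'rV[R]_n) :
 pseudo_immersion p -> Ainf_admissible X -> {within X, continuous f} ->
 Cinf X (p \o f) -> Cinf X f.
Proof.
move=> pP XP cf Cpf.
have Afi i : Ainf X (fun x => f x 0 i).
 move=> c sc cX.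
 have cc : continuous c by move=> s; exact: (sc [::]).1.
 apply: (proj1 (smooth_on_row _ openT) _ i) => /=.
 apply: (pseudo_immersion_curve pP).
  move=> t; have /subspace_continuousP /(_ _ (cX t)) cft := cf.
  apply: cvg_comp cft; move=> B BX.
  have : nbhs t (c @^-1` [set y | X y -> B y]) by exact: (cc t _ BX).
  by apply: filterS => s /=; apply.
 apply: smooth_on_locally => t _.
 have [W [F [oW Wct sF FE]]] := Cpf _ (cX t).
 have oA : open (c @^-1` W) by apply: open_comp => // s _; exact: cc.
 exists (c @^-1` W) => //.
 apply: (@smooth_on_ext _ _ _ (F \o c)) => //.
  by move=> s Ws /=; exact: FE.
 by apply: (smooth_on_comp oW oA _ sF) => //; exact: smooth_on_sub sc.
have Cfi i : Cinf X (fun x => f x 0 i) by exact/XP.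
move=> x Xx.
have /choice [W WP] : forall i, exists W, exists F : 'rV[R]_d -> R,
  [/\ open W, W x, smooth_on W F & forall y, W y -> X y -> F y = f y 0 i].
 by move=> i; exact: Cfi.
have /choice [F FP] := WP.
have oW : open [set y | forall i, W i y].
 rewrite openE => y Wy; rewrite /interior.
 have nW i : nbhs y (W i) by have [oWi _ _ _] := FP i; exact: open_nbhs_nbhs.
 exact: filter_forall nW.
exists [set y | forall i, W i y], (fun y => \row_i F i y); split=> //.
- by move=> i; have [] := FP i.
- apply/(smooth_on_row _ oW) => i.
 apply: (@smooth_on_ext _ _ _ (F i)) => //.
  by move=> y _; rewrite mxE.
 have [_ _ sF _] := FP i; apply: smooth_on_sub sF.
 by move=> y; exact.
- move=> y Wy Xy; apply/rowP => i; rewrite mxE.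
 by have [_ _ _ FE] := FP i; apply: FE => //; exact: Wy.
Qed.

End AdmissibleSets.
From mathcomp Require Import ring lra.

Section SmoothReal.
Context {R : realType} {U : normedModType R} (A : set U).
Hypothesis oA : open A.
Implicit Types f g : U -> R.

Lemma smooth_cst {V : normedModType R} (a : V) : smooth_on A (cst a).
Proof. by apply/smooth_onP => n; exact: Cn_cst. Qed.

Lemma smoothD {V : normedModType R} (f g : U -> V) : smooth_on A f -> smooth_on A g ->
 smooth_on A (fun x => f x + g x).
Proof.
by move=> /smooth_onP Cf /smooth_onP Cg; apply/smooth_onP => n; exact: CnD.
Qed.

Lemma smoothM f g : smooth_on A f -> smooth_on A g ->
 smooth_on A (fun x => f x * g x).
Proof.
by move=> /smooth_onP Cf /smooth_onP Cg; apply/smooth_onP => n; exact: CnM.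
Qed.

Lemma smoothZ (a : R) f : smooth_on A f -> smooth_on A (fun x => a * f x).
Proof. by apply: smoothM; exact: smooth_cst. Qed.

Lemma smoothN f : smooth_on A f -> smooth_on A (fun x => - f x).
Proof.
move=> sf; apply: smooth_on_ext (smoothZ (-1) sf) => // x _.
by rewrite mulN1r.
Qed.

Lemma smoothB f g : smooth_on A f -> smooth_on A g ->
 smooth_on A (fun x => f x - g x).
Proof. by move=> sf sg; exact: (smoothD sf (smoothN sg)). Qed.

Lemma smooth_sum (I : Type) (r : seq I) (P : pred I) (f : I -> U -> R) :
 (forall i, smooth_on A (f i)) ->
 smooth_on A (fun x => \sum_(i <- r | P i) f i x).
Proof.
move=> sf; elim: r => [|i r IHr].
 by apply: smooth_on_ext (smooth_cst (0 : R)) => // x _; rewrite big_nil.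
have [Pi|Pi] := boolP (P i).
 apply: smooth_on_ext (smoothD (sf i) IHr) => // x _.
 by rewrite big_cons Pi.
by apply: smooth_on_ext IHr => // x _; rewrite big_cons (negPf Pi).
Qed.

Lemma smooth_prod (I : Type) (r : seq I) (P : pred I) (f : I -> U -> R) :
 (forall i, smooth_on A (f i)) ->
 smooth_on A (fun x => \prod_(i <- r | P i) f i x).
Proof.
move=> sf; elim: r => [|i r IHr].
 by apply: smooth_on_ext (smooth_cst (1 : R)) => // x _; rewrite big_nil.
have [Pi|Pi] := boolP (P i).
 apply: smooth_on_ext (smoothM (sf i) IHr) => // x _.
 by rewrite big_cons Pi.
by apply: smooth_on_ext IHr => // x _; rewrite big_cons (negPf Pi).
Qed.

Lemma smoothX f n : smooth_on A f -> smooth_on A (fun x => f x ^+ n).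
Proof.
move=> sf; elim: n => [|n IHn].
 by apply: smooth_on_ext (smooth_cst (1 : R)).
by apply: smooth_on_ext (smoothM sf IHn) => // x _; rewrite exprS.
Qed.

Lemma CnV n f : (forall x, A x -> f x != 0) -> Cn n A f ->
 Cn n A (fun x => (f x)^-1).
Proof.
move=> f0; elim: n => [|n IHn] Cf.
 split=> // x Ax; apply: cvgV; first exact: f0.
 exact: (Cn_continuous Cf).
have [cf df] := Cf; split=> [x Ax|v].
 by apply: cvgV; [exact: f0 | exact: cf].
have [dfv Df] := df v; split=> [x Ax|].
 by apply: derivableV; [exact: f0 | exact: dfv].
have IH := IHn (CnW Cf).
have := CnM oA (CnM oA (Cn_cst n A (-1 : R)) (CnM oA IH IH)) Df.
apply: Cn_ext => // x Ax.
rewrite [RHS]deriveV; [|exact: f0|exact: dfv].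
by rewrite /cst mulN1r /GRing.scale /= expr2 invfM.
Qed.

Lemma smoothV f : (forall x, A x -> f x != 0) -> smooth_on A f ->
 smooth_on A (fun x => (f x)^-1).
Proof. by move=> f0 /smooth_onP Cf; apply/smooth_onP => n; exact: CnV. Qed.

Lemma smooth_continuous {V : normedModType R} (f : U -> V) x :
 smooth_on A f -> A x -> {for x, continuous f}.
Proof. by move=> sf; exact: (sf [::]).1. Qed.

Lemma smooth_derivable {V : normedModType R} (f : U -> V) x v :
 smooth_on A f -> A x -> derivable f x v.
Proof. by move=> sf; exact: (sf [::]).2. Qed.

Lemma smooth_derive {V : normedModType R} (f : U -> V) v :
 smooth_on A f -> smooth_on A (fun x => derive f x v).
Proof.
move=> /smooth_onP Cf; apply/smooth_onP => n.
by have [_ /(_ v) []] := Cf n.+1.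
Qed.

End SmoothReal.

Section SmoothComp.
Context {R : realType}.

Lemma smooth_comp {U : normedModType R} d (F : 'rV[R]_d -> R)
  (k : U -> 'rV[R]_d) (W : set 'rV[R]_d) (A : set U) :
 open W -> open A -> (forall x, A x -> W (k x)) ->
 smooth_on W F -> smooth_on A k -> smooth_on A (F \o k).
Proof.
move=> oW oA AW /smooth_onP sF /smooth_onP sk; apply/smooth_onP => n.
exact: (Cn_comp oW oA AW (sF n) (sk n)).
Qed.

Lemma smooth_coord d (A : set 'rV[R]_d) (i : 'I_d) : open A ->
 smooth_on A (fun x => x 0 i).
Proof.
move=> oA; apply: (@smooth_on_sub R _ _ setT) => //.
apply: (@smooth_on_comp_linear R _ _ _ (fun x : R => x) (fun x : 'rV[R]_d => x 0 i)).
- by move=> a u v; rewrite !mxE.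
- exact: coord_continuous.
apply/smooth_onP => n; case: n => [|n]; split=> //; try by move=> x _; exact: cvg_id.
move=> v; split=> [x _|]; first exact: derivable_id.
rewrite (_ : (fun x => _) = cst v); first exact: Cn_cst.
by apply/funext => x; exact: derive_id.
Qed.

Lemma smooth_id d (A : set 'rV[R]_d) : open A -> smooth_on A (fun x => x).
Proof. by move=> oA; apply/(smooth_on_row _ oA) => i; exact: smooth_coord. Qed.

Lemma smooth_row {U : normedModType R} d (A : set U) (f : 'I_d -> U -> R) :
 open A -> (forall i, smooth_on A (f i)) -> smooth_on A (fun x => \row_i f i x).
Proof.
move=> oA sf; apply/(smooth_on_row _ oA) => i.
by apply: smooth_on_ext (sf i) => // x _; rewrite mxE.
Qed.

End SmoothComp.

Section Words.
Context {R : realType} {d : nat}.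
Implicit Types (f g : 'rV[R]_d -> R) (w : seq 'I_d) (A : set 'rV[R]_d).

Definition Dw w f : 'rV[R]_d -> R :=
 foldr (fun i g x => derive g x (delta_mx 0 i)) f w.

Lemma Dw_cat u w f : Dw (u ++ w) f = Dw u (Dw w f).
Proof. exact: foldr_cat. Qed.

Lemma Dw_nil f : Dw [::] f = f.
Proof. by []. Qed.

Lemma Dw_cons i w f : Dw (i :: w) f = fun x => derive (Dw w f) x (delta_mx 0 i).
Proof. by []. Qed.

Lemma Dw1 i f : Dw [:: i] f = fun x => derive f x (delta_mx 0 i).
Proof. by []. Qed.

Lemma Dw_rcons w i f : Dw (rcons w i) f = Dw w (Dw [:: i] f).
Proof. by rewrite -cats1 Dw_cat. Qed.

Lemma Dw_smooth A w f : smooth_on A f -> smooth_on A (Dw w f).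
Proof.
move=> sf; elim: w => [//|i w IHw].
exact: (smooth_derive (delta_mx 0 i : 'rV[R]_d) IHw).
Qed.

Lemma smooth_wordsP A f : open A -> smooth_on A f <-> forall w,
 (forall x, A x -> {for x, continuous (Dw w f)}) /\
 (forall i x, A x -> derivable (Dw w f) x (delta_mx 0 i)).
Proof.
move=> oA; split=> [sf w|Cf].
 have sw := Dw_smooth w sf; split=> [x|i x]; first exact: smooth_continuous sw.
 exact: smooth_derivable sw.
suff H n w : Cn n A (Dw w f) by apply/smooth_onP => n; exact: (H n [::]).
elim: n w => [|n IHn] w; first by split=> //; exact: (Cf w).1.
have D x : A x -> differentiable (Dw w f) x /\
  forall v, derive (Dw w f) x v = gradient_form (Dw w f) x v.
 move=> Ax; apply: (continuous_partials_differentiable oA) => //.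
  by move=> y i Ay; exact: (Cf w).2.
 by move=> i; exact: (Cf (i :: w)).1.
split; first exact: (Cf w).1.
move=> v; split=> [x Ax|]; first by apply: diff_derivable; exact: (D x Ax).1.
have : Cn n A (fun x => \sum_(i < d) v 0 i * Dw (i :: w) f x).
 by apply: Cn_sum => // i; apply: CnM => //; exact: Cn_cst.
by apply: Cn_ext => // x Ax; rewrite (D x Ax).2.
Qed.

Lemma derive_gradient A f x v : open A -> smooth_on A f -> A x ->
 derive f x v = \sum_(i < d) v 0 i * Dw [:: i] f x.
Proof.
move=> oA sf Ax; apply: (continuous_partials_differentiable oA Ax _ _).2.
 by move=> y i Ay; exact: smooth_derivable sf Ay.
by move=> i; exact: smooth_continuous (smooth_derive _ sf) Ax.
Qed.

Lemma Dw_ext A f g w x : open A -> (forall y, A y -> f y = g y) -> A x ->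
 Dw w f x = Dw w g x.
Proof.
move=> oA fg; elim: w x => [|i w IHw] x Ax /=; first exact: fg.
by apply: near_eq_derive; exact: near_open_eq oA IHw Ax.
Qed.

Lemma Dw_cst w (a : R) x : Dw w (cst a) x = if w is [::] then a else 0.
Proof.
case: w => // i w; elim: w i x => [|j w IHw] i x; first exact: derive_cst.
have E : Dw (j :: w) (cst a) = cst 0 by apply/funext => y; exact: IHw.
by rewrite -[LHS]/(derive (Dw (j :: w) (cst a)) x (delta_mx 0 i)) E derive_cst.
Qed.

Section OnOpen.
Variable A : set 'rV[R]_d.
Hypothesis oA : open A.

Lemma DwD w f g x : smooth_on A f -> smooth_on A g -> A x ->
 Dw w (fun y => f y + g y) x = Dw w f x + Dw w g x.
Proof.
move=> sf sg; elim: w x => //= i w IHw x Ax.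
rewrite (near_eq_derive _ (near_open_eq oA IHw Ax)).
by rewrite [LHS]deriveD //; [exact: smooth_derivable (Dw_smooth w sf) Ax
              |exact: smooth_derivable (Dw_smooth w sg) Ax].
Qed.

Lemma DwZ w (a : R) f x : smooth_on A f -> A x ->
 Dw w (fun y => a * f y) x = a * Dw w f x.
Proof.
move=> sf; elim: w x => //= i w IHw x Ax.
rewrite (near_eq_derive _ (near_open_eq oA IHw Ax)).
by rewrite [LHS]deriveZ //; exact: smooth_derivable (Dw_smooth w sf) Ax.
Qed.

Lemma DwB w f g x : smooth_on A f -> smooth_on A g -> A x ->
 Dw w (fun y => f y - g y) x = Dw w f x - Dw w g x.
Proof.
move=> sf sg Ax; have sg' := smoothN oA sg.
rewrite DwD //; congr (_ + _).
rewrite (@Dw_ext A _ (fun y => (-1) * g y)) // => [|y _]; last by rewrite mulN1r.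
by rewrite DwZ // mulN1r.
Qed.

Lemma Dw_sum (I : Type) (r : seq I) (P : pred I) (f : I -> 'rV[R]_d -> R) w x :
 (forall i, smooth_on A (f i)) -> A x ->
 Dw w (fun y => \sum_(i <- r | P i) f i y) x = \sum_(i <- r | P i) Dw w (f i) x.
Proof.
move=> sf Ax; elim: r => [|i r IHr].
 rewrite big_nil (@Dw_ext A _ (cst 0)) //; last by move=> y _; rewrite big_nil.
 by rewrite Dw_cst; case: w.
rewrite big_cons -IHr; have [Pi|Pi] := boolP (P i).
 rewrite -DwD //; last exact: smooth_sum.
 by apply: (@Dw_ext A) => // y _; rewrite big_cons Pi.
by apply: (@Dw_ext A) => // y _; rewrite big_cons (negPf Pi).
Qed.

Lemma DwM1 i f g x : smooth_on A f -> smooth_on A g -> A x ->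
 Dw [:: i] (fun y => f y * g y) x = Dw [:: i] f x * g x + f x * Dw [:: i] g x.
Proof.
move=> sf sg Ax /=; rewrite [LHS]deriveM //; first by rewrite addrC /GRing.scale /= [g x * _]mulrC.
 exact: smooth_derivable sf Ax.
exact: smooth_derivable sg Ax.
Qed.

End OnOpen.

Definition leibniz (a b : nat -> R) (n : nat) : R :=
 \sum_(k < n.+1) 'C(n, k)%:R * a k * b (n - k)%N.

Lemma leibnizS a b n :
 leibniz a b n.+1 = leibniz (fun k => a k.+1) b n + leibniz a (fun k => b k.+1) n.
Proof.
rewrite /leibniz big_ord_recl /= bin0 subn0.
under eq_bigr do rewrite /bump /= add1n binS natrD mulrDl mulrDl subSS.
rewrite big_split /= addrA [RHS]addrC; congr (_ + _).
rewrite [RHS]big_ord_recl /= bin0 subn0; congr (_ + _).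
rewrite big_ord_recr /= bin_small // !mul0r addr0.
by apply: eq_bigr => i _; rewrite /bump /= add1n subnSK.
Qed.

Lemma leibniz_cst (a b : R) n : leibniz (fun=> a) (fun=> b) n = 2 ^+ n * a * b.
Proof.
elim: n => [|n IHn]; first by rewrite /leibniz big_ord1 bin0 expr0.
by rewrite leibnizS IHn exprS; ring.
Qed.

(* The Leibniz rule in the form of a bound at one point: no product formula over subwords is needed. *)
Lemma Dw_mul_bound A f g x (a b : nat -> R) (K : nat) :
 open A -> smooth_on A f -> smooth_on A g -> A x ->
 (forall w, (size w <= K)%N -> `|Dw w f x| <= a (size w)) ->
 (forall w, (size w <= K)%N -> `|Dw w g x| <= b (size w)) ->
 forall w, (size w <= K)%N -> `|Dw w (fun y => f y * g y) x| <= leibniz a b (size w).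
Proof.
move=> oA + + Ax + + w; elim/last_ind: w K f g a b => [|w i IHw] K f g a b sf sg fa gb.
 move=> _; rewrite /leibniz big_ord1 /= bin0 mul1r normrM.
 by apply: ler_pM => //; [exact: (fa [::]) | exact: (gb [::])].
rewrite size_rcons => wK; case: K => // K in fa gb wK *.
rewrite Dw_rcons leibnizS.
have sf1 := Dw_smooth [:: i] sf; have sg1 := Dw_smooth [:: i] sg.
rewrite (@Dw_ext A _ (fun y => Dw [:: i] f y * g y + f y * Dw [:: i] g y)) //; last first.
 by move=> y Ay; exact: DwM1.
rewrite (DwD oA w (smoothM oA sf1 sg) (smoothM oA sf sg1) Ax).
apply: le_normD; apply: lerD.
 apply: (IHw K _ _ (fun k => a k.+1) b sf1 sg) => //.
  by move=> u uK; rewrite -Dw_rcons -(size_rcons u i); apply: fa; rewrite size_rcons.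
 by move=> u uK; apply: gb; exact: leqW.
apply: (IHw K _ _ a (fun k => b k.+1) sf sg1) => //.
 by move=> u uK; apply: fa; exact: leqW.
by move=> u uK; rewrite -Dw_rcons -(size_rcons u i); apply: gb; rewrite size_rcons.
Qed.

End Words.

Global Opaque Dw smooth_on.
From mathcomp Require Import ring lra.

Lemma derive_embed {R : realType} {U V W : normedModType R} (F : V -> W) (iota : U -> V) x v v' :
 (forall h : R, iota (h *: v + x) = h *: v' + iota x) -> derive (F \o iota) x v = derive F (iota x) v'.
Proof.
move=> E; rewrite /derive; set a := (X in lim (X @ _)); set b := (X in _ = lim (X @ _)).
by have -> : a = b by apply/funext => h; rewrite /a /b /= E.
Qed.

Lemma Dw_embed {R : realType} k N (iota : 'rV[R]_k -> 'rV[R]_N) (s : 'I_k -> 'I_N) (F : 'rV[R]_N -> R) w x :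
 (forall i (h : R) x, iota (h *: delta_mx 0 i + x) = h *: delta_mx 0 (s i) + iota x) ->
 Dw w (F \o iota) x = Dw (map s w) F (iota x).
Proof.
move=> E; elim: w x => [//|i w IHw] x; rewrite Dw_cons [map _ _]/= Dw_cons.
by rewrite (_ : Dw w (F \o iota) = Dw (map s w) F \o iota); [exact: derive_embed | exact/funext].
Qed.

Section MeanValue.
Context {R : realType}.

Lemma MVT_line {U : normedModType R} (f : U -> R) (a v : U) (h : R) : 0 <= h ->
 (forall s, 0 <= s <= h -> derivable f (s *: v + a) v) ->
 exists2 c, 0 <= c <= h & f (h *: v + a) - f a = h * derive f (c *: v + a) v.
Proof.
move=> h0 df.
have D (s : R) : 0 <= s <= h -> is_derive s 1 (fun t : R => f (t *: v + a))
  (derive f (s *: v + a) v).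
 by move=> sh; apply: is_derive_line; exact: df.
have [||c] := @MVT_segment R (fun t : R => f (t *: v + a))
  (fun t => derive f (t *: v + a) v) 0 h h0.
- by move=> s; rewrite in_itv /= => /andP[s0 sh]; apply: D; rewrite !ltW.
- by apply: derivable_within_continuous => s; rewrite in_itv /= => /D [].
rewrite in_itv /= => ch; rewrite scale0r add0r subr0 mulrC => E.
by exists c.
Qed.

Lemma segment_bound {U : normedModType R} (f : U -> R) (a b : U) (M : R) :
 (forall s : R, 0 <= s <= 1 -> derivable f (s *: (b - a) + a) (b - a)) ->
 (forall s : R, 0 <= s <= 1 -> `|derive f (s *: (b - a) + a) (b - a)| <= M) ->
 `|f b - f a| <= M.
Proof.
move=> df fM; have [c c01] := MVT_line ler01 df.
by rewrite scale1r subrK mul1r => ->; exact: fM.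
Qed.

Lemma ball_segment {U : normedModType R} (x a b : U) (r s : R) : 0 <= s <= 1 ->
 ball x r a -> ball x r b -> ball x r (s *: (b - a) + a).
Proof.
move=> /andP[s0 s1]; rewrite -!ball_normE /ball_ /= => xa xb.
have -> : x - (s *: (b - a) + a) = s *: (x - b) + (1 - s) *: (x - a).
 rewrite scalerBl scale1r [RHS]addrCA -scalerBr opprB addrC [x - b + _]addrC subrKA.
 by rewrite opprD -scalerN opprB addrC addrA addrAC.
apply: lt_normD; rewrite !normrZ !ger0_norm ?subr_ge0 //.
have [->|sn0] := eqVneq s 0; first by rewrite mul0r add0r subr0 mul1r.
have sgt0 : 0 < s by rewrite lt0r sn0.
apply: (@lt_le_trans _ _ (s * r + (1 - s) * r)).
 apply: ltr_leD; first by rewrite ltr_pM2l.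
 by rewrite ler_wpM2l ?subr_ge0 // ltW.
by rewrite -mulrDl addrC subrK mul1r.
Qed.

Lemma gradient_segment_bound d (A : set 'rV[R]_d) (f : 'rV[R]_d -> R) a b (M : R) :
 open A -> smooth_on A f ->
 (forall s : R, 0 <= s <= 1 -> A (s *: (b - a) + a)) ->
 (forall s : R, 0 <= s <= 1 -> forall i, `|Dw [:: i] f (s *: (b - a) + a)| <= M) ->
 `|f b - f a| <= d%:R * M * `|b - a|.
Proof.
move=> oA sf Aab fM; apply: segment_bound => s s01.
 exact: smooth_derivable sf (Aab s s01).
rewrite (derive_gradient _ oA sf (Aab s s01)).
rewrite -mulrA; apply: norm_sum_le => i; rewrite normrM mulrC; apply: ler_pM => //; first exact: fM.
exact: coord_le_norm.
Qed.

End MeanValue.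

Section Schwarz.
Context {R : realType} {d : nat}.

Lemma le_dist_half (a b c e : R) :
 `|a - c| <= e / 2 -> `|b - c| <= e / 2 -> `|a - b| <= e.
Proof.
move=> ac bc; rewrite -(subrKA c) [leRHS]splitr; apply: le_normD.
by apply: lerD => //; rewrite distrC.
Qed.

Lemma subr_subr_swap (a b c z : R) : a - b - (c - z) = a - c - (b - z).
Proof. ring. Qed.

Lemma Dw_second_difference (A : set 'rV[R]_d) (f : 'rV[R]_d -> R) (x : 'rV[R]_d) (i j : 'I_d) (h r : R) :
 smooth_on A f -> 0 < h -> (h + h < r) -> ball x r `<=` A ->
 exists2 y, `|y - x| <= h + h &
  f (h *: delta_mx 0 i + (h *: delta_mx 0 j + x)) - f (h *: delta_mx 0 j + x)
  - (f (h *: delta_mx 0 i + x) - f x) = h * h * Dw [:: i; j] f y.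
Proof.
move=> sf h0 hr xrA; pose ei : 'rV[R]_d := delta_mx 0 i; pose ej : 'rV[R]_d := delta_mx 0 j.
have hN (k : 'I_d) (s : R) : 0 <= s <= h -> `|s *: (delta_mx 0 k : 'rV[R]_d)| <= h.
 move=> /andP[s0 sh]; rewrite normrZ ger0_norm //.
 apply: le_trans (_ : s * 1 <= h); last by rewrite mulr1.
 apply: ler_wpM2l => //; exact: delta_norm_le1.
have inA (s t : R) : 0 <= s <= h -> 0 <= t <= h -> A (s *: ei + (t *: ej + x)).
 move=> sh th; apply: xrA; rewrite -ball_normE /ball_ /= addrA opprD addrCA subrr addr0 normrN.
 apply: le_lt_trans hr; apply: le_normD.
 by apply: lerD; exact: hN.
have hh : 0 <= h <= h by rewrite ltW /=.
have zh : (0 : R) <= 0 <= h by rewrite lexx ltW.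
pose g := fun y : 'rV[R]_d => f (h *: ei + y) - f y.
have dshift (y v : 'rV[R]_d) : A (h *: ei + y) -> is_derive y v (fun z => f (h *: ei + z)) (derive f (h *: ei + y) v).
 move=> Ay; have dfy := smooth_derivable (v := v) sf Ay.
 have E : (fun t : R => t^-1 *: (((fun z => f (h *: ei + z)) \o shift y) (t *: v) - f (h *: ei + y)))
     = (fun t => t^-1 *: ((f \o shift (h *: ei + y)) (t *: v) - f (h *: ei + y))).
  by apply/funext => t /=; rewrite addrCA.
 by split; [rewrite /derivable E | rewrite /derive E].
have dg (t : R) : 0 <= t <= h -> is_derive (t *: ej + x) ej g
  (derive f (h *: ei + (t *: ej + x)) ej - derive f (t *: ej + x) ej).
 move=> th; have D1 := dshift (t *: ej + x) ej (inA _ _ hh th).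
 have A0 : A (t *: ej + x) by have := inA _ _ zh th; rewrite scale0r add0r.
 have D2 : is_derive (t *: ej + x) ej f (derive f (t *: ej + x) ej).
  by apply/derivableP; exact: smooth_derivable sf A0.
 exact: is_deriveB.
have [t th E1] := @MVT_line R _ g x ej h (ltW h0) (fun s sh => @ex_derive _ _ _ _ _ _ _ (dg s sh)).
have [s sh E2] := @MVT_line R _ (fun z => derive f z ej) (t *: ej + x) ei h (ltW h0)
 (fun s sh => smooth_derivable (v := ei) (smooth_derive ej sf) (inA s t sh th)).
exists (s *: ei + (t *: ej + x)).
 rewrite addrA addrK; apply: le_normD.
 by apply: lerD; exact: hN.
rewrite -[LHS]/(g (h *: ej + x) - g x) E1 (@derive_val _ _ _ _ _ _ _ (dg t th)) E2.
by rewrite mulrA.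
Qed.

Lemma Schwarz (A : set 'rV[R]_d) (f : 'rV[R]_d -> R) (x : 'rV[R]_d) (i j : 'I_d) :
 open A -> smooth_on A f -> A x -> Dw [:: i; j] f x = Dw [:: j; i] f x.
Proof.
move=> oA sf Ax; apply/eqP; rewrite -subr_eq0 -normr_le0; apply/ler_addgt0Pr => e e0.
rewrite add0r.
have e20 : 0 < e / 2 by rewrite divr_gt0.
have cont k l : \forall y \near x, `|Dw [:: k; l] f x - Dw [:: k; l] f y| <= e / 2.
 have := smooth_continuous (Dw_smooth [:: k; l] sf) Ax.
 by move/cvgrPdist_le => /(_ _ e20).
have : nbhs x (A `&` ([set y | `|Dw [:: i; j] f x - Dw [:: i; j] f y| <= e / 2] `&`
 [set y | `|Dw [:: j; i] f x - Dw [:: j; i] f y| <= e / 2])).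
 by apply: filterI; [exact: open_nbhs_nbhs | apply: filterI; exact: cont].
move=> /nbhs_ballP [r /= r0 rP].
have h0 : 0 < r / 4 by rewrite divr_gt0.
have hr : r / 4 + r / 4 < r by lra.
have rA : ball x r `<=` A by move=> y /rP [].
have [y1 y1x E1] := Dw_second_difference i j sf h0 hr rA.
have [y2 y2x E2] := Dw_second_difference j i sf h0 hr rA.
have E : Dw [:: i; j] f y1 = Dw [:: j; i] f y2.
 apply: (@mulfI _ (r / 4 * (r / 4))); first by rewrite mulf_neq0 // gt_eqF.
 rewrite -E1 -E2 subr_subr_swap; congr (f _ - _ - _); exact: addrCA.
have b1 : ball x r y1 by rewrite ballE (le_lt_trans y1x).
have b2 : ball x r y2 by rewrite ballE (le_lt_trans y2x).
have [_ [+ _]] := rP _ b1; have [_ [_ +]] := rP _ b2; rewrite /= => F2 F1.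
by rewrite E in F1; exact: (le_dist_half F1 F2).
Qed.

Lemma Dw_swap (A : set 'rV[R]_d) (f : 'rV[R]_d -> R) (x : 'rV[R]_d) v (i j : 'I_d) w :
 open A -> smooth_on A f -> A x ->
 Dw (v ++ i :: j :: w) f x = Dw (v ++ j :: i :: w) f x.
Proof.
move=> oA sf Ax; rewrite (Dw_cat v (i :: j :: w)) (Dw_cat v (j :: i :: w)).
apply: (@Dw_ext _ _ A (Dw (i :: j :: w) f) (Dw (j :: i :: w) f) v x oA _ Ax) => y Ay.
rewrite (Dw_cat [:: i; j] w) (Dw_cat [:: j; i] w).
exact: (Schwarz i j oA (Dw_smooth w sf) Ay).
Qed.

End Schwarz.
From mathcomp Require Import ring lra.

Lemma cvg_seq_norm_le (R : realType) (u : nat -> R) (l M : R) (N : nat) :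
 (forall n, (N <= n)%N -> `|u n| <= M) -> u @ \oo --> l -> `|l| <= M.
Proof.
move=> uM ul; rewrite -(cvg_lim (@Rhausdorff R) (cvg_norm ul)).
apply: limr_le; first by apply: cvgP (cvg_norm ul).
by exists N => // n Nn; exact: uM.
Qed.

Section SmoothSeries.
Context {R : realType} {d : nat} (A : set 'rV[R]_d) (g : nat -> 'rV[R]_d -> R).
Variable C : seq 'I_d -> R.
Hypothesis oA : open A.
Hypothesis sg : forall k, smooth_on A (g k).
Hypothesis gC : forall w k x, A x -> `|Dw w (g k) x| <= C w / 2 ^+ k.

Let S w n x : R := \sum_(0 <= k < n) Dw w (g k) x.
Let G w x : R := limn (S w ^~ x).

Let C_ge0 w x : A x -> 0 <= C w.
Proof.
by move=> Ax; have := gC w 0 Ax; rewrite expr0 divr1; exact: le_trans.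
Qed.

Let S_cauchy w n m x : A x -> (n <= m)%N -> `|S w m x - S w n x| <= 2 * C w / 2 ^+ n.
Proof.
move=> Ax /subnKC <-; move: (m - n)%N => p.
apply: (@le_trans _ _ (2 * C w / 2 ^+ n - 2 * C w / 2 ^+ (n + p))); last first.
 by rewrite gerBl divr_ge0 // ?exprn_ge0 // mulr_ge0 // (C_ge0 _ Ax).
elim: p => [|p IHp]; first by rewrite addn0 !subrr normr0.
rewrite addnS {1}/S big_nat_recr //= -/(S w (n + p) x) addrAC.
apply: le_normD; apply: le_trans (lerD IHp (gC w (n + p) Ax)) _.
by rewrite exprS; apply: le_eq; field; rewrite !expf_neq0.
Qed.

Let S_cvg w x : A x -> S w ^~ x @ \oo --> G w x.
Proof.
move=> Ax.
have : cvgn (series (fun k => Dw w (g k) x)).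
 apply: normed_cvg; apply: (@series_le_cvg R _ (geometric (C w) (2^-1))).
 - by move=> n; exact: normr_ge0.
 - by move=> n; rewrite /geometric /= mulr_ge0 ?(C_ge0 _ Ax) // exprn_ge0 // invr_ge0.
 - by move=> n; rewrite /geometric /= exprVn; exact: gC.
 - by apply: is_cvg_geometric_series; rewrite gtr0_norm ?invr_gt0 // invf_lt1 // ltr1n.
by [].
Qed.

Let S_tail w n x : A x -> `|G w x - S w n x| <= 2 * C w / 2 ^+ n.
Proof.
move=> Ax; apply: (@cvg_seq_norm_le _ (fun m => S w m x - S w n x) _ _ n).
 by move=> m; exact: S_cauchy.
by apply: cvgB; [exact: S_cvg | exact: cvg_cst].
Qed.

Let small_tail (c e : R) : 0 < e -> exists n, c / 2 ^+ n <= e.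
Proof.
move=> e0; have : (fun n => c * (2^-1) ^+ n) @ \oo --> (0 : R).
 rewrite -[X in _ --> X](mulr0 c); apply: cvgM; first exact: cvg_cst.
 by apply: cvg_expr; rewrite gtr0_norm ?invr_gt0 // invf_lt1 // ltr1n.
move=> /cvgrPdist_le /(_ _ e0) [N _ /(_ N (leqnn N))]; rewrite sub0r normrN => H.
by exists N; rewrite -exprVn; exact: le_trans (ler_norm _) H.
Qed.

Let S_smooth w n : smooth_on A (S w n).
Proof. by apply: (smooth_sum oA) => k; exact: Dw_smooth. Qed.

Let S_derive w n i x : A x -> derive (S w n) x (delta_mx 0 i) = S (i :: w) n x.
Proof.
move=> Ax; rewrite -[LHS]/((fun x => derive (S w n) x (delta_mx 0 i)) x) -Dw1.
have sD k : smooth_on A (Dw w (g k)) by exact: Dw_smooth.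
by rewrite (Dw_sum oA _ _ _ sD Ax); apply: eq_bigr => k _; rewrite -Dw_cat.
Qed.

Let G_continuous w x : A x -> {for x, continuous (G w)}.
Proof.
move=> Ax; have FF : Filter (nbhs x) by exact: nbhs_filter.
suff : G w @ (nbhs x) --> G w x by [].
apply/cvgrPdist_le => e e0.
have e30 : 0 < e / 3 by rewrite divr_gt0.
have [n nP] := small_tail (2 * C w) e30.
have /cvgrPdist_le /(_ _ e30) cS := smooth_continuous (S_smooth w n) Ax.
have : nbhs x (A `&` [set t | `|S w n x - S w n t| <= e / 3]).
 by apply: filterI => //; exact: open_nbhs_nbhs.
apply: filterS => y [Ay Sxy].
have E (a b c e' : R) : a - b = (a - c) + (c - e') + - (b - e') by ring.
rewrite (E _ _ (S w n x) (S w n y)) (le_trans (ler_normD _ _)) // normrN.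
have -> : e = e / 3 + e / 3 + e / 3 by field.
apply: lerD; last exact: le_trans (S_tail w n Ay) nP.
apply: le_normD.
by apply: lerD => //; exact: le_trans (S_tail w n Ax) nP.
Qed.

Let G_increment w n i x (h : R) :
 (forall s : R, 0 <= s <= 1 -> A (s *: (h *: delta_mx 0 i) + x)) ->
 `|(G w (h *: delta_mx 0 i + x) - S w n (h *: delta_mx 0 i + x)) - (G w x - S w n x)|
  <= 2 * C (i :: w) / 2 ^+ n * `|h|.
Proof.
move=> Ah; have Ax : A x by have := Ah 0; rewrite scale0r add0r lexx ler01; exact.
have Ax' : A (h *: delta_mx 0 i + x) by have := Ah 1; rewrite scale1r lexx ler01; exact.
set x' := _ + x in Ax' *.
apply: (@cvg_seq_norm_le _
 (fun m => (S w m x' - S w n x') - (S w m x - S w n x)) _ _ n); last first.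
 by apply: cvgB; apply: cvgB; try exact: cvg_cst; exact: S_cvg.
move=> m nm.
have sB := smoothB oA (S_smooth w m) (S_smooth w n).
have xx' : x' - x = h *: delta_mx 0 i by rewrite /x' addrK.
apply: (@segment_bound R _ (fun y => S w m y - S w n y) x x') => s s01; rewrite xx'.
 exact: smooth_derivable sB (Ah s s01).
rewrite (derive_gradient _ oA sB (Ah s s01)) (bigD1 i) //= big1 ?addr0; last first.
 by move=> j ji; rewrite !mxE (negPf ji) andbF mulr0 mul0r.
rewrite !mxE !eqxx mulr1 normrM mulrC; apply: ler_wpM2r => //.
rewrite (DwB oA _ (S_smooth w m) (S_smooth w n) (Ah s s01)) !Dw1.
by rewrite !S_derive; [exact: S_cauchy (Ah s s01) nm|exact: Ah..].
Qed.

Let G_is_derive w i x : A x -> is_derive x (delta_mx 0 i) (G w) (G (i :: w) x).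
Proof.
move=> Ax.
suff H : (fun h : R => h^-1 *: ((G w \o shift x) (h *: delta_mx 0 i) - G w x)) @ 0^'
  --> G (i :: w) x.
 by split; [apply: cvgP H | apply/cvg_lim].
apply/cvgrPdist_le => e e0.
have e30 : 0 < e / 3 by rewrite divr_gt0.
have [n nP] := small_tail (2 * C (i :: w)) e30.
have := smooth_derivable (v := delta_mx 0 i) (S_smooth w n) Ax.
rewrite /derivable => /cvg_ex [l lP].
have El : l = S (i :: w) n x.
 by rewrite -(S_derive w n i Ax) /derive; apply/esym/cvg_lim.
move: lP; rewrite El => /cvgrPdist_le /(_ _ e30) cS.
have [r /= r0 rA] : nbhs_ball x A by apply/nbhs_ballP; exact: open_nbhs_nbhs.
near=> h.
have h0 : h != 0 by near: h; exact: nbhs_dnbhs_neq.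
have hr : `|h| < r by near: h; exact: dnbhs0_lt.
have Ah (s : R) : 0 <= s <= 1 -> A (s *: (h *: delta_mx 0 i) + x).
 move=> /andP[s0 s1]; apply: rA; rewrite -ball_normE /ball_ /= opprD addrCA subrr addr0 normrN.
 apply: le_lt_trans hr; rewrite normrZ ger0_norm //.
 apply: le_trans (_ : 1 * `|h *: (delta_mx 0 i : 'rV[R]_d)| <= _); first exact: ler_wpM2r.
 rewrite mul1r normrZ -[leRHS]mulr1; apply: ler_wpM2l => //.
 exact: delta_norm_le1.
have Sn : `|S (i :: w) n x - h^-1 * (S w n (h *: delta_mx 0 i + x) - S w n x)| <= e / 3.
 by near: h; exact: cS.
have := G_increment w n Ah; move: Sn; set x' := _ + x => Sn inc.
have E (g1 s1 k gx' gx sx' sx : R) : g1 - k * (gx' - gx) =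
 (g1 - s1) + (s1 - k * (sx' - sx)) + - (k * ((gx' - sx') - (gx - sx))) by ring.
rewrite /= -/x' /GRing.scale /= (E _ (S (i :: w) n x) _ _ _ (S w n x') (S w n x)).
have -> : e = e / 3 + e / 3 + e / 3 by field.
apply: le_normD; apply: lerD.
 apply: le_normD.
 by apply: lerD => //; exact: le_trans (S_tail (i :: w) n Ax) nP.
rewrite normrN normrM normfV mulrC ler_pdivrMr ?normr_gt0 //.
by apply: le_trans inc _; exact: ler_wpM2r.
Unshelve. all: by end_near. Qed.

Let Dw_G w x : A x -> Dw w (G [::]) x = G w x.
Proof.
elim: w x => [|i w IHw] x Ax //; rewrite Dw_cons.
rewrite (near_eq_derive _ (near_open_eq oA IHw Ax)).
by case: (G_is_derive w i Ax).
Qed.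

Lemma smooth_series : exists F : 'rV[R]_d -> R, smooth_on A F /\
 (forall w x, A x -> (fun n => \sum_(0 <= k < n) Dw w (g k) x) @ \oo --> Dw w F x).
Proof.
exists (G [::]); split=> [|w x Ax]; last by rewrite Dw_G //; exact: S_cvg.
apply/smooth_wordsP => // w; split=> [x Ax|i x Ax].
 have E : \near x, G w x = Dw w (G [::]) x.
  by apply: (near_open_eq oA _ Ax) => y Ay; rewrite Dw_G.
 exact: (near_eq_continuous_at E) (G_continuous Ax).
apply: (@near_eq_derivable _ _ _ (G w)).
 by apply: (near_open_eq oA _ Ax) => y Ay; rewrite Dw_G.
by case: (G_is_derive w i Ax).
Qed.

End SmoothSeries.

Section DiagonalMaps.
Context {R : realType} {d : nat}.
Implicit Types (f : 'rV[R]_d -> R) (l b : 'I_d -> R) (A B : set 'rV[R]_d).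

Definition diagmap l b (x : 'rV[R]_d) : 'rV[R]_d := \row_j (l j * x 0 j + b j).

Lemma diagmap_smooth l b A : open A -> smooth_on A (diagmap l b).
Proof.
move=> oA; apply: (smooth_row oA) => j; apply: (smoothD oA); last exact: smooth_cst.
by apply: smoothZ => //; exact: smooth_coord.
Qed.

Lemma derive_diagmap l b A f x (j : 'I_d) :
 open A -> smooth_on A f -> A (diagmap l b x) ->
 derive (f \o diagmap l b) x (delta_mx 0 j) = l j * Dw [:: j] f (diagmap l b x).
Proof.
move=> oA sf Ax; transitivity (derive f (diagmap l b x) (l j *: delta_mx 0 j)).
 apply: derive_embed => h; apply/rowP => k; rewrite !mxE mulrDr addrA; congr (_ + _ + _).
 by have [->|] := eqVneq k j; rewrite ?mulr0 ?mulr1 //= mulrC.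
rewrite (derive_gradient _ oA sf Ax) (bigD1 j) //= big1 ?addr0.
 by rewrite !mxE !eqxx mulr1.
by move=> k kj; rewrite !mxE (negPf kj) andbF mulr0 mul0r.
Qed.

Lemma Dw_diagmap l b A B f w x :
 open A -> open B -> (forall y, B y -> A (diagmap l b y)) -> smooth_on A f -> B x ->
 Dw w (f \o diagmap l b) x = (\prod_(j <- w) l j) * Dw w f (diagmap l b x).
Proof.
move=> oA oB BA sf; elim: w x => [|j w IHw] x Bx; first by rewrite big_nil mul1r.
have sDw := Dw_smooth w sf.
rewrite Dw_cons (near_eq_derive _ (near_open_eq oB IHw Bx)).
rewrite [LHS](@deriveZ R _ _ (Dw w f \o diagmap l b)); last first.
 apply: (@smooth_derivable _ _ B) => //.
 exact: (smooth_comp oA oB BA sDw (diagmap_smooth l b oB)).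
rewrite (derive_diagmap j oA sDw (BA _ Bx)) big_cons -Dw_cat /= /GRing.scale /=.
by rewrite mulrCA mulrA.
Qed.

End DiagonalMaps.

Section SmoothBounded.
Context {R : realType} {d : nat}.

Lemma closed_ball0_compact (r : R) : compact [set x : 'rV[R]_d | `|x| <= r].
Proof.
apply: bounded_closed_compact.
 exists r; split; first exact: num_real.
 by move=> M rM x /= xr; rewrite (le_trans xr) // ltW.
rewrite (_ : [set x | _] = (fun x : 'rV[R]_d => `|x|) @^-1` [set y | y <= r]) //.
apply: closed_comp; last exact: closed_le.
by move=> x _; exact: norm_continuous.
Qed.

Lemma smooth_bounded (A : set 'rV[R]_d) (f : 'rV[R]_d -> R) (r : R) w :
 smooth_on A f -> (forall x, `|x| <= r -> A x) ->
 exists2 M, 0 <= M & forall x, `|x| <= r -> `|Dw w f x| <= M.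
Proof.
move=> sf rA; have [r0|r0] := ltP r 0.
 by exists 0 => // x xr; have := le_lt_trans xr r0; rewrite normr_lt0.
have K0 : [set x : 'rV[R]_d | `|x| <= r] !=set0 by exists 0; rewrite /= normr0.
have cf : {within [set x : 'rV[R]_d | `|x| <= r], continuous (fun x => `|Dw w f x|)}.
 apply: continuous_in_subspaceT => x /set_mem /= xr.
 apply: (@continuous_comp _ _ _ (Dw w f) (fun y : R => `|y|)).
  exact: smooth_continuous (Dw_smooth w sf) (rA _ xr).
 exact: norm_continuous.
have [c _ cP] := EVT_max_rV K0 (@closed_ball0_compact r) cf.
by exists `|Dw w f c| => // x xr; apply: cP; rewrite inE.
Qed.

End SmoothBounded.

Lemma le_norm_segment {R : realType} {U : normedModType R} (a b : U) (u r : R) :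
 0 <= u <= 1 -> `|a| <= r -> `|b| <= r -> `|u *: (b - a) + a| <= r.
Proof.
move=> /andP[u0 u1] ar br; have -> : u *: (b - a) + a = u *: b + (1 - u) *: a.
 by rewrite scalerBr scalerBl scale1r addrAC -addrA.
apply: le_normD; rewrite !normrZ !ger0_norm ?subr_ge0 //.
have -> : r = u * r + (1 - u) * r by ring.
by apply: lerD; apply: ler_wpM2l; rewrite ?subr_ge0.
Qed.

Section Hadamard.
Context {R : realType} {d : nat} (i : 'I_d).
Implicit Types (f : 'rV[R]_d -> R) (x : 'rV[R]_d) (s t : R).

Definition scoord s : 'rV[R]_d -> 'rV[R]_d :=
 diagmap (fun j => if j == i then s else 1) (fun=> 0).

Lemma scoordE s x j : scoord s x 0 j = if j == i then s * x 0 j else x 0 j.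
Proof. by rewrite mxE addr0; case: eqP => _; rewrite ?mul1r. Qed.

Lemma scoord_norm s x : 0 <= s <= 1 -> `|scoord s x| <= `|x|.
Proof.
move=> /andP[s0 s1]; apply: row_norm_le => // j; rewrite scoordE; case: eqP => _; last exact: coord_le_norm.
by rewrite normrM ger0_norm // (le_trans _ (coord_le_norm x j)) // ler_piMl.
Qed.

Lemma scoordB s t x : scoord s x - scoord t x = (s - t) * x 0 i *: delta_mx 0 i.
Proof.
apply/rowP => j; rewrite [LHS]mxE [X in _ + X]mxE !scoordE !mxE.
by have [->|_] := eqVneq j i; rewrite ?subrr ?mulr0 //= mulr1 mulrBl.
Qed.

Definition hadamard f x : R :=
 if x 0 i == 0 then Dw [:: i] f x else (f x - f (scoord 0 x)) / x 0 i.

Lemma exprB_le (s t : R) n : 0 <= s <= 1 -> 0 <= t <= 1 ->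
 `|s ^+ n - t ^+ n| <= n%:R * `|s - t|.
Proof.
move=> /andP[s0 s1] /andP[t0 t1]; elim: n => [|n IHn]; first by rewrite subrr normr0 mul0r.
have -> : s ^+ n.+1 - t ^+ n.+1 = s * (s ^+ n - t ^+ n) + (s - t) * t ^+ n.
 by rewrite !exprS; ring.
apply: le_normD; rewrite mulrS [leRHS]mulrDl mul1r [leRHS]addrC; apply: lerD.
 by rewrite normrM ger0_norm // (le_trans _ IHn) // ler_piMl.
rewrite normrM ler_piMr // ger0_norm ?exprn_ge0 //.
by apply: exprn_ile1.
Qed.

Section OnBall.
Variables (r : R) (A : set 'rV[R]_d) (f : 'rV[R]_d -> R).
Hypotheses (oA : open A) (sf : smooth_on A f) (rA : forall x, `|x| <= r -> A x).

Let B : set 'rV[R]_d := ball 0 r.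
Let oB : open B. Proof. exact: ball_open. Qed.

Let BE x : B x = (`|x| < r) :> Prop.
Proof. by rewrite /B ball0E. Qed.

Let F := Dw [:: i] f.
Let sF : smooth_on A F. Proof. exact: Dw_smooth. Qed.

Let hs s x := F (scoord s x).

Let inA s x : 0 <= s <= 1 -> B x -> A (scoord s x).
Proof.
by move=> s01; rewrite BE => xr; apply: rA; rewrite (le_trans (scoord_norm x s01)) // ltW.
Qed.

Let hs_smooth s : 0 <= s <= 1 -> smooth_on B (hs s).
Proof.
move=> s01; apply: (smooth_comp oA oB _ sF); last exact: diagmap_smooth.
by move=> x Bx; exact: inA.
Qed.

Let Dw_hs w s x : 0 <= s <= 1 -> B x ->
 Dw w (hs s) x = s ^+ (count_mem i w) * Dw w F (scoord s x).
Proof.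
move=> s01 Bx; rewrite (@Dw_diagmap _ _ _ _ A B) //; last by move=> y By; exact: inA.
congr (_ * _); elim: w => [|j w IHw]; first by rewrite big_nil.
by rewrite big_cons IHw /=; case: eqP => _; rewrite ?exprS ?mul1r.
Qed.

Let hs_lip w : exists2 L, 0 <= L & forall s t x, 0 <= s <= 1 -> 0 <= t <= 1 -> B x ->
 `|Dw w (hs s) x - Dw w (hs t) x| <= L * `|s - t|.
Proof.
have [M M0 MP] := smooth_bounded w sF rA.
have /choice [M' M'P] : forall j : 'I_d, exists M, 0 <= M /\
  forall x, `|x| <= r -> `|Dw (j :: w) F x| <= M.
 by move=> j; have [M1 ? ?] := smooth_bounded (j :: w) sF rA; exists M1.
pose M1 := \sum_j M' j.
have M10 : 0 <= M1 by apply: sumr_ge0 => j _; have [] := M'P j.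
exists ((count_mem i w)%:R * M + d%:R * M1 * `|r|).
 by rewrite addr_ge0 // mulr_ge0 // mulr_ge0.
move=> s t x s01 t01 Bx; rewrite (Dw_hs w s01 Bx) (Dw_hs w t01 Bx).
have sr (u : R) : 0 <= u <= 1 -> `|scoord u x| <= r.
 by move=> u01; rewrite (le_trans (scoord_norm x u01)) // ltW // -BE.
set c := count_mem i w; set P := Dw w F.
have -> : s ^+ c * P (scoord s x) - t ^+ c * P (scoord t x) =
  (s ^+ c - t ^+ c) * P (scoord s x) + t ^+ c * (P (scoord s x) - P (scoord t x)) by ring.
apply: le_normD; rewrite [leRHS]mulrDl; apply: lerD.
 rewrite normrM mulrAC; apply: ler_pM => //; first exact: exprB_le.
 exact: (MP _ (sr _ s01)).
have /andP[t0 t1] := t01.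
rewrite normrM ger0_norm ?exprn_ge0 // (le_trans (ler_piMl _ (exprn_ile1 _ t0 t1))) //.
have := @gradient_segment_bound R d A P (scoord t x) (scoord s x) M1 oA (Dw_smooth w sF).
move=> /(_ _ _)/le_trans; apply.
- move=> u u01; apply: rA; exact: (le_norm_segment u01 (sr _ t01) (sr _ s01)).
- move=> u u01 j; rewrite -Dw_cat /=; apply: (@le_trans _ _ (M' j)).
  by apply: (M'P j).2; exact: (le_norm_segment u01 (sr _ t01) (sr _ s01)).
 by rewrite /M1 (bigD1 j) //= lerDl sumr_ge0 // => k _; have [] := M'P k.
- rewrite -[leRHS]mulrA; apply: ler_wpM2l; first by rewrite mulr_ge0.
 rewrite scoordB normrZ normrM [`|r| * _]mulrC -mulrA; apply: ler_wpM2l => //.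
 apply: (@le_trans _ _ (`|x 0 i| * 1)).
  apply: ler_wpM2l => //; exact: delta_norm_le1.
 rewrite mulr1 (le_trans (coord_le_norm x i)) //.
 by rewrite (le_trans _ (ler_norm r)) // ltW // -BE.
Qed.

Let riem n x := (2 ^- n) * \sum_(0 <= j < 2 ^ n) hs (j%:R / 2 ^+ n) x.

Let dy01 n j : (j < 2 ^ n)%N -> 0 <= (j%:R / 2 ^+ n : R) <= 1.
Proof.
move=> jn; rewrite divr_ge0 ?exprn_ge0 //= ler_pdivrMr ?exprn_gt0 // mul1r.
by rewrite -natrX ler_nat ltnW.
Qed.

Let gk k x := if k is k'.+1 then riem k'.+1 x - riem k' x else riem 0 x.

Let sum_even_odd (G : nat -> R) n :
 \sum_(0 <= j < n * 2) G j = \sum_(0 <= j < n) (G (j * 2)%N + G (j * 2).+1).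
Proof.
elim: n => [|n IHn]; first by rewrite !big_geq.
rewrite mulSn [(2 + _)%N]addnC addn2 !big_nat_recr //= IHn.
by rewrite addrA.
Qed.

Let riem_smooth n : smooth_on B (riem n).
Proof.
apply: (smoothZ oB).
have S0 : smooth_on B (fun x => \sum_(j < 2 ^ n) hs (j%:R / 2 ^+ n) x).
 by apply: (smooth_sum oB) => j; apply: hs_smooth; exact: dy01.
by apply: smooth_on_ext S0 => // x _; rewrite big_mkord.
Qed.

Let Dw_riem w n x : B x ->
 Dw w (riem n) x = (2 ^- n) * \sum_(0 <= j < 2 ^ n) Dw w (hs (j%:R / 2 ^+ n)) x.
Proof.
move=> Bx; have sj (j : 'I_(2 ^ n)) : smooth_on B (hs (j%:R / 2 ^+ n)).
 by apply: hs_smooth; exact: dy01.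
have S0 : smooth_on B (fun x => \sum_(j < 2 ^ n) hs (j%:R / 2 ^+ n) x).
 exact: (smooth_sum oB).
rewrite (@Dw_ext _ _ B _ (fun x => 2 ^- n * \sum_(j < 2 ^ n) hs (j%:R / 2 ^+ n) x)) //.
 by rewrite (DwZ oB _ _ S0 Bx) (Dw_sum oB _ _ _ sj Bx) big_mkord.
by move=> y _; rewrite /riem big_mkord.
Qed.

Let gk_smooth k : smooth_on B (gk k).
Proof. by case: k => [|k]; [exact: riem_smooth | apply: (smoothB oB); exact: riem_smooth]. Qed.

Let gk_bound w : exists C, forall k x, B x -> `|Dw w (gk k) x| <= C / 2 ^+ k.
Proof.
have [L L0 LP] := hs_lip w.
have [M M0 MP] := smooth_bounded w sF rA.
exists (L + M) => -[|k] x Bx.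
 rewrite expr0 divr1 Dw_riem // expr0 invr1 mul1r expn0 big_nat1.
 rewrite mul0r Dw_hs // ?lexx ?ler01 // normrM.
 apply: (@le_trans _ _ M); last by rewrite lerDr.
 rewrite -[leRHS]mul1r; apply: ler_pM => //.
  by rewrite normrX normr0; apply: exprn_ile1.
 by apply: MP; rewrite (le_trans (scoord_norm x _)) ?lexx ?ler01 // ltW // -BE.
rewrite (DwB oB _ (riem_smooth k.+1) (riem_smooth k) Bx) !Dw_riem //.
rewrite expnS mulnC sum_even_odd.
have -> : 2 ^- k * \sum_(0 <= j < 2 ^ k) Dw w (hs (j%:R / 2 ^+ k)) x =
 2 ^- k.+1 * \sum_(0 <= j < 2 ^ k) (Dw w (hs ((j * 2)%:R / 2 ^+ k.+1)) x
                 + Dw w (hs ((j * 2)%:R / 2 ^+ k.+1)) x).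
 have E2 : 2 ^- k = 2 ^- k.+1 * 2 :> R by rewrite exprS invfM mulrAC mulVf ?mul1r.
 rewrite {1}E2 -mulrA mulr_sumr; congr (_ * _); apply: eq_bigr => j _.
 have -> : (j * 2)%:R / 2 ^+ k.+1 = j%:R / 2 ^+ k :> R.
  by rewrite natrM exprS; field; rewrite expf_neq0.
 rewrite mulr_natl mulr2n. by [].
rewrite -mulrBr -sumrB normrM [`|2 ^- _|]ger0_norm ?invr_ge0 ?exprn_ge0 //.
rewrite mulrC; apply: ler_wpM2r; first by rewrite invr_ge0 exprn_ge0.
apply: le_trans (ler_norm_sum _ _ _) _.
apply: (@le_trans _ _ (\sum_(0 <= j < 2 ^ k) (L * 2 ^- k.+1))).
 rewrite big_seq_cond [leRHS]big_seq_cond; apply: ler_sum => j.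
 rewrite mem_index_iota andbT => /andP[_ jk].
 rewrite opprD addrACA subrr add0r.
 have jk2 : ((j * 2).+1 < 2 ^ k.+1)%N by rewrite expnS mulnC; lia.
 apply: le_trans (LP _ _ _ (dy01 jk2) (dy01 (ltnW jk2)) Bx) _.
 apply: ler_wpM2l => //; rewrite -mulrBl -natrB // subSnn mul1r ger0_norm //.
rewrite big_const_nat subn0 iter_addr_0 -[leLHS]mulr_natl natrX exprS invfM.
have -> : 2 ^+ k * (L * (2^-1 / 2 ^+ k)) = L * 2^-1 by field; rewrite expf_neq0.
by rewrite ler_wpDr // ler_piMr // invf_le1 // ler1n.
Qed.

Let riem_gk n x : \sum_(0 <= k < n.+1) gk k x = riem n x.
Proof.
elim: n => [|n IHn]; first by rewrite big_nat1.
by rewrite big_nat_recr //= IHn addrC subrK.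
Qed.

Let scoord_line (s a : R) x : scoord s x = (s - a) *: (x 0 i *: delta_mx 0 i) + scoord a x.
Proof. by rewrite scalerA -scoordB subrK. Qed.

Let increment (L a b : R) x :
 (forall s t x, 0 <= s <= 1 -> 0 <= t <= 1 -> B x -> `|hs s x - hs t x| <= L * `|s - t|) ->
 0 <= L -> 0 <= a -> a <= b -> b <= 1 -> B x ->
 `|f (scoord b x) - f (scoord a x) - (b - a) * (x 0 i * hs a x)|
  <= (b - a) * (`|x 0 i| * (L * (b - a))).
Proof.
move=> LP L0 a0 ab b1 Bx.
have ba0 : 0 <= b - a by rewrite subr_ge0.
have in01 (s : R) : 0 <= s <= b - a -> 0 <= s + a <= 1.
 by move=> /andP[s0 sb]; apply/andP; split; lra.
have A_line (s : R) : 0 <= s <= b - a -> A (s *: (x 0 i *: delta_mx 0 i) + scoord a x).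
 by move=> sb; have := inA (in01 s sb) Bx; rewrite (scoord_line _ a) addrK.
have [c cb] := @MVT_line R _ f (scoord a x) (x 0 i *: delta_mx 0 i) (b - a) ba0
 (fun s sb => smooth_derivable sf (A_line s sb)).
rewrite -scoord_line => ->; rewrite (derive_gradient _ oA sf (A_line c cb)).
rewrite (bigD1 i) //= big1 ?addr0; last first.
 by move=> k ki; rewrite !mxE (negPf ki) andbF mulr0 mul0r.
rewrite !mxE !eqxx mulr1 -mulrBr -mulrBr !normrM ger0_norm //.
apply: ler_wpM2l => //; apply: ler_wpM2l => //.
have -> : c *: (x 0 i *: delta_mx 0 i) + scoord a x = scoord (c + a) x.
 by rewrite (scoord_line (c + a) a) addrK.
have a01 : 0 <= a <= 1 by apply/andP; split=> //; exact: le_trans b1.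
apply: le_trans (LP _ _ _ (in01 c cb) a01 Bx) _; rewrite addrK.
by apply: ler_wpM2l => //; have /andP[c0 cba] := cb; rewrite ger0_norm.
Qed.

Let riem_f x : B x -> (fun n => x 0 i * riem n x) @ \oo --> f x - f (scoord 0 x).
Proof.
move=> Bx; have [L L0 LP] := hs_lip [::].
have LP' s t y : 0 <= s <= 1 -> 0 <= t <= 1 -> B y -> `|hs s y - hs t y| <= L * `|s - t|.
 exact: LP.
have bound n : `|x 0 i * riem n x - (f x - f (scoord 0 x))| <= (`|x 0 i| * L) * (2^-1) ^+ n.
 have E : f x - f (scoord 0 x) = \sum_(0 <= j < 2 ^ n)
   (f (scoord (j.+1%:R / 2 ^+ n) x) - f (scoord (j%:R / 2 ^+ n) x)).
  rewrite telescope_sumr ?expn_gt0 // mul0r natrX divff ?expf_neq0 //; congr (f _ - _).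
  by apply/rowP => j; rewrite scoordE mul1r if_same.
 have E' : x 0 i * riem n x - \sum_(0 <= j < 2 ^ n)
   (f (scoord (j.+1%:R / 2 ^+ n) x) - f (scoord (j%:R / 2 ^+ n) x)) =
  - \sum_(0 <= j < 2 ^ n) (f (scoord (j.+1%:R / 2 ^+ n) x) - f (scoord (j%:R / 2 ^+ n) x)
    - (j.+1%:R / 2 ^+ n - j%:R / 2 ^+ n) * (x 0 i * hs (j%:R / 2 ^+ n) x)).
  have E0 : x 0 i * riem n x = \sum_(0 <= j < 2 ^ n)
    ((j.+1%:R / 2 ^+ n - j%:R / 2 ^+ n) * (x 0 i * hs (j%:R / 2 ^+ n) x)).
   rewrite /riem mulrCA !mulr_sumr; apply: eq_bigr => j _.
   by rewrite -mulrBl -natrB // subSnn mul1r.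
  by rewrite E0 -[RHS]sumrN -sumrB; apply: eq_bigr => j _; rewrite [RHS]opprB.
 rewrite E E' normrN; apply: le_trans (ler_norm_sum _ _ _) _.
 apply: (@le_trans _ _ (\sum_(0 <= j < 2 ^ n) (2 ^- n * (`|x 0 i| * (L * 2 ^- n))))).
  rewrite big_seq_cond [leRHS]big_seq_cond; apply: ler_sum => j.
  rewrite mem_index_iota andbT => /andP[_ jn].
  have /andP[j0 j1] := dy01 jn.
  have jj : j.+1%:R / 2 ^+ n - j%:R / 2 ^+ n = 2 ^- n :> R.
   by rewrite -mulrBl -natrB // subSnn mul1r.
  have jS : j%:R / 2 ^+ n <= j.+1%:R / 2 ^+ n :> R.
   by rewrite -subr_ge0 jj invr_ge0 exprn_ge0.
  have jS1 : j.+1%:R / 2 ^+ n <= 1 :> R.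
   by rewrite ler_pdivrMr ?exprn_gt0 // mul1r -natrX ler_nat.
  have inc := increment LP' L0 j0 jS jS1 Bx.
  by move: inc; rewrite jj.
 rewrite big_const_nat subn0 iter_addr_0 -[leLHS]mulr_natl natrX.
 by rewrite mulrA mulfV ?expf_neq0 // mul1r mulrA exprVn.
apply/cvgrPdist_le => e e0.
have : (fun n => (`|x 0 i| * L) * (2^-1) ^+ n) @ \oo --> (0 : R).
 rewrite -[X in _ --> X](mulr0 (`|x 0 i| * L)); apply: cvgM; first exact: cvg_cst.
 by apply: cvg_expr; rewrite gtr0_norm ?invr_gt0 // invf_lt1 // ltr1n.
move=> /cvgrPdist_le /(_ _ e0); apply: filterS => n; rewrite sub0r normrN => H.
by rewrite distrC (le_trans (bound n)) // (le_trans (ler_norm _) H).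
Qed.

Lemma hadamard_spec x : f x = f (scoord 0 x) + x 0 i * hadamard f x.
Proof.
rewrite /hadamard; case: eqP => [x0|/eqP x0]; last by rewrite mulrC divfK // addrC subrK.
rewrite x0 mul0r addr0; congr f; apply/rowP => j; rewrite scoordE.
by case: eqP => // ->; rewrite x0 mulr0.
Qed.

Let hadamard_limit : smooth_on B (hadamard f) /\ forall w x, B x ->
 (fun n => Dw w (riem n) x) @ \oo --> Dw w (hadamard f) x.
Proof.
have /choice [C CP] := gk_bound.
have [G [sG GP]] := smooth_series oB gk_smooth CP.
have riemG w x : B x -> (fun n => Dw w (riem n) x) @ \oo --> Dw w G x.
 move=> Bx; have := GP w x Bx; rewrite -(cvg_shiftS _) => Gx.
 apply: cvg_trans Gx; apply: near_eq_cvg; apply: nearW => n; rewrite /=.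
 rewrite -(Dw_sum oB _ _ w gk_smooth Bx).
 by apply: (Dw_ext (A := B)) => // y _; rewrite riem_gk.
have GE x : B x -> G x = hadamard f x.
 move=> Bx; have := riemG [::] x Bx; rewrite Dw_nil => rG.
 rewrite /hadamard; case: eqP => [x0|/eqP x0].
  apply: (cvg_unique (@Rhausdorff R) rG).
  have -> : riem ^~ x = cst (F x); last exact: cvg_cst.
  have sx (s : R) : scoord s x = x.
   by apply/rowP => j; rewrite scoordE; case: eqP => // ->; rewrite x0 mulr0.
  apply/funext => n; rewrite /riem /hs.
  under eq_bigr do rewrite sx.
  by rewrite sumr_const_nat subn0 -[F x *+ _]mulr_natl natrX mulKf ?expf_neq0.
 have xG : (fun n => x 0 i * riem n x) @ \oo --> x 0 i * G x.
  by apply: cvgM => //; exact: cvg_cst.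
 rewrite -(cvg_unique (@Rhausdorff R) xG (riem_f Bx)).
 by rewrite mulrC mulKf.
split; first exact: smooth_on_ext sG.
by move=> w x Bx; rewrite -(Dw_ext w oB GE Bx); exact: riemG.
Qed.

Lemma hadamard_smooth : smooth_on B (hadamard f).
Proof. by have [] := hadamard_limit. Qed.

Lemma hadamard_bound w x M : B x ->
 (forall s, 0 <= s <= 1 -> `|Dw (rcons w i) f (scoord s x)| <= M) ->
 `|Dw w (hadamard f) x| <= M.
Proof.
move=> Bx MP; have [_ /(_ w x Bx) lim] := hadamard_limit.
apply: (@cvg_seq_norm_le R (fun n => Dw w (riem n) x) _ _ 0 _ lim) => n _.
rewrite Dw_riem // normrM ger0_norm ?invr_ge0 ?exprn_ge0 //.
rewrite mulrC ler_pdivrMr ?exprn_gt0 //.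
apply: le_trans (ler_norm_sum _ _ _) _.
apply: (@le_trans _ _ (\sum_(0 <= j < 2 ^ n) M)).
 rewrite big_seq_cond [leRHS]big_seq_cond; apply: ler_sum => j.
 rewrite mem_index_iota andbT => /andP[_ jn].
 rewrite (Dw_hs w (dy01 jn) Bx) normrM -[M]mul1r; apply: ler_pM => //.
  have /andP[j0 j1] := dy01 jn.
  by rewrite normrX ger0_norm //; apply: exprn_ile1.
 by rewrite /F -Dw_rcons; apply: MP; exact: dy01.
by rewrite sumr_const_nat subn0 -[M *+ _]mulr_natr natrX.
Qed.

End OnBall.
End Hadamard.

Section Taylor.
Context {R : realType} {d : nat}.
Implicit Types (c : seq 'I_d -> R) (w : seq 'I_d) (h : 'rV[R]_d).

Fixpoint Qp c (k : nat) w h : R :=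
 if k is k'.+1 then \sum_i h 0 i * Qp c k' (i :: w) h else c w.

Definition Tp c (m : nat) w h : R := \sum_(k < m.+1) Qp c k w h / k`!%:R.

Definition symm_words c := forall v i j w, c (v ++ i :: j :: w) = c (v ++ j :: i :: w).

Lemma Qp_sym c k v i j w h : symm_words c ->
 Qp c k (v ++ i :: j :: w) h = Qp c k (v ++ j :: i :: w) h.
Proof.
move=> sc; elim: k v => [|k IHk] v /=; first exact: sc.
by apply: eq_bigr => l _; rewrite -!cat_cons IHk.
Qed.

Lemma Qp_smooth c k w : smooth_on setT (Qp c k w).
Proof.
elim: k w => [|k IHk] w; first exact: smooth_cst.
apply: (smooth_sum openT) => i; apply: (smoothM openT); last exact: IHk.
exact: smooth_coord openT.
Qed.

Lemma Tp_smooth c m w : smooth_on setT (Tp c m w).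
Proof.
apply: (smooth_sum openT) => k.
apply: (smoothM openT); [exact: Qp_smooth | exact: smooth_cst].
Qed.

Lemma Dw1_coord (i j : 'I_d) h : Dw [:: j] (fun h : 'rV[R]_d => h 0 i) h = (i == j)%:R.
Proof.
rewrite Dw1 /derive; set F := (fun _ : R => _).
have E : {near 0^', F =1 cst (i == j)%:R}.
 near=> t; rewrite /F /= !mxE addrK eqxx /= /GRing.scale /=.
 by case: eqP => _; rewrite ?mulr0 // mulr1 mulVf //; near: t; exact: nbhs_dnbhs_neq.
apply/cvg_lim => //; apply: (cvg_trans (near_eq_cvg _)); last exact: cvg_cst.
by apply: filterS E => t /= ->.
Unshelve. all: by end_near. Qed.

Lemma Dw_Qp c k j w h : symm_words c ->
 Dw [:: j] (Qp c k w) h = if k is k'.+1 then k%:R * Qp c k' (j :: w) h else 0.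
Proof.
move=> sc; elim: k w => [|k IHk] w; first exact: (Dw_cst [:: j] (c w) h).
have sM i : smooth_on setT (fun h => h 0 i * Qp c k (i :: w) h).
 by apply: (smoothM openT); [exact: smooth_coord openT | exact: Qp_smooth].
rewrite [LHS](Dw_sum openT _ _ [:: j] sM I).
under eq_bigr do rewrite (DwM1 j (smooth_coord _ openT) (Qp_smooth _ _ _) I) Dw1_coord.
rewrite big_split /= (bigD1 j) //= eqxx mul1r big1 ?addr0; last first.
 by move=> i ij; rewrite (negPf ij) mul0r.
rewrite mulrS mulrDl mul1r; congr (_ + _).
under eq_bigr do rewrite IHk.
case: k {IHk sM} => [|k]; first by rewrite mul0r big1 // => i _; rewrite mulr0.
rewrite mulr_sumr; apply: eq_bigr => i _.
by rewrite mulrCA -[j :: i :: w]cat0s (Qp_sym _ _ _ _ _ _ sc).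
Qed.

Lemma Dw1_Tp c m j w h : symm_words c ->
 Dw [:: j] (Tp c m w) h = if m is m'.+1 then Tp c m' (j :: w) h else 0.
Proof.
move=> sc; have sQ (k : 'I_m.+1) : smooth_on setT (fun h => Qp c k w h / k`!%:R).
 by apply: (smoothM openT); [exact: Qp_smooth | exact: smooth_cst].
rewrite [LHS](Dw_sum openT _ _ [:: j] sQ I).
have E (k : 'I_m.+1) : Dw [:: j] (fun h => Qp c k w h / k`!%:R) h =
  (if k : nat is k'.+1 then Qp c k' (j :: w) h / k'`!%:R else 0).
 rewrite (@Dw_ext _ _ setT _ (fun h => k`!%:R^-1 * Qp c k w h)) //; first last.
 - by move=> y _; rewrite mulrC.
 - exact: openT.
 rewrite (DwZ openT _ _ (Qp_smooth _ _ _) I) Dw_Qp //.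
 case: (k : nat) => [|k']; first by rewrite mulr0.
 by rewrite factS natrM invfM mulrACA mulVf ?pnatr_eq0 // mul1r mulrC.
under eq_bigr do rewrite E.
case: m {sQ E} => [|m]; first by rewrite big_ord1.
by rewrite big_ord_recl add0r.
Qed.

Lemma Tp0 c m w : Tp c m w 0 = c w.
Proof.
rewrite /Tp big_ord_recl /= divr1 big1 ?addr0 // => k _.
by rewrite /= big1 ?mul0r // => i _; rewrite mxE mul0r.
Qed.

Lemma Qp_bound c k w h (B : R) :
 (forall u, (size u <= k + size w)%N -> `|c u| <= B) ->
 `|Qp c k w h| <= B * (d%:R * `|h|) ^+ k.
Proof.
elim: k w => [|k IHk] w cB /=; first by rewrite expr0 mulr1; exact: cB.
rewrite exprS -mulrA mulrCA; apply: norm_sum_le => i; rewrite normrM mulrCA; apply: ler_pM => //.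
 exact: coord_le_norm.
by apply: IHk => u uk; apply: cB; rewrite addSnnS.
Qed.

End Taylor.

Lemma is_derive_sub_cst {R : realType} {U V : normedModType R} (f : U -> V) x v df a :
 is_derive x v f df -> is_derive x v (fun y => f y - a) df.
Proof.
move=> [dfx dfE].
have E : (fun h : R => h^-1 *: (((fun y => f y - a) \o shift x) (h *: v) - (f x - a))) =
 (fun h => h^-1 *: ((f \o shift x) (h *: v) - f x)).
 by apply/funext => h /=; rewrite opprB addrA subrK.
by split; [rewrite /derivable E | rewrite -dfE /derive E].
Qed.

Section PathLemma.
Context {R : realType} {d : nat}.
Variables (c : seq 'I_d -> R) (a : 'rV[R]_d) (phi dphi : R -> 'rV[R]_d) (G : seq 'I_d -> R -> R).
Variables (q : nat) (B l L : R).
Hypothesis sc : symm_words c.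
Hypotheses (B0 : 0 <= B) (l0 : 0 <= l) (L0 : 0 <= L).
Hypothesis dphiP : forall s : R, 0 <= s <= 1 -> is_derive s 1 phi (dphi s).
Hypothesis dphiL : forall s : R, 0 <= s <= 1 -> `|dphi s| <= L.
Hypothesis dG : forall w (s : R), 0 <= s <= 1 ->
 is_derive s 1 (G w) (\sum_i dphi s 0 i * G (i :: w) s).
Hypothesis start : forall j w, (j + size w <= q)%N ->
 `|G w 0 - Tp c j w (phi 0 - a)| <= B * l ^+ j.
Hypothesis bnd : forall w (s : R), (size w <= q)%N -> 0 <= s <= 1 -> `|G w s - c w| <= B.

Lemma path_estimate j w (s : R) : (j + size w <= q)%N -> 0 <= s <= 1 ->
 `|G w s - Tp c j w (phi s - a)| <= B * (l + d%:R * L) ^+ j.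
Proof.
elim: j w s => [|j IHj] w s jq s01.
 by rewrite /Tp big_ord1 /= divr1 expr0 mulr1; apply: bnd.
have /andP[s0 s1] := s01.
pose g t := G w t - Tp c j.+1 w (phi t - a).
pose dg t := \sum_i dphi t 0 i * (G (i :: w) t - Tp c j (i :: w) (phi t - a)).
have dphi_a (t : R) : 0 <= t <= 1 -> is_derive t 1 (fun t => phi t - a) (dphi t).
 by move=> t01; apply: is_derive_sub_cst; exact: dphiP.
have D (t : R) : 0 <= t <= 1 -> is_derive t 1 g (dg t).
 move=> t01.
 have E : is_derive t 1 (Tp c j.+1 w \o (fun t => phi t - a))
  (\sum_(i < d) derive (fun t => phi t - a) t 1 0 i *
    derive (Tp c j.+1 w) (phi t - a) (delta_mx 0 i)).
  apply: (@is_derive_comp _ _ _ _ _ setT) => //; first exact: openT.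
  - by move=> x i _; exact: smooth_derivable (Tp_smooth c j.+1 w) I.
  - move=> i; exact: smooth_continuous (smooth_derive _ (Tp_smooth c j.+1 w)) I.
  - by case: (dphi_a t t01).
 have Ed : derive (fun t => phi t - a) t 1 = dphi t.
  by case: (dphi_a t t01).
 have -> : dg t = \sum_i dphi t 0 i * G (i :: w) t -
   (\sum_(i < d) derive (fun t => phi t - a) t 1 0 i *
    derive (Tp c j.+1 w) (phi t - a) (delta_mx 0 i)).
  rewrite Ed -sumrB; apply: eq_bigr => i _; rewrite mulrBr; congr (_ - _ * _).
  by have := @Dw1_Tp R d c j.+1 i w (phi t - a) sc; rewrite Dw1.
 exact: (is_deriveB (dG w t01) E).
have dgB (t : R) : 0 <= t <= 1 -> `|dg t| <= d%:R * L * (B * (l + d%:R * L) ^+ j).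
 move=> t01; apply: le_trans (ler_norm_sum _ _ _) _.
 apply: (@le_trans _ _ (\sum_(i < d) (L * (B * (l + d%:R * L) ^+ j)))).
  apply: ler_sum => i _; rewrite normrM; apply: ler_pM => //.
   exact: le_trans (coord_le_norm _ _) (dphiL t01).
  by apply: IHj => //; rewrite /= addnS -addSn.
 by rewrite sumr_const card_ord -[leLHS]mulr_natl mulrA.
have in01 (t : R) : t \in `[0, s]%R -> 0 <= t <= 1.
 by rewrite in_itv /= => /andP[-> ts] /=; exact: le_trans ts s1.
have [||t ts Et] := @MVT_segment R g dg 0 s s0.
- by move=> t ts; apply: D; apply: in01; exact: subset_itv_oo_cc ts.
- by apply: derivable_within_continuous => t /in01 /D [].
have -> : G w s - Tp c j.+1 w (phi s - a) = g 0 + dg t * (s - 0).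
 by rewrite -Et [RHS]addrC subrK.
apply: le_normD.
have lL : l <= l + d%:R * L by rewrite lerDl mulr_ge0.
apply: (@le_trans _ _ (B * l ^+ j.+1 + d%:R * L * (B * (l + d%:R * L) ^+ j))).
 apply: lerD; first exact: start.
 rewrite subr0 normrM (ger0_norm s0) (le_trans _ (dgB t (in01 _ ts))) //.
 by rewrite ler_piMr.
have -> : B * (l + d%:R * L) ^+ j.+1 =
 B * (l * (l + d%:R * L) ^+ j) + d%:R * L * (B * (l + d%:R * L) ^+ j).
 by rewrite exprS; ring.
rewrite lerD2r; apply: ler_wpM2l => //; rewrite exprS; apply: ler_wpM2l => //.
by apply: lerXn2r => //; rewrite nnegrE // addr_ge0 // mulr_ge0.
Qed.

End PathLemma.

Section FlatFunction.
Context {R : realType}.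
Implicit Types (P : {poly R}) (t : R).

Definition flatp P t : R := if 0 < t then P.[t^-1] * expR (- t^-1) else 0.

Definition flat_next P : {poly R} := 'X^2 * (P - P^`()).

Lemma poly_expR_bound P : exists2 M, 0 <= M &
 forall s : R, 0 < s -> `|P.[s] * expR (- s)| <= M / s ^+ 2.
Proof.
exists (\sum_(i < size P) `|P`_i| * (i.+2)`!%:R).
 by apply: sumr_ge0 => i _; rewrite mulr_ge0.
move=> s s0; rewrite horner_coef mulr_suml mulr_suml.
apply: le_trans (ler_norm_sum _ _ _) _; apply: ler_sum => i _.
rewrite -!mulrA normrM; apply: ler_wpM2l => //.
rewrite ger0_norm; last by rewrite mulr_ge0 ?exprn_ge0 ?expR_ge0 // ltW.
rewrite expRN ler_pdivrMr ?expR_gt0 // mulrAC ler_pdivlMr ?exprn_gt0 //.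
rewrite -exprD addn2 mulrC -ler_pdivrMr ?ltr0n ?fact_gt0 //.
by apply: le_trans (expR_ge1Dxn i.+1 (ltW s0)); rewrite lerDr.
Qed.

Lemma flatp_le P : exists2 M, 0 <= M & forall t, `|flatp P t| <= M * t ^+ 2.
Proof.
have [M M0 MP] := poly_expR_bound P; exists M => // t; rewrite /flatp.
case: ifPn => [t0|_]; last by rewrite normr0 mulr_ge0 // sqr_ge0.
by have := MP t^-1; rewrite invr_gt0 exprVn invrK; exact.
Qed.

Lemma flatp_derive P t : is_derive t 1 (flatp P) (flatp (flat_next P) t).
Proof.
have [t0|t0|t0] := ltgtP t 0.
- have E : \near t, (cst 0 : R -> R) t = flatp P t.
  near=> s; rewrite /flatp ifN //= -leNgt ltW //; near: s.
  by apply: open_nbhs_nbhs; split=> //; exact: open_lt.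
 apply: (near_eq_is_derive E); rewrite /flatp ifN -?leNgt ?ltW //.
 exact: is_derive_cst.
- have E : \near t, P.[t^-1] * expR (- t^-1) = flatp P t.
  near=> s; rewrite /flatp ifT //; near: s.
  by apply: open_nbhs_nbhs; split=> //; exact: open_gt.
 apply: (near_eq_is_derive E).
 have tn0 : t != 0 by rewrite gt_eqF.
 have DV : is_derive t 1 (fun y : R => y^-1) (- t ^- 2).
  have H := @is_deriveV R id t 1 1 tn0 (is_derive_id _ _).
  by move: H; rewrite /GRing.scale /= mulr1.
 have DP : is_derive t 1 (fun y : R => P.[y^-1]) (P^`().[t^-1] * (- t ^- 2)).
  exact: (is_derive1_comp (is_derive_poly P t^-1) DV).
 have DE : is_derive t 1 (fun y : R => expR (- y^-1)) (expR (- t^-1) * (t ^- 2)).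
  have DN : is_derive t 1 (fun y : R => - y^-1) (t ^- 2).
   by have H := is_deriveN DV; rewrite opprK in H.
  exact: (is_derive1_comp (is_derive_expR _) DN).
 have H := is_deriveM DP DE.
 rewrite /flatp t0 /flat_next; apply: is_derive_eq H _.
 rewrite !hornerE; move: (P.[_]) (P^`().[_]) (expR _) => p p' e.
 by rewrite -[p *: _]/(p * _) -[e *: _]/(e * _); field.
- have [M M0 MP] := flatp_le P.
 suff H : (fun h : R => h^-1 *: ((flatp P \o shift 0) (h *: 1) - flatp P 0)) @ 0^' --> (0 : R).
  rewrite t0 {2}/flatp ltxx; split; first by apply: cvgP H.
  exact/cvg_lim.
 apply/cvgrPdist_le => e e0; near=> h.
 have h0 : h != 0 by near: h; exact: nbhs_dnbhs_neq.
 have hM : `|h| < e / (M + 1).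
  by near: h; apply: dnbhs0_lt; rewrite divr_gt0 // ltr_wpDl.
 rewrite sub0r normrN /= addr0 [h *: 1]mulr1 {2}/flatp ltxx subr0.
 rewrite normrZ normfV ler_pdivrMl ?normr_gt0 //.
 apply: le_trans (MP h) _; rewrite -real_normK ?num_real // expr2 mulrCA.
 apply: ler_wpM2l => //; apply: (@le_trans _ _ ((M + 1) * `|h|)).
  by apply: ler_wpM2r => //; rewrite lerDl.
 by rewrite mulrC -ler_pdivlMr ?ltr_wpDl // ltW.
Unshelve. all: by end_near. Qed.

Lemma derive_R_scale (f : R -> R) (x v : R) : derivable f x 1 ->
 derivable f x v /\ derive f x v = v * derive f x 1.
Proof.
move=> /derivable1_diffP df; split; first exact: diff_derivable.
by rewrite !deriveE // -{1}[v]mulr1 -[v * 1]/(v *: (1 : R)) linearZ.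
Qed.

Lemma Cn_derive1 n (F : nat -> R -> R) :
 (forall k t, is_derive t 1 (F k) (F k.+1 t)) -> forall k, Cn n setT (F k).
Proof.
move=> dF; elim: n => [|n IHn] k.
 split=> // t _; apply: differentiable_continuous; apply/derivable1_diffP.
 by case: (dF k t).
split=> [t _|v].
 apply: differentiable_continuous; apply/derivable1_diffP.
 by case: (dF k t).
split=> [t _|]; first by apply: (derive_R_scale _ _).1; case: (dF k t).
have := CnM openT (Cn_cst n setT (v : R)) (IHn k.+1).
apply: Cn_ext; first exact: openT.
move=> t _; have [dt Et] := dF k t.
by rewrite (derive_R_scale v dt).2 Et.
Qed.

Lemma flatp_smooth P : smooth_on setT (flatp P).
Proof.
apply/smooth_onP => n; apply: (@Cn_derive1 n (fun k => flatp (iter k flat_next P)) _ 0%N).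
by move=> k t; exact: flatp_derive.
Qed.

End FlatFunction.

Section Steps.
Context {R : realType}.
Implicit Types t : R.

Definition flat t : R := flatp 1 t.

Lemma flat_gt0 t : 0 < t -> 0 < flat t.
Proof. by move=> t0; rewrite /flat /flatp t0 hornerE mul1r expR_gt0. Qed.

Lemma flat_le0 t : t <= 0 -> flat t = 0.
Proof. by move=> t0; rewrite /flat /flatp ltNge t0. Qed.

Lemma flat_ge0 t : 0 <= flat t.
Proof. by have [/flat_gt0/ltW //|/flat_le0 ->] := ltP 0 t. Qed.

Lemma smooth_comp1 {U : normedModType R} (A : set U) (F : R -> R) (k : U -> R) :
 open A -> smooth_on setT F -> smooth_on A k -> smooth_on A (F \o k).
Proof.
move=> oA sF sk.
have sF1 : smooth_on setT (F \o (fun u : 'rV[R]_1 => u 0 0)).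
 apply: smooth_on_comp_linear sF; last exact: coord_continuous.
 by move=> a u v; rewrite !mxE.
have sk1 : smooth_on A (fun x => \row_(i < 1) k x) by apply: (smooth_row oA) => i.
have := smooth_comp openT oA (fun _ _ => I) sF1 sk1.
by apply: smooth_on_ext => // x _ /=; rewrite mxE.
Qed.

Definition step t : R := flat t / (flat t + flat (1 - t)).

Lemma step_den t : flat t + flat (1 - t) != 0.
Proof.
rewrite gt_eqF //; have [t0|t0] := ltP 0 t.
 by rewrite ltr_pwDl ?flat_gt0 ?flat_ge0.
by rewrite ltr_wpDl ?flat_ge0 // flat_gt0 // subr_gt0 (le_lt_trans t0).
Qed.

Lemma smooth_idR : smooth_on setT (fun t => t).
Proof.
apply/smooth_onP => n; apply: (@Cn_derive1 R n
 (fun k => if k is k'.+1 then (if k' is 0%N then cst 1 else cst 0) else (fun t => t)) _ 0%N).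
move=> [|[|k]] t; [exact: is_derive_id|exact: is_derive_cst|exact: is_derive_cst].
Qed.

Lemma step_smooth : smooth_on setT step.
Proof.
have s1 : smooth_on setT flat by exact: flatp_smooth.
have s2 : smooth_on setT (fun t => flat (1 - t)).
 have k1 : smooth_on setT (fun t : R => 1 - t).
  exact: (smoothB openT (smooth_cst setT (1 : R)) smooth_idR).
 exact: (smooth_comp1 openT s1 k1).
have s3 := smoothD openT s1 s2.
have s4 := smoothV openT (fun t _ => step_den t) s3.
exact: (smoothM openT s1 s4).
Qed.

Lemma step_le0 t : t <= 0 -> step t = 0.
Proof. by move=> t0; rewrite /step flat_le0 // mul0r. Qed.

Lemma step_ge1 t : 1 <= t -> step t = 1.
Proof.
move=> t1; rewrite /step (@flat_le0 (1 - t)) ?subr_le0 // addr0 divff // gt_eqF //.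
by rewrite flat_gt0 // (lt_le_trans ltr01).
Qed.

Lemma step_ge0 t : 0 <= step t.
Proof. by rewrite divr_ge0 ?addr_ge0 ?flat_ge0. Qed.

Definition hat t : R := step (t + 1) - step t.

Lemma hat_smooth : smooth_on setT hat.
Proof.
apply: (smoothB openT); last exact: step_smooth.
have k1 : smooth_on setT (fun t : R => t + 1).
 exact: (smoothD openT smooth_idR (smooth_cst setT (1 : R))).
exact: (smooth_comp1 openT step_smooth k1).
Qed.

Lemma hat_out t : 1 <= `|t| -> hat t = 0.
Proof.
rewrite ler_normr /hat => /orP[t1|t1].
 by rewrite !step_ge1 ?subrr //; lra.
by rewrite !step_le0 ?subrr //; lra.
Qed.

Lemma hat_sum n t : `|t| <= n%:R -> \sum_(j < n.*2.+1) hat (t - (j%:R - n%:R)) = 1.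
Proof.
move=> tn.
pose G (j : nat) := - step (t + n%:R + 1 - j%:R).
have E j : hat (t - (j%:R - n%:R)) = G j.+1 - G j.
 rewrite /hat /G opprK [RHS]addrC; congr (step _ - step _); first by ring.
 by rewrite -natr1; ring.
have -> : \sum_(j < n.*2.+1) hat (t - (j%:R - n%:R)) = \sum_(0 <= j < n.*2.+1) (G j.+1 - G j).
 by rewrite big_mkord; apply: eq_bigr => j _; exact: E.
have /andP[t1 t2] : - n%:R <= t <= n%:R by rewrite -ler_norml.
rewrite telescope_sumr // /G opprK addrC step_ge1; last by rewrite subr0; lra.
rewrite step_le0 ?subr0 //; rewrite -natr1 -addnn natrD; lra.
Qed.

End Steps.

Section Grid.
Context {R : realType} {d : nat}.
Implicit Types (x y : 'rV[R]_d) (w : seq 'I_d).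

Definition bump y : R := \prod_(i < d) hat (y 0 i).

Lemma bump_smooth : smooth_on setT bump.
Proof.
apply: (smooth_prod openT) => i.
exact: (smooth_comp1 openT hat_smooth (smooth_coord i openT)).
Qed.

Lemma bump_out y : 1 <= `|y| -> bump y = 0.
Proof.
move=> y1; have [i yi] : exists i, 1 <= `|y 0 i|.
 apply: contrapT => /forallNP H; have : `|y| < 1.
  apply: row_norm_lt => // i.
  by rewrite ltNge; apply/negP; exact: H.
 by rewrite ltNge y1.
by rewrite /bump (bigD1 i) //= hat_out // mul0r.
Qed.

Lemma Dw_bump_out w y : 1 < `|y| -> Dw w bump y = 0.
Proof.
move=> y1; have oA : open [set z : 'rV[R]_d | 1 < `|z|].
 apply: (@open_comp _ _ (fun z : 'rV[R]_d => `|z|) [set r | 1 < r]); last exact: open_gt.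
 by move=> z _; exact: norm_continuous.
rewrite (@Dw_ext _ _ _ _ (cst 0) w y oA) //; first by rewrite Dw_cst; case: w.
by move=> z /= z1; rewrite bump_out // ltW.
Qed.

Lemma Dw_bump_bound (K : nat) : exists2 M, 0 <= M &
 forall w y, (size w <= K)%N -> `|Dw w bump y| <= M.
Proof.
elim: K => [|K [M M0 MP]].
 have [M M0 MP] := smooth_bounded (r := 1) [::] bump_smooth (fun _ _ => I).
 exists M => // -[|//] y _; have [y1|y1] := leP `|y| 1; first exact: MP.
 by rewrite Dw_bump_out // normr0.
have /choice [M' M'P] : forall w : K.+1.-tuple 'I_d, exists M, 0 <= M /\
  forall y, `|y| <= 1 -> `|Dw w bump y| <= M.
 by move=> w; have [M1 ? ?] := smooth_bounded (r := 1) w bump_smooth (fun _ _ => I); exists M1.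
have S0 : 0 <= \sum_w M' w by apply: sumr_ge0 => w _; have [] := M'P w.
exists (M + \sum_w M' w); first exact: addr_ge0.
move=> w y; rewrite leq_eqVlt => /orP[/eqP wK|wK]; last first.
 by apply: le_trans (MP w y wK) _; rewrite lerDl.
have [y1|y1] := leP `|y| 1; last by rewrite Dw_bump_out // normr0 addr_ge0.
pose t := Tuple (introT eqP wK).
apply: (@le_trans _ _ (M' t)); first exact: (M'P t).2.
rewrite (bigD1 t) //= addrCA lerDl addr_ge0 //.
by apply: sumr_ge0 => v _; have [] := M'P v.
Qed.

Definition gridpt n (j : {ffun 'I_d -> 'I_n.*2.+1}) : 'rV[R]_d :=
 \row_i ((j i)%:R - n%:R).

Definition gridbump (E : R) n (j : {ffun 'I_d -> 'I_n.*2.+1}) x : R :=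
 bump (diagmap (fun=> E) (fun i => - gridpt j 0 i) x).

Lemma gridbumpE (E : R) n (j : {ffun 'I_d -> 'I_n.*2.+1}) x :
 gridbump E j x = bump (E *: x - gridpt j).
Proof.
by congr bump; apply/rowP => i; rewrite [LHS]mxE [RHS]mxE [in RHS]mxE [X in _ = _ + X]mxE.
Qed.

Lemma gridbump_smooth (E : R) n (j : {ffun 'I_d -> 'I_n.*2.+1}) :
 smooth_on setT (gridbump E j).
Proof.
exact: (smooth_comp openT openT (fun _ _ => I) bump_smooth (diagmap_smooth _ _ openT)).
Qed.

Lemma Dw_gridbump (E : R) n (j : {ffun 'I_d -> 'I_n.*2.+1}) w x :
 Dw w (gridbump E j) x = E ^+ size w * Dw w bump (E *: x - gridpt j).
Proof.
rewrite (@Dw_diagmap _ _ _ _ setT setT bump w x openT openT (fun _ _ => I) bump_smooth I).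
congr (_ * Dw w bump _); first by elim: w => [|i w IH]; rewrite ?big_nil // big_cons IH exprS.
by apply/rowP => i; rewrite [LHS]mxE [RHS]mxE [in RHS]mxE [X in _ = _ + X]mxE.
Qed.

Lemma gridbump_sum (E : R) n x : 0 <= E -> E * `|x| <= n%:R ->
 \sum_j gridbump E (n := n) j x = 1.
Proof.
move=> E0 Ex.
transitivity (\prod_(i < d) \sum_(j < n.*2.+1) hat (E * x 0 i - (j%:R - n%:R))).
 rewrite bigA_distr_bigA /=; apply: eq_bigr => j _.
 by rewrite gridbumpE /bump; apply: eq_bigr => i _; rewrite !mxE.
rewrite big1 // => i _; apply: hat_sum.
rewrite normrM ger0_norm // (le_trans _ Ex) //.
by apply: ler_wpM2l => //; exact: coord_le_norm.
Qed.

Lemma card_grid n : #|{: {ffun 'I_d -> 'I_n.*2.+1}}|%:R = (n.*2.+1)%:R ^+ d :> R.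
Proof. by rewrite card_ffun !card_ord natrX. Qed.

End Grid.

Section SlowIndex.
Context {R : realType}.

Lemma slow_index (c : nat -> R) : exists q : nat -> nat, forall Q, exists k0, forall k,
 (k0 <= k)%N -> (Q <= q k)%N /\ c (q k) <= 2 ^+ k.
Proof.
have big2 (x : R) : exists k0 : nat, forall k, (k0 <= k)%N -> x <= 2 ^+ k.
 have [k0 k0P] : exists k0 : nat, x <= k0%:R.
  by exists (Num.bound `|x|); exact: le_trans (ler_norm _) (ltW (archi_boundP (normr_ge0 x))).
 exists k0 => k kk; apply: (le_trans k0P); rewrite -natrX ler_nat.
 by apply: leq_trans kk _; rewrite ltnW // ltn_expl.
exists (fun k => \max_(i < k.+1 | `[< c i <= 2 ^+ k >]) i) => Q.
have [k0 k0P] := big2 (c Q).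
exists (maxn k0 Q) => k; rewrite geq_max => /andP[kk Qk].
have PQ : `[< c (Ordinal (leq_ltn_trans Qk (ltnSn k))) <= 2 ^+ k >].
 by apply/asboolP; exact: k0P.
split.
 exact: (@leq_bigmax_cond _ (fun i : 'I_k.+1 => `[< c i <= 2 ^+ k >]) (fun i => i : nat)
  (Ordinal (leq_ltn_trans Qk (ltnSn k))) PQ).
have [|i Pi ->] := @eq_bigmax_cond 'I_k.+1 (fun i : 'I_k.+1 => `[< c i <= 2 ^+ k >]) (fun i => i : nat).
 by apply/card_gt0P; eexists; exact: PQ.
by move/asboolP: Pi.
Qed.

End SlowIndex.

Lemma words_bound (R : realType) d (F : seq 'I_d -> R) (K : nat) :
 exists2 M, 0 <= M & forall w, (size w <= K)%N -> `|F w| <= M.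
Proof.
elim: K => [|K [M M0 MP]]; first by exists `|F [::]| => // -[|//].
have S0 : 0 <= \sum_(w : K.+1.-tuple 'I_d) `|F w| by apply: sumr_ge0.
exists (M + \sum_(w : K.+1.-tuple 'I_d) `|F w|); first exact: addr_ge0.
move=> w; rewrite leq_eqVlt => /orP[/eqP wK|wK]; last first.
 by apply: le_trans (MP w wK) _; rewrite lerDl.
pose t := Tuple (introT eqP wK).
rewrite (bigD1 t) //= addrCA lerDl addr_ge0 //.
by apply: sumr_ge0.
Qed.

Lemma subn_split (q Q s : nat) : (s <= Q -> Q <= q -> q - s = (Q - s) + (q - Q))%N.
Proof. lia. Qed.

Lemma leq_sub_split (q Q s u : nat) : (s <= Q -> Q <= q -> u <= Q - s + (q - Q) + s -> u <= q)%N.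
Proof. lia. Qed.

Lemma leq_order_sub (K P m s : nat) : (s <= K -> 0 < P -> m <= K + P * m - s)%N.
Proof. by move=> sK P0; rewrite leq_subRL; nia. Qed.

Lemma leq_order_subM (K P m s : nat) : (s <= K -> P * m <= K + P * m - s)%N.
Proof. lia. Qed.

Section TaylorExtra.
Context {R : realType} {d : nat}.
Implicit Types (c : seq 'I_d -> R) (w u v : seq 'I_d) (h x a : 'rV[R]_d).

Lemma Dw_shift (F : 'rV[R]_d -> R) a w x : Dw w (fun x => F (x - a)) x = Dw w F (x - a).
Proof.
by rewrite -{2}[w]map_id; apply: (@Dw_embed R d d (fun x => x - a) id F) => i h y; rewrite addrA.
Qed.

Lemma smooth_shift (F : 'rV[R]_d -> R) a : smooth_on setT F ->
 smooth_on setT (fun x => F (x - a)).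
Proof.
move=> sF; apply: (smooth_on_ext openT _ (smooth_comp openT openT (fun _ _ => I) sF
 (diagmap_smooth (fun=> 1) (fun i => - a 0 i) openT))).
by move=> x _ /=; congr F; apply/rowP => i; rewrite !mxE mul1r.
Qed.

Lemma Dw_Tp c q u w h : symm_words c -> (size u <= q)%N ->
 Dw u (Tp c q w) h = Tp c (q - size u) (u ++ w) h.
Proof.
move=> sc; elim: u h => [|i u IHu] h uq; first by rewrite subn0.
have E : Dw u (Tp c q w) = Tp c (q - size u) (u ++ w).
 by apply/funext => y; apply: IHu; exact: ltnW.
rewrite Dw_cons E -[LHS]/((fun x => derive (Tp c (q - size u) (u ++ w)) x (delta_mx 0 i)) h).
by rewrite -Dw1 Dw1_Tp // -(subnSK uq).
Qed.

Lemma Tp_tail c m p w h (B : R) : 0 <= B -> d%:R * `|h| <= 1 ->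
 (forall u, (size u <= m + p + size w)%N -> `|c u| <= B) ->
 `|Tp c (m + p) w h - Tp c m w h| <= p%:R * B * (d%:R * `|h|) ^+ m.
Proof.
move=> B0 h1; elim: p => [|p IHp] cB; first by rewrite addn0 subrr normr0 !mul0r.
rewrite addnS {1}/Tp big_ord_recr /= -/(Tp c (m + p) w h) addrAC.
apply: le_normD; rewrite [p.+1%:R]mulrS !mulrDl mul1r [leRHS]addrC.
apply: lerD.
 by apply: IHp => u uk; apply: cB; rewrite addnS addSn; exact: leqW.
rewrite -/(Qp c (m + p).+1 w h) normrM normfV [X in _ / X]ger0_norm //.
apply: (@le_trans _ _ (B * (d%:R * `|h|) ^+ (m + p).+1 / 1)).
 apply: ler_pM => //.
  by apply: Qp_bound => u uk; apply: cB; rewrite addnS.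
 by rewrite lef_pV2 ?posrE // ?ler1n ?ltr0n fact_gt0.
rewrite divr1; apply: ler_wpM2l => //.
have h0 : 0 <= d%:R * `|h| by rewrite mulr_ge0.
by rewrite -addnS exprD ler_piMr ?exprn_ge0 // exprn_ile1.
Qed.

Lemma Tp_bound c m w h (B : R) : 0 <= B -> d%:R * `|h| <= 1 ->
 (forall u, (size u <= m + size w)%N -> `|c u| <= B) ->
 `|Tp c m w h| <= m.+1%:R * B.
Proof.
move=> B0 h1 cB; have := @Tp_tail c 0 m w h B B0 h1.
rewrite add0n expr0 mulr1 /Tp big_ord1 /= divr1 => /(_ cB) H.
rewrite [m.+1%:R]mulrS mulrDl mul1r addrC -[X in `|X|](subrK (c w)).
apply: le_normD; apply: lerD => //.
by apply: cB; rewrite leq_addl.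
Qed.

Lemma Tp_compare (ca cb : seq 'I_d -> R) (a b x : 'rV[R]_d) (Q : nat) (B B1 l : R) v :
 symm_words ca -> symm_words cb -> 0 <= B -> 0 <= B1 -> 0 <= l -> d%:R * `|x - b| <= 1 ->
 (forall u, (size u <= Q)%N -> `|ca u| <= B1) -> (forall u, (size u <= Q)%N -> `|cb u| <= B1) ->
 (forall j w, (j + size w <= Q)%N -> `|cb w - Tp ca j w (b - a)| <= B * l ^+ j) ->
 (size v <= Q)%N ->
 `|Tp cb (Q - size v) v (x - b) - Tp ca (Q - size v) v (x - a)| <=
  (B + Q.+2%:R * B1) * (l + d%:R * `|x - b|) ^+ (Q - size v).
Proof.
move=> sa sb B0 B10 l0 xb1 caB cbB W vQ.
pose phi (s : R) := s *: (x - b) + b.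
pose G w (s : R) : R := if (size w <= Q)%N then Tp cb (Q - size w) w (s *: (x - b)) else 0.
have line (s : R) : is_derive s 1 (fun s : R => s *: (x - b)) (x - b).
 have Dl : derivable (fun s : R => s *: (x - b)) s 1.
  by apply/derivable1_diffP; exact: ex_diff.
 split=> //; rewrite deriveE; last by apply/derivable1_diffP.
 by rewrite diff_val /= scale1r.
have phiP (s : R) : 0 <= s <= 1 -> is_derive s 1 phi (x - b).
 move=> _; have := is_derive_sub_cst (- b) (line s).
 by rewrite /phi; under eq_fun do rewrite opprK.
have GP w (s : R) : 0 <= s <= 1 ->
  is_derive s 1 (G w) (\sum_i (x - b) 0 i * G (i :: w) s).
 move=> _; rewrite /G; have [wQ|wQ] := leqP (size w) Q; last first.
  rewrite big1; first exact: is_derive_cst.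
  by move=> i _; rewrite /= leqNgt ltnS (ltnW wQ) /= mulr0.
 have [E|wQ'] := eqVneq (size w) Q.
  rewrite big1; last by move=> i _; rewrite /= E ltnn mulr0.
  have -> : (fun s : R => Tp cb (Q - size w) w (s *: (x - b))) = cst (cb w).
   by apply/funext => t; rewrite E subnn /Tp big_ord1 /= divr1.
  exact: is_derive_cst.
 have wQ2 : (size w < Q)%N by rewrite ltn_neqAle wQ'.
 have [Dl El] := line s.
 have D : is_derive s 1 (Tp cb (Q - size w) w \o (fun s : R => s *: (x - b)))
  (\sum_(i < d) derive (fun s : R => s *: (x - b)) s 1 0 i *
    derive (Tp cb (Q - size w) w) (s *: (x - b)) (delta_mx 0 i)).
  apply: (@is_derive_comp _ _ _ _ _ setT) => //; first exact: openT.
  - by move=> y i _; exact: smooth_derivable (Tp_smooth cb _ w) I.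
  - by move=> i; exact: smooth_continuous (smooth_derive _ (Tp_smooth cb _ w)) I.
 apply: is_derive_eq D _; rewrite El; apply: eq_bigr => i _; congr (_ * _).
 rewrite /= wQ2 -(subnSK wQ2).
 by have := @Dw1_Tp R d cb (Q - (size w).+1).+1 i w (s *: (x - b)) sb; rewrite Dw1.
have B'0 : 0 <= B + Q.+2%:R * B1 by rewrite addr_ge0 // mulr_ge0.
have := @path_estimate R d ca a phi (fun=> x - b) G Q (B + Q.+2%:R * B1) l `|x - b|
 sa B'0 l0 (normr_ge0 _) phiP (fun s _ => lexx _) GP _ _ (Q - size v)%N v 1.
rewrite /G vQ scale1r /phi scale1r subrK; apply => //.
- move=> j w jw; have wQ : (size w <= Q)%N by apply: leq_trans jw; rewrite leq_addl.
 rewrite wQ scale0r add0r Tp0; apply: le_trans (W j w jw) _.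
 by apply: ler_wpM2r; rewrite ?exprn_ge0 // lerDl mulr_ge0.
- move=> w s wQ /andP[s0 s1]; rewrite wQ; apply: le_normB.
 have -> : B + Q.+2%:R * B1 = Q.+1%:R * B1 + B1 + B by rewrite -[Q.+2%:R]natr1; ring.
 rewrite ler_wpDr //; apply: lerD; last exact: caB.
 apply: (@le_trans _ _ ((Q - size w).+1%:R * B1)); last first.
  by apply: ler_wpM2r => //; rewrite ler_nat ltnS leq_subr.
 apply: Tp_bound => //; last by move=> u; rewrite subnK //; exact: cbB.
 apply: le_trans xb1; apply: ler_wpM2l => //; rewrite normrZ ger0_norm // ler_piMl //.
- by rewrite subnK.
- by rewrite ler01 lexx.
Qed.

End TaylorExtra.

Section Extension.
Context {R : realType} {d : nat}.
Variables (U U' : set 'rV[R]_d) (f : 'rV[R]_d -> R) (K0 P : nat) (C : R).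
Hypotheses (oU : open U) (sf : smooth_on U f) (U'U : U' `<=` U).
Hypothesis (U'K : forall a, U' a -> `|a| + 1 <= K0%:R).
Hypotheses (P0 : (0 < P)%N) (C0 : 0 <= C).
Hypothesis whitney : forall q : nat, exists2 B, 0 <= B & forall a b, U' a -> U' b ->
 exists2 l, 0 <= l /\ l ^+ P <= C * `|a - b| & forall j w, (j + size w <= q)%N ->
  `|Dw w f b - Tp (fun u => Dw u f a) j w (b - a)| <= B * l ^+ j.

Let cj a : seq 'I_d -> R := fun u => Dw u f a.

Let cj_sym a : U' a -> symm_words (cj a).
Proof. by move=> /U'U Ua v i j w; exact: Dw_swap oU sf Ua. Qed.

Let jets_bound q : exists2 B1, 0 <= B1 & forall a w, U' a -> (size w <= q)%N -> `|Dw w f a| <= B1.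
Proof.
have [[a0 U'a0]|noU'] := pselect (exists a, U' a); last first.
 by exists 0 => // a w U'a; case: noU'; exists a.
have [B B0 BP] := whitney q; have [M M0 MP] := words_bound (cj a0) q.
exists (B + M); first exact: addr_ge0.
move=> b w U'b wq; have [l _ /(_ 0%N w wq)] := BP a0 b U'a0 U'b.
rewrite /Tp big_ord1 /= divr1 expr0 mulr1 => H.
rewrite -[Dw w f b](subrK (Dw w f a0)); apply: le_normD.
by apply: lerD => //; exact: MP.
Qed.

Let B1 q : R := s2val (cid2 (jets_bound q)).
Let B1_ge0 q : 0 <= B1 q. Proof. by rewrite /B1; case: (cid2 _). Qed.
Let B1P q a w : U' a -> (size w <= q)%N -> `|Dw w f a| <= B1 q.
Proof. by rewrite /B1; case: (cid2 _) => B ? H; exact: H. Qed.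

Let slow := cid (slow_index (fun q => q.+1%:R * B1 q)).
Let q := sval slow.
Let qP Q : exists k0, forall k, (k0 <= k)%N -> (Q <= q k)%N /\ (q k).+1%:R * B1 (q k) <= 2 ^+ k.
Proof. exact: (svalP slow). Qed.

Let E k : R := 4 ^+ k.
Let n k := (K0 * 4 ^ k)%N.
Let E_gt0 k : 0 < E k. Proof. exact: exprn_gt0. Qed.
Let E_ge0 k : 0 <= E k. Proof. exact: ltW. Qed.
Let E_ge1 k : 1 <= E k. Proof. by rewrite /E exprn_ege1 // ler1n. Qed.
Let J k (j : {ffun 'I_d -> 'I_(n k).*2.+1}) : set 'rV[R]_d :=
 [set a | U' a /\ `|E k *: a - gridpt j| <= 2].
Let inJ k (j : {ffun 'I_d -> 'I_(n k).*2.+1}) : bool := `[< exists a, J j a >].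
Let pt k (j : {ffun 'I_d -> 'I_(n k).*2.+1}) := xget 0 (J j).
Let ptP k (j : {ffun 'I_d -> 'I_(n k).*2.+1}) : inJ j -> J j (pt j).
Proof. by move=> /asboolP [a Ja]; exact: (xgetPex 0 (ex_intro _ a Ja)). Qed.

Let gb k (j : {ffun 'I_d -> 'I_(n k).*2.+1}) := gridbump (E k) j.
Let fk k x := \sum_(j | inJ j) gb j x * Tp (cj (pt j)) (q k) [::] (x - pt (k := k) j).
Let chi k x := \sum_(j | inJ (k := k) j) gb j x.

Let gb_smooth k (j : {ffun 'I_d -> 'I_(n k).*2.+1}) : smooth_on setT (gb j).
Proof. exact: gridbump_smooth. Qed.

Let TT (a : 'rV[R]_d) Q (x : 'rV[R]_d) := Tp (cj a) Q [::] (x - a).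
Let TT_smooth a Q : smooth_on setT (TT a Q).
Proof. exact: (smooth_shift a (Tp_smooth (cj a) Q [::])). Qed.

Let Dw_TT a Q u x : U' a -> (size u <= Q)%N ->
 Dw u (TT a Q) x = Tp (cj a) (Q - size u) u (x - a).
Proof.
move=> U'a uQ; rewrite (@Dw_shift _ _ (Tp (cj a) Q [::])).
by rewrite (Dw_Tp _ _ (cj_sym U'a) uQ) cats0.
Qed.

Let fk_smooth k : smooth_on setT (fk k).
Proof.
by apply: (smooth_sum openT) => j; exact: (smoothM openT (gb_smooth j) (TT_smooth _ _)).
Qed.

Let chi_smooth k : smooth_on setT (chi k).
Proof. by apply: (smooth_sum openT) => j; exact: gb_smooth. Qed.

Let gb_out k (j : {ffun 'I_d -> 'I_(n k).*2.+1}) x b : U' b -> E k * `|x - b| <= 1 ->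
 ~~ inJ j -> gb j x = 0.
Proof.
move=> U'b xb /asboolP nJ; rewrite /gb gridbumpE; apply: bump_out.
rewrite leNgt; apply/negP => Ex; apply: nJ; exists b; split=> //.
rewrite -(subrKA (E k *: x)) (le_trans (ler_normD _ _)) // -[2]/(1 + 1 : R) -scalerBr normrZ.
by rewrite lerD ?(ltW Ex) // distrC ger0_norm // ltW.
Qed.

Let chi1 k x b : U' b -> `|x| <= K0%:R -> E k * `|x - b| <= 1 -> chi k x = 1.
Proof.
move=> U'b xK xb; rewrite -(@gridbump_sum R d (E k) (n k) x (E_ge0 k)); last first.
 by rewrite /n natrM natrX mulrC; apply: ler_wpM2r => //; exact: E_ge0.
rewrite [RHS](bigID (@inJ k)) /= [X in _ + X]big1 ?addr0 // => j.
exact: gb_out U'b xb.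
Qed.

Let chi0 k x : (forall b, U' b -> 3 <= E k * `|x - b|) -> chi k x = 0.
Proof.
move=> far; apply: big1 => j /ptP [U'p p2]; rewrite /gb gridbumpE; apply: bump_out.
have := far _ U'p; have -> : E k * `|x - pt j| = `|E k *: x - E k *: pt j|.
 by rewrite -scalerBr normrZ ger0_norm.
rewrite -(subrKA (gridpt j)) => H; have := le_trans H (ler_normD _ _).
rewrite [X in _ + X]distrC => H'; lra.
Qed.

(* Cost of a sum over the grid and of one Leibniz rule: only the power of [E k] matters. *)
Let sum_gb_bound (K : nat) : exists2 M, 0 <= M & forall k (x : 'rV[R]_d)
  (g : {ffun 'I_d -> 'I_(n k).*2.+1} -> 'rV[R]_d -> R) (e : R),
 (forall j, smooth_on setT (g j)) -> 0 <= e ->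
 (forall j u, inJ j -> (size u <= K)%N -> `|E k *: x - gridpt j| <= 1 -> `|Dw u (g j) x| <= e) ->
 forall u, (size u <= K)%N ->
 `|Dw u (fun y => \sum_(j | inJ j) gb j y * g j y) x| <= M * E k ^+ (K + d) * e.
Proof.
have [M M0 MP] := @Dw_bump_bound R d K.
exists ((2 ^+ K * M) * (3 * (K0%:R + 1)) ^+ d).
 by rewrite !mulr_ge0 ?exprn_ge0 // mulr_ge0 // addr_ge0.
move=> k x g e sg e0 ge u uK.
have sM j : smooth_on setT (fun y => gb j y * g j y) by exact: (smoothM openT (gb_smooth j) (sg j)).
rewrite (Dw_sum openT _ _ u sM I).
have term j : inJ j -> `|Dw u (fun y => gb j y * g j y) x| <= 2 ^+ K * M * E k ^+ K * e.
 move=> Jj; have [x1|x1] := leP `|E k *: x - gridpt j| 1; last first.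
  have gb0 v : Dw v (gb j) x = 0 by rewrite Dw_gridbump Dw_bump_out // mulr0.
  have [M2 M20 M2P] := words_bound (fun v => Dw v (g j) x) K.
  have := @Dw_mul_bound R d setT (gb j) (g j) x (fun=> 0) (fun=> M2) K openT (gb_smooth j) (sg j) I.
  move=> /(_ _ M2P u uK)/le_trans; apply; first by move=> v _; rewrite gb0 normr0.
  by rewrite leibniz_cst mulr0 mul0r !mulr_ge0 ?exprn_ge0.
 have := @Dw_mul_bound R d setT (gb j) (g j) x (fun=> M * E k ^+ K) (fun=> e) K openT
  (gb_smooth j) (sg j) I.
 move=> /(_ _ (fun v vK => ge j v Jj vK x1) u uK)/le_trans; apply.
  move=> v vK; rewrite Dw_gridbump normrM mulrC; apply: ler_pM => //; first exact: MP.
  by rewrite ger0_norm ?exprn_ge0 //; apply: ler_weXn2l.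
 rewrite leibniz_cst !mulrA; do 3 (apply: ler_wpM2r; rewrite ?exprn_ge0 //).
 by apply: ler_weXn2l => //; rewrite ler1n.
apply: le_trans (ler_norm_sum _ _ _) _; apply: le_trans (ler_sum _ term) _.
have c0 : 0 <= 2 ^+ K * M * E k ^+ K * e by rewrite !mulr_ge0 ?exprn_ge0.
apply: (@le_trans _ _ (\sum_(j : {ffun 'I_d -> 'I_(n k).*2.+1}) (2 ^+ K * M * E k ^+ K * e))).
 by rewrite [leRHS](bigID (@inJ k)) /= lerDl; apply: sumr_ge0.
rewrite sumr_const -[leLHS]mulr_natl card_grid.
have -> : 2 ^+ K * M * (3 * (K0%:R + 1)) ^+ d * E k ^+ (K + d) * e =
 (3 * (K0%:R + 1) * E k) ^+ d * (2 ^+ K * M * E k ^+ K * e).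
 by rewrite exprD [(_ * E k) ^+ d]exprMn; ring.
apply: ler_wpM2r => //; apply: lerXn2r; rewrite ?nnegrE ?mulr_ge0 ?addr_ge0 //.
rewrite -natr1 -mul2n natrM /n natrM natrX -/(E k).
by have := E_ge1 k; have : 0 <= K0%:R :> R by []; nra.
Qed.

Let addX_le (x y : R) : 0 <= x -> 0 <= y -> (x + y) ^+ P <= 2 ^+ P * (x ^+ P + y ^+ P).
Proof.
move=> x0 y0; have H (a b : R) : 0 <= a -> a <= b -> (a + b) ^+ P <= 2 ^+ P * (a ^+ P + b ^+ P).
 move=> a0 ab; have b0 : 0 <= b := le_trans a0 ab.
 apply: (@le_trans _ _ ((2 * b) ^+ P)).
  by apply: lerXn2r; rewrite ?nnegrE ?addr_ge0 ?mulr_ge0 // mulr_natl mulr2n lerD2r.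
 by rewrite exprMn; apply: ler_wpM2l; rewrite ?exprn_ge0 // lerDr exprn_ge0.
have [xy|/ltW yx] := leP x y; first exact: H.
by rewrite addrC [x ^+ P + _]addrC; exact: H.
Qed.

Let E_big (c : R) : exists k0, forall k, (k0 <= k)%N -> c / E k <= 1.
Proof.
have [k0 k0P] : exists k0 : nat, c <= k0%:R.
 by exists (Num.bound `|c|); exact: le_trans (ler_norm _) (ltW (archi_boundP (normr_ge0 c))).
exists k0 => k kk; rewrite ler_pdivrMr // mul1r (le_trans k0P) // /E -natrX ler_nat.
by apply: leq_trans kk _; rewrite ltnW // ltn_expl.
Qed.

Let term_est (K m : nat) : exists k0 C4, 0 <= C4 /\ forall k, (k0 <= k)%N ->
 forall a b x v, U' a -> U' b -> E k * `|x - a| <= 3 -> E k * `|x - b| <= 1 ->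
 (size v <= K)%N ->
 `|Dw v (fun y => TT a (q k) y - TT b (K + P * m) y) x| <= C4 * 2 ^+ k / E k ^+ m.
Proof.
set Q := (K + P * m)%N; have [B B0 BP] := whitney Q.
pose C3 := 2 ^+ P * (4 * C + d%:R ^+ P); pose B' := B + Q.+2%:R * B1 Q.
have C30 : 0 <= C3 by rewrite mulr_ge0 ?exprn_ge0 // addr_ge0 ?mulr_ge0 ?exprn_ge0.
have B'0 : 0 <= B' by rewrite addr_ge0 // mulr_ge0.
have [k1 k1P] := qP Q; have [k2 k2P] := E_big (3 * d%:R); have [k3 k3P] := E_big C3.
exists (maxn k1 (maxn k2 k3)), ((3 * d%:R) ^+ m + B' * C3 ^+ m); split.
 by rewrite addr_ge0 ?mulr_ge0 ?exprn_ge0 // mulr_ge0.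
move=> k; rewrite !geq_max => /and3P[/k1P [Qq qB] /k2P d1 /k3P c1].
move=> a b x v U'a U'b xa xb vK.
have vQ : (size v <= Q)%N by rewrite (leq_trans vK) // leq_addr.
have mQ : (m <= Q - size v)%N by exact: leq_order_sub.
have PmQ : (P * m <= Q - size v)%N by exact: leq_order_subM.
rewrite (DwB openT v (TT_smooth a (q k)) (TT_smooth b Q) I).
rewrite (Dw_TT _ U'a (leq_trans vQ Qq)) (Dw_TT _ U'b vQ).
have da : d%:R * `|x - a| <= 3 * d%:R / E k.
 by rewrite ler_pdivlMr // -mulrA [3 * _]mulrC; apply: ler_wpM2l => //; rewrite mulrC.
have db : d%:R * `|x - b| <= d%:R / E k.
 by rewrite ler_pdivlMr // -mulrA ler_piMr // mulrC.
have db1 : d%:R * `|x - b| <= 1.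
 apply: le_trans db _; apply: le_trans d1; apply: ler_wpM2r; first by rewrite invr_ge0.
 by rewrite ler_peMl // ler1n.
have T1 : `|Tp (cj a) (q k - size v) v (x - a) - Tp (cj a) (Q - size v) v (x - a)|
  <= (3 * d%:R) ^+ m * 2 ^+ k / E k ^+ m.
 rewrite (subn_split vQ Qq); apply: le_trans (@Tp_tail R d (cj a) _ _ v _ (B1 (q k)) (B1_ge0 _) _ _) _.
 - exact: le_trans da d1.
 - by move=> u uq; apply: B1P => //; exact: leq_sub_split vQ Qq uq.
 rewrite [leRHS]mulrAC -expr_div_n mulrC; apply: ler_pM.
 - by rewrite exprn_ge0 // mulr_ge0.
 - by rewrite mulr_ge0.
 - apply: (@le_trans _ _ ((3 * d%:R / E k) ^+ (Q - size v))).
   by apply: lerXn2r => //; rewrite nnegrE ?mulr_ge0 // ?invr_ge0.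
  by apply: ler_wiXn2l => //; rewrite mulr_ge0 ?mulr_ge0 ?invr_ge0.
 - by apply: le_trans qB; apply: ler_wpM2r => //; rewrite ler_nat leqW // leq_subr.
have T2 : `|Tp (cj a) (Q - size v) v (x - a) - Tp (cj b) (Q - size v) v (x - b)|
  <= B' * C3 ^+ m * 2 ^+ k / E k ^+ m.
 have [l [l0 lP] lW] := BP a b U'a U'b.
 rewrite distrC; apply: le_trans (@Tp_compare R d (cj a) (cj b) a b x Q B (B1 Q) l v _ _ _ _ _ _ _ _ _ _) _ => //.
 - exact: cj_sym.
 - exact: cj_sym.
 - by move=> u uQ; exact: B1P.
 - by move=> u uQ; exact: B1P.
 rewrite -/B' -!mulrA; apply: ler_wpM2l => //.
 set lam := l + _; have lam0 : 0 <= lam by rewrite addr_ge0 // mulr_ge0.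
 have lamP : lam ^+ P <= C3 / E k.
  apply: le_trans (addX_le l0 _) _; first by rewrite mulr_ge0.
  rewrite /C3 -mulrA; apply: ler_wpM2l; first exact: exprn_ge0.
  rewrite mulrDl; apply: lerD.
   apply: le_trans lP _; rewrite [4 * C]mulrC -mulrA; apply: ler_wpM2l => //.
   rewrite ler_pdivlMr // mulrC -[a](subrK x) -addrA.
   apply: le_trans (ler_wpM2l (E_ge0 k) (ler_normD _ _)) _; rewrite mulrDr distrC; lra.
  apply: (@le_trans _ _ ((d%:R / E k) ^+ P)).
   by apply: lerXn2r => //; rewrite nnegrE ?mulr_ge0 // ?invr_ge0.
  rewrite expr_div_n; apply: ler_wpM2l; first exact: exprn_ge0.
  by rewrite lef_pV2 ?posrE ?exprn_gt0 // ler_eXnr.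
 have lam1 : lam <= 1.
  by have := le_trans lamP c1; rewrite -[X in _ <= X](expr1n R P) ler_pXn2r // nnegrE.
 apply: (@le_trans _ _ (lam ^+ (P * m))); first exact: ler_wiXn2l.
 rewrite exprM mulrCA -expr_div_n; apply: (@le_trans _ _ ((C3 / E k) ^+ m)).
  by apply: lerXn2r => //; rewrite nnegrE ?exprn_ge0 // mulr_ge0 // invr_ge0.
 apply: ler_peMl; first by rewrite exprn_ge0 // mulr_ge0 // invr_ge0.
 by rewrite exprn_ege1 // ler1n.
rewrite -(subrKA (Tp (cj a) (Q - size v) v (x - a))); apply: le_normD.
by apply: le_trans (lerD T1 T2) _; rewrite !mulrDl.
Qed.

Let near_est (K : nat) : exists k0 M, 0 <= M /\ forall k, (k0 <= k)%N ->
 forall b x u, U' b -> `|x| < K0%:R -> E k * `|x - b| < 1 -> (size u <= K)%N ->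
 `|Dw u (fun y => fk k y - TT b (K + P * (K + d + (K + d).+1)) y) x|
   <= M * 2 ^+ k / E k ^+ (K + d).+1.
Proof.
set m := (K + d + (K + d).+1)%N.
have [k0 [C4 [C40 C4P]]] := term_est K m; have [M M0 MP] := sum_gb_bound K.
exists k0, (M * C4); split; first exact: mulr_ge0.
move=> k kk b x u U'b xK xb uK.
pose V : set 'rV[R]_d := [set y | `|y| < K0%:R] `&` ball b (E k)^-1.
have oV : open V.
 apply: openI; last exact: ball_open.
 apply: (@open_comp _ _ (fun z : 'rV[R]_d => `|z|) [set r | r < K0%:R]); last exact: open_lt.
 by move=> z _; exact: norm_continuous.
have Ey (y : 'rV[R]_d) : ball b (E k)^-1 y = (E k * `|y - b| < 1) :> Prop.
 by rewrite ballE -[X in _ < X]mul1r ltr_pdivlMr // mulrC.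
have Vx : V x by split=> //=; rewrite Ey.
pose g (j : {ffun 'I_d -> 'I_(n k).*2.+1}) y := TT (pt j) (q k) y - TT b (K + P * m) y.
have sg j : smooth_on setT (g j) by exact: (smoothB openT (TT_smooth _ _) (TT_smooth _ _)).
rewrite (@Dw_ext _ _ V _ (fun y => \sum_(j | inJ j) gb j y * g j y) u x oV _ Vx); last first.
 move=> y [yK /=]; rewrite Ey => yb; rewrite /g.
 under [RHS]eq_bigr do rewrite mulrBr.
 rewrite sumrB -mulr_suml -/(chi k y) (chi1 U'b (ltW yK) (ltW yb)) mul1r.
 by [].
have e0 : 0 <= C4 * 2 ^+ k / E k ^+ m by rewrite !mulr_ge0 ?invr_ge0 ?exprn_ge0.
apply: le_trans (MP k x g _ sg e0 _ u uK) _.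
 move=> j v Jj vK x1; have [U'p p2] := ptP Jj; apply: C4P => //; last exact: ltW.
 have -> : E k * `|x - pt j| = `|E k *: x - E k *: pt j| by rewrite -scalerBr normrZ ger0_norm.
 rewrite -(subrKA (gridpt j)); apply: le_normD.
 by rewrite [X in _ + X]distrC; lra.
apply: le_eq; rewrite /m [E k ^+ (K + d + _)%N]exprD.
have En0 i : E k ^+ i != 0 by rewrite expf_neq0 // gt_eqF.
move: (En0 (K + d)%N) (En0 (K + d).+1).
by move: (E k ^+ (K + d)) (E k ^+ (K + d).+1) => X Y X0 Y0; field; rewrite X0 Y0.
Qed.

Let gk k x := if k is k'.+1 then chi k'.+2 x * (fk k'.+1 x - fk k' x) else fk 0 x.

Let gk_smooth k : smooth_on setT (gk k).
Proof.
case: k => [|k]; first exact: fk_smooth.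
exact: (smoothM openT (chi_smooth _) (smoothB openT (fk_smooth _) (fk_smooth _))).
Qed.

Let ES k : E k.+1 = 4 * E k. Proof. by rewrite /E exprS. Qed.

Let gk_tail w : exists k0 M, forall k, (k0 <= k)%N -> forall x, `|x| < K0%:R ->
 `|Dw w (gk k.+1) x| <= M / 2 ^+ k.+1.
Proof.
set K := size w; have [k0 [M [M0 MP]]] := near_est K; have [M' M'0 M'P] := sum_gb_bound K.
set Q := (K + P * (K + d + (K + d).+1))%N in MP.
exists k0, (2 * (2 ^+ K * (M' * 16 ^+ (K + d)) * (3 * M))) => k kk x xK.
have [[b [U'b xb]]|far] := pselect (exists b, U' b /\ E k.+1 * `|x - b| < 1); last first.
 have far' b : U' b -> 1 <= E k.+1 * `|x - b|.
  by move=> U'b; rewrite leNgt; apply/negP => xb; apply: far; exists b.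
 have oV : open (ball x (E k.+2)^-1) by exact: ball_open.
 rewrite (@Dw_ext _ _ _ _ (cst 0) w x oV _ (ballxx _ _)) ?invr_gt0 //; last first.
  move=> y; rewrite -ball_normE /ball_ /= => yx; rewrite /gk chi0 ?mul0r // => b U'b.
  have yx' : E k.+2 * `|x - y| < 1 by rewrite mulrC -ltr_pdivlMr // mul1r.
  have := far' b U'b; have xyb : `|x - b| <= `|x - y| + `|y - b|.
   by rewrite -(subrKA y) ler_normD.
  have := ler_wpM2l (E_ge0 k.+2) xyb; rewrite mulrDr ES -/(E k.+1).
  by move: yx'; rewrite ES; lra.
 rewrite Dw_cst; case: (w) => [|? ?]; rewrite normr0 divr_ge0 ?exprn_ge0 //;
 by rewrite !mulr_ge0 ?exprn_ge0.
have xb0 : E k * `|x - b| < 1.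
 by apply: le_lt_trans xb; rewrite ES; apply: ler_wpM2r => //; rewrite ler_peMl // ler1n.
have sD := smoothB openT (fk_smooth k.+1) (fk_smooth k).
have H1 v : (size v <= K)%N -> `|Dw v (chi k.+2) x| <= M' * 16 ^+ (K + d) * E k ^+ (K + d).
 move=> vK; have := M'P k.+2 x (fun=> cst 1) 1 (fun j => smooth_cst setT (1 : R)) ler01 _ v vK.
 rewrite (@Dw_ext _ _ setT _ (chi k.+2) v x openT _ I); last first.
  by move=> y _; apply: eq_bigr => j _; rewrite mulr1.
 rewrite mulr1 ES ES mulrA -natrM exprMn mulrA; apply.
 by move=> j u _ _ _; rewrite Dw_cst; case: u; rewrite ?normr1 ?normr0.
have H2 v : (size v <= K)%N -> `|Dw v (fun y => fk k.+1 y - fk k y) x|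
  <= 3 * M * 2 ^+ k / E k ^+ (K + d).+1.
 move=> vK; rewrite (DwB openT v (fk_smooth k.+1) (fk_smooth k) I).
 have F1 := MP k.+1 (leqW kk) b x v U'b xK xb vK.
 have F2 := MP k kk b x v U'b xK xb0 vK.
 rewrite (DwB openT v (fk_smooth _) (TT_smooth b Q) I) in F1.
 rewrite (DwB openT v (fk_smooth _) (TT_smooth b Q) I) in F2.
 rewrite -(subrKA (Dw v (TT b Q) x)); apply: le_normD.
 rewrite [X in _ + X]distrC; apply: le_trans (lerD F1 F2) _.
 have -> : 3 * M * 2 ^+ k / E k ^+ (K + d).+1 =
  M * (2 * 2 ^+ k) / E k ^+ (K + d).+1 + M * 2 ^+ k / E k ^+ (K + d).+1 by ring.
 rewrite lerD2r exprS; apply: ler_wpM2l; first by rewrite !mulr_ge0 ?exprn_ge0.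
 rewrite lef_pV2 ?posrE ?exprn_gt0 //; apply: lerXn2r; rewrite ?nnegrE //.
 by rewrite ES ler_peMl // ler1n.
have := @Dw_mul_bound R d setT (chi k.+2) (fun y => fk k.+1 y - fk k y) x
 (fun=> M' * 16 ^+ (K + d) * E k ^+ (K + d)) (fun=> 3 * M * 2 ^+ k / E k ^+ (K + d).+1) K
 openT (chi_smooth _) sD I H1 H2 w (leqnn _).
move=> /le_trans; apply; rewrite leibniz_cst; apply: le_eq.
have E4 : E k = 2 ^+ k * 2 ^+ k by rewrite /E -exprMn -natrM.
have En0 : E k ^+ (K + d) != 0 by rewrite expf_neq0 // gt_eqF.
have k20 : 2 ^+ k != 0 :> R by rewrite expf_neq0.
rewrite [_ ^+ (K + d).+1]exprS {2}E4 exprS; field.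
by rewrite k20 En0.
Qed.

Let finite_patch (a : nat -> 'rV[R]_d -> R) (A : set 'rV[R]_d) :
 (forall k, exists2 M, 0 <= M & forall x, A x -> `|a k x| <= M) ->
 (exists k0 M, forall k, (k0 <= k)%N -> forall x, A x -> `|a k x| <= M / 2 ^+ k) ->
 exists M, forall k x, A x -> `|a k x| <= M / 2 ^+ k.
Proof.
move=> aM [k0 [M MP]]; elim: k0 M MP => [|k0 IH] M MP; first by exists M => k x; exact: MP.
have [M0 M00 M0P] := aM k0.
apply: (IH (`|M| + M0 * 2 ^+ k0)) => k; rewrite leq_eqVlt => /orP[/eqP <-|kk] x Ax.
 rewrite mulrDl mulfK ?expf_neq0 // ler_wpDl ?divr_ge0 ?exprn_ge0 //; exact: M0P.
apply: le_trans (MP k kk x Ax) _; apply: ler_wpM2r; first by rewrite invr_ge0 exprn_ge0.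
by rewrite (le_trans (ler_norm M)) // lerDl mulr_ge0 ?exprn_ge0.
Qed.

Lemma whitney_extension : exists2 F : 'rV[R]_d -> R,
 smooth_on (ball (0 : 'rV[R]_d) K0%:R) F & forall x, U' x -> F x = f x.
Proof.
set A := ball _ _; have oA : open A by exact: ball_open.
have AE x : A x -> `|x| < K0%:R by rewrite /A ball0E.
have /choice [Cw CwP] : forall w, exists M, forall k x, A x -> `|Dw w (gk k) x| <= M / 2 ^+ k.
 move=> w; apply: finite_patch.
  move=> k; have [M M0 MP] := smooth_bounded (r := K0%:R) w (gk_smooth k) (fun _ _ => I).
  by exists M => // x Ax; apply: MP; rewrite ltW // AE.
 have [k0 [M MP]] := gk_tail w; exists k0.+1, M => -[//|k] kk x Ax.
 by apply: MP => //; exact: AE.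
have sgA k : smooth_on A (gk k) by exact: smooth_on_sub (gk_smooth k).
have [F [sF FP]] := smooth_series oA sgA CwP.
exists F => // x U'x; have xK : `|x| < K0%:R by apply: lt_le_trans (U'K U'x); rewrite ltrDl.
have Ax : A x by rewrite /A ball0E.
have chix k : chi k x = 1.
 by apply: (chi1 U'x (ltW xK)); rewrite subrr normr0 mulr0 ler01.
have := FP [::] x Ax; rewrite Dw_nil -(cvg_shiftS _) => Fx.
have Sf k : \sum_(0 <= i < k.+1) Dw [::] (gk i) x = fk k x.
 elim: k => [|k IHk]; first by rewrite big_nat1.
 by rewrite big_nat_recr //= IHk Dw_nil /= chix mul1r addrC subrK.
have fkf : fk k x @[k --> \oo] --> f x.
 have [k0 [M [M0 MP]]] := near_est 0.
 apply/cvgrPdist_le => e e0.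
 have : (fun k => M * (2^-1) ^+ k) @ \oo --> (0 : R).
  rewrite -[X in _ --> X](mulr0 M); apply: cvgM; first exact: cvg_cst.
  by apply: cvg_expr; rewrite gtr0_norm ?invr_gt0 // invf_lt1 // ltr1n.
 move=> /cvgrPdist_le /(_ _ e0) [N _ NP]; exists (maxn N k0) => // k.
 rewrite /= geq_max => /andP[Nk kk]; have := NP k Nk; rewrite sub0r normrN => Hk.
 have xx : E k * `|x - x| < 1 by rewrite subrr normr0 mulr0 ltr01.
 have := MP k kk x x [::] U'x xK xx (leq0n _).
 rewrite Dw_nil /TT subrr Tp0 distrC => /le_trans; apply.
 apply: le_trans Hk; apply: le_trans (ler_norm _); rewrite -mulrA; apply: ler_wpM2l => //.
 rewrite exprVn ler_pdivrMr ?exprn_gt0 // mulrC ler_pdivlMr ?exprn_gt0 //.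
 have -> : 2 ^+ k * 2 ^+ k = E k :> R by rewrite /E -exprMn -natrM.
 by rewrite exprS ler_peMr // exprn_ege1.
apply: (cvg_unique (@Rhausdorff R) _ fkf).
by apply: cvg_trans Fx; apply: near_eq_cvg; apply: nearW => k; rewrite /= Sf.
Qed.

End Extension.

Lemma whitney_local {R : realType} {d : nat} (U : set 'rV[R]_d) (f : 'rV[R]_d -> R) x0 (rho C : R) (P : nat) :
 open U -> smooth_on U f -> 0 < rho -> (0 < P)%N -> 0 <= C ->
 (forall q : nat, exists2 B, 0 <= B & forall a b, U a -> U b -> `|a - x0| < rho -> `|b - x0| < rho ->
  exists2 l, 0 <= l /\ l ^+ P <= C * `|a - b| & forall j w, (j + size w <= q)%N ->
   `|Dw w f b - Tp (fun u => Dw u f a) j w (b - a)| <= B * l ^+ j) ->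
 exists W G, [/\ open W, W x0, smooth_on W G & forall y, W y -> U y -> G y = f y].
Proof.
move=> oU sf rho0 P0 C0 wh; pose U' := U `&` [set a | `|a - x0| < rho]; pose K0 := Num.bound (`|x0| + rho + 1).
have K0P : `|x0| + rho + 1 <= K0%:R.
 by apply: ltW; apply: archi_boundP; rewrite !addr_ge0 // ltW.
have U'K a : U' a -> `|a| + 1 <= K0%:R.
 move=> [_ /= ar]; apply: le_trans K0P; rewrite lerD2r -[a](subrK x0).
 by apply: le_normD; rewrite addrC lerD2l ltW.
have U'U : U' `<=` U by move=> a [].
have [|G sG GE] := @whitney_extension R d U U' f K0 P C oU sf U'U U'K P0 C0.
 by move=> q; have [B B0 BP] := wh q; exists B => // a b [Ua ar] [Ub br]; exact: BP.
exists (ball 0 K0%:R `&` ball x0 rho), G; split.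
- by apply: openI; exact: ball_open.
- split; last exact: ballxx.
 by rewrite ball0E; apply: lt_le_trans K0P; rewrite -addrA ltrDl addr_gt0.
- by apply: smooth_on_sub sG => y [].
- by move=> y [_]; rewrite ballE => yr Uy; apply: GE; split.
Qed.

Section TestMaps.
Context {R : realType}.

Definition testable {d : nat} (X : set 'rV[R]_d) (f : 'rV[R]_d -> R) : Prop :=
 forall (k : nat) (P : set 'rV[R]_k) (c : 'rV[R]_k -> 'rV[R]_d), open P ->
  smooth_on P c -> (forall x, P x -> X (c x)) -> smooth_on P (f \o c).

Lemma pseudo_immersion_testable n m (p : 'rV[R]_n -> 'rV[R]_m) d (X : set 'rV[R]_d)
  (f : 'rV[R]_d -> 'rV[R]_n) (i : 'I_n) :
 pseudo_immersion p -> {within X, continuous f} -> Cinf X (p \o f) ->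
 testable X (fun x => f x 0 i).
Proof.
move=> [_ pP] cf Cpf k P c oP sc cX.
apply: (proj1 (smooth_on_row (f \o c) oP) _ i).
apply: pP => //.
 apply: continuous_in_subspaceT => t /set_mem Pt.
 have /subspace_continuousP /(_ _ (cX t Pt)) cft := cf.
 have cc : {for t, continuous c} by exact: smooth_continuous sc Pt.
 suff : (f \o c) @ (nbhs t) --> (f \o c) t by [].
 move=> B /cft; rewrite /= /fmap /= => BX.
 have : nbhs t (P `&` (c @^-1` [set y | X y -> (f @^-1` B) y])).
  by apply: filterI; [exact: open_nbhs_nbhs | exact: (cc _ BX)].
 by apply: filterS => s [Ps]; apply; exact: cX.
apply: smooth_on_locally => t Pt.
have [W [F [oW Wct sF FE]]] := Cpf _ (cX t Pt).
have oA : open (P `&` (c @^-1` W)).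
 rewrite openE => s [Ps Ws]; apply: filterI; first exact: open_nbhs_nbhs.
 have cc : {for s, continuous c} by exact: smooth_continuous sc Ps.
 by apply: cc; exact: open_nbhs_nbhs.
exists (P `&` (c @^-1` W)) => //.
apply: (@smooth_on_ext _ _ _ _ (F \o c)) => //.
 by move=> s [Ps Ws] /=; apply: FE => //; exact: cX.
apply: (smooth_on_comp oW oA _ sF); first by move=> s [].
by apply: smooth_on_sub sc => s [].
Qed.

Lemma testable_smooth d (X U : set 'rV[R]_d) f : testable X f -> open U -> U `<=` X ->
 smooth_on U f.
Proof. by move=> tf oU UX; exact: (tf d U (fun x => x) oU (smooth_id oU)). Qed.

(* [f] is only continuous on [X], so it is compared with the extension on the dense part [U] first. *)
Lemma Cinf_of_extensions n d (X U : set 'rV[R]_d) (f : 'rV[R]_d -> 'rV[R]_n) :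
 {within X, continuous f} -> U `<=` X -> X `<=` closure U ->
 (forall x i, X x -> exists W F, [/\ open W, W x, smooth_on W F &
  forall y, W y -> U y -> F y = f y 0 i :> R]) -> Cinf X f.
Proof.
move=> cf UX XU ext x Xx.
have /choice [W WP] : forall i, exists W, exists F : 'rV[R]_d -> R, [/\ open W, W x, smooth_on W F &
  forall y, W y -> U y -> F y = f y 0 i] by move=> i; exact: ext.
have /choice [F FP] := WP.
have oW : open [set y | forall i, W i y].
 rewrite openE => y Wy; rewrite /interior.
 have nW i : nbhs y (W i) by have [oWi _ _ _] := FP i; exact: open_nbhs_nbhs.
 exact: filter_forall nW.
exists [set y | forall i, W i y], (fun y => \row_i F i y); split=> //.
- by move=> i; have [] := FP i.
- apply: (smooth_row oW) => i; have [_ _ sF _] := FP i.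
 by apply: smooth_on_sub sF => y; exact.
- move=> y Wy Xy; apply/rowP => i; rewrite mxE; have [oWi _ sF FE] := FP i.
 apply/eqP; rewrite -subr_eq0 -normr_le0; apply/ler_addgt0Pr => e e0; rewrite add0r.
 have e20 : 0 < e / 2 by rewrite divr_gt0.
 have /subspace_continuousP /(_ _ Xy) cfy := cf.
 have cfi : (fun z => f z 0 i) @ within X (nbhs y) --> f y 0 i.
  exact: cvg_comp cfy (@coord_continuous _ _ _ _ _ (f y)).
 have /cvgrPdist_le /(_ _ e20) nf := cfi.
 have /cvgrPdist_le /(_ _ e20) nF := smooth_continuous sF (Wy i).
 have nWi : nbhs y (W i) by exact: open_nbhs_nbhs.
 have := XU _ Xy _ (filterI nWi (filterI nF nf)).
 move=> [z [Uz [Wz [Fz fz]]]]; have fz' := fz (UX _ Uz).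
 rewrite -(FE _ Wz Uz) in fz'.
 exact: (le_dist_half Fz fz').
Qed.

Lemma punctured_eq (r : R) (G H : 'rV[R]_1 -> R) : 0 < r ->
 {for 0, continuous G} -> {for 0, continuous H} ->
 (forall x, `|x| < r -> x != 0 -> G x = H x) -> H 0 = G 0.
Proof.
move=> r0 cG cH GH; apply/esym/limit_eq => // e e0; pose t := Num.min e r / 2.
have t0 : 0 < t by rewrite divr_gt0 // lt_min e0.
have [te tr] : t < e /\ t < r.
 by apply/andP; rewrite -lt_min ltr_pdivrMr // ltr_pMr ?ltr1n // lt_min e0.
have xt : `|const_mx t : 'rV[R]_1| <= t by apply: row_norm_le => [|i]; [exact: ltW | rewrite mxE gtr0_norm].
exists (const_mx t); first by rewrite subr0 (le_lt_trans xt).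
apply: GH; first exact: le_lt_trans xt tr.
by apply: contraTneq t0 => /rowP/(_ 0); rewrite !mxE => ->; rewrite ltxx.
Qed.

Lemma power_factor_bound (K : nat) (r M : R) (G H : 'rV[R]_1 -> R) : 0 < r ->
 smooth_on (ball 0 r) G -> (forall x, `|x| < r -> `|Dw (nseq K ord0) G x| <= M) ->
 {for 0, continuous H} ->
 (forall x, `|x| < r -> x != 0 -> G x = x 0 0 ^+ K * H x) -> `|H 0| <= M.
Proof.
move=> r0; elim: K r r0 M G => [|K IHK] r r0 M G sG GM cH GH.
 have -> : H 0 = G 0; last by rewrite -[G]Dw_nil; apply: GM; rewrite normr0.
 apply: (punctured_eq r0 _ cH); first exact: smooth_continuous sG (ballxx _ r0).
 by move=> x xr xn0; rewrite GH // expr0 mul1r.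
have r20 : 0 < r / 2 by rewrite divr_gt0.
have r2r : r / 2 < r by rewrite ltr_pdivrMr // ltr_pMr // ltr1n.
have G0 : G 0 = 0.
 rewrite -(punctured_eq (H := fun x => x 0 0 ^+ K.+1 * H x) r0 _ _ GH).
 - by rewrite mxE expr0n mul0r.
 - exact: smooth_continuous sG (ballxx _ r0).
 - have cx := smooth_continuous (smoothX openT K.+1 (smooth_coord (R := R) (0 : 'I_1) openT)) (I : setT 0).
  exact: cvgM cx cH.
apply: (IHK (r / 2) r20 M (hadamard ord0 G)).
- apply: (@hadamard_smooth R 1 ord0 (r / 2) (ball 0 r) G (@ball_open _ _ _ _)) => //.
 by move=> x xr; rewrite ball0E (le_lt_trans xr).
- move=> x xr; apply: (@hadamard_bound R 1 ord0 (r / 2) (ball 0 r) G) => //.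
 + exact: ball_open.
 + by move=> y yr; rewrite ball0E (le_lt_trans yr).
 + by rewrite ball0E.
 move=> s s01; rewrite -[rcons _ _]cats1 -[[:: ord0]]/(nseq 1 ord0) -nseqD addn1.
 by apply: GM; rewrite (le_lt_trans (scoord_norm _ _ s01)) // (lt_trans xr).
- by [].
- move=> x xr xn0; have x00 : x 0 0 != 0.
  by apply: contra xn0 => /eqP x0; apply/eqP/rowP => j; rewrite ord1 x0 mxE.
 rewrite /hadamard (negPf x00).
 have -> : scoord ord0 0 x = 0 by apply/rowP => j; rewrite scoordE ord1 eqxx mul0r mxE.
 rewrite G0 subr0 GH ?(lt_trans xr) // exprS -mulrA.
 by rewrite [LHS]mulrC mulKf.
Qed.

End TestMaps.

Section BumpProfiles.
Context {R : realType}.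
Implicit Types t : R.

Definition profB t : R := step (3 - 4 * t) * step (3 + 4 * t).
Definition profA t : R := t ^+ 2 * (step (4 - 4 * t) * step (4 + 4 * t)).

Let smooth_affine_step (a b : R) : smooth_on setT (fun t : R => step (a + b * t)).
Proof.
have k1 := smoothD openT (smooth_cst setT (a : R)) (smoothZ openT b smooth_idR).
exact: (smooth_comp1 openT step_smooth k1).
Qed.

Lemma profB_smooth : smooth_on setT profB.
Proof.
have := smoothM openT (smooth_affine_step 3 (-4)) (smooth_affine_step 3 4).
by apply: smooth_on_ext; [exact: openT | move=> t _; rewrite mulNr].
Qed.

Lemma profA_smooth : smooth_on setT profA.
Proof.
have s1 := smoothM openT (smooth_affine_step 4 (-4)) (smooth_affine_step 4 4).
have := smoothM openT (smoothX openT 2 smooth_idR) s1.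
by apply: smooth_on_ext; [exact: openT | move=> t _; rewrite mulNr].
Qed.

Lemma profB_in t : `|t| <= 1 / 2 -> profB t = 1.
Proof. by rewrite ler_norml => /andP[? ?]; rewrite /profB !step_ge1 ?mulr1 //; lra. Qed.

Lemma profB_out t : 3 / 4 <= `|t| -> profB t = 0.
Proof.
rewrite ler_normr /profB => /orP[?|?].
 by rewrite (@step_le0 R (3 - 4 * t)) ?mul0r //; lra.
by rewrite (@step_le0 R (3 + 4 * t)) ?mulr0 //; lra.
Qed.

Lemma step_le1 t : step t <= 1.
Proof.
rewrite /step ler_pdivrMr ?mul1r ?lerDl ?flat_ge0 //.
by rewrite lt0r step_den addr_ge0 ?flat_ge0.
Qed.

Lemma profB_01 t : 0 <= profB t <= 1.
Proof.
by rewrite mulr_ge0 ?step_ge0 //= -[1]mulr1 ler_pM ?step_ge0 ?step_le1.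
Qed.

Lemma profA_in t : `|t| <= 3 / 4 -> profA t = t ^+ 2.
Proof. by rewrite ler_norml => /andP[? ?]; rewrite /profA !step_ge1 ?mulr1 //; lra. Qed.

Lemma profA_out t : 1 <= `|t| -> profA t = 0.
Proof.
rewrite ler_normr /profA => /orP[?|?].
 by rewrite (@step_le0 R (4 - 4 * t)) ?mul0r ?mulr0 //; lra.
by rewrite (@step_le0 R (4 + 4 * t)) ?mulr0 //; lra.
Qed.

Lemma profA_01 t : 0 <= profA t <= 1.
Proof.
have s0 : 0 <= step (4 - 4 * t) * step (4 + 4 * t) by exact: mulr_ge0 (step_ge0 _) (step_ge0 _).
have s1 : step (4 - 4 * t) * step (4 + 4 * t) <= 1.
 by rewrite -[1]mulr1; apply: ler_pM; rewrite ?step_ge0 ?step_le1.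
apply/andP; split; first exact: mulr_ge0 (sqr_ge0 _) s0.
have [t1|t1] := leP 1 `|t|; first by rewrite profA_out // ler01.
rewrite -[1]mulr1; apply: ler_pM => //; first exact: sqr_ge0.
by rewrite -real_normK ?num_real //; apply: exprn_ile1 => //; exact: ltW.
Qed.

Lemma pow2_gauss (j : nat) : exists2 C : R, 0 <= C &
 forall k : nat, 2 ^+ ((k + 2) * j) * (2 ^- (k * k)) <= C / 2 ^+ k.
Proof.
exists (2 ^+ (2 * j + (j + 1) * (j + 1))); first exact: exprn_ge0.
move=> k; rewrite ler_pdivrMr ?exprn_gt0 // mulrAC ler_pdivlMr ?exprn_gt0 //.
rewrite -!exprD; apply: ler_weXn2l; first by rewrite ler1n.
nia.
Qed.

End BumpProfiles.

Lemma expr_split (R : realType) (x k L : R) (N m : nat) :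
 (k * (x ^+ 2 * L) ^+ N) ^+ m = x ^+ (2 * N * m) * (k * L ^+ N) ^+ m.
Proof. by rewrite [(_ * L) ^+ N]exprMn mulrCA [LHS]exprMn -!exprM mulnA. Qed.

Section CuspBounds.
Context {R : realType} {d : nat}.
Variables (X U : set 'rV[R]_d) (x0 e : 'rV[R]_d) (f : 'rV[R]_d -> R) (kap s0 eps : R) (N : nat).
Hypotheses (oU : open U) (UX : U `<=` X) (Xx0 : X x0) (tf : testable X f).
Hypotheses (kap0 : 0 < kap) (s00 : 0 < s0) (eps0 : 0 < eps) (N0 : (0 < N)%N).
Hypothesis cusp : forall y s v, U y \/ y = x0 -> ball x0 eps y -> 0 < s -> s <= s0 ->
 `|v| <= kap * s ^+ N -> U (y + s *: e + v).

Local Notation t0 := (lshift d (ord0 : 'I_1)).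
Let tc (x : 'rV[R]_(1 + d)) : R := x 0 t0.
Let uc (x : 'rV[R]_(1 + d)) (i : 'I_d) : R := x 0 (rshift 1 i).

Let slab : set 'rV[R]_(1 + d) := [set x | forall i, `|uc x i| <= 1].

Let prof_bound (Psi : 'rV[R]_(1 + d) -> R) : smooth_on setT Psi ->
 (forall x, 1 <= `|tc x| -> Psi x = 0) ->
 forall w, exists2 M, 0 <= M & forall x, slab x -> `|Dw w Psi x| <= M.
Proof.
move=> sP P0 w; have [M M0 MP] := smooth_bounded (r := 1) w sP (fun _ _ => I).
exists M => // x sx; have [x1|x1] := leP `|tc x| 1.
 apply: MP; apply: row_norm_le => // b.
 by case: (split_ordP b) => j ->; [rewrite (ord1 j) | exact: sx].
have oA : open [set z : 'rV[R]_(1 + d) | 1 < `|tc z|].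
 apply: (@open_comp _ _ (fun z : 'rV[R]_(1 + d) => `|tc z|) [set r | 1 < r]); last exact: open_gt.
 move=> z _; apply: (@continuous_comp _ _ _ tc (fun r : R => `|r|)); last exact: norm_continuous.
 exact: coord_continuous.
rewrite (@Dw_ext _ _ _ _ (cst 0) w x oA) //; first by rewrite Dw_cst; case: (w); rewrite normr0.
by move=> z /= z1; apply: P0; exact: ltW.
Qed.

Let lk k (i : 'I_(1 + d)) : R := if i == t0 then 2 ^+ (k + 2) else 1.
Let bk (i : 'I_(1 + d)) : R := if i == t0 then -4 else 0.
Let Lk k := diagmap (lk k) bk.

Let tc_Lk k x : tc (Lk k x) = 2 ^+ (k + 2) * tc x - 4.
Proof. by rewrite /tc /Lk mxE /lk /bk eqxx. Qed.

Let rl (i : 'I_d) : (rshift 1 i == t0) = false.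
Proof. by apply/eqP => /(congr1 val) /=; rewrite add1n. Qed.

Let uc_Lk k x i : uc (Lk k x) i = uc x i.
Proof. by rewrite /uc /Lk mxE /lk /bk rl mul1r addr0. Qed.

Let Dw_Lk (Psi : 'rV[R]_(1 + d) -> R) w M k x : smooth_on setT Psi -> 0 <= M -> slab x ->
 (forall x, slab x -> `|Dw w Psi x| <= M) ->
 `|Dw w (Psi \o Lk k) x| <= 2 ^+ ((k + 2) * size w) * M.
Proof.
move=> sP M0 sx MP.
rewrite (@Dw_diagmap _ _ _ _ setT setT Psi w x openT openT (fun _ _ => I) sP I) normrM.
apply: ler_pM => //; last by apply: MP => i; rewrite uc_Lk.
elim: w {MP} => [|i w IHw]; first by rewrite big_nil normr1 muln0.
rewrite big_cons normrM /= mulnS exprD; apply: ler_pM => //.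
have p1 : (1 : R) <= 2 ^+ (k + 2) by apply: exprn_ege1; rewrite ler1n.
by rewrite /lk; case: eqP => _; rewrite ger0_norm ?exprn_ge0.
Qed.

Let xi k x := 2 ^+ (k + 2) * tc x - 4.

Let xi_inj k j x : `|xi k x| < 1 -> `|xi j x| < 1 -> k = j.
Proof.
wlog kj : k j / (k <= j)%N.
 by move=> H; have [kj|/ltnW jk] := leqP k j; [exact: H | move=> *; apply/esym; exact: H].
move=> xk xj; apply/eqP; rewrite eqn_leq kj leqNgt; apply/negP => lt_kj.
move: xk xj; rewrite !ltr_norml /xi => /andP[k1 k2] /andP[j1 j2].
have t_gt0 : 0 < tc x by rewrite -(pmulr_rgt0 _ (exprn_gt0 (k + 2) (ltr0Sn R 1))); lra.
have : 2 * (2 ^+ (k + 2) * tc x) <= 2 ^+ (j + 2) * tc x.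
 rewrite mulrA -exprS; apply: ler_wpM2r; first exact: ltW.
 by apply: ler_weXn2l; [rewrite ler1n | rewrite -addSn leq_add2r].
lra.
Qed.

Section Glue.
Variables (lam : nat -> R) (y : nat -> 'rV[R]_d).
Hypotheses (lam0 : forall k, 0 < lam k) (lams : forall k, lam k <= s0) (lam1 : forall k, lam k <= 2 ^- (k * k)).
Hypotheses (Uy : forall k, U (y k)) (ylam : forall k, `|y k - x0| <= lam k)
 (yk : forall k, `|y k - x0| <= kap / 2 * (lam k / 4) ^+ N) (yeps : forall k, ball x0 eps (y k)).

Let term k (i : 'I_d) (x : 'rV[R]_(1 + d)) : R :=
 lam k * e 0 i * profA (xi k x) + (y k - x0) 0 i * profB (xi k x)
 + kap / 2 * lam k ^+ N * (profA (xi k x) ^+ N * uc x i).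

Let Psi1 (x : 'rV[R]_(1 + d)) := profA (tc x).
Let Psi2 (x : 'rV[R]_(1 + d)) := profB (tc x).
Let Psi3 i (x : 'rV[R]_(1 + d)) := profA (tc x) ^+ N * uc x i.

Let sPsi1 : smooth_on setT Psi1.
Proof. exact: (smooth_comp1 openT profA_smooth (smooth_coord t0 openT)). Qed.
Let sPsi2 : smooth_on setT Psi2.
Proof. exact: (smooth_comp1 openT profB_smooth (smooth_coord t0 openT)). Qed.
Let sPsi3 i : smooth_on setT (Psi3 i).
Proof.
apply: (smoothM openT); last exact: smooth_coord openT.
by apply: (smoothX openT); exact: sPsi1.
Qed.

Let sLk k : smooth_on setT (Lk k). Proof. exact: diagmap_smooth openT. Qed.
Let sP1 k : smooth_on setT (Psi1 \o Lk k). Proof. exact: (smooth_comp openT openT (fun _ _ => I) sPsi1 (sLk k)). Qed.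
Let sP2 k : smooth_on setT (Psi2 \o Lk k). Proof. exact: (smooth_comp openT openT (fun _ _ => I) sPsi2 (sLk k)). Qed.
Let sP3 k i : smooth_on setT (Psi3 i \o Lk k). Proof. exact: (smooth_comp openT openT (fun _ _ => I) (sPsi3 i) (sLk k)). Qed.

Let term' k (i : 'I_d) (x : 'rV[R]_(1 + d)) : R :=
 lam k * e 0 i * (Psi1 \o Lk k) x + (y k - x0) 0 i * (Psi2 \o Lk k) x
 + kap / 2 * lam k ^+ N * (Psi3 i \o Lk k) x.

Let termE k i : term' k i = term k i.
Proof. by apply/funext => x; rewrite /term' /term /Psi1 /Psi2 /Psi3 /= tc_Lk uc_Lk. Qed.

Let term_smooth k i : smooth_on setT (term k i).
Proof.
rewrite -termE; apply: (smoothD openT); last exact: (smoothZ openT _ (sP3 k i)).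
exact: (smoothD openT (smoothZ openT _ (sP1 k)) (smoothZ openT _ (sP2 k))).
Qed.

Let lamN k : lam k ^+ N <= lam k.
Proof.
have l1 : lam k <= 1 by apply: le_trans (lam1 k) _; rewrite invf_le1 ?exprn_gt0 // exprn_ege1 // ler1n.
by rewrite -[leRHS]expr1; apply: ler_wiXn2l => //; exact: ltW.
Qed.

Let term_bound i w : exists C, forall k x, slab x -> `|Dw w (term k i) x| <= C / 2 ^+ k.
Proof.
have [M1 M10 M1P] := prof_bound sPsi1 (fun x => @profA_out R (tc x)) w.
have P20 x : 1 <= `|tc x| -> Psi2 x = 0 by move=> x1; apply: profB_out; apply: le_trans x1; lra.
have [M2 M20 M2P] := prof_bound sPsi2 P20 w.
have P30 x : 1 <= `|tc x| -> Psi3 i x = 0.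
 by move=> x1; rewrite /Psi3 profA_out // expr0n gtn_eqF // mul0r.
have [M3 M30 M3P] := prof_bound (sPsi3 i) P30 w.
have [G G0 GP] := @pow2_gauss R (size w).
pose C0 := `|e 0 i| * M1 + M2 + kap / 2 * M3.
have C00 : 0 <= C0 by rewrite !addr_ge0 ?mulr_ge0 // ltW.
exists (G * C0) => k x sx; rewrite -termE.
have -> : Dw w (term' k i) x = lam k * e 0 i * Dw w (Psi1 \o Lk k) x
  + (y k - x0) 0 i * Dw w (Psi2 \o Lk k) x + kap / 2 * lam k ^+ N * Dw w (Psi3 i \o Lk k) x.
 rewrite (DwD openT w (smoothD openT (smoothZ openT (lam k * e 0 i) (sP1 k)) (smoothZ openT ((y k - x0) 0 i) (sP2 k)))
  (smoothZ openT (kap / 2 * lam k ^+ N) (sP3 k i)) I).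
 rewrite (DwD openT w (smoothZ openT (lam k * e 0 i) (sP1 k)) (smoothZ openT ((y k - x0) 0 i) (sP2 k)) I).
 by rewrite (DwZ openT w _ (sP1 k) I) (DwZ openT w _ (sP2 k) I) (DwZ openT w _ (sP3 k i) I).
have B1 := Dw_Lk k sPsi1 M10 sx M1P; have B2 := Dw_Lk k sPsi2 M20 sx M2P.
have B3 := Dw_Lk k (sPsi3 i) M30 sx M3P.
set E := 2 ^+ ((k + 2) * size w) in B1 B2 B3.
have E0 : 0 <= E by exact: exprn_ge0.
apply: (@le_trans _ _ (lam k * (E * C0))).
 have -> : lam k * (E * C0) = lam k * `|e 0 i| * (E * M1) + lam k * (E * M2) + kap / 2 * lam k * (E * M3).
  by rewrite /C0; ring.
 have lk0 := ltW (lam0 k).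
 apply: le_normD; apply: lerD.
  apply: le_normD; apply: lerD; rewrite normrM; apply: ler_pM => //.
   by rewrite normrM ger0_norm.
  exact: le_trans (coord_le_norm _ _) (ylam k).
 rewrite normrM; apply: ler_pM => //.
 have k20 : 0 <= kap / 2 by rewrite divr_ge0 // ltW.
 by rewrite ger0_norm; [exact: ler_wpM2l k20 _ _ (lamN k) | rewrite mulr_ge0 ?exprn_ge0].
apply: (@le_trans _ _ (2 ^- (k * k) * (E * C0))).
 by apply: ler_wpM2r => //; rewrite mulr_ge0.
rewrite mulrA [_ * E]mulrC [leRHS]mulrAC; apply: ler_wpM2r => //; exact: GP.
Qed.

Let B1 : set 'rV[R]_(1 + d) := ball 0 1.
Let B1E x : B1 x = (`|x| < 1) :> Prop.
Proof. by rewrite /B1 ball0E. Qed.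
Let oB1 : open B1. Proof. exact: ball_open. Qed.
Let B1_slab x : B1 x -> slab x.
Proof. by rewrite B1E => x1 i; exact: le_trans (coord_le_norm _ _) (ltW x1). Qed.

Lemma glued_map : exists c : 'rV[R]_(1 + d) -> 'rV[R]_d,
 [/\ smooth_on B1 c, (forall x, B1 x -> X (c x)) &
  forall k x, B1 x -> `|xi k x| <= 1 / 2 ->
   c x = y k + (lam k * xi k x ^+ 2) *: e
     + (kap / 2 * (lam k * xi k x ^+ 2) ^+ N) *: rsubmx x
   /\ (xi k x != 0 -> forall v : 'rV[R]_d, `|v| <= 1 ->
    U (y k + (lam k * xi k x ^+ 2) *: e + (kap / 2 * (lam k * xi k x ^+ 2) ^+ N) *: v))].
Proof.
have /choice [F FP] : forall i, exists F : 'rV[R]_(1 + d) -> R, smooth_on B1 F /\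
  forall x, B1 x -> (fun n => \sum_(0 <= k < n) term k i x) @ \oo --> F x.
 move=> i; have /choice [C CP] := term_bound i.
 have sT k : smooth_on B1 (term k i) by exact: smooth_on_sub (term_smooth k i).
 have CP' w k x : B1 x -> `|Dw w (term k i) x| <= C w / 2 ^+ k by move=> /B1_slab; exact: CP.
 have [F [sF FP]] := smooth_series oB1 sT CP'.
 by exists F; split=> // x Bx; have := FP [::] x Bx; rewrite Dw_nil.
have term0 k i x : 1 <= `|xi k x| -> term k i x = 0.
 move=> x1; rewrite /term profA_out // profB_out; last by apply: le_trans x1; lra.
 by rewrite expr0n gtn_eqF // mul0r !mulr0 !addr0.
have F1 k i x : B1 x -> `|xi k x| < 1 -> F i x = term k i x.
 move=> Bx xk; apply: (cvg_unique (@Rhausdorff R) ((FP i).2 x Bx)).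
 apply: (cvg_trans (near_eq_cvg _)); last exact: cvg_cst.
 exists k.+1 => // n /= kn; apply/esym; rewrite (bigD1_seq k) ?iota_uniq ?mem_index_iota //=.
 rewrite big1 ?addr0 // => j jk; apply: term0; rewrite leNgt; apply/negP => xj.
 by move/eqP: jk; apply; exact: xi_inj xj xk.
have F0 i x : B1 x -> (forall k, 1 <= `|xi k x|) -> F i x = 0.
 move=> Bx xk; apply: (cvg_unique (@Rhausdorff R) ((FP i).2 x Bx)).
 apply: (cvg_trans (near_eq_cvg _)); last exact: cvg_cst.
 by apply: nearW => n /=; rewrite big1 // => k _; exact: term0.
have cE k x : B1 x -> `|xi k x| < 1 -> x0 + \row_i F i x =
  x0 + profB (xi k x) *: (y k - x0) + (lam k * profA (xi k x)) *: e
  + (kap / 2 * (lam k * profA (xi k x)) ^+ N) *: rsubmx x.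
 move=> Bx xk; apply/rowP => i; rewrite !mxE (F1 k) // /term /uc !mxE.
 move: (profA _) (profB _) => p q; rewrite [(lam k * p) ^+ N]exprMn.
 move: (p ^+ N) (lam k ^+ N) (x 0 (rshift 1 i) : R) (e 0 i) (x0 0 i) (y k 0 i) (lam k) => *; ring.
have lo k x : 0 <= lam k * profA (xi k x) <= s0.
 have /andP[a0 a1] := profA_01 (xi k x); rewrite mulr_ge0 ?(ltW (lam0 k)) //=.
 by apply: le_trans (lams k); rewrite ler_piMr // ltW.
have urN x : B1 x -> `|rsubmx x| <= 1.
 move=> Bx; apply: row_norm_le => // i; rewrite mxE.
 exact: (B1_slab Bx).
have inner k x : `|xi k x| <= 1 / 2 -> xi k x != 0 -> forall v : 'rV[R]_d, `|v| <= 1 ->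
  U (y k + (lam k * xi k x ^+ 2) *: e + (kap / 2 * (lam k * xi k x ^+ 2) ^+ N) *: v).
 move=> xk xn0 v v1; have xk' : `|xi k x| <= 3 / 4 by apply: le_trans xk _; lra.
 have := lo k x; rewrite (profA_in xk') => /andP[l0 l1].
 apply: cusp => //; [by left | by rewrite mulr_gt0 // exprn_even_gt0 |].
 rewrite normrZ ger0_norm; last by rewrite mulr_ge0 ?exprn_ge0 // divr_ge0 // ltW.
 apply: (@le_trans _ _ (kap / 2 * (lam k * xi k x ^+ 2) ^+ N * 1)).
  by apply: ler_wpM2l => //; rewrite mulr_ge0 ?exprn_ge0 // divr_ge0 // ltW.
 rewrite mulr1; apply: ler_wpM2r; first exact: exprn_ge0.
 by have := kap0; lra.
exists (fun x => x0 + \row_i F i x); split.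
- apply: (smoothD oB1); first exact: smooth_cst.
 by apply: (smooth_row oB1) => i; exact: (FP i).1.
- move=> x Bx; have [[k xk]|no] := pselect (exists k, `|xi k x| < 1); last first.
  have -> : x0 + \row_i F i x = x0; last exact: Xx0.
  apply/rowP => i; rewrite !mxE F0 ?addr0 // => k.
  by rewrite leNgt; apply/negP => xk; apply: no; exists k.
 rewrite (cE k) //; have [xh|xh] := leP `|xi k x| (1 / 2).
  rewrite profB_in // scale1r [x0 + _]addrC subrK.
  rewrite profA_in; last by apply: le_trans xh _; lra.
  have [xz|xn0] := eqVneq (xi k x) 0.
   by rewrite xz expr0n mulr0 expr0n gtn_eqF // mulr0 !scale0r !addr0; exact: UX.
  by apply: UX; apply: inner => //; exact: urN.
 set s := lam k * _; have /andP[s_ge0 s_le] := lo k x; rewrite -/s in s_ge0 s_le.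
 have v2 : `|(kap / 2 * s ^+ N) *: rsubmx x| <= kap / 2 * s ^+ N.
  have k2 : 0 <= kap / 2 * s ^+ N by rewrite mulr_ge0 ?exprn_ge0 // divr_ge0 // ltW.
  by rewrite normrZ ger0_norm // -[leRHS]mulr1; apply: ler_wpM2l => //; exact: urN.
 have v1 : `|profB (xi k x) *: (y k - x0)| <= kap / 2 * s ^+ N.
  have [x34|x34] := leP (3 / 4) `|xi k x|.
   by rewrite profB_out // scale0r normr0 mulr_ge0 ?exprn_ge0 // divr_ge0 // ltW.
  have /andP[b0 b1] := profB_01 (xi k x).
  rewrite normrZ ger0_norm //; apply: le_trans (_ : `|y k - x0| <= _); first by rewrite ler_piMl.
  apply: le_trans (yk k) _; apply: ler_wpM2l; first by rewrite divr_ge0 // ltW.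
  apply: lerXn2r; rewrite ?nnegrE //; first by rewrite divr_ge0 // ltW.
  rewrite /s profA_in; last exact: ltW.
  apply: ler_wpM2l; first exact: ltW.
  rewrite -real_normK ?num_real //; apply: le_trans (_ : (1 / 2) ^+ 2 <= _); first by lra.
  by apply: lerXn2r; rewrite ?nnegrE ?divr_ge0 // ltW.
 have [sz|sn0] := eqVneq s 0.
  have : `|profB (xi k x) *: (y k - x0)| <= 0 by apply: le_trans v1 _; rewrite sz expr0n gtn_eqF // mulr0.
  rewrite normr_le0 => /eqP ->.
  by rewrite sz scale0r expr0n gtn_eqF // mulr0 scale0r !addr0; exact: Xx0.
 apply: UX.
 have -> : x0 + profB (xi k x) *: (y k - x0) + s *: e + (kap / 2 * s ^+ N) *: rsubmx x =
   x0 + s *: e + (profB (xi k x) *: (y k - x0) + (kap / 2 * s ^+ N) *: rsubmx x).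
  by rewrite -!addrA; congr (_ + _); rewrite addrCA.
 apply: cusp => //; [by right | exact: ballxx | by rewrite lt0r sn0 |].
 apply: le_normD; apply: le_trans (lerD v1 v2) _; lra.
- move=> k x Bx xh; split; last exact: inner.
 have xk : `|xi k x| < 1 by apply: le_lt_trans xh _; lra.
 rewrite (cE k) // profB_in // scale1r [x0 + _]addrC subrK profA_in //.
 by apply: le_trans xh _; lra.
Qed.

End Glue.

Let tau k : R := 2 ^- k.
Let iot k (x : 'rV[R]_1) : 'rV[R]_(1 + d) := row_mx (\row__ (tau k + x 0 0)) 0.
Let iou k (x : R) (u : 'rV[R]_d) : 'rV[R]_(1 + d) := row_mx (\row__ (tau k + x)) u.

Let norm_row_mx_le (a : R) (u : 'rV[R]_d) (r : R) : 0 < r -> `|a| < r -> `|u| < r ->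
 `|row_mx (\row__ a) u : 'rV[R]_(1 + d)| < r.
Proof.
move=> r0 ar ur; apply: row_norm_lt => // c.
case: (split_ordP c) => j ->; first by rewrite row_mxEl mxE.
by rewrite row_mxEr; apply: le_lt_trans ur; exact: coord_le_norm.
Qed.

Lemma cusp_bounded w : exists delta M : R, 0 < delta /\
 forall y, U y -> ball x0 delta y -> `|Dw w f y| <= M.
Proof.
pose lam k := Num.min s0 1 * 2 ^- (k * k) : R.
have m0 : 0 < Num.min s0 1 by rewrite lt_min s00 ltr01.
have lam0 k : 0 < lam k by rewrite mulr_gt0 // invr_gt0 exprn_gt0.
have lams k : lam k <= s0.
 apply: (@le_trans _ _ (Num.min s0 1 * 1)); last by rewrite mulr1 ge_min lexx.
 by apply: ler_wpM2l; [exact: ltW | rewrite invf_le1 ?exprn_gt0 // exprn_ege1 // ler1n].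
have lam1 k : lam k <= 2 ^- (k * k).
 by rewrite -[leRHS]mul1r; apply: ler_wpM2r; rewrite ?invr_ge0 ?exprn_ge0 // ge_min lexx orbT.
pose Z k := (kap / 2 * (lam k * (2 ^+ (k + 2)) ^+ 2) ^+ N) ^+ size w.
have Z0 k : 0 < Z k by rewrite exprn_gt0 // mulr_gt0 ?divr_gt0 // exprn_gt0 // mulr_gt0 // !exprn_gt0.
pose dk k := Num.min (lam k) (Num.min (kap / 2 * (lam k / 4) ^+ N) eps).
have dk0 k : 0 < dk k.
 by rewrite !lt_min lam0 eps0 andbT /= mulr_gt0 ?divr_gt0 // exprn_gt0 // divr_gt0.
have [//|no] := pselect (exists delta M : R, 0 < delta /\ forall y, U y -> ball x0 delta y -> `|Dw w f y| <= M).
have /choice [y yP] : forall k : nat, exists y, [/\ U y, ball x0 (dk k) y & k%:R / Z k < `|Dw w f y|].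
 move=> k; apply: contrapT => noy; apply: no; exists (dk k), (k%:R / Z k); split=> // y Uy By.
 by rewrite leNgt; apply/negP => lt; apply: noy; exists y.
have yd k : `|y k - x0| < dk k by have [_] := yP k; rewrite ballE.
have Uy k : U (y k) by have [] := yP k.
have ylam k : `|y k - x0| <= lam k by apply/ltW/(lt_le_trans (yd k)); rewrite ge_min lexx.
have yk k : `|y k - x0| <= kap / 2 * (lam k / 4) ^+ N.
 by apply/ltW/(lt_le_trans (yd k)); rewrite !ge_min lexx orbT.
have yeps k : ball x0 eps (y k).
 by rewrite ballE; apply/(lt_le_trans (yd k)); rewrite !ge_min lexx !orbT.
have [c [sc cX cE]] := glued_map lam0 lams lam1 Uy ylam yk yeps.
have oB : open (ball 0 1 : set 'rV[R]_(1 + d)) by exact: ball_open.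
have BE (x : 'rV[R]_(1 + d)) : `|x| < 1 -> ball 0 1 x by rewrite ball0E.
have sF : smooth_on (ball 0 1) (f \o c) := tf oB sc cX.
pose K := (2 * N * size w)%N; pose mw := map (@rshift 1 d) w.
have rA (x : 'rV[R]_(1 + d)) : `|x| <= 3 / 4 -> ball 0 1 x by move=> x1; apply: BE; apply: le_lt_trans x1 _; lra.
have [M M0 MP] := smooth_bounded (nseq K t0 ++ mw) sF rA.
have sU : smooth_on U f := testable_smooth tf oU UX.
suff HM k : (2 <= k)%N -> k%:R <= M.
 have Mb : `|M| < (Num.bound M).+2%:R by apply: lt_trans (archi_boundP (normr_ge0 M)) _; rewrite ger0_norm // ltr_nat.
 by have := HM (Num.bound M).+2 isT; rewrite leNgt (le_lt_trans (ler_norm M) Mb).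
move=> k2; pose H (x : 'rV[R]_1) := Z k * Dw w f (y k + (lam k * (2 ^+ (k + 2) * x 0 0) ^+ 2) *: e).
suff : `|H 0| <= M.
 rewrite /H mxE mulr0 expr0n mulr0 scale0r addr0 normrM gtr0_norm //.
 apply: le_trans; have [_ _ /ltW] := yP k.
 by rewrite ler_pdivrMr // mulrC.
have tau4 : tau k <= 1 / 4.
 rewrite div1r /tau lef_pV2 ?posrE ?exprn_gt0 //.
 have -> : 4 = 2 ^+ 2 :> R by rewrite expr2 -natrM.
 by apply: ler_weXn2l; rewrite ?ler1n.
have tau0 : 0 < tau k by rewrite invr_gt0 exprn_gt0.
pose r := 2 ^- (k + 3) : R.
have r0 : 0 < r by rewrite invr_gt0 exprn_gt0.
have pr : 2 ^+ (k + 2) * r = 1 / 2.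
 have e3 : (k + 3 = (k + 2).+1)%N by rewrite addnS.
 by rewrite /r e3 [2 ^+ _.+1]exprS invfM mulrCA divff ?mulr1 ?div1r // expf_neq0.
have r4 : r <= 1 / 4.
 apply: le_trans tau4; rewrite lef_pV2 ?posrE ?exprn_gt0 //.
 by apply: ler_weXn2l; rewrite ?ler1n // leq_addr.
have xiE (x : R) u : xi k (iou k x u) = 2 ^+ (k + 2) * x.
 rewrite /xi /tc /iou row_mxEl mxE mulrDr /tau exprD mulrAC divff ?expf_neq0 // mul1r expr2 -natrM.
 by rewrite addrAC subrr add0r.
have iouB (x : R) u : `|x| < r -> `|u| < 1 -> ball 0 1 (iou k x u).
 move=> xr u1; apply: BE; apply: norm_row_mx_le => //; apply: lt_normD.
 by rewrite (gtr0_norm tau0); lra.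
have iotE x : iot k x = iou k (x 0 0) 0 by [].
have xn (x : 'rV[R]_1) : `|x| < r -> `|x 0 0| < r by apply: le_lt_trans; exact: coord_le_norm.
have siot : smooth_on setT (iot k).
 apply: (proj2 (smooth_on_row _ openT)) => i; case: (split_ordP i) => j ->.
  apply: (@smooth_on_ext _ _ _ _ (fun x : 'rV[R]_1 => tau k + x 0 0)) => //; first exact: openT.
   by move=> x _; rewrite row_mxEl mxE.
  exact: (smoothD openT (smooth_cst setT (tau k)) (smooth_coord (0 : 'I_1) openT)).
 apply: (@smooth_on_ext _ _ _ _ (fun x : 'rV[R]_1 => 0)) => //; first exact: openT.
  by move=> x _; rewrite row_mxEr mxE.
 exact: (smooth_cst setT (0 : R)).
apply: (@power_factor_bound _ K r M (Dw mw (f \o c) \o iot k)) => //.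
- apply: (smooth_comp oB (ball_open _ _) _ (Dw_smooth mw sF)); last exact: smooth_on_sub siot.
 by move=> x; rewrite ball0E => xr; rewrite iotE; apply: iouB; rewrite ?normr0 // xn.
- move=> x xr; rewrite (@Dw_embed _ _ _ (iot k) (fun=> t0)); last first.
  move=> i h z; rewrite (ord1 i); apply/rowP => j; rewrite !mxE /=.
  case: (split_ordP j) => l -> /=.
   by rewrite !mxE (ord1 l) !eqxx /= mulr1 addrCA.
  by rewrite mulr0 add0r.
 rewrite map_nseq -Dw_cat; apply: MP; apply: ltW; rewrite iotE.
 apply: norm_row_mx_le; rewrite ?normr0; [lra| |lra].
 by apply: lt_normD; rewrite (gtr0_norm tau0); have := xn x xr; lra.
- have cU : {for y k, continuous (Dw w f)} := smooth_continuous (Dw_smooth w sU) (Uy k).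
 pose g (x : 'rV[R]_1) := y k + (lam k * (2 ^+ (k + 2) * x 0 0) ^+ 2) *: e.
 have sg : smooth_on setT g.
  apply: (proj2 (smooth_on_row _ openT)) => i.
  apply: (@smooth_on_ext _ _ _ _ (fun x : 'rV[R]_1 => y k 0 i + (lam k * e 0 i) * (2 ^+ (k + 2) * x 0 0) ^+ 2)); first exact: openT.
   by move=> x _; rewrite !mxE; ring.
  exact: (smoothD openT (smooth_cst setT (y k 0 i)) (smoothZ openT _ (smoothX openT 2 (smoothZ openT _ (smooth_coord (0 : 'I_1) openT))))).
 have g0 : g 0 = y k by rewrite /g mxE mulr0 expr0n mulr0 scale0r addr0.
 have cg : {for 0, continuous g} := smooth_continuous sg I.
 have cU' : {for g 0, continuous (Dw w f)} by rewrite g0.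
 have cc : {for 0, continuous (Dw w f \o g)} := continuous_comp cg cU'.
 exact: (cvgM (cvg_cst (Z k)) cc).
- move=> x xr xn0; have x00 : x 0 0 != 0.
  by apply: contra xn0 => /eqP x0'; apply/eqP/rowP => j; rewrite ord1 x0' mxE.
 set s := lam k * (2 ^+ (k + 2) * x 0 0) ^+ 2.
 have ku v : `|v| < 1 -> (f \o c) (iou k (x 0 0) v) = (f \o diagmap (fun=> kap / 2 * s ^+ N) (fun i => (y k + s *: e) 0 i)) v
  /\ U (y k + s *: e + (kap / 2 * s ^+ N) *: v).
  move=> v1; have [|cEk Uk] := cE k (iou k (x 0 0) v) (iouB _ _ (xn _ xr) v1).
   rewrite xiE normrM ger0_norm ?exprn_ge0 // -pr; apply: ler_wpM2l; first exact: exprn_ge0.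
   exact: ltW (xn _ xr).
  move: cEk Uk; rewrite xiE row_mxKr -/s => cEk Uk; split; last first.
   by apply: Uk; [rewrite mulf_neq0 // expf_neq0 | exact: ltW].
  rewrite /= cEk; congr (f _); apply/rowP => j; rewrite !mxE; ring.
 have BB : forall v, ball (0 : 'rV[R]_d) 1 v -> `|v| < 1.
  by move=> v; rewrite ball0E.
 transitivity (Dw w (fun v => (f \o c) (iou k (x 0 0) v)) 0).
  rewrite (@Dw_embed _ _ _ (iou k (x 0 0)) (@rshift 1 d)) //.
  move=> i h z; apply/rowP => j; rewrite !mxE /=.
  case: (split_ordP j) => l -> /=.
   by rewrite (ord1 l) eq_sym rl mulr0 add0r.
  by rewrite !mxE /= (inj_eq (@rshift_inj _ _)).
 have oB' : open (ball 0 1 : set 'rV[R]_d) by exact: ball_open.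
 rewrite (@Dw_ext _ _ _ _ _ w 0 oB' (fun v Bv => (ku v (BB v Bv)).1) (ballxx _ ltr01)).
 rewrite (@Dw_diagmap _ _ _ _ U (ball 0 1) f w 0 oU oB') //; last 2 first.
 - move=> v Bv; have := (ku v (BB v Bv)).2; congr U; apply/rowP => j; rewrite !mxE; ring.
 - exact: ballxx.
 have -> : diagmap (fun=> kap / 2 * s ^+ N) (fun i => (y k + s *: e) 0 i) 0 = y k + s *: e.
  by apply/rowP => j; rewrite !mxE mulr0 add0r.
 rewrite big_const_seq count_predT iter_mulr_1 /H -/s mulrA; congr (_ * _).
 have -> : s = x 0 0 ^+ 2 * (lam k * (2 ^+ (k + 2)) ^+ 2) by rewrite /s; move: (2 ^+ (k + 2)) (x 0 0 : R) (lam k) => p q r'; ring.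
 exact: expr_split.
Qed.

End CuspBounds.

Lemma segment_estimate {R : realType} {d : nat} (U : set 'rV[R]_d) (f : 'rV[R]_d -> R)
  (c : seq 'I_d -> R) (a p1 p2 : 'rV[R]_d) (q : nat) (B l : R) :
 open U -> smooth_on U f -> (forall s : R, 0 <= s <= 1 -> U (s *: (p2 - p1) + p1)) ->
 symm_words c -> 0 <= B -> 0 <= l ->
 (forall j w, (j + size w <= q)%N -> `|Dw w f p1 - Tp c j w (p1 - a)| <= B * l ^+ j) ->
 (forall w (s : R), (size w <= q)%N -> 0 <= s <= 1 -> `|Dw w f (s *: (p2 - p1) + p1) - c w| <= B) ->
 forall j w, (j + size w <= q)%N ->
 `|Dw w f p2 - Tp c j w (p2 - a)| <= B * (l + d%:R * `|p2 - p1|) ^+ j.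
Proof.
move=> oU sf Us sc B0 l0 start bnd j w jq.
have dphi (s : R) : is_derive s 1 (fun t : R => t *: (p2 - p1) + p1) (p2 - p1).
 have d1 : derivable (id : 'rV[R]_d -> 'rV[R]_d) (s *: (p2 - p1) + p1) (p2 - p1) by exact: derivable_id.
 by have := is_derive_line d1; rewrite derive_id.
have := @path_estimate R d c a (fun t => t *: (p2 - p1) + p1) (fun=> p2 - p1)
 (fun w t => Dw w f (t *: (p2 - p1) + p1)) q B l `|p2 - p1| sc B0 l0 (normr_ge0 _)
 (fun s _ => dphi s) (fun s _ => lexx _) _ _ bnd j w 1 jq _.
rewrite scale1r subrK; apply.
- move=> v s s01; have sD := Dw_smooth v sf.
 have -> : \sum_i (p2 - p1) 0 i * Dw (i :: v) f (s *: (p2 - p1) + p1) =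
  derive (Dw v f) (s *: (p2 - p1) + p1) (p2 - p1).
  by rewrite (derive_gradient _ oU sD (Us _ s01)); apply: eq_bigr => i _; rewrite -Dw_cat.
 by apply: is_derive_line; exact: smooth_derivable sD (Us _ s01).
- by move=> i v iq; rewrite scale0r add0r; exact: start.
- by rewrite ler01 lexx.
Qed.

Lemma powR_root {R : realType} (z s1 : R) (N : nat) : (0 < N)%N -> 0 < z -> 0 <= s1 -> z <= s1 ^+ N ->
 exists s : R, [/\ 0 < s, s <= s1 & s ^+ N = z].
Proof.
move=> N0 z0 s10 zs; exists (z `^ N%:R^-1).
have E : (z `^ N%:R^-1) ^+ N = z.
 by rewrite -powR_mulrn ?powR_ge0 // -powRrM mulVf ?powRr1 ?pnatr_eq0 -?lt0n // ltW.
split=> //; first exact: powR_gt0.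
by rewrite -(ler_pXn2r N0) ?nnegrE ?powR_ge0 // E.
Qed.

Section CuspExtension.
Context {R : realType} {d : nat}.
Variables (X U : set 'rV[R]_d) (x0 e : 'rV[R]_d) (f : 'rV[R]_d -> R) (kap s0 eps : R) (N : nat).
Hypotheses (oU : open U) (UX : U `<=` X) (UcX : closure U `<=` X) (tf : testable X f).
Hypotheses (kap0 : 0 < kap) (s00 : 0 < s0) (eps0 : 0 < eps) (N0 : (0 < N)%N).
Hypothesis cusp : forall y s v, closure U y -> ball x0 eps y -> 0 < s -> s <= s0 ->
 `|v| <= kap * s ^+ N -> U (y + s *: e + v).

Let sf : smooth_on U f. Proof. exact: testable_smooth tf oU UX. Qed.

Lemma cusp_derivatives_bounded w : exists2 M : R, 0 <= M &
 forall y, U y -> `|x0 - y| <= eps / 2 -> `|Dw w f y| <= M.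
Proof.
pose P (M : R) y := U y -> `|x0 - y| <= eps / 2 -> `|Dw w f y| <= M.
have /compact_near_coveringP cK := @closed_ball0_compact R d (`|x0| + eps).
have FF : Filter (pinfty_nbhs R) by typeclasses eauto.
have geF (M : R) : pinfty_nbhs R [set M' | M <= M'] by exact: nbhs_pinfty_ge (num_real M).
have [|M [_ MP]] := cK R (pinfty_nbhs R) P FF; last first.
 exists (Num.max (M + 1) 0); first by rewrite le_max lexx orbT.
 move=> y Uy yd; apply: le_trans (_ : M + 1 <= _); last by rewrite le_max lexx.
 apply: (MP (M + 1)) => //; first by rewrite ltrDl.
 rewrite /= -[y](subrK x0); apply: le_normD; rewrite addrC lerD2l distrC.
 by apply: le_trans yd _; rewrite ler_pdivrMr // ler_peMr // ?ler1n // ltW.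
move=> x _; have [xe|xe] := leP eps `|x0 - x|.
 exists ([set y | ball x (eps / 2) y], setT) => /=; first by split; [apply: nbhsx_ballx; rewrite divr_gt0 | exact: filterT].
 move=> [y M] /= [By _] Uy yd; exfalso; move: By; rewrite -ball_normE /ball_ /= => By.
 have := ler_distD y x0 x; rewrite [`|y - x|]distrC => H.
 by have := le_trans xe H; lra.
have Bx : ball x0 eps x by rewrite -ball_normE.
have [Ux|nUx] := pselect (U x).
 have cD := smooth_continuous (Dw_smooth w sf) Ux.
 have /cvgrPdist_le /(_ _ ltr01) nD := cD.
 exists ([set y | `|Dw w f x - Dw w f y| <= 1], [set M | `|Dw w f x| + 1 <= M]) => /=; first by split; [exact: nD | exact: geF].
 move=> [y M] /= [D1 M1] Uy yd; apply: le_trans M1.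
 rewrite -[Dw w f y](subrK (Dw w f x)) addrC; apply: le_normD.
 by rewrite lerD2l distrC.
have [cUx|ncUx] := pselect (closure U x); last first.
 exists ([set y | ~ closure U y], setT) => /=.
  split; last exact: filterT.
  by apply: open_nbhs_nbhs; split => //; exact: closed_openC (@closed_closure _ U).
 by move=> [y M] /= [ncy _] Uy; case: ncy; exact: subset_closure.
have [e1 e10 e1P] : exists2 e1 : R, 0 < e1 & forall y, ball x e1 y -> ball x0 eps y.
 exists (eps - `|x0 - x|) => [|y]; first by rewrite subr_gt0.
 rewrite -!ball_normE /ball_ /= => By; apply: le_lt_trans (ler_distD x _ _) _.
 by rewrite addrC -ltrBrDr.
have [|delta [M [d0 MP]]] := @cusp_bounded R d X U x e f kap s0 e1 N oU UX (UcX cUx) tf kap0 s00 e10 N0 _ w.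
 move=> y s v Uy By s0' ss vv; apply: cusp => //; last exact: e1P.
 by case: Uy => [|->//]; exact: subset_closure.
exists ([set y | ball x delta y], [set M' | M <= M']) => /=.
 by split; [exact: nbhsx_ballx | exact: geF].
move=> [y M'] /= [By MM'] Uy _; apply: le_trans MM'; exact: MP.
Qed.

Lemma cusp_extension : exists W F, [/\ open W, W x0, smooth_on W F &
 forall y, W y -> U y -> F y = f y].
Proof.
pose s1 := Num.min s0 (Num.min 1 (eps / (4 * (`|e| + 1)))).
have e1 : 0 < `|e| + 1 by rewrite ltr_wpDl.
have s10 : 0 < s1 by rewrite !lt_min s00 ltr01 /= divr_gt0 // mulr_gt0.
have s1s : s1 <= s0 by rewrite ge_min lexx.
have s11 : s1 <= 1 by rewrite !ge_min lexx orbT.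
have s1e : s1 * `|e| <= eps / 4.
 have : s1 <= eps / (4 * (`|e| + 1)) by rewrite !ge_min lexx !orbT.
 rewrite ler_pdivlMr ?mulr_gt0 // mulrCA => H; rewrite ler_pdivlMr // mulrC; apply: le_trans H.
 by apply: ler_wpM2l => //; apply: ler_wpM2l; [exact: ltW | rewrite lerDl].
pose delta := Num.min (eps / 4) (kap * s1 ^+ N / 2).
have delta0 : 0 < delta by rewrite lt_min !divr_gt0 //= mulr_gt0 // exprn_gt0.
have de : delta <= eps / 4 by rewrite ge_min lexx.
have dk : 2 * delta <= kap * s1 ^+ N by rewrite mulrC -ler_pdivlMr // ge_min lexx orbT.
pose H := d%:R * (2 * `|e| + kap).
have H0 : 0 <= H by rewrite mulr_ge0 // addr_ge0 ?mulr_ge0 // ltW.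
have C0 : 0 <= H ^+ N / kap by rewrite divr_ge0 ?exprn_ge0 // ltW.
apply: (whitney_local oU sf delta0 N0 C0) => q.
have /choice [M MP] : forall w, exists M : R, 0 <= M /\
  forall y, U y -> `|x0 - y| <= eps / 2 -> `|Dw w f y| <= M.
 by move=> w; have [M ? ?] := cusp_derivatives_bounded w; exists M.
have [M1 M10 M1P] := words_bound M q.
have bnd y w : U y -> `|x0 - y| <= eps / 2 -> (size w <= q)%N -> `|Dw w f y| <= M1.
 by move=> Uy yd wq; apply: le_trans ((MP w).2 y Uy yd) _; apply: le_trans (ler_norm _) (M1P w wq).
exists (M1 + M1); first exact: addr_ge0.
move=> a b Ua Ub; rewrite -!ballE => Ba Bb.
have sc : symm_words (fun u => Dw u f a) by move=> v i j w; exact: Dw_swap oU sf Ua.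
have [->|ab] := eqVneq a b.
 exists 0; first by rewrite lexx expr0n gtn_eqF // mulr_ge0.
 by move=> j w _; rewrite subrr Tp0 subrr normr0 mulr_ge0 ?addr_ge0 // exprn_ge0.
have L0 : 0 < `|a - b| by rewrite normr_gt0 subr_eq0.
have Ld : `|a - b| <= kap * s1 ^+ N.
 apply: le_trans dk; have := ler_distD x0 a b; rewrite [`|a - x0|]distrC.
 by move: Ba Bb; rewrite -!ball_normE /ball_ /=; lra.
have [|s [s0' ss1 sN]] := @powR_root R (`|a - b| / kap) s1 N N0 (divr_gt0 L0 kap0) (ltW s10).
 by rewrite ler_pdivrMr // mulrC.
have sN' : kap * s ^+ N = `|a - b| by rewrite sN mulrCA divff ?mulr1 // gt_eqF.
have se : `|s *: e| <= eps / 4.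
 by rewrite normrZ gtr0_norm //; apply: le_trans s1e; apply: ler_wpM2r.
have Bes y : ball x0 delta y -> ball x0 eps y.
 by rewrite -!ball_normE /ball_ /=; move: eps0 de; lra.
have up y : U y -> ball x0 delta y -> forall t : R, 0 <= t <= 1 ->
  U (t *: (s *: e) + y) /\ `|x0 - (t *: (s *: e) + y)| <= eps / 2.
 move=> Uy By t /andP[t0 t1]; split.
  have [->|tn0] := eqVneq t 0; first by rewrite scale0r add0r.
  have -> : t *: (s *: e) + y = y + (t * s) *: e + 0 by rewrite addr0 addrC scalerA.
  apply: cusp; [exact: subset_closure | exact: Bes | by rewrite mulr_gt0 // lt0r tn0 | |].
   by apply: le_trans s1s; apply: le_trans ss1; rewrite ler_piMl // ltW.
  by rewrite normr0 mulr_ge0 ?exprn_ge0 ?mulr_ge0 // ltW.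
 rewrite [t *: _ + y]addrC opprD addrA; apply: le_normB.
 have : `|t *: (s *: e)| <= eps / 4 by rewrite normrZ ger0_norm //; apply: le_trans se; rewrite ler_piMl.
 by move: By; rewrite -ball_normE /ball_ /=; move: de; lra.
have bnd2 y w : U y -> `|x0 - y| <= eps / 2 -> (size w <= q)%N -> `|Dw w f y - Dw w f a| <= M1 + M1.
 move=> Uy yd wq; apply: le_normB; apply: lerD; apply: bnd => //.
 by move: Ba; rewrite -ball_normE /ball_ /=; move: de eps0; lra.
have MM : 0 <= M1 + M1 by exact: addr_ge0.
pose a1 := s *: e + a; pose b1 := s *: e + b.
have a1a : a1 - a = s *: e by rewrite addrK.
have b1b : b - b1 = - (s *: e) by rewrite opprD addrCA subrr addr0.
have E1 := @segment_estimate R d U f (fun u => Dw u f a) a a a1 q (M1 + M1) 0 oU sf _ sc MM (lexx 0).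
have {}E1 : forall j w, (j + size w <= q)%N ->
  `|Dw w f a1 - Tp (fun u => Dw u f a) j w (a1 - a)| <= (M1 + M1) * (0 + d%:R * `|a1 - a|) ^+ j.
 apply: E1.
 - by move=> t t01; rewrite a1a; exact: (up a Ua Ba t t01).1.
 - by move=> j w _; rewrite subrr Tp0 subrr normr0 mulr_ge0 // exprn_ge0.
 - move=> w t wq t01; rewrite a1a; have [? ?] := up a Ua Ba t t01; exact: bnd2.
have l1 : 0 <= 0 + d%:R * `|a1 - a| by rewrite add0r mulr_ge0.
have mid (t : R) : 0 <= t <= 1 -> U (t *: (b1 - a1) + a1) /\ `|x0 - (t *: (b1 - a1) + a1)| <= eps / 2.
 move=> /andP[t0 t1]; have ba : b1 - a1 = b - a by rewrite /a1 opprD addrACA subrr add0r.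
 split.
  have -> : t *: (b1 - a1) + a1 = a + s *: e + t *: (b - a) by rewrite ba addrC [a1]addrC.
  apply: cusp => //; [exact: subset_closure | exact: Bes | exact: le_trans s1s |].
  by rewrite sN' normrZ ger0_norm // distrC ler_piMl.
 have -> : t *: (b1 - a1) + a1 = s *: e + (t *: (b - a) + a) by rewrite ba addrCA.
 rewrite [s *: e + _]addrC opprD addrA; apply: le_normB.
 have t01 : 0 <= t <= 1 by rewrite t0.
 by move: (ball_segment t01 Ba Bb); rewrite -ball_normE /ball_ /=; move: de se; lra.
have E2 := @segment_estimate R d U f (fun u => Dw u f a) a a1 b1 q (M1 + M1) _ oU sf
 (fun t t01 => (mid t t01).1) sc MM l1 E1
 (fun w t wq t01 => bnd2 _ w (mid t t01).1 (mid t t01).2 wq).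
have l2 : 0 <= 0 + d%:R * `|a1 - a| + d%:R * `|b1 - a1| by rewrite addr_ge0 // mulr_ge0.
have dn (t : R) : 0 <= t <= 1 -> U (t *: (b - b1) + b1) /\ `|x0 - (t *: (b - b1) + b1)| <= eps / 2.
 move=> /andP[t0 t1]; have -> : t *: (b - b1) + b1 = (1 - t) *: (s *: e) + b.
  by rewrite b1b /b1 addrA scalerN scalerBl scale1r [- _ + _]addrC.
 by apply: up => //; rewrite subr_ge0 t1 lerBlDr lerDl.
have E3 := @segment_estimate R d U f (fun u => Dw u f a) a b1 b q (M1 + M1) _ oU sf
 (fun t t01 => (dn t t01).1) sc MM l2 E2
 (fun w t wq t01 => bnd2 _ w (dn t t01).1 (dn t t01).2 wq).
exists (0 + d%:R * `|a1 - a| + d%:R * `|b1 - a1| + d%:R * `|b - b1|) => //.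
split; first by rewrite addr_ge0 // mulr_ge0.
have b1a1 : b1 - a1 = b - a by rewrite /a1 opprD addrACA subrr add0r.
rewrite add0r a1a b1b b1a1 normrN normrZ gtr0_norm // -!mulrDr [`|b - a|]distrC.
have s1' : s <= 1 by exact: le_trans s11.
have Ls : `|a - b| <= kap * s.
 rewrite -sN'; apply: ler_wpM2l; first exact: ltW.
 by rewrite -[leRHS]expr1; apply: ler_wiXn2l => //; exact: ltW.
apply: (@le_trans _ _ ((H * s) ^+ N)).
 apply: lerXn2r; rewrite ?nnegrE; [|by rewrite mulr_ge0 // ltW |].
  by rewrite mulr_ge0 // !addr_ge0 // mulr_ge0 // ltW.
 rewrite /H -mulrA; apply: ler_wpM2l => //.
 have -> : (2 * `|e| + kap) * s = s * `|e| + kap * s + s * `|e| by ring.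
 by rewrite !lerD2r lerD2l.
by rewrite exprMn sN mulrA mulrAC.
Qed.

End CuspExtension.

Section HolderSets.
Context {R : realType} {d : nat}.

Lemma mulmx_bound m n (A : 'M[R]_(m, n)) (u : 'rV[R]_m) (b : R) : 0 <= b -> (forall i j, `|A i j| <= b) ->
 `|u *m A| <= m%:R * b * `|u|.
Proof.
move=> b0 Ab; apply: row_norm_le => [|j]; first by rewrite !mulr_ge0.
rewrite mxE -mulrA; apply: norm_sum_le => i; rewrite normrM mulrC; apply: ler_pM => //; exact: coord_le_norm.
Qed.

Lemma head_norm_le (z : 'rV[R]_d.+1) (C : R) : 0 <= C ->
 (forall i, i != ord_max -> `|z 0 i| <= C) -> head_norm z <= d.+1%:R * C.
Proof.
move=> C0 zC; rewrite /head_norm -[leRHS]ger0_norm ?mulr_ge0 // -sqrtr_sqr.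
rewrite ler_sqrt ?sqr_ge0 //.
apply: (@le_trans _ _ (\sum_(i < d.+1) C ^+ 2)).
 rewrite big_mkcond /=; apply: ler_sum => i _; case: ifP => [im|_]; last exact: sqr_ge0.
 by rewrite -real_normK ?num_real //; apply: lerXn2r; rewrite ?nnegrE //; exact: zC.
rewrite sumr_const card_ord -[leLHS]mulr_natl exprMn; apply: ler_wpM2r; first exact: sqr_ge0.
by rewrite expr2 ler_peMl // ler1n.
Qed.

Lemma holder_cusp (X : set 'rV[R]_d.+1) x0 : holder_set X -> closure X° x0 -> ~ X° x0 ->
 exists (e : 'rV[R]_d.+1) (kap s0 eps : R) (N : nat),
  [/\ 0 < kap, 0 < s0, 0 < eps, (0 < N)%N &
   forall y s v, closure X° y -> ball x0 eps y -> 0 < s -> s <= s0 ->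
    `|v| <= kap * s ^+ N -> X° (y + s *: e + v)].
Proof.
move=> [_ [al [/andP[al0 al1] HX]]] cx nx.
have [eps [r [h [eps0 r0 h0 [A [oA AP]]]]]] := HX x0 cx nx.
pose C0 := \sum_i \sum_j `|A i j|.
have C0P i j : `|A^T i j| <= C0 + 1.
 rewrite mxE /C0 (bigD1 j) //= (bigD1 i) //= -!addrA lerDl !addr_ge0 //; apply: sumr_ge0 => k _ //.
 exact: sumr_ge0.
have C00 : 0 < C0 + 1.
 by rewrite ltr_wpDl //; apply: sumr_ge0 => i _; apply: sumr_ge0.
have [C [C1 CP]] : exists C : R, 0 < C /\ forall (v : 'rV[R]_d.+1) j, `|(v *m A^T) 0 j| <= C * `|v|.
 exists (d.+1%:R * (C0 + 1)); split; first by rewrite mulr_gt0 // ltr0n.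
 by move=> v j; apply: le_trans (coord_le_norm _ _) _; exact: mulmx_bound (ltW C00) C0P.
pose N := (Num.bound al^-1).+1.
have NP : 1 <= N%:R * al.
 rewrite -ler_pdivrMr // div1r; apply/ltW; apply: lt_le_trans (archi_boundP _) _; first by rewrite invr_ge0 ltW.
 by rewrite ler_nat.
pose kap := Num.min (r / (d.+1%:R * C * (4 * h) ^+ N)) (1 / (4 * C)).
have D1 : 0 < d.+1%:R * C * (4 * h) ^+ N.
 by apply: mulr_gt0; [exact: mulr_gt0 (ltr0Sn R d) C1 | apply: exprn_gt0; exact: mulr_gt0].
have kap0 : 0 < kap by rewrite lt_min (divr_gt0 r0 D1) divr_gt0 // mulr_gt0.
pose s0 := Num.min 1 (h / 2).
exists (delta_mx 0 ord_max *m A), kap, s0, eps, N; split=> //; first by rewrite lt_min ltr01 divr_gt0.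
move=> y s v cy By s_gt0 ss0 vk.
have s1 : s <= 1 by apply: le_trans ss0 _; rewrite ge_min lexx.
have sh : s <= h / 2 by apply: le_trans ss0 _; rewrite ge_min lexx orbT.
pose z : 'rV[R]_d.+1 := s *: delta_mx 0 ord_max + v *m A^T.
have -> : y + s *: (delta_mx 0 ord_max *m A) + v = y + z *m A.
 by rewrite /z mulmxDl scalemxAl -mulmxA (mulmx1C oA) mulmx1 addrA.
apply: AP => //.
have vA j : `|(v *m A^T) 0 j| <= C * (kap * s ^+ N).
 by apply: le_trans (CP v j) _; apply: ler_wpM2l => //; exact: ltW.
have sN0 : 0 <= s ^+ N by rewrite exprn_ge0 // ltW.
have hz : head_norm z / r <= (s / (4 * h)) ^+ N.
 rewrite ler_pdivrMr //; apply: le_trans (@head_norm_le z (C * (kap * s ^+ N)) _ _) _.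
 - exact: mulr_ge0 (ltW C1) (mulr_ge0 (ltW kap0) sN0).
 - by move=> i im; rewrite !mxE (negPf im) andbF mulr0 add0r; have := vA i; rewrite mxE.
 have H4 : 0 < (4 * h) ^+ N by rewrite exprn_gt0 // mulr_gt0.
 rewrite expr_div_n mulrAC ler_pdivlMr //.
 have : kap <= r / (d.+1%:R * C * (4 * h) ^+ N) by rewrite ge_min lexx.
 rewrite ler_pdivlMr // => H; apply: le_trans (ler_wpM2l sN0 H).
 by move: (s ^+ N) ((4 * h) ^+ N) => p p'; apply: le_eq; ring.
have q0 : 0 < s / (4 * h) by rewrite divr_gt0 // mulr_gt0.
have q1 : s / (4 * h) <= 1 by rewrite ler_pdivrMr ?mulr_gt0 // mul1r; lra.
have hn0 : 0 <= head_norm z by exact: sqrtr_ge0.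
have hr0 : 0 <= head_norm z / r by rewrite divr_ge0 // ltW.
have pw : powR (head_norm z / r) al <= s / (4 * h).
 apply: (@le_trans _ _ (powR ((s / (4 * h)) ^+ N) al)).
  by apply: ge0_ler_powR; rewrite ?nnegrE ?exprn_ge0 // ltW.
 rewrite -powR_mulrn ?(ltW q0) // -powRrM -[leRHS](powRr1 (ltW q0)).
 by apply: ger_powR => //; rewrite q0.
have v4 : `|(v *m A^T) 0 ord_max| <= s / 4.
 apply: le_trans (vA _) _; have : kap <= 1 / (4 * C) by rewrite ge_min lexx orbT.
 rewrite ler_pdivlMr ?mulr_gt0 // => H.
 have sNs : s ^+ N <= s by rewrite -[leRHS]expr1; apply: ler_wiXn2l => //; exact: ltW.
 have : kap * (4 * C) * s ^+ N <= 1 * s by apply: ler_pM => //; rewrite mulr_ge0 ?mulr_ge0 // ltW.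
 rewrite mul1r ler_pdivlMr //; apply: le_trans; move: (s ^+ N) => p.
 by apply: le_eq; ring.
have zl : last_coord z = s + (v *m A^T) 0 ord_max by rewrite /last_coord !mxE !eqxx mulr1.
move: v4; rewrite ler_norml => /andP[v41 v42]; split.
 have : head_norm z / r < 1.
  apply: le_lt_trans hz _; apply: exprn_ilt1 => //; first exact: ltW.
  by rewrite ltr_pdivrMr ?mulr_gt0 // mul1r; lra.
 by rewrite ltr_pdivrMr // mul1r.
rewrite zl; apply/andP; split; last lra.
apply: (@le_lt_trans _ _ (h * (s / (4 * h)))); first by apply: ler_wpM2l => //; exact: ltW.
have -> : h * (s / (4 * h)) = s / 4 by field; exact: lt0r_neq0.
lra.
Qed.

Lemma holder_Cinf n m (p : 'rV[R]_n -> 'rV[R]_m) (X : set 'rV[R]_d.+1) (f : 'rV[R]_d.+1 -> 'rV[R]_n) :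
 pseudo_immersion p -> holder_set X -> {within X, continuous f} -> Cinf X (p \o f) -> Cinf X f.
Proof.
move=> pp HX cf Cpf; have [[clX [XE _]] _] := HX.
have UX : X° `<=` X := @interior_subset _ X.
have UcX : closure X° `<=` X by rewrite -XE.
apply: (@Cinf_of_extensions _ _ _ X X°) => //; first by rewrite -XE.
move=> x i Xx; have tf := pseudo_immersion_testable i pp cf Cpf.
have [Ux|nUx] := pselect (X° x).
 by exists X°, (fun y => f y 0 i); split=> //; [exact: open_interior | exact: testable_smooth tf (@open_interior _ X) UX].
have cx : closure X° x by rewrite -XE.
have [e [kap [s0 [eps [N [k0 s00 e0 N0 cusp]]]]]] := holder_cusp HX cx nUx.
exact: (@cusp_extension R d.+1 X X° x e _ kap s0 eps N (@open_interior _ X) UX UcX tf k0 s00 e0 N0 cusp).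
Qed.

End HolderSets.

Lemma fact_ratio_le (n k q : nat) : (k <= n)%N -> (n`! * (k + q)`! <= (n + q)`! * k`!)%N.
Proof.
move=> kn; elim: q => [|q IHq]; first by rewrite !addn0.
by rewrite !addnS !factS mulnCA -mulnA; apply: leq_mul; rewrite ?ltnS ?leq_add2r.
Qed.

Lemma bin_fact_le (n k q : nat) : (k <= n)%N -> ('C(n, k) * (k + q)`! * (n - k)`! <= (n + q)`!)%N.
Proof.
move=> kn; rewrite -(leq_pmul2r (fact_gt0 k)).
apply: leq_trans (fact_ratio_le q kn); rewrite -(bin_fact kn); lia.
Qed.

Lemma bin_le_pow2 (n k : nat) : ('C(n, k) <= 2 ^ n)%N.
Proof.
elim: n k => [|n IHn] [|k]; rewrite ?bin0 ?expn_gt0 //.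
by rewrite binS expnS mul2n -addnn; apply: leq_add; exact: IHn.
Qed.

Section AnalyticBounds.
Context {R : realType}.

Lemma geometric_half_le (n : nat) : \sum_(k < n.+1) (2 ^- (n - k) : R) <= 2.
Proof.
rewrite (reindex_inj rev_ord_inj) /=.
under eq_bigr => k _ do rewrite subSS (subKn (leq_ord k)).
suff -> : \sum_(k < n.+1) (2 ^- k : R) = 2 - 2 ^- n by rewrite gerBl invr_ge0 exprn_ge0.
elim: n => [|n IHn]; first by rewrite big_ord1 expr0 invr1; ring.
rewrite big_ord_recr /= IHn exprS invfM; field; exact: expf_neq0.
Qed.

Lemma leibniz_fact (sg mu : R) (q n : nat) : 0 <= mu -> 4 * mu <= sg ->
 leibniz (fun k => sg ^+ k * (k + q)`!%:R) (fun k => mu ^+ k * k.+1`!%:R) n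
  <= 2 * sg ^+ n * (n + q)`!%:R.
Proof.
move=> mu0 ms; have s0 : 0 <= sg by apply: le_trans ms; rewrite mulr_ge0.
apply: (@le_trans _ _ (\sum_(k < n.+1) (2 ^- (n - k)) * (sg ^+ n * (n + q)`!%:R))); last first.
 rewrite -mulr_suml -mulrA; apply: ler_wpM2r; first by rewrite mulr_ge0 ?exprn_ge0.
 exact: geometric_half_le.
apply: ler_sum => k _; have kn : (k <= n)%N by rewrite -ltnS.
set m := (n - k)%N.
have -> : 'C(n, k)%:R * (sg ^+ k * (k + q)`!%:R) * (mu ^+ m * (m.+1)`!%:R) =
  (sg ^+ k * (mu ^+ m * m.+1%:R)) * ('C(n, k) * (k + q)`! * m`!)%:R :> R.
 by rewrite factS !natrM; ring.
have -> : 2 ^- m * (sg ^+ n * (n + q)`!%:R) = (sg ^+ k * (sg / 2) ^+ m) * (n + q)`!%:R.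
 by rewrite expr_div_n -[in sg ^+ n](subnKC kn) exprD; ring.
apply: ler_pM; rewrite ?mulr_ge0 ?exprn_ge0 //; last by rewrite ler_nat; exact: bin_fact_le.
apply: ler_wpM2l; first exact: exprn_ge0.
apply: (@le_trans _ _ (mu ^+ m * 2 ^+ m)).
 by apply: ler_wpM2l; rewrite ?exprn_ge0 // -natrX ler_nat ltn_expl.
rewrite -exprMn; apply: lerXn2r; rewrite ?nnegrE ?mulr_ge0 ?divr_ge0 //.
by rewrite ler_pdivlMr //; lra.
Qed.

Lemma leibnizZ (a b : nat -> R) (c e : R) n :
 leibniz (fun k => c * a k) (fun k => e * b k) n = c * e * leibniz a b n.
Proof. by rewrite /leibniz mulr_sumr; apply: eq_bigr => k _; ring. Qed.

Definition abound {N} (M : R) (f : 'rV[R]_N -> R) (x : 'rV[R]_N) : Prop :=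
 forall w, `|Dw w f x| <= M ^+ (size w).+1 * (size w)`!%:R.

Lemma abound_le N (M M' : R) (f : 'rV[R]_N -> R) x : 0 <= M -> M <= M' -> abound M f x -> abound M' f x.
Proof.
move=> M0 MM fM w; apply: le_trans (fM w) _; apply: ler_wpM2r => //.
by apply: lerXn2r; rewrite ?nnegrE // (le_trans M0).
Qed.

Lemma abound_scaled N (C rho : R) (f : 'rV[R]_N -> R) x : 0 <= C -> 0 <= rho ->
 (forall w, `|Dw w f x| <= C * rho ^+ size w * (size w)`!%:R) -> abound (C + rho) f x.
Proof.
move=> C0 r0 H w; apply: le_trans (H w) _; apply: ler_wpM2r => //; rewrite exprS.
apply: ler_pM; rewrite ?exprn_ge0 // ?lerDl //.
by apply: lerXn2r; rewrite ?nnegrE ?addr_ge0 // lerDr.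
Qed.

Section OnOpen.
Context {N : nat}.
Implicit Types (f g : 'rV[R]_N -> R) (x : 'rV[R]_N) (A : set 'rV[R]_N).

Lemma aboundD A f g x (M M' : R) : open A -> smooth_on A f -> smooth_on A g -> A x ->
 0 <= M -> 0 <= M' -> abound M f x -> abound M' g x -> abound (M + M') (fun y => f y + g y) x.
Proof.
move=> oA sf sg Ax M0 M'0 fM gM w; rewrite (DwD oA w sf sg Ax).
apply: le_normD; apply: le_trans (lerD (fM w) (gM w)) _.
rewrite -mulrDl; apply: ler_wpM2r => //; elim: (size w) => [|n IHn]; first by rewrite !expr1.
rewrite exprS [M' ^+ n.+2]exprS [leRHS]exprS; apply: le_trans (ler_wpM2l (addr_ge0 M0 M'0) IHn).
have a0 := mulr_ge0 M0 (exprn_ge0 n.+1 M'0); have b0 := mulr_ge0 M'0 (exprn_ge0 n.+1 M0).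
by rewrite mulrDl !mulrDr; apply: lerD; rewrite ?lerDl ?lerDr.
Qed.

Lemma aboundM A f g x (M M' : R) : open A -> smooth_on A f -> smooth_on A g -> A x ->
 0 <= M -> 0 <= M' -> abound M f x -> abound M' g x ->
 abound (2 * M * M' + (M + 4 * M')) (fun y => f y * g y) x.
Proof.
move=> oA sf sg Ax M0 M'0 fM gM; pose sig := M + 4 * M'.
have s0 : 0 <= sig by rewrite addr_ge0 // mulr_ge0.
apply: abound_scaled; [by rewrite mulr_ge0 // mulr_ge0 | exact: s0 | move=> w].
apply: le_trans (@Dw_mul_bound _ _ A f g x (fun k => M * (sig ^+ k * (k + 0)`!%:R))
  (fun k => M' * (M' ^+ k * k.+1`!%:R)) (size w) oA sf sg Ax _ _ w (leqnn _)) _.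
- move=> u _; apply: le_trans (fM u) _; rewrite exprS -mulrA addn0; apply: ler_wpM2l => //.
 apply: ler_wpM2r => //; apply: lerXn2r; rewrite ?nnegrE //; by rewrite lerDl mulr_ge0.
- move=> u _; apply: le_trans (gM u) _; rewrite exprS -mulrA; apply: ler_wpM2l => //.
 by apply: ler_wpM2l; rewrite ?exprn_ge0 // ler_nat factS leq_pmull.
rewrite leibnizZ.
have := @leibniz_fact sig M' 0 (size w) M'0; rewrite addn0 => /(_ _) LF.
apply: le_trans (ler_wpM2l (mulr_ge0 M0 M'0) (LF _)) _; first by rewrite /sig lerDr.
by apply: le_eq; ring.
Qed.

End OnOpen.

Lemma Dw1_comp N d (W : set 'rV[R]_d) (A : set 'rV[R]_N) (G : 'rV[R]_d -> R)
  (g : 'rV[R]_N -> 'rV[R]_d) j y :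
 open W -> (forall y, A y -> W (g y)) -> smooth_on W G -> smooth_on A g -> A y ->
 Dw [:: j] (G \o g) y = \sum_i (Dw [:: i] G \o g) y * Dw [:: j] (fun y => g y 0 i) y.
Proof.
move=> oW AW sG sg Ay; rewrite !Dw1.
have dg : derivable g y (delta_mx 0 j) by exact: smooth_derivable sg Ay.
have E : is_derive y (delta_mx 0 j) (G \o g) (\sum_(i < d) derive g y (delta_mx 0 j) 0 i *
   derive G (g y) (delta_mx 0 i)).
 apply: (@is_derive_comp _ _ _ _ _ W) => //; first exact: AW.
 - by move=> z i Wz; exact: smooth_derivable sG Wz.
 - move=> i; exact: smooth_continuous (smooth_derive _ sG) (AW _ Ay).
rewrite (@derive_val _ _ _ _ _ _ _ E); apply: eq_bigr => i _; rewrite /= mulrC !Dw1.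
by congr (_ * _); rewrite (derive_mx dg) mxE.
Qed.

(* [D_j (F o g) = \sum_i (D_i F o g) * D_j g_i], so an induction over the order of [w], uniform in
  the derivatives of [F], avoids Faa di Bruno. *)
Lemma abound_comp_aux N d (W : set 'rV[R]_d) (A : set 'rV[R]_N) (F : 'rV[R]_d -> R)
  (g : 'rV[R]_N -> 'rV[R]_d) x (C rho M sig : R) :
 open W -> open A -> (forall y, A y -> W (g y)) -> smooth_on A g -> A x ->
 0 <= C -> 0 <= rho -> 0 <= M -> 4 * M <= sig -> 2 * d%:R * rho * M ^+ 2 <= sig ->
 (forall i, abound M (fun y => g y 0 i) x) ->
 forall n p G, smooth_on W G ->
 (forall u, `|Dw u G (g x)| <= C * rho ^+ (size u + p) * (size u + p)`!%:R) ->
 forall w, size w = n -> `|Dw w (G \o g) x| <= C * rho ^+ p * sig ^+ n * (n + p)`!%:R.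
Proof.
move=> oW oA AW sg Ax C0 r0 M0 Ms rs gM n.
have s0 : 0 <= sig by apply: le_trans Ms; rewrite mulr_ge0.
have sgi i : smooth_on A (fun y => g y 0 i) := proj1 (smooth_on_row g oA) sg i.
elim/ltn_ind: n => n IHn p G sG GB w.
case/lastP: w => [|w j].
 by move=> <-; rewrite Dw_nil expr0 mulr1 add0n; have := GB [::]; rewrite Dw_nil.
rewrite size_rcons; case: n IHn => // n IHn [wn].
have sDG i : smooth_on W (Dw [:: i] G) := Dw_smooth [:: i] sG.
have sGg i : smooth_on A (Dw [:: i] G \o g) := smooth_comp oW oA AW (sDG i) sg.
have sDg i : smooth_on A (Dw [:: j] (fun y => g y 0 i)) := Dw_smooth [:: j] (sgi i).
rewrite Dw_rcons (@Dw_ext _ _ A _ (fun y => \sum_i (Dw [:: i] G \o g) y * Dw [:: j] (fun y => g y 0 i) y)) //; last first.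
 by move=> y Ay; exact: Dw1_comp oW AW sG sg Ay.
rewrite (Dw_sum oA _ xpredT w (fun i : 'I_d => smoothM oA (sGg i) (sDg i)) Ax).
apply: le_trans (ler_norm_sum _ _ _) _.
apply: (@le_trans _ _ (\sum_(i < d) (C * rho ^+ p.+1 * M ^+ 2 * (2 * sig ^+ n * (n + p.+1)`!%:R)))); last first.
 rewrite sumr_const card_ord -[leLHS]mulr_natl addSnnS.
 have -> : d%:R * (C * rho ^+ p.+1 * M ^+ 2 * (2 * sig ^+ n * (n + p.+1)`!%:R)) =
  2 * d%:R * rho * M ^+ 2 * (C * rho ^+ p * sig ^+ n * (n + p.+1)`!%:R).
  by rewrite exprS; move: (_`!%:R) (rho ^+ p) (sig ^+ n) => *; ring.
 rewrite [sig ^+ n.+1]exprS.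
 have -> : C * rho ^+ p * (sig * sig ^+ n) * (n + p.+1)`!%:R = sig * (C * rho ^+ p * sig ^+ n * (n + p.+1)`!%:R).
  by move: (_`!%:R) (rho ^+ p) (sig ^+ n) => *; ring.
 by apply: ler_wpM2r => //; rewrite !mulr_ge0 ?exprn_ge0.
apply: ler_sum => i _.
apply: le_trans (@Dw_mul_bound _ _ A (Dw [:: i] G \o g) (Dw [:: j] (fun y => g y 0 i)) x
 (fun k => C * rho ^+ p.+1 * (sig ^+ k * (k + p.+1)`!%:R))
  (fun k => M ^+ 2 * (M ^+ k * k.+1`!%:R)) n oA (sGg i) (sDg i) Ax _ _ w _) _.
- move=> u un; rewrite mulrA.
 have GB' v : `|Dw v (Dw [:: i] G) (g x)| <= C * rho ^+ (size v + p.+1) * (size v + p.+1)`!%:R.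
  by rewrite -Dw_rcons; have := GB (rcons v i); rewrite size_rcons addSnnS.
 exact: (IHn (size u) un p.+1 (Dw [:: i] G) (sDG i) GB' u erefl).
- move=> u un; rewrite -Dw_rcons mulrA -exprD; have := gM i (rcons u j).
 by rewrite size_rcons.
- by rewrite wn.
rewrite wn leibnizZ; apply: ler_wpM2l; last exact: leibniz_fact.
by rewrite !mulr_ge0 ?exprn_ge0.
Qed.

Lemma abound_comp N d (W : set 'rV[R]_d) (A : set 'rV[R]_N) (F : 'rV[R]_d -> R)
  (g : 'rV[R]_N -> 'rV[R]_d) x (C M : R) :
 open W -> open A -> (forall y, A y -> W (g y)) -> smooth_on W F -> smooth_on A g -> A x ->
 0 <= C -> 0 <= M -> abound C F (g x) -> (forall i, abound M (fun y => g y 0 i) x) ->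
 abound (C + (4 * M + 2 * d%:R * C * M ^+ 2)) (F \o g) x.
Proof.
move=> oW oA AW sF sg Ax C0 M0 FC gM.
have q0 : 0 <= 2 * d%:R * C * M ^+ 2 by rewrite !mulr_ge0 ?exprn_ge0.
have m0 : 0 <= 4 * M by rewrite mulr_ge0.
apply: abound_scaled => [//||w]; first exact: addr_ge0.
have := @abound_comp_aux N d W A F g x C C M (4 * M + 2 * d%:R * C * M ^+ 2) oW oA AW sg Ax C0 C0 M0 _ _ gM
 (size w) 0 F sF _ w erefl.
rewrite expr0 mulr1 addn0; apply; rewrite ?lerDl ?lerDr // => u.
by rewrite addn0 -exprS; exact: FC.
Qed.

End AnalyticBounds.

Section GlobalAnalytic.
Context {R : realType}.

Lemma continuous_neq0_ball N (f : 'rV[R]_N -> R) x : {for x, continuous f} -> f x != 0 ->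
 exists2 e : R, 0 < e & forall y, ball x e y -> f y != 0.
Proof.
move=> cf fx; have fx2 : 0 < `|f x| / 2 by rewrite divr_gt0 // normr_gt0.
have /cvgrPdist_lt /(_ _ fx2) /nbhs_ballP [e /= e0 eP] := cf.
exists e => // y /eP; apply: contraTneq => ->; rewrite subr0 -leNgt.
by rewrite ler_pdivrMr // ler_peMr // ler1n.
Qed.

Lemma fact_shift (M : R) n : 0 <= M -> M ^+ n.+2 * n.+1`!%:R <= M ^+ 2 * (2 * M) ^+ n * n`!%:R.
Proof.
move=> M0; rewrite factS natrM exprMn.
have -> : M ^+ 2 * (2 ^+ n * M ^+ n) * n`!%:R = M ^+ n.+2 * (2 ^+ n * n`!%:R) by rewrite !exprS expr0; ring.
apply: ler_wpM2l; first exact: exprn_ge0.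
by apply: ler_wpM2r => //; rewrite -natrX ler_nat ltn_expl.
Qed.

Lemma open_neq0 : open [set r : R | r != 0].
Proof.
have -> : [set r : R | r != 0] = [set r | r < 0] `|` [set r | 0 < r].
 by apply/seteqP; split => [r /= |r /= ]; rewrite neq_lt => /orP.
exact: openU (@open_lt R 0) (@open_gt R 0).
Qed.

Definition ganalytic {N} (f : 'rV[R]_N -> R) : Prop :=
 smooth_on setT f /\ forall K : R, exists2 M, 0 <= M & forall x, `|x| <= K -> abound M f x.

Definition ganalyticv {N d} (g : 'rV[R]_N -> 'rV[R]_d) : Prop :=
 forall i, ganalytic (fun x => g x 0 i).

Lemma ganalyticv_smooth N d (g : 'rV[R]_N -> 'rV[R]_d) : ganalyticv g -> smooth_on setT g.
Proof. by move=> ag; apply/(smooth_on_row g openT) => i; have [] := ag i. Qed.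

Lemma ganalyticv_bound N d (g : 'rV[R]_N -> 'rV[R]_d) (K : R) : ganalyticv g ->
 exists2 M, 0 <= M & forall x i, `|x| <= K -> abound M (fun y => g y 0 i) x.
Proof.
move=> ag; have /choice [M MP] : forall i, exists M, 0 <= M /\ forall x, `|x| <= K -> abound M (fun y => g y 0 i) x.
 by move=> i; have [_ /(_ K) [M M0 MP]] := ag i; exists M.
exists (\sum_i M i); first by apply: sumr_ge0 => i _; have [] := MP i.
move=> x i xK; have [M0 Mi] := MP i; apply: abound_le (Mi x xK) => //.
by rewrite (bigD1 i) //= lerDl; apply: sumr_ge0 => j _; have [] := MP j.
Qed.

Lemma ganalyticv_range N d (g : 'rV[R]_N -> 'rV[R]_d) (K : R) : ganalyticv g ->
 exists2 M, 0 <= M & forall x, `|x| <= K -> `|g x| <= M.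
Proof.
move=> ag; have [M M0 MP] := ganalyticv_bound K ag; exists M => // x xK.
apply: row_norm_le => // i.
by have := MP x i xK [::]; rewrite Dw_nil expr1 mulr1.
Qed.

Lemma ganalytic_cst N (c : R) : ganalytic (fun _ : 'rV[R]_N => c).
Proof.
split=> [|K]; first exact: smooth_cst.
exists `|c| => // x _ w; rewrite Dw_cst; case: w => [|i w]; first by rewrite expr1 mulr1.
by rewrite normr0 mulr_ge0 ?exprn_ge0.
Qed.

Lemma ganalytic_coord N (i : 'I_N) : ganalytic (fun x : 'rV[R]_N => x 0 i).
Proof.
split=> [|K]; first exact: smooth_coord openT.
exists (`|K| + 1) => [|x xK w]; first exact: addr_ge0.
have K1 : 1 <= `|K| + 1 by rewrite lerDr.
have E1 n m : 1 <= (`|K| + 1) ^+ n * m`!%:R.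
 have e1 : 1 <= (`|K| + 1) ^+ n by exact: exprn_ege1.
 have f1 : (1 : R) <= m`!%:R by rewrite ler1n fact_gt0.
 by apply: (@le_trans _ _ (1 * 1)); [rewrite mulr1 | exact: ler_pM].
case/lastP: w => [|w j].
 rewrite Dw_nil expr1 mulr1; apply: le_trans (coord_le_norm _ _) _; apply: le_trans xK _.
 by apply: le_trans (ler_norm K) _; rewrite lerDl.
rewrite Dw_rcons (@Dw_ext _ _ setT _ (fun=> (i == j)%:R)) //; last 2 first.
- exact: openT.
- by move=> y _; exact: Dw1_coord.
apply: le_trans (E1 _ _).
rewrite Dw_cst; case: w => [|k w]; last by rewrite normr0.
by case: eqP; rewrite ?normr1 ?normr0.
Qed.

Lemma ganalyticD N (f g : 'rV[R]_N -> R) : ganalytic f -> ganalytic g -> ganalytic (fun x => f x + g x).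
Proof.
move=> [sf Mf] [sg Mg]; split=> [|K]; first exact: (smoothD openT sf sg).
have [M M0 MP] := Mf K; have [M' M'0 M'P] := Mg K.
exists (M + M') => [|x xK]; first exact: addr_ge0.
by apply: (aboundD openT sf sg) => //; [exact: MP | exact: M'P].
Qed.

Lemma ganalyticM N (f g : 'rV[R]_N -> R) : ganalytic f -> ganalytic g -> ganalytic (fun x => f x * g x).
Proof.
move=> [sf Mf] [sg Mg]; split=> [|K]; first exact: (smoothM openT sf sg).
have [M M0 MP] := Mf K; have [M' M'0 M'P] := Mg K.
exists (2 * M * M' + (M + 4 * M')) => [|x xK]; first by rewrite !addr_ge0 // !mulr_ge0.
by apply: (aboundM openT sf sg) => //; [exact: MP | exact: M'P].
Qed.

Lemma ganalyticZ N (c : R) (f : 'rV[R]_N -> R) : ganalytic f -> ganalytic (fun x => c * f x).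
Proof. by move=> af; exact: ganalyticM (ganalytic_cst N c) af. Qed.

Lemma ganalyticN N (f : 'rV[R]_N -> R) : ganalytic f -> ganalytic (fun x => - f x).
Proof.
by move=> /(ganalyticZ (-1)); congr ganalytic; apply/funext => x; rewrite mulN1r.
Qed.

Lemma ganalyticB N (f g : 'rV[R]_N -> R) : ganalytic f -> ganalytic g -> ganalytic (fun x => f x - g x).
Proof. by move=> af /ganalyticN; exact: ganalyticD. Qed.

Lemma ganalytic_sum N (I : Type) (r : seq I) (P : pred I) (F : I -> 'rV[R]_N -> R) :
 (forall i, P i -> ganalytic (F i)) -> ganalytic (fun x => \sum_(i <- r | P i) F i x).
Proof.
move=> aF; elim: r => [|i r IHr].
 by under eq_fun do rewrite big_nil; exact: ganalytic_cst.
under eq_fun do rewrite big_cons; case: (boolP (P i)) => // Pi.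
by apply: ganalyticD => //; exact: aF.
Qed.

Lemma ganalytic_prod N (I : Type) (r : seq I) (P : pred I) (F : I -> 'rV[R]_N -> R) :
 (forall i, P i -> ganalytic (F i)) -> ganalytic (fun x => \prod_(i <- r | P i) F i x).
Proof.
move=> aF; elim: r => [|i r IHr].
 by under eq_fun do rewrite big_nil; exact: ganalytic_cst.
under eq_fun do rewrite big_cons; case: (boolP (P i)) => // Pi.
by apply: ganalyticM => //; exact: aF.
Qed.

Lemma ganalyticX N (f : 'rV[R]_N -> R) n : ganalytic f -> ganalytic (fun x => f x ^+ n).
Proof.
move=> af; elim: n => [|n IHn]; first by under eq_fun do rewrite expr0; exact: ganalytic_cst.
by under eq_fun do rewrite exprS; exact: ganalyticM.
Qed.

Lemma ganalytic_Dw1 N (i : 'I_N) (f : 'rV[R]_N -> R) : ganalytic f -> ganalytic (Dw [:: i] f).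
Proof.
move=> [sf Mf]; split=> [|K]; first exact: Dw_smooth.
have [M M0 MP] := Mf K; exists (M ^+ 2 + 2 * M) => [|x xK]; first by rewrite addr_ge0 ?exprn_ge0 ?mulr_ge0.
apply: abound_scaled; rewrite ?exprn_ge0 ?mulr_ge0 // => w; rewrite -Dw_rcons.
apply: le_trans (MP x xK _) _; by rewrite size_rcons; exact: fact_shift.
Qed.

Lemma ganalytic_Dw N w (f : 'rV[R]_N -> R) : ganalytic f -> ganalytic (Dw w f).
Proof.
move=> af; elim: w => [|i w IHw]; first by rewrite Dw_nil.
by rewrite -cat1s Dw_cat; exact: ganalytic_Dw1.
Qed.

Lemma ganalytic_comp_on N d (W : set 'rV[R]_d) (F : 'rV[R]_d -> R) (g : 'rV[R]_N -> 'rV[R]_d) :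
 open W -> smooth_on W F -> (forall x, W (g x)) -> ganalyticv g ->
 (forall K : R, exists2 C, 0 <= C & forall x, `|x| <= K -> abound C F (g x)) -> ganalytic (F \o g).
Proof.
move=> oW sF gW ag FC; have sg := ganalyticv_smooth ag.
split=> [|K]; first exact: (smooth_comp oW openT (fun x _ => gW x) sF sg).
have [C C0 CP] := FC K; have [M M0 MP] := ganalyticv_bound K ag.
exists (C + (4 * M + 2 * d%:R * C * M ^+ 2)) => [|x xK].
 by rewrite !addr_ge0 ?mulr_ge0 ?exprn_ge0.
apply: (abound_comp oW openT (fun x _ => gW x) sF sg) => //; first exact: CP.
by move=> i; exact: MP.
Qed.

Lemma ganalytic_comp N d (F : 'rV[R]_d -> R) (g : 'rV[R]_N -> 'rV[R]_d) :
 ganalytic F -> ganalyticv g -> ganalytic (F \o g).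
Proof.
move=> [sF MF] ag; apply: (ganalytic_comp_on openT sF) => // K.
have [K' _ gK] := ganalyticv_range K ag; have [C C0 CP] := MF K'.
by exists C => // x xK; apply: CP; exact: gK.
Qed.

Lemma ganalyticv_comp N d e (F : 'rV[R]_d -> 'rV[R]_e) (g : 'rV[R]_N -> 'rV[R]_d) :
 ganalyticv F -> ganalyticv g -> ganalyticv (F \o g).
Proof. by move=> aF ag i; exact: ganalytic_comp (aF i) ag. Qed.

Let inv1 (t : 'rV[R]_1) : R := (t 0 0)^-1.
Let W1 : set 'rV[R]_1 := [set t | t 0 0 != 0].

Let oW1 : open W1.
Proof.
apply: (@open_comp _ _ (fun t : 'rV[R]_1 => t 0 0) [set r | r != 0]).
 by move=> t _; exact: coord_continuous.
exact: open_neq0.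
Qed.

Let sinv1 : smooth_on W1 inv1.
Proof. exact: (smoothV oW1 (fun t Wt => Wt) (smooth_coord (0 : 'I_1) oW1)). Qed.

Let Dinv1 t : W1 t -> Dw [:: ord0] inv1 t = - inv1 t ^+ 2.
Proof.
move=> Wt; have := DwM1 ord0 (smooth_coord (0 : 'I_1) oW1) sinv1 Wt.
rewrite (@Dw_ext _ _ W1 _ (fun=> 1) [:: ord0] t oW1) //; last first.
 by move=> y Wy; rewrite /inv1 divff.
rewrite Dw_cst Dw1_coord eqxx mul1r => /esym/eqP; rewrite addrC addr_eq0 => /eqP E.
by rewrite expr2 -mulNr -E -mulrA mulrCA divff ?mulr1.
Qed.

Let Dinv1X n t : W1 t -> Dw [:: ord0] (fun t => inv1 t ^+ n) t = - n%:R * inv1 t ^+ n.+1.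
Proof.
move=> Wt; elim: n => [|n IHn].
 by under eq_fun do rewrite expr0; rewrite Dw_cst oppr0 mul0r.
under eq_fun do rewrite exprS.
rewrite (DwM1 ord0 sinv1 (smoothX oW1 n sinv1) Wt) Dinv1 // IHn.
by rewrite -natr1 !exprS expr0; ring.
Qed.

Let Dinv1n n t : W1 t -> Dw (nseq n ord0) inv1 t = (-1) ^+ n * n`!%:R * inv1 t ^+ n.+1.
Proof.
elim: n t => [|n IHn] t Wt; first by rewrite Dw_nil expr0 expr1 !mul1r.
rewrite /= -cat1s Dw_cat (@Dw_ext _ _ W1 _ _ [:: ord0] t oW1 IHn Wt).
rewrite (DwZ oW1 [:: ord0] _ (smoothX oW1 n.+1 sinv1) Wt) Dinv1X //.
by rewrite factS natrM [(-1) ^+ n.+1]exprS; ring.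
Qed.

Lemma aboundV N (A : set 'rV[R]_N) (f : 'rV[R]_N -> R) x (M B : R) : open A -> smooth_on A f -> A x ->
 (forall y, A y -> f y != 0) -> 0 <= M -> 0 <= B -> abound M f x -> `|(f x)^-1| <= B ->
 abound (B + (4 * M + 2 * B * M ^+ 2)) (fun y => (f y)^-1) x.
Proof.
move=> oA sf Ax f0 M0 B0 fM fB; pose g (x : 'rV[R]_N) : 'rV[R]_1 := \row__ f x.
have E : (fun x => (f x)^-1) = inv1 \o g by apply/funext => y; rewrite /inv1 /= mxE.
have sg : smooth_on A g by exact: smooth_row.
have gW y : A y -> W1 (g y) by move=> Ay; rewrite /W1 /= mxE f0.
rewrite E; have := @abound_comp R N 1 W1 A inv1 g x B M oW1 oA gW sinv1 sg Ax B0 M0; rewrite mulr1; apply.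
 move=> w; have -> : w = nseq (size w) ord0.
  by elim: w => //= i w <-; rewrite (ord1 i).
 rewrite size_nseq Dinv1n; last exact: gW.
 rewrite !normrM normrX normrN1 expr1n mul1r mulrC normr_nat; apply: ler_wpM2r => //.
 by rewrite normrX; apply: lerXn2r; rewrite ?nnegrE // /inv1 mxE.
by move=> i w; under eq_fun do rewrite mxE; exact: fM.
Qed.

Lemma ganalyticV N (f : 'rV[R]_N -> R) : ganalytic f -> (forall x, f x != 0) ->
 ganalytic (fun x => (f x)^-1).
Proof.
move=> [sf Mf] f0; have sV := smoothV openT (fun x _ => f0 x) sf; split=> // K.
have [B B0 BP] := smooth_bounded (r := K) [::] sV (fun _ _ => I).
have [M M0 MP] := Mf K; exists (B + (4 * M + 2 * B * M ^+ 2)) => [|x xK].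
 by rewrite !addr_ge0 ?mulr_ge0 ?exprn_ge0.
apply: (aboundV openT sf I (fun y _ => f0 y)) => //; first exact: MP.
by have := BP x xK; rewrite Dw_nil.
Qed.

Lemma ganalytic_hadamard N (i : 'I_N) (f : 'rV[R]_N -> R) : ganalytic f -> ganalytic (hadamard i f).
Proof.
move=> [sf Mf]; split=> [|K].
 apply: smooth_on_locally => x _; exists (ball 0 (`|x| + 1)).
  split; first exact: ball_open.
  by rewrite ball0E ltrDl.
 exact: (@hadamard_smooth R N i (`|x| + 1) setT f openT sf (fun _ _ => I)).
have [M M0 MP] := Mf K; exists (M ^+ 2 + 2 * M) => [|x xK]; first by rewrite addr_ge0 ?exprn_ge0 ?mulr_ge0.
apply: abound_scaled; rewrite ?exprn_ge0 ?mulr_ge0 // => w.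
apply: (@hadamard_bound R N i (`|x| + 1) setT f openT sf (fun _ _ => I) w x).
 by rewrite ball0E ltrDl.
move=> s s01; apply: le_trans (MP _ _ (rcons w i)) _.
 exact: le_trans (scoord_norm _ _ s01) xK.
by rewrite size_rcons; exact: fact_shift.
Qed.

Lemma is_derive_pow n (s : R) : is_derive s 1 (fun s : R => s ^+ n.+1) (n.+1%:R * s ^+ n).
Proof.
elim: n => [|n IHn].
 by under eq_fun do rewrite expr1; rewrite expr0 mulr1; exact: is_derive_id.
under eq_fun do rewrite exprS.
apply: (is_derive_eq (is_deriveM (is_derive_id s 1) IHn)).
by rewrite /GRing.scale /= mulr1 -natr1 exprS; ring.
Qed.

Lemma powint_bound (phi dphi : R -> R) (K : R) (m : nat) (t : R) : 0 <= t ->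
 (forall s : R, 0 <= s <= t -> is_derive s 1 phi (dphi s)) -> phi 0 = 0 ->
 (forall s : R, 0 <= s <= t -> `|dphi s| <= K * s ^+ m) -> `|phi t| <= K * t ^+ m.+1 / m.+1%:R.
Proof.
move=> t0 D p0 B; have [->|tn0] := eqVneq t 0.
 by rewrite p0 normr0 expr0n mulr0 mul0r.
have tp : 0 < t by rewrite lt0r tn0.
pose chi s := phi s * t ^+ m.+1 - phi t * s ^+ m.+1.
have Dc (s : R) : 0 <= s <= t -> is_derive s 1 chi (dphi s * t ^+ m.+1 - phi t * (m.+1%:R * s ^+ m)).
 move=> st; have [d1 e1] := D s st.
 have E1 : is_derive s 1 (fun s => phi s * t ^+ m.+1) (dphi s * t ^+ m.+1).
  apply: (is_derive_eq (is_deriveM (D s st) (is_derive_cst (t ^+ m.+1) s 1))).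
  by rewrite scaler0 add0r mulrC.
 have E2 : is_derive s 1 (fun s => phi t * s ^+ m.+1) (phi t * (m.+1%:R * s ^+ m)).
  apply: (is_derive_eq (is_deriveZ (phi t) (is_derive_pow m s))).
  by [].
 exact: is_deriveB E1 E2.
have [||c ct E] := @MVT R chi (fun s => dphi s * t ^+ m.+1 - phi t * (m.+1%:R * s ^+ m)) 0 t tp.
- by move=> s; rewrite in_itv /= => /andP[a b]; apply: Dc; rewrite !ltW.
- by apply: derivable_within_continuous => s; rewrite in_itv /= => /Dc [].
move: ct; rewrite in_itv /= => /andP[c0 ct].
have chi0 : chi t - chi 0 = 0 by rewrite /chi p0 expr0n /= mul0r mulr0 !subr0 subrr.
move: E; rewrite chi0 subr0 => /esym/eqP; rewrite mulf_eq0 (negPf tn0) orbF subr_eq0 => /eqP E.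
have cm : 0 < m.+1%:R * c ^+ m by rewrite mulr_gt0 // exprn_gt0.
have -> : phi t = dphi c * t ^+ m.+1 / (m.+1%:R * c ^+ m) by rewrite E mulfK // gt_eqF.
rewrite !normrM normfV (gtr0_norm cm) (ger0_norm (exprn_ge0 _ t0)) ler_pdivrMr //.
have -> : K * t ^+ m.+1 / m.+1%:R * (m.+1%:R * c ^+ m) = (K * c ^+ m) * t ^+ m.+1.
 by have : (m.+1%:R : R) != 0 by []; move: (m.+1%:R) => q qn0; field.
by apply: ler_wpM2r; [exact: exprn_ge0 | apply: B; rewrite !ltW].
Qed.

(* Taylor's formula with [1/m!]: this is where the factorials of [abound] are absorbed. *)
Lemma flat_segment N (f : 'rV[R]_N -> R) (p v : 'rV[R]_N) (M : R) : 0 <= M ->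
 smooth_on setT f -> (forall w, Dw w f p = 0) ->
 (forall s : R, 0 <= s <= 1 -> abound M f (s *: v + p)) ->
 forall m w (s : R), 0 <= s <= 1 -> `|Dw w f (s *: v + p)| <=
  M ^+ (size w + m).+1 * (size w + m)`!%:R * (N%:R * `|v|) ^+ m * s ^+ m / m`!%:R.
Proof.
move=> M0 sf fp fM; elim=> [|m IHm] w s s01.
 by rewrite !expr0 divr1 !mulr1 addn0; exact: fM.
pose K := M ^+ (size w + m.+1).+1 * (size w + m.+1)`!%:R * (N%:R * `|v|) ^+ m.+1 / m`!%:R.
have -> : M ^+ (size w + m.+1).+1 * (size w + m.+1)`!%:R * (N%:R * `|v|) ^+ m.+1 * s ^+ m.+1 / m.+1`!%:R
  = K * s ^+ m.+1 / m.+1%:R.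
 by rewrite /K factS natrM invfM; ring.
have /andP[s0 s1] := s01; have sD := Dw_smooth w sf.
apply: (@powint_bound (fun s => Dw w f (s *: v + p)) (fun s => derive (Dw w f) (s *: v + p) v)) => //.
- by move=> t _; apply: is_derive_line; exact: smooth_derivable sD I.
- by rewrite scale0r add0r fp.
move=> t /andP[t0 ts]; have t01 : 0 <= t <= 1 by rewrite t0 (le_trans ts).
rewrite (derive_gradient _ openT sD I); apply: le_trans (ler_norm_sum _ _ _) _.
apply: (@le_trans _ _ (\sum_(i < N) `|v| * (M ^+ (size w + m.+1).+1 * (size w + m.+1)`!%:R * (N%:R * `|v|) ^+ m * t ^+ m / m`!%:R))).
 apply: ler_sum => i _; rewrite normrM; apply: ler_pM => //; first exact: coord_le_norm.
 by rewrite -Dw_cat; have := IHm (i :: w) t t01; rewrite /= addSnnS.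
rewrite sumr_const card_ord -[leLHS]mulr_natl /K [(N%:R * `|v|) ^+ m.+1]exprS.
by apply: le_eq; ring.
Qed.

Lemma flat_step N (f : 'rV[R]_N -> R) (p v : 'rV[R]_N) (M : R) : 0 <= M ->
 smooth_on setT f -> (forall w, Dw w f p = 0) ->
 (forall s : R, 0 <= s <= 1 -> abound M f (s *: v + p)) -> 4 * M * (N%:R * `|v|) <= 1 ->
 forall w, Dw w f (v + p) = 0.
Proof.
move=> M0 sf fp fM vM w; pose C := M ^+ (size w).+1 * (size w)`!%:R * 2 ^+ size w.
have H (m : nat) : `|Dw w f (v + p)| <= C * (1 / 2) ^+ m.
 have := flat_segment M0 sf fp fM m w (s := 1); rewrite ler01 lexx scale1r => /(_ isT) /le_trans; apply.
 rewrite expr1n mulr1 ler_pdivrMr ?ltr0n ?fact_gt0 //.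
 apply: (@le_trans _ _ (M ^+ (size w + m).+1 * (2 ^ (size w + m) * ((size w)`! * m`!))%:R * (N%:R * `|v|) ^+ m)).
  apply: ler_wpM2r; first by rewrite exprn_ge0 // mulr_ge0.
  apply: ler_wpM2l; first exact: exprn_ge0.
  rewrite ler_nat -(bin_fact (leq_addr m (size w))) addKn; apply: leq_mul => //; exact: bin_le_pow2.
 rewrite !natrM natrX /C exprD -addSn exprD.
 have q0 : 0 <= 2 * M * (N%:R * `|v|) by rewrite !mulr_ge0.
 have q1 : (2 * M * (N%:R * `|v|)) ^+ m <= (1 / 2) ^+ m.
  by apply: lerXn2r; rewrite ?nnegrE ?divr_ge0 //; move: vM; rewrite -!mulrA; lra.
 have C0 : 0 <= C * m`!%:R by rewrite !mulr_ge0 ?exprn_ge0.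
 rewrite [leRHS]mulrAC; apply: le_trans (ler_wpM2l C0 q1); rewrite !exprMn /C.
 by apply: le_eq; ring.
apply/eqP; rewrite -normr_le0; apply/ler_addgt0Pr => e e0; rewrite add0r.
have C0 : 0 <= C by rewrite !mulr_ge0 ?exprn_ge0.
pose n := Num.bound (C / e).
apply: le_trans (H n) _; rewrite expr_div_n expr1n mulrA mulr1 ler_pdivrMr ?exprn_gt0 //.
rewrite mulrC -ler_pdivrMr //; apply/ltW.
apply: lt_le_trans (archi_boundP _) _; first by rewrite divr_ge0 // ltW.
by rewrite -natrX ler_nat ltnW // ltn_expl.
Qed.

Lemma ganalytic_flat0 N (f : 'rV[R]_N -> R) p : ganalytic f -> (forall w, Dw w f p = 0) -> forall x, f x = 0.
Proof.
move=> [sf Mf] fp x; pose K := `|p| + `|x - p|; have [M M0 MP] := Mf K.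
pose L := (Num.bound (4 * M * (N%:R * `|x - p|))).+1.
have LP : 4 * M * (N%:R * `|x - p|) <= L%:R.
 apply: ltW; apply: lt_le_trans (archi_boundP _) _; first by rewrite !mulr_ge0.
 by rewrite ler_nat.
pose v := (L%:R^-1 : R) *: (x - p).
have nL : `|v| = `|x - p| / L%:R by rewrite normrZ gtr0_norm ?invr_gt0 // mulrC.
have inK (s : R) : 0 <= s <= L%:R -> `|s *: v + p| <= K.
 move=> /andP[s0 sL]; apply: le_normD; rewrite addrC lerD2l normrZ ger0_norm // nL.
 by rewrite mulrA ler_pdivrMr // mulrC; apply: ler_wpM2l.
have step k : (k <= L)%N -> forall w, Dw w f (k%:R *: v + p) = 0.
 elim: k => [|k IHk] kL w; first by rewrite scale0r add0r.
 have -> : k.+1%:R *: v + p = v + (k%:R *: v + p) by rewrite -natr1 scalerDl scale1r addrCA addrA.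
 apply: (@flat_step N f _ _ M M0 sf (IHk (ltnW kL))).
  move=> s /andP[s0 s1]; apply: MP; rewrite addrA -scalerDl; apply: inK.
  rewrite addr_ge0 //=; apply: (@le_trans _ _ (1 + k%:R)); first by rewrite lerD2r.
  by rewrite addrC natr1 ler_nat.
 rewrite nL; have -> : 4 * M * (N%:R * (`|x - p| / L%:R)) = 4 * M * (N%:R * `|x - p|) / L%:R by rewrite !mulrA.
 by rewrite ler_pdivrMr // mul1r.
by have := step L (leqnn _) [::]; rewrite Dw_nil scalerA divff ?scale1r ?subrK // pnatr_eq0.
Qed.

Lemma ganalytic_identity N (f : 'rV[R]_N -> R) p (e : R) : ganalytic f -> 0 < e ->
 (forall x, ball p e x -> f x = 0) -> forall x, f x = 0.
Proof.
move=> af e0 fe; apply: (ganalytic_flat0 af (p := p)) => w.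
rewrite (@Dw_ext _ _ (ball p e) _ (fun=> 0) w p (ball_open _ _) fe (ballxx _ e0)) Dw_cst.
by case: w.
Qed.

Lemma ganalytic_domain N (f g : 'rV[R]_N -> R) : ganalytic f -> ganalytic g ->
 (forall x, f x * g x = 0) -> (forall x, f x = 0) \/ (forall x, g x = 0).
Proof.
move=> af ag fg; have [[x fx]|nof] := pselect (exists x, f x != 0); last first.
 left=> x; apply/eqP; apply: contrapT => /negP fx; apply: nof; by exists x.
right; have cf : {for x, continuous f} := smooth_continuous af.1 I.
have [e e0 eP] := continuous_neq0_ball cf fx.
apply: (ganalytic_identity ag e0 (p := x)) => y /eP fy.
by have /eqP := fg y; rewrite mulf_eq0 (negPf fy) => /eqP.
Qed.

Lemma ganalytic_near_nonzero N (f : 'rV[R]_N -> R) p (e : R) : ganalytic f -> 0 < e ->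
 (exists x, f x != 0) -> exists2 x, ball p e x & f x != 0.
Proof.
move=> af e0 [x fx]; apply: contrapT => no; move/eqP: fx; apply.
apply: (ganalytic_identity af e0 (p := p)) => y By; apply/eqP; apply: contrapT => /negP fy.
by apply: no; exists y.
Qed.

End GlobalAnalytic.

Section Lambda.
Context {R : realType}.

(* [lam] maps the line onto [-1, 1], is a diffeomorphism near 0, and equals [y] times a positive function:
  it turns functions on boxes into functions on the whole space without disturbing monomials. *)
Definition lamu (y : R) : R := 2 * (1 + y ^+ 2)^-1.
Definition lam (y : R) : R := y * lamu y.

Lemma lam_den (y : R) : 0 < 1 + y ^+ 2.
Proof. by rewrite ltr_pwDl // sqr_ge0. Qed.

Lemma lamu_gt0 y : 0 < lamu y.
Proof. by rewrite mulr_gt0 // invr_gt0 lam_den. Qed.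

Lemma lam0 : lam 0 = 0. Proof. by rewrite /lam mul0r. Qed.

Lemma lam_le1 y : `|lam y| <= 1.
Proof.
rewrite /lam /lamu mulrA normrM normfV (gtr0_norm (lam_den y)) ler_pdivrMr ?lam_den // mul1r.
rewrite ler_norml; have := sqr_ge0 (y - 1); have := sqr_ge0 (y + 1).
by rewrite sqrrD sqrrB !mulr1 expr1n => *; apply/andP; split; lra.
Qed.

Lemma lam_inv (c : R) : `|c| <= 1 -> exists2 y, `|y| <= `|c| & lam y = c.
Proof.
move=> c1; pose q := Num.sqrt (1 - c ^+ 2); have q0 : 0 <= q by exact: sqrtr_ge0.
have c2 : c ^+ 2 <= 1 by rewrite -real_normK ?num_real // exprn_ile1.
have qq : q ^+ 2 = 1 - c ^+ 2 by rewrite sqr_sqrtr // subr_ge0.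
have q1 : 0 < 1 + q by rewrite ltr_pwDl.
exists (c / (1 + q)).
 by rewrite normrM normfV (gtr0_norm q1) ler_pdivrMr // ler_peMr // lerDl.
have E : 1 + (c / (1 + q)) ^+ 2 = 2 / (1 + q).
 rewrite expr_div_n; apply: (canRL (mulfK _)); first by rewrite gt_eqF.
 have -> : (1 + c ^+ 2 / (1 + q) ^+ 2) * (1 + q) = ((1 + q) ^+ 2 + c ^+ 2) / (1 + q).
  by field; rewrite gt_eqF.
 rewrite sqrrD qq !expr1n mul1r; apply: (canLR (mulfK _)); first by rewrite gt_eqF.
 ring.
by rewrite /lam /lamu E; field; rewrite gt_eqF.
Qed.

Context {N : nat}.
Implicit Types (s x p : 'rV[R]_N).

Definition lamv (r : R) p s : 'rV[R]_N := \row_i (p 0 i + r * lam (s 0 i)).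

Lemma ganalytic_lamu (i : 'I_N) : ganalytic (fun s : 'rV[R]_N => lamu (s 0 i)).
Proof.
apply: ganalyticZ; apply: ganalyticV; last by move=> s; rewrite gt_eqF // lam_den.
by apply: ganalyticD; [exact: ganalytic_cst | apply: ganalyticX; exact: ganalytic_coord].
Qed.

Lemma ganalytic_lam (i : 'I_N) : ganalytic (fun s : 'rV[R]_N => lam (s 0 i)).
Proof. by apply: ganalyticM; [exact: ganalytic_coord | exact: ganalytic_lamu]. Qed.

Lemma ganalyticv_lamv r p : ganalyticv (lamv r p).
Proof.
move=> i; under eq_fun do rewrite mxE.
by apply: ganalyticD; [exact: ganalytic_cst | apply: ganalyticZ; exact: ganalytic_lam].
Qed.

Lemma lamv_dist r p s : 0 <= r -> `|lamv r p s - p| <= r.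
Proof.
move=> r0; apply: row_norm_le => // i; rewrite !mxE.
by rewrite addrAC subrr add0r normrM ger0_norm // ler_piMr // lam_le1.
Qed.

Lemma lamv_at0 r p : lamv r p 0 = p.
Proof. by apply/rowP => i; rewrite !mxE lam0 mulr0 addr0. Qed.

Lemma lamv_onto r p x : 0 < r -> `|x - p| <= r -> exists2 s, `|s| <= `|x - p| / r & lamv r p s = x.
Proof.
move=> r0 xr.
have ci i : `|(x - p) 0 i / r| <= `|x - p| / r.
 rewrite normrM normfV (gtr0_norm r0); apply: ler_wpM2r; first by rewrite invr_ge0 ltW.
 exact: coord_le_norm.
have /choice [y yP] : forall i, exists y, `|y| <= `|(x - p) 0 i / r| /\ lam y = (x - p) 0 i / r.
 move=> i; have [|y y1 y2] := @lam_inv ((x - p) 0 i / r); last by exists y.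
 by apply: le_trans (ci i) _; rewrite ler_pdivrMr // mul1r.
exists (\row_i y i).
 apply: row_norm_le => [|i]; first by rewrite divr_ge0 // ltW.
 by rewrite mxE; exact: le_trans (yP i).1 (ci i).
apply/rowP => i; rewrite !mxE (yP i).2 !mxE mulrCA divff ?gt_eqF // mulr1.
by rewrite addrCA subrr addr0.
Qed.

End Lambda.

Section PowerSeries.
Context {R : realType} {d : nat}.
Implicit Types (a : 'I_d -> nat) (y z : 'rV[R]_d) (c : ('I_d -> nat) -> R).

Lemma ganalytic_monomial a : ganalytic (fun y => monomial a y).
Proof. by apply: ganalytic_prod => i _; apply: ganalyticX; exact: ganalytic_coord. Qed.

Let Dpow n (t : 'rV[R]_1) : Dw [:: ord0] (fun t : 'rV[R]_1 => t 0 0 ^+ n) t = n%:R * t 0 0 ^+ n.-1.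
Proof.
elim: n => [|n IHn]; first by under eq_fun do rewrite expr0; rewrite Dw_cst mul0r.
under eq_fun do rewrite exprS.
have sc := smooth_coord (R := R) (0 : 'I_1) openT.
rewrite (DwM1 ord0 sc (smoothX openT n sc) I) IHn Dw1_coord eqxx mul1r -natr1.
case: n {IHn} => [|n] /=; first by rewrite !expr0 mul0r mulr0 addr0 add0r mulr1.
by rewrite !exprS; ring.
Qed.

Lemma Dw1_monomial a j y :
 Dw [:: j] (fun y => monomial a y) y = (a j)%:R * monomial (fun i => (a i - (i == j))%N) y.
Proof.
pose C := \prod_(i < d | i != j) y 0 i ^+ a i.
pose iota (t : 'rV[R]_1) : 'rV[R]_d := \row_i (if i == j then t 0 0 else y 0 i).
have -> : y = iota (\row__ y 0 j).
 by apply/rowP => i; rewrite !mxE; case: eqP => [->|].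
have iotaE : forall (k : 'I_1) (h : R) x, iota (h *: delta_mx 0 k + x) = h *: delta_mx 0 j + iota x.
 move=> k h t; apply/rowP => i; rewrite !mxE (ord1 k) eqxx /=.
 by case: (i == j); rewrite ?mulr1 ?mulr0 ?add0r.
rewrite -[LHS](@Dw_embed _ _ _ iota (fun=> j) (fun y => monomial a y) [:: ord0] _ iotaE).
have E : (fun y => monomial a y) \o iota = (fun t => C * t 0 0 ^+ a j).
 apply/funext => t; rewrite /= /monomial (bigD1 j) //= mxE eqxx mulrC; congr (_ * _).
 by apply: eq_bigr => i /negPf ij; rewrite mxE ij.
rewrite E (DwZ openT [:: ord0] C (smoothX openT (a j) (smooth_coord (0 : 'I_1) openT)) I) Dpow mulrCA; congr (_ * _).
rewrite /monomial (bigD1 j) //= !mxE eqxx subn1 mulrC; congr (_ * _).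
by apply: eq_bigr => i /negPf ij; rewrite mxE ij subn0.
Qed.

Lemma Dw_monomial_bound a w y (eta : R) : `|y| <= eta ->
 `|Dw w (fun y => monomial a y) y| <= ((\sum_i a i) ^_ (size w))%:R * eta ^+ (\sum_i a i - size w).
Proof.
move=> ye; have e0 : 0 <= eta by exact: le_trans ye.
elim/last_ind: w a => [|w j IHw] a.
 rewrite Dw_nil /= ffactn0 mul1r subn0 /monomial normr_prod -prodrXr.
 apply: ler_prod => i _; rewrite normr_ge0 normrX /=; apply: lerXn2r; rewrite ?nnegrE //.
 exact: le_trans (coord_le_norm _ _) ye.
rewrite Dw_rcons.
have -> : Dw [:: j] (fun y => monomial a y) = fun y => (a j)%:R * monomial (fun i => (a i - (i == j))%N) y.
 by apply/funext => z; exact: Dw1_monomial.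
rewrite (DwZ openT w _ (ganalytic_monomial _).1 I) normrM normr_nat size_rcons.
have [aj0|aj] := posnP (a j); first by rewrite aj0 mul0r mulr_ge0 ?exprn_ge0.
have Es : (\sum_i (a i - (i == j)) = (\sum_i a i).-1)%N.
 rewrite [in RHS](bigD1 j) //= (bigD1 j) //= eqxx subn1 -[in RHS](prednK aj) /=; congr (_ + _)%N.
 by apply: eq_bigr => i /negPf ->; rewrite subn0.
have aS : (a j <= \sum_i a i)%N by rewrite (bigD1 j) //= leq_addr.
apply: le_trans (ler_wpM2l (ler0n R (a j)) (IHw _)) _.
rewrite Es ffactnS natrM mulrA; apply: ler_pM; rewrite ?mulr_ge0 ?exprn_ge0 //.
 by apply: ler_wpM2r; rewrite // ler_nat.
by rewrite -subn1 -subnDA add1n.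
Qed.

Definition hompart c (k : nat) y : R :=
 \sum_(a : {ffun 'I_d -> 'I_k.+1} | (\sum_i (a i : nat) == k)%N)
   c (fun i => a i : nat) * monomial (fun i => a i : nat) y.

Lemma psum_truncS c n y : psum_trunc c n.+1 y = psum_trunc c n y + hompart c n.+1 y.
Proof.
rewrite /psum_trunc (bigID (fun a : {ffun 'I_d -> 'I_n.+2} => (\sum_i (a i : nat) == n.+1)%N)) /= addrC.
congr (_ + _); last first.
 by apply: eq_bigl => a; case: eqP => [->|_]; rewrite ?leqnn ?andbF ?andbT.
pose h (b : {ffun 'I_d -> 'I_n.+1}) : {ffun 'I_d -> 'I_n.+2} := [ffun i => widen_ord (leqnSn n.+1) (b i)].
pose h' (a : {ffun 'I_d -> 'I_n.+2}) : {ffun 'I_d -> 'I_n.+1} := [ffun i => inord (a i)].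
have hval b : (fun i => h b i : nat) = (fun i => b i : nat) by apply/funext => i; rewrite ffunE.
rewrite (reindex_onto h h') /=.
 apply: eq_big => [b|b _]; last by rewrite hval.
 have -> : h' (h b) == b.
  by apply/eqP/ffunP => i; rewrite !ffunE; apply/val_inj; rewrite /= inordK.
 have -> : (\sum_i (h b i : nat) = \sum_i (b i : nat))%N by apply: eq_bigr => i _; rewrite ffunE.
 by rewrite andbT andbC -ltn_neqAle ltnS.
move=> a /andP[an1 an2]; have an : (\sum_i (a i : nat) <= n)%N by rewrite -ltnS ltn_neqAle an2.
apply/ffunP => i; rewrite !ffunE; apply/val_inj; rewrite /= inordK // ltnS.
by apply: leq_trans an; rewrite (bigD1 i) //= leq_addr.
Qed.

Lemma psum_truncE c n y : psum_trunc c n y = \sum_(k < n.+1) hompart c k y.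
Proof.
elim: n => [|n IHn]; last by rewrite psum_truncS IHn [RHS]big_ord_recr.
rewrite big_ord1 /psum_trunc /hompart; apply: eq_bigl => a.
by rewrite leqn0.
Qed.

Lemma smooth_hompart c k : smooth_on setT (hompart c k).
Proof.
apply: (proj1 (_ : ganalytic _)).
by apply: ganalytic_sum => a _; apply: ganalyticZ; exact: ganalytic_monomial.
Qed.

Lemma Dw_hompart_bound c k w y (eta : R) : `|y| <= eta ->
 `|Dw w (hompart c k) y| <= hompart (fun a => `|c a|) k (\row__ 1) * (k ^_ (size w))%:R * eta ^+ (k - size w).
Proof.
move=> ye; rewrite /hompart.
have sM (a : {ffun 'I_d -> 'I_k.+1}) : smooth_on setT
  (fun y => c (fun i => a i : nat) * monomial (fun i => a i : nat) y).
 by apply: (proj1 (_ : ganalytic _)); apply: ganalyticZ; exact: ganalytic_monomial.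
rewrite (Dw_sum openT _ _ w sM I) -mulrA mulr_suml; apply: le_trans (ler_norm_sum _ _ _) _.
apply: ler_sum => a /eqP ak; rewrite (DwZ openT w _ (ganalytic_monomial _).1 I) normrM.
rewrite [monomial _ (\row__ 1)]big1 ?mulr1; last by move=> i _; rewrite mxE expr1n.
by apply: ler_wpM2l => //; have := Dw_monomial_bound (fun i => a i : nat) w ye; rewrite ak.
Qed.

Lemma hompart_scale c k (rho : R) : hompart c k (\row__ rho) = rho ^+ k * hompart c k (\row__ 1).
Proof.
rewrite /hompart mulr_sumr; apply: eq_bigr => a /eqP ak.
rewrite mulrCA; congr (_ * _); rewrite /monomial.
rewrite [X in _ * X]big1 ?mulr1; last by move=> i _; rewrite mxE expr1n.
by under eq_bigr do rewrite mxE; rewrite prodrXr ak.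
Qed.

Lemma analytic_local (g : 'rV[R]_d -> R) x (V : set 'rV[R]_d) : analytic_on V g -> V x ->
 exists r C : R, [/\ 0 < r, 0 <= C, smooth_on (ball x r) g & forall y, ball x r y -> abound C g y].
Proof.
move=> ag Vx; have [r [c [r0 gP]]] := ag x Vx.
pose rho := r / 2; have rho0 : 0 < rho by rewrite divr_gt0.
pose one : 'rV[R]_d := \row__ rho.
have onex : ball x r (x + one).
 rewrite -ball_normE /ball_ /= opprD addrA subrr sub0r normrN [ltLHS]mx_normrE.
 apply: bigmax_lt => // -[a b] _ /=; by rewrite mxE gtr0_norm // /rho ltr_pdivrMr // ltr_pMr // ltr1n.
have [ab _] := gP _ onex.
have oneE : \row_i `|(x + one) 0 i - x 0 i| = one.
 by apply/rowP => i; rewrite !mxE addrAC subrr add0r gtr0_norm.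
rewrite oneE in ab.
have [B [_ BP]] := cvg_seq_bounded ab.
pose B1 := `|B| + 1.
have B0 : 0 <= B1 by exact: addr_ge0.
have hom0 k : 0 <= hompart (fun a => `|c a|) k one.
 apply: sumr_ge0 => a _; rewrite mulr_ge0 // /monomial; apply: prodr_ge0 => i _.
 by rewrite mxE exprn_ge0 // ltW.
have homB k : hompart (fun a => `|c a|) k (\row__ 1) * rho ^+ k <= B1.
 rewrite mulrC -hompart_scale; apply: (@le_trans _ _ (psum_trunc (fun a => `|c a|) k one)).
  by rewrite psum_truncE big_ord_recr /= lerDr sumr_ge0.
 apply: le_trans (ler_norm _) _; apply: (BP B1) => //.
 by rewrite /B1; apply: le_lt_trans (ler_norm B) _; rewrite ltrDl.
pose A := ball x (rho / 8); have oA : open A by exact: ball_open.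
pose gk k y := hompart c k (y - x).
have sgk k : smooth_on A (gk k).
 exact: smooth_on_sub (smooth_shift x (smooth_hompart c k)).
pose C (w : seq 'I_d) := B1 * (8 / rho) ^+ size w * (size w)`!%:R.
have C0 w : 0 <= C w by rewrite !mulr_ge0 ?exprn_ge0 // divr_ge0 // ltW.
have gkB w k y : A y -> `|Dw w (gk k) y| <= C w / 2 ^+ k.
 move=> Ay; rewrite /gk (Dw_shift (hompart c k)).
 have ye : `|y - x| <= rho / 8 by move: Ay; rewrite /A ballE => /ltW.
 apply: le_trans (Dw_hompart_bound c k w ye) _.
 have [kw|wk] := ltnP k (size w); first by rewrite ffact_small // mulr0 mul0r divr_ge0 // exprn_ge0.
 set h := hompart _ _ _; have hB : h * rho ^+ k <= B1 := homB k.
 have h0 : 0 <= h.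
  apply: sumr_ge0 => a _; rewrite mulr_ge0 // /monomial; apply: prodr_ge0 => i _.
  by rewrite mxE expr1n.
 have fB : (k ^_ size w)%:R <= 2 ^+ k * (size w)`!%:R :> R.
  by rewrite -natrX -natrM ler_nat -bin_ffact leq_mul2r bin_le_pow2 orbT.
 have e0 : 0 <= (rho / 8) ^+ (k - size w) by rewrite exprn_ge0 // divr_ge0 // ltW.
 apply: (@le_trans _ _ (h * (2 ^+ k * (size w)`!%:R) * (rho / 8) ^+ (k - size w))).
  by apply: ler_wpM2r => //; apply: ler_wpM2l.
 have e8 : (rho / 8) ^+ (k - size w) = rho ^+ k * (8 / rho) ^+ size w / 8 ^+ k.
  rewrite -[in RHS](subnK wk) !exprD !expr_div_n; field.
  by rewrite !expf_neq0 // gt_eqF.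
 rewrite e8 ler_pdivlMr ?exprn_gt0 //.
 have -> : h * (2 ^+ k * (size w)`!%:R) * (rho ^+ k * (8 / rho) ^+ size w / 8 ^+ k) * 2 ^+ k =
   (h * rho ^+ k) * ((8 / rho) ^+ size w * (size w)`!%:R) * (4 ^+ k / 8 ^+ k).
  have -> : 4 ^+ k = 2 ^+ k * 2 ^+ k :> R by rewrite -exprMn -natrM.
  by move: ((8 / rho) ^+ _) (_`!%:R) => *; ring.
 have q0 : 0 <= (8 / rho) ^+ size w * (size w)`!%:R by rewrite mulr_ge0 // exprn_ge0 // divr_ge0 // ltW.
 have q1 : 4 ^+ k / 8 ^+ k <= 1 :> R.
  by rewrite ler_pdivrMr ?exprn_gt0 // mul1r; apply: lerXn2r; rewrite ?nnegrE // ler_nat.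
 have hr : 0 <= h * rho ^+ k by rewrite mulr_ge0 // exprn_ge0 // ltW.
 rewrite /C -[leRHS]mulrA; apply: le_trans (ler_wpM2r q0 hB).
 by apply: ler_piMr => //; exact: mulr_ge0.
have [F [sF FP]] := smooth_series oA sgk gkB.
have Fg y : A y -> F y = g y.
 move=> Ay; have By : ball x r y.
  move: Ay; rewrite /A -!ball_normE /ball_ /= => /lt_le_trans; apply.
  by rewrite /rho; move: r0; lra.
 have [_ cg] := gP y By; apply: (cvg_unique (@Rhausdorff R) _ cg).
 have := FP [::] y Ay; rewrite Dw_nil -(cvg_shiftS _); apply: cvg_trans.
 apply: near_eq_cvg; apply: nearW => n /=.
 by rewrite psum_truncE big_mkord; apply: eq_bigr => k _; rewrite Dw_nil.
have sg : smooth_on A g by apply: smooth_on_ext sF => // y Ay; rewrite Fg.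
exists (rho / 8), (2 * B1 + 8 / rho); split=> //; first by rewrite divr_gt0.
 have r8 : 0 <= 8 / rho by rewrite divr_ge0 // ltW.
 exact: addr_ge0 (mulr_ge0 (ler0n R 2) B0) r8.
move=> y Ay; apply: abound_scaled; [by rewrite mulr_ge0 | by rewrite divr_ge0 // ltW | move=> w].
rewrite -(@Dw_ext _ _ A F g w y oA Fg Ay).
apply: (@cvg_seq_norm_le R _ _ _ 0 _ (FP w y Ay)) => n _.
apply: le_trans (ler_norm_sum _ _ _) _.
apply: (@le_trans _ _ (\sum_(0 <= k < n) C w / 2 ^+ k)).
 by apply: ler_sum => k _; exact: gkB.
have -> : 2 * B1 * (8 / rho) ^+ size w * (size w)`!%:R = C w * 2 by rewrite /C; ring.
rewrite -mulr_sumr; apply: ler_wpM2l => //; case: n => [|n]; first by rewrite big_nil.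
rewrite big_mkord (reindex_inj rev_ord_inj) /=; apply: le_trans (geometric_half_le n).
by apply: ler_sum => k _; rewrite subSS.
Qed.

End PowerSeries.

Section SplitCoordinates.
Context {R : realType} {n : nat}.
Implicit Types (x : 'rV[R]_(1 + n)) (y : 'rV[R]_n) (z : R).

Definition z0 : 'I_(1 + n) := lshift n ord0.
Definition zc x : R := x 0 z0.
Definition yc x : 'rV[R]_n := rsubmx x.
Definition zy z y : 'rV[R]_(1 + n) := row_mx (\row__ z) y.

Lemma zc_zy z y : zc (zy z y) = z. Proof. by rewrite /zc /zy row_mxEl mxE. Qed.
Lemma yc_zy z y : yc (zy z y) = y. Proof. exact: row_mxKr. Qed.
Lemma zy_r z y i : zy z y 0 (rshift 1 i) = y 0 i. Proof. exact: row_mxEr. Qed.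
Lemma ycE x i : yc x 0 i = x 0 (rshift 1 i). Proof. by rewrite mxE. Qed.

Lemma zyP x y z : zc x = z -> yc x = y -> x = zy z y.
Proof.
move=> <- <-; apply/rowP => j; case: (split_ordP j) => i ->.
 by rewrite row_mxEl mxE /zc (ord1 i).
by rewrite row_mxEr mxE.
Qed.

Lemma zy_eta x : zy (zc x) (yc x) = x. Proof. exact/esym/zyP. Qed.

Lemma zy00 : zy 0 0 = 0. Proof. by apply/esym/zyP; [rewrite /zc mxE | apply/rowP => i; rewrite ycE !mxE]. Qed.

Lemma zcB x x' : zc (x - x') = zc x - zc x'. Proof. by rewrite /zc !mxE. Qed.

Lemma ycB x x' : yc (x - x') = yc x - yc x'.
Proof. by apply/rowP => i; rewrite ycE !mxE. Qed.

Lemma zyB z z' y y' : zy z y - zy z' y' = zy (z - z') (y - y').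
Proof. by apply: zyP; rewrite ?zcB ?ycB ?zc_zy ?yc_zy. Qed.

Lemma zc_le x : `|zc x| <= `|x|. Proof. exact: coord_le_norm. Qed.

Lemma yc_le x : `|yc x| <= `|x|.
Proof.
apply: row_norm_le => // i; rewrite ycE.
exact: coord_le_norm.
Qed.

Lemma zy_le z y (r : R) : `|z| <= r -> `|y| <= r -> `|zy z y| <= r.
Proof.
move=> zr yr; apply: row_norm_le => [|j]; first exact: le_trans zr.
case: (split_ordP j) => i ->; first by rewrite row_mxEl mxE.
by rewrite row_mxEr; exact: le_trans (coord_le_norm _ _) yr.
Qed.

Lemma zy_lt z y (r : R) : `|z| < r -> `|y| < r -> `|zy z y| < r.
Proof.
move=> zr yr; have h : `|zy z y| <= Num.max `|z| `|y| by apply: zy_le; rewrite le_max lexx ?orbT.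
by apply: le_lt_trans h _; rewrite gt_max zr.
Qed.

Lemma ganalytic_zc : ganalytic zc. Proof. exact: ganalytic_coord. Qed.

Lemma ganalyticv_yc : ganalyticv yc.
Proof. by move=> i; under eq_fun do rewrite ycE; exact: ganalytic_coord. Qed.

Lemma ganalyticv_zy m (f : 'rV[R]_m -> R) (g : 'rV[R]_m -> 'rV[R]_n) :
 ganalytic f -> ganalyticv g -> ganalyticv (fun s => zy (f s) (g s)).
Proof.
move=> af ag j; case: (split_ordP j) => i ->.
 by under eq_fun do rewrite row_mxEl mxE.
by under eq_fun do rewrite row_mxEr; exact: ag.
Qed.

Lemma smooth_zy {V : normedModType R} (A : set V) (f : V -> R) (g : V -> 'rV[R]_n) : open A ->
 smooth_on A f -> smooth_on A g -> smooth_on A (fun s => zy (f s) (g s)).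
Proof.
move=> oA sf sg; apply/(smooth_on_row _ oA) => j; case: (split_ordP j) => i ->.
 by under eq_fun do rewrite row_mxEl mxE.
by under eq_fun do rewrite row_mxEr; exact: (proj1 (smooth_on_row g oA) sg i).
Qed.

End SplitCoordinates.

Lemma MVT_gradient {R : realType} {N : nat} (A : set 'rV[R]_N) (f : 'rV[R]_N -> R) a b :
 open A -> smooth_on A f -> (forall s : R, 0 <= s <= 1 -> A (s *: (b - a) + a)) ->
 exists2 s : R, 0 <= s <= 1 &
  f b - f a = \sum_i (b - a) 0 i * Dw [:: i] f (s *: (b - a) + a).
Proof.
move=> oA sf As.
have df (s : R) : 0 <= s <= 1 -> derivable f (s *: (b - a) + a) (b - a).
 by move=> s01; exact: smooth_derivable sf (As s s01).
have [s s01] := MVT_line ler01 df.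
rewrite scale1r subrK mul1r => E; exists s => //.
by rewrite E (derive_gradient _ oA sf (As s s01)).
Qed.

Section ImplicitGraph.
Context {R : realType} {n : nat}.
Variable k : 'rV[R]_(1 + n) -> R.
Hypotheses (ak : ganalytic k) (k0 : k 0 = 0) (kz0 : 0 < Dw [:: z0] k 0).

Let sk : smooth_on setT k. Proof. exact: ak.1. Qed.
Let kz := Dw [:: z0] k.
Let c0 := kz 0 / 2.
Let c00 : 0 < c0. Proof. exact: divr_gt0. Qed.

Let etaP : exists2 eta : R, 0 < eta & forall x, `|x| <= eta -> c0 <= kz x.
Proof.
have cz : {for 0, continuous kz} := smooth_continuous (Dw_smooth [:: z0] sk) I.
have /cvgrPdist_le /(_ _ c00) /nbhs_ballP [e /= e0 eP] := cz.
exists (e / 2) => [|x xe]; first by rewrite divr_gt0.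
have : `|kz 0 - kz x| <= c0.
 by apply: eP; rewrite ball0E; apply: le_lt_trans xe _; rewrite ltr_pdivrMr // ltr_pMr // ltr1n.
by rewrite ler_norml /c0 => /andP[_]; lra.
Qed.

Let eta : R := s2val (cid2 etaP).
Let eta0 : 0 < eta. Proof. by rewrite /eta; case: (cid2 _). Qed.
Let kzc x : `|x| <= eta -> c0 <= kz x. Proof. by rewrite /eta; case: (cid2 _) => e ? H; exact: H. Qed.

Let conv (a b : 'rV[R]_(1 + n)) (r : R) : `|a| <= r -> `|b| <= r ->
 forall s : R, 0 <= s <= 1 -> `|s *: (b - a) + a| <= r.
Proof.
move=> ar br s /andP[s0 s1].
have -> : s *: (b - a) + a = (1 - s) *: a + s *: b.
 by rewrite scalerBr scalerBl scale1r addrC addrA addrAC.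
apply: le_normD; rewrite !normrZ !ger0_norm ?subr_ge0 //.
have -> : r = (1 - s) * r + s * r by ring.
by apply: lerD; apply: ler_wpM2l => //; rewrite subr_ge0.
Qed.

Let vert : exists2 L : R, 0 <= L & forall a b, `|a| <= eta -> `|b| <= eta -> k a = 0 -> k b = 0 ->
 `|b - a| <= L * `|yc b - yc a|.
Proof.
have [M M0 MP] := ak.2 eta.
have M2 i x : `|x| <= eta -> `|Dw [:: i] k x| <= M ^+ 2.
 by move=> xe; have := MP x xe [:: i]; rewrite mulr1.
exists (n%:R * M ^+ 2 / c0 + 1).
 by rewrite addr_ge0 // divr_ge0 ?mulr_ge0 ?exprn_ge0 // ltW.
move=> a b ae be ka kb.
have [s s01] := @MVT_gradient R (1 + n) setT k a b openT sk (fun _ _ => I).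
rewrite ka kb subrr; set c := s *: _ + _; have ce : `|c| <= eta by exact: conv.
rewrite big_split_ord /= big_ord1 => /esym/eqP; rewrite addr_eq0 => /eqP E.
have Ez : `|zc b - zc a| * c0 <= n%:R * M ^+ 2 * `|yc b - yc a|.
 apply: (@le_trans _ _ `|(b - a) 0 z0 * kz c|).
  rewrite normrM; apply: ler_pM => //; first exact: ltW.
   by rewrite !mxE.
  exact: le_trans (kzc ce) (ler_norm _).
 rewrite E normrN; apply: le_trans (ler_norm_sum _ _ _) _.
 apply: (@le_trans _ _ (\sum_(i < n) `|yc b - yc a| * M ^+ 2)).
  apply: ler_sum => i _; rewrite normrM; apply: ler_pM => //; last exact: M2.
  have -> : (b - a) 0 (rshift 1 i) = (yc b - yc a) 0 i by rewrite !mxE.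
  exact: coord_le_norm.
 rewrite sumr_const card_ord -[leLHS]mulr_natl.
 by apply: le_eq; ring.
have -> : b - a = zy (zc b - zc a) (yc b - yc a) by rewrite -zyB !zy_eta.
have y0 : 0 <= `|yc b - yc a| by [].
have q0 : 0 <= n%:R * M ^+ 2 / c0 by rewrite divr_ge0 ?mulr_ge0 ?exprn_ge0 // ltW.
apply: zy_le; rewrite mulrDl mul1r.
 rewrite -(ler_pM2r c00) mulrDl; apply: le_trans Ez _.
 by rewrite [_ / c0 * _]mulrAC divfK ?gt_eqF // lerDl mulr_ge0 // ltW.
by rewrite lerDr mulr_ge0.
Qed.

Let k_incr z z' y : `|zy z y| <= eta -> `|zy z' y| <= eta -> z < z' -> k (zy z y) < k (zy z' y).
Proof.
move=> e1 e2 zz.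
have [s s01] := @MVT_gradient R (1 + n) setT k (zy z y) (zy z' y) openT sk (fun _ _ => I).
set c := s *: _ + _; have ce : `|c| <= eta by exact: conv.
rewrite zyB subrr big_split_ord /= big_ord1 big1 ?addr0; last first.
 by move=> i _; rewrite zy_r mxE mul0r.
rewrite -/(zc _) zc_zy => E; rewrite -subr_gt0 E mulr_gt0 ?subr_gt0 //.
exact: lt_le_trans c00 (kzc ce).
Qed.

Let h := eta / 2.
Let h0 : 0 < h. Proof. exact: divr_gt0. Qed.
Let he : h <= eta. Proof. by rewrite /h ler_pdivrMr // ler_peMr ?ler1n // ltW. Qed.

Let ck x : {for x, continuous k}. Proof. exact: (smooth_continuous sk I). Qed.

Let rhoP : exists2 rho : R, 0 < rho <= eta & forall y, `|y| <= rho -> k (zy (- h) y) < 0 < k (zy h y).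
Proof.
have nz (t : R) : `|t| <= eta -> `|zy t (0 : 'rV[R]_n)| <= eta by move=> te; apply: zy_le; rewrite ?normr0 // ltW.
have nh : `|h| <= eta by rewrite gtr0_norm.
have n0 : `|0 : R| <= eta by rewrite normr0 ltW.
have kp : 0 < k (zy h 0).
 by rewrite -k0 -zy00; apply: k_incr => //; apply: nz.
have km : k (zy (- h) 0) < 0.
 by rewrite -[ltRHS]k0 -zy00; apply: k_incr; rewrite ?oppr_lt0 //; apply: nz; rewrite ?normrN.
have /cvgrPdist_lt /(_ _ kp) /nbhs_ballP [e1 /= e10 e1P] := @ck (zy h 0).
have km' : 0 < - k (zy (- h) 0) by rewrite oppr_gt0.
have /cvgrPdist_lt /(_ _ km') /nbhs_ballP [e2 /= e20 e2P] := @ck (zy (- h) 0).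
pose e := Num.min e1 (Num.min e2 eta).
have e0 : 0 < e by rewrite !lt_min e10 e20.
exists (e / 2).
 rewrite divr_gt0 //= ler_pdivrMr //; apply: (@le_trans _ _ (eta * 1)); first by rewrite mulr1 !ge_min lexx !orbT.
 by apply: ler_wpM2l; [exact: ltW | rewrite ler1n].
move=> y ye; have ye1 : `|y| < e by apply: le_lt_trans ye _; rewrite ltr_pdivrMr // ltr_pMr // ltr1n.
have B (t : R) e' : e <= e' -> ball (zy t 0) e' (zy t y).
 move=> ee; rewrite -ball_normE /ball_ /= zyB subrr sub0r; apply: lt_le_trans ee.
 by apply: zy_lt; rewrite ?normr0 ?normrN.
apply/andP; split.
 have := e2P _ (B (- h) e2 _); rewrite /= !ge_min lexx orbT => /(_ isT).
 by rewrite ltr_norml => /andP[H _]; lra.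
have := e1P _ (B h e1 _); rewrite /= ge_min lexx => /(_ isT).
by rewrite ltr_norml => /andP[_]; lra.
Qed.

Let rho : R := s2val (cid2 rhoP).
Let rhoe : 0 < rho <= eta. Proof. by rewrite /rho; case: (cid2 _). Qed.
Let rho0 : 0 < rho. Proof. by have /andP[] := rhoe. Qed.
Let rho_le : rho <= eta. Proof. by have /andP[] := rhoe. Qed.
Let signs y : `|y| <= rho -> k (zy (- h) y) < 0 < k (zy h y).
Proof. by rewrite /rho; case: (cid2 _) => e ? H; exact: H. Qed.

Let psiP y : exists z : R, `|y| <= rho -> `|z| <= h /\ k (zy z y) = 0.
Proof.
have [yr|yr] := pselect (`|y| <= rho); last by exists 0.
have cz : {within `[- h, h], continuous (fun z => k (zy z y))}.
 apply: continuous_subspaceT => z.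
 have sz : smooth_on setT (fun z : R => zy z y).
  apply: smooth_zy; [exact: openT | exact: smooth_idR | exact: smooth_cst].
 exact: (@continuous_comp _ _ _ (fun z : R => zy z y) k z (smooth_continuous sz I) (@ck _)).
have /andP[k1 k2] := signs yr.
have [||z] := @IVT R (fun z => k (zy z y)) (- h) h 0 _ cz.
- by rewrite -subr_ge0 opprK addr_ge0 // ltW.
- by rewrite ge_min (ltW k1) le_max (ltW k2) orbT.
by rewrite in_itv /= -ler_norml => zh kz0'; exists z.
Qed.

Let psi0 y : R := sval (cid (psiP y)).
Let psi0h y : `|y| <= rho -> `|psi0 y| <= h.
Proof. by move=> yr; rewrite /psi0; case: (cid _) => z /= /(_ yr) []. Qed.
Let psi0k y : `|y| <= rho -> k (zy (psi0 y) y) = 0.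
Proof. by move=> yr; rewrite /psi0; case: (cid _) => z /= /(_ yr) []. Qed.

Let Gr y := zy (psi0 y) y.
Let Gre y : `|y| <= rho -> `|Gr y| <= eta.
Proof.
by move=> yr; apply: zy_le; [exact: le_trans (psi0h yr) he | exact: le_trans rho_le].
Qed.

Let uniq_zero z y : `|zy z y| <= eta -> `|y| <= rho -> k (zy z y) = 0 -> z = psi0 y.
Proof.
move=> ze yr kz1; have [zp|zp|//] := ltgtP z (psi0 y).
 by have := k_incr ze (Gre yr) zp; rewrite psi0k // kz1 ltxx.
by have := k_incr (Gre yr) ze zp; rewrite psi0k // kz1 ltxx.
Qed.

Let psi00 : psi0 0 = 0.
Proof. by apply/esym/uniq_zero; rewrite ?zy00 ?normr0 // ltW. Qed.

Let A : set 'rV[R]_n := ball 0 rho.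
Let oA : open A. Proof. exact: ball_open. Qed.
Let Arho y : A y -> `|y| <= rho.
Proof. by rewrite /A ball0E => /ltW. Qed.

Let B : set 'rV[R]_(1 + n) := [set x | 0 < kz x].
Let oB : open B.
Proof.
apply: (@open_comp _ _ kz [set r | 0 < r]); last exact: open_gt.
by move=> x _; exact: (smooth_continuous (Dw_smooth [:: z0] sk) I).
Qed.
Let BGr y : A y -> B (Gr y).
Proof. by move=> /Arho yr; exact: lt_le_trans c00 (kzc (Gre yr)). Qed.

Let Gr_cont y : A y -> {for y, continuous Gr}.
Proof.
move=> Ay; have [L L0 LP] := vert.
suff : Gr @ (nbhs y) --> Gr y by [].
have FF : Filter (nbhs y) by typeclasses eauto.
apply/cvgrPdist_lt => e e0; have e1 : 0 < e / (L + 1) by rewrite divr_gt0 // ltr_wpDl.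
have nA : nbhs y (A `&` ball y (e / (L + 1))).
 by apply: filterI; [exact: open_nbhs_nbhs | exact: nbhsx_ballx].
apply: filterS nA => y' [Ay' By']; have yr := Arho Ay; have yr' := Arho Ay'.
have := LP _ _ (Gre yr') (Gre yr) (psi0k yr') (psi0k yr); rewrite !yc_zy => H.
apply: le_lt_trans H _; move: By'; rewrite -ball_normE /ball_ /= ltr_pdivlMr ?ltr_wpDl // => By'.
by apply: le_lt_trans By'; rewrite mulrC; apply: ler_wpM2l => //; rewrite lerDl.
Qed.

Let slope i x : R := - (Dw [:: rshift 1 i] k x / kz x).
Let sslope i : smooth_on B (slope i).
Proof.
have s1 : smooth_on B (Dw [:: rshift 1 i] k) by exact: smooth_on_sub (Dw_smooth _ sk).
have s2 : smooth_on B kz by exact: smooth_on_sub (Dw_smooth _ sk).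
have nz x : B x -> kz x != 0 by move=> Bx; rewrite gt_eqF.
exact: (smoothN oB (smoothM oB s1 (smoothV oB nz s2))).
Qed.

Let psi0_derive i y : A y -> is_derive y (delta_mx 0 i) psi0 (slope i (Gr y)).
Proof.
move=> Ay.
suff H : (fun t : R => t^-1 *: ((psi0 \o shift y) (t *: delta_mx 0 i) - psi0 y)) @ 0^' --> slope i (Gr y).
 by split; [apply/cvg_ex; eexists; exact: H | exact: cvg_lim H].
apply/cvgrPdist_lt => e e0.
have cs : {for Gr y, continuous (slope i)} := smooth_continuous (sslope i) (BGr Ay).
have /cvgrPdist_lt /(_ _ e0) /nbhs_ballP [d1 /= d10 d1P] := cs.
have /cvgrPdist_lt /(_ _ d10) nG := Gr_cont Ay.
have : nbhs y (A `&` [set y' | `|Gr y - Gr y'| < d1]).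
 by apply: filterI; [exact: open_nbhs_nbhs | exact: nG].
move=> /nbhs_ballP [d2 /= d20 d2P].
have d2t : (0 : R)^' (ball 0 d2 : set R) by apply: nbhs_dnbhs; exact: nbhsx_ballx.
have tn : (0 : R)^' [set t : R | t != 0] by apply: withinT; typeclasses eauto.
apply: filterS2 d2t tn => t Bt tn0; set y' := t *: delta_mx 0 i + y.
have By' : ball y d2 y'.
 rewrite -ball_normE /ball_ /= opprD addrCA subrr addr0 normrN normrZ.
 have dn : `|delta_mx 0 i : 'rV[R]_n| <= 1.
  exact: delta_norm_le1.
 apply: le_lt_trans (_ : `|t| * 1 < d2); first exact: ler_wpM2l.
 by move: Bt; rewrite mulr1 ball0E.
have [Ay' Gy'] := d2P _ By'.
have yr := Arho Ay; have yr' := Arho Ay'.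
have [s s01] := @MVT_gradient R (1 + n) setT k (Gr y) (Gr y') openT sk (fun _ _ => I).
rewrite (psi0k yr) (psi0k yr') subrr; set c := s *: _ + _ => E.
have ce : `|c| <= eta by apply: conv => //; exact: Gre.
have Bc : B c by exact: lt_le_trans c00 (kzc ce).
have kzn : kz c != 0 by rewrite gt_eqF.
have Es : t^-1 * (psi0 y' - psi0 y) = slope i c.
 move: E; rewrite zyB big_split_ord /= big_ord1 -[zy _ _ 0 (lshift _ _)]/(zc _) zc_zy.
 rewrite (bigD1 i) //= big1 ?addr0 => [|j ji]; last first.
  by rewrite zy_r !mxE (negPf ji) andbF mulr0 add0r subrr mul0r.
 rewrite zy_r !mxE !eqxx mulr1 addrK => /esym/eqP; rewrite addr_eq0 => /eqP E.
 have E' : (psi0 y' - psi0 y) * kz c = - (t * Dw [:: rshift 1 i] k c) := E.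
 by apply: (mulIf kzn); rewrite -mulrA E' mulrN mulKf // /slope mulNr divfK.
rewrite /= /GRing.scale /= Es; apply: d1P; rewrite -ball_normE /ball_ /=.
have -> : Gr y - c = s *: (Gr y - Gr y').
 by rewrite /c opprD addrCA subrr addr0 -scalerN opprB.
have /andP[s0 s1] := s01; rewrite normrZ ger0_norm //; apply: le_lt_trans Gy'.
by rewrite ler_piMl.
Qed.

Let Xf i (F : 'rV[R]_(1 + n) -> R) x : R := Dw [:: rshift 1 i] F x + Dw [:: z0] F x * slope i x.

Let sXf i F : smooth_on B F -> smooth_on B (Xf i F).
Proof.
move=> sF; exact: (smoothD oB (Dw_smooth _ sF) (smoothM oB (Dw_smooth _ sF) (sslope i))).
Qed.

Let derive_graph i F y : smooth_on B F -> A y -> is_derive y (delta_mx 0 i) (F \o Gr) (Xf i F (Gr y)).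
Proof.
move=> sF Ay; have [dp ep] := psi0_derive i Ay.
have dG : derivable Gr y (delta_mx 0 i).
 apply/derivable_mxP => a j; rewrite (ord1 a); case: (split_ordP j) => l ->.
  have -> : (fun x => Gr x 0 (lshift n l)) = psi0 by apply/funext => x; rewrite /Gr /zy row_mxEl mxE.
  exact: dp.
 have -> : (fun x => Gr x 0 (rshift 1 l)) = (fun x => x 0 l) by apply/funext => x; exact: zy_r.
 exact: (smooth_derivable (smooth_coord l openT) I).
have E := @is_derive_comp R _ _ F Gr B y (delta_mx 0 i) oB (BGr Ay)
 (fun x j Bx => smooth_derivable sF Bx)
 (fun j => smooth_continuous (smooth_derive _ sF) (BGr Ay)) dG.
have E0 : derive Gr y (delta_mx 0 i) 0 (lshift n ord0) = slope i (Gr y).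
 transitivity (derive (fun x => Gr x 0 (lshift n ord0)) y (delta_mx 0 i)); first by rewrite (derive_mx dG) mxE.
 have -> : (fun x => Gr x 0 (lshift n ord0)) = psi0 by apply/funext => x; rewrite /Gr /zy row_mxEl mxE.
 exact: ep.
have E1 l : derive Gr y (delta_mx 0 i) 0 (rshift 1 l) = (l == i)%:R.
 transitivity (derive (fun x => Gr x 0 (rshift 1 l)) y (delta_mx 0 i)); first by rewrite (derive_mx dG) mxE.
 have -> : (fun x => Gr x 0 (rshift 1 l)) = (fun x => x 0 l) by apply/funext => x; exact: zy_r.
 by have := @Dw1_coord R n l i y; rewrite Dw1.
apply: (is_derive_eq E); rewrite big_split_ord /= big_ord1 E0 (bigD1 i) //= E1 eqxx mul1r.
rewrite big1 ?addr0 => [|j ji]; last by rewrite E1 (negPf ji) mul0r.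
by rewrite /Xf !Dw1 addrC mulrC.
Qed.

Let Vw : seq 'I_n -> 'rV[R]_(1 + n) -> R := foldr Xf (@zc R n).

Let sVw w : smooth_on B (Vw w).
Proof. by elim: w => [|i w IHw]; [exact: smooth_coord | exact: sXf]. Qed.

Let Dw_psi0 w y : A y -> Dw w psi0 y = Vw w (Gr y).
Proof.
elim: w y => [|i w IHw] y Ay; first by rewrite Dw_nil /= zc_zy.
rewrite Dw_cons (near_eq_derive _ (near_open_eq oA IHw Ay)).
by have [_ ->] := derive_graph i (sVw w) Ay.
Qed.

Let spsi0 : smooth_on A psi0.
Proof.
apply/(smooth_wordsP _ oA) => w; split=> [y Ay|i y Ay].
 have E : \near y, Vw w (Gr y) = Dw w psi0 y.
  by apply: (near_open_eq oA _ Ay) => y' Ay'; rewrite Dw_psi0.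
 apply: (near_eq_continuous_at E).
 exact: (continuous_comp (Gr_cont Ay) (smooth_continuous (sVw w) (BGr Ay))).
apply: (@near_eq_derivable _ _ _ (Vw w \o Gr)).
 by apply: (near_open_eq oA _ Ay) => y' Ay'; rewrite Dw_psi0.
by have [] := derive_graph i (sVw w) Ay.
Qed.

Let psi0_bound : exists2 M, 0 <= M & forall y, A y -> abound M psi0 y.
Proof.
have [M M0 MP] := ak.2 eta; have [Mz Mz0 MzP] := (@ganalytic_zc R n).2 eta.
have [M1 M10 M1P] : exists2 M1, 0 <= M1 & forall x i, `|x| <= eta -> abound M1 (slope i) x.
 have [Md Md0 MdP] : exists2 Md, 0 <= Md & forall i x, `|x| <= eta -> abound Md (Dw [:: i] k) x.
  have aD : ganalyticv (fun x => \row_(i < 1 + n) Dw [:: i] k x).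
   by move=> i; under eq_fun do rewrite mxE; exact: ganalytic_Dw1.
  have [Md Md0 MdP] := ganalyticv_bound eta aD; exists Md => // i x xe w.
  by have := MdP x i xe w; under eq_fun do rewrite mxE.
 pose Mi := c0^-1 + (4 * Md + 2 * c0^-1 * Md ^+ 2).
 have c0i : 0 <= c0^-1 by rewrite invr_ge0 ltW.
 have Mi0 : 0 <= Mi by rewrite !addr_ge0 ?mulr_ge0 ?exprn_ge0.
 pose Mp := 2 * Md * Mi + (Md + 4 * Mi).
 have Mp0 : 0 <= Mp by rewrite !addr_ge0 ?mulr_ge0.
 exists Mp => // x i xe w; have Bx : B x by exact: lt_le_trans c00 (kzc xe).
 have nz y : B y -> kz y != 0 by move=> By; rewrite gt_eqF.
 have skz : smooth_on B kz by exact: smooth_on_sub (Dw_smooth _ sk).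
 have ski : smooth_on B (Dw [:: rshift 1 i] k) by exact: smooth_on_sub (Dw_smooth _ sk).
 have ai : abound Mi (fun y => (kz y)^-1) x.
  apply: (aboundV oB skz Bx nz) => //; first exact: MdP.
  by rewrite gtr0_norm ?invr_gt0 // lef_pV2 ?posrE //; exact: kzc.
 have sV := smoothV oB nz skz.
 have := aboundM oB ski sV Bx Md0 Mi0 (MdP _ _ xe) ai w; rewrite -/Mp.
 have -> : slope i = fun y => -1 * (Dw [:: rshift 1 i] k y / kz y) by apply/funext => y; rewrite mulN1r.
 by rewrite (DwZ oB w (-1) (smoothM oB ski sV) Bx) normrM normrN1 mul1r.
pose r1 := 4 * M1 + Mz; pose sg := r1 * (1 + 2 * M1).
have r10 : 0 <= r1 by rewrite addr_ge0 // mulr_ge0.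
have sg0 : 0 <= sg by rewrite mulr_ge0 // addr_ge0 // mulr_ge0.
have VB w u x : `|x| <= eta -> `|Dw u (Vw w) x| <= Mz * r1 ^+ size u * sg ^+ size w * (size u + size w)`!%:R.
 move=> xe; have Bx : B x by exact: lt_le_trans c00 (kzc xe).
 elim: w u => [|i w IHw] u.
  rewrite expr0 mulr1 addn0; apply: le_trans (MzP x xe u) _; rewrite exprS -!mulrA.
  apply: ler_wpM2l => //; apply: ler_wpM2r => //; apply: lerXn2r; rewrite ?nnegrE //.
  by rewrite lerDr mulr_ge0.
 have sD j : smooth_on B (Dw [:: j] (Vw w)) := Dw_smooth [:: j] (sVw w).
 rewrite /= (DwD oB u (sD _) (smoothM oB (sD _) (sslope i)) Bx).
 set m := size u; set q := size w; set T := Mz * r1 ^+ m.+1 * sg ^+ q * (m + q.+1)`!%:R.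
 have T0 : 0 <= T by rewrite !mulr_ge0 ?exprn_ge0.
 have -> : Mz * r1 ^+ m * sg ^+ q.+1 * (m + q.+1)`!%:R = T + 2 * M1 * T.
  by rewrite /T !exprS /sg; move: (r1 ^+ m) (_ ^+ q) (_`!%:R) => *; ring.
 apply: le_normD; apply: lerD.
  by rewrite -Dw_rcons; have := IHw (rcons u (rshift 1 i)); rewrite size_rcons -/m -/q [(m.+1 + q)%N]addSnnS.
 apply: le_trans (@Dw_mul_bound _ _ B (Dw [:: z0] (Vw w)) (slope i) x
  (fun k => Mz * r1 * sg ^+ q * (r1 ^+ k * (k + q.+1)`!%:R)) (fun k => M1 * (M1 ^+ k * k.+1`!%:R))
  m oB (sD _) (sslope i) Bx _ _ u (leqnn _)) _.
 - move=> v _; rewrite -Dw_rcons; apply: le_trans (IHw _) _; rewrite size_rcons -/q [((size v).+1 + q)%N]addSnnS [r1 ^+ _.+1]exprS.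
  by apply: le_eq; move: (r1 ^+ _) (sg ^+ _) (_`!%:R) => *; ring.
 - move=> v _; apply: le_trans (M1P x i xe v) _; rewrite exprS -mulrA; apply: ler_wpM2l => //.
  by apply: ler_wpM2l; rewrite ?exprn_ge0 // ler_nat factS leq_pmull.
 rewrite leibnizZ.
 have C1 : 0 <= Mz * r1 * sg ^+ q * M1 by rewrite !mulr_ge0 ?exprn_ge0.
 apply: le_trans (ler_wpM2l C1 (@leibniz_fact R r1 M1 q.+1 m M10 _)) _; first by rewrite lerDl.
 by rewrite /T [r1 ^+ m.+1]exprS; apply: le_eq; move: (r1 ^+ _) (sg ^+ _) (_`!%:R) => *; ring.
exists (Mz + sg); first exact: addr_ge0.
move=> y Ay; apply: abound_scaled => // w; rewrite Dw_psi0 //.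
have := VB w [::] (Gr y) (Gre (Arho Ay)).
by rewrite Dw_nil /= expr0 mulr1 add0n.
Qed.

Lemma implicit_graph_pos : exists (r : R) (psi : 'rV[R]_n -> R),
 [/\ 0 < r, ganalytic psi, psi 0 = 0, (forall y, k (zy (psi y) (lamv r 0 y)) = 0) &
  exists2 e : R, 0 < e & forall x, `|x| < e -> k x = 0 ->
   exists2 y, `|y| <= 1 & x = zy (psi y) (lamv r 0 y)].
Proof.
pose r := rho / 2; have r0 : 0 < r by rewrite divr_gt0.
have rr : r < rho by rewrite /r ltr_pdivrMr // ltr_pMr // ltr1n.
have lA y : A (lamv r 0 y).
 rewrite /A ballE; apply: le_lt_trans rr; exact: lamv_dist (ltW r0).
have [M M0 MP] := psi0_bound.
exists r, (psi0 \o lamv r 0); split=> //.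
- apply: (ganalytic_comp_on oA spsi0 lA (ganalyticv_lamv r 0)) => K.
 by exists M => // x _; exact: MP.
- by rewrite /= lamv_at0 psi00.
- by move=> y; apply: psi0k; apply: Arho.
exists r => // x xr kx.
have yr : `|yc x - 0| <= r by rewrite subr0; apply: le_trans (yc_le _) (ltW xr).
have [y y1 yE] := lamv_onto r0 yr; exists y.
 by apply: le_trans y1 _; rewrite ler_pdivrMr // mul1r.
rewrite /= yE; apply: zyP => //; apply: uniq_zero; rewrite ?zy_eta //.
 by apply: le_trans (ltW xr) _; apply: le_trans (ltW rr) _.
by apply: le_trans (yc_le _) _; apply: le_trans (ltW xr) (ltW rr).
Qed.

End ImplicitGraph.

Lemma implicit_graph {R : realType} {n : nat} (k : 'rV[R]_(1 + n) -> R) :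
 ganalytic k -> k 0 = 0 -> Dw [:: z0] k 0 != 0 ->
 exists (r : R) (psi : 'rV[R]_n -> R),
 [/\ 0 < r, ganalytic psi, psi 0 = 0, (forall y, k (zy (psi y) (lamv r 0 y)) = 0) &
  exists2 e : R, 0 < e & forall x, `|x| < e -> k x = 0 ->
   exists2 y, `|y| <= 1 & x = zy (psi y) (lamv r 0 y)].
Proof.
move=> ak k0; rewrite neq_lt => /orP[kn|kp]; last exact: implicit_graph_pos.
have ak' : ganalytic (fun x => - k x) by exact: ganalyticN.
have [||r [psi [r0 apsi psi00 kpsi [e e0 eP]]]] := implicit_graph_pos ak'.
- by rewrite k0 oppr0.
- have := DwZ openT [:: z0] (-1) ak.1 (I : setT 0); under eq_fun do rewrite mulN1r.
 by move=> ->; rewrite mulN1r oppr_gt0.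
exists r, psi; split=> //; first by move=> y; apply/eqP; rewrite -oppr_eq0; apply/eqP.
by exists e => // x xe kx; apply: eP; rewrite ?kx ?oppr0.
Qed.

Section Monomials.
Context {R : realType} {N : nat}.
Implicit Types (g : 'I_N -> nat) (x s p : 'rV[R]_N).

Lemma monomial0 x : monomial (fun=> 0%N) x = 1.
Proof. by rewrite /monomial big1. Qed.

Lemma monomialD g g' x : monomial (fun i => g i + g' i)%N x = monomial g x * monomial g' x.
Proof. by rewrite /monomial -big_split; apply: eq_bigr => i _; rewrite exprD. Qed.

Lemma monomial_delta (j : 'I_N) (k : nat) x : monomial (fun i => if i == j then k else 0%N) x = x 0 j ^+ k.
Proof.
rewrite /monomial (bigD1 j) //= eqxx big1 ?mulr1 // => i /negPf ->.
by rewrite expr0.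
Qed.

Lemma monomialX g k x : monomial (fun i => k * g i)%N x = monomial g x ^+ k.
Proof. by rewrite /monomial -prodrXl; apply: eq_bigr => i _; rewrite mulnC exprM. Qed.

Lemma monomial_split g (j : 'I_N) x : (0 < g j)%N ->
 monomial g x = x 0 j * monomial (fun i => g i - (i == j))%N x.
Proof.
move=> gj; rewrite /monomial (bigD1 j) //= [in RHS](bigD1 j) //= mulrA eqxx subn1 -exprS prednK //.
by congr (_ * _); apply: eq_bigr => i /negPf ->; rewrite subn0.
Qed.

Lemma monomial_neq0 g x : (forall i, (0 < g i)%N -> x 0 i != 0) -> monomial g x != 0.
Proof.
move=> gx; apply/prodf_neq0 => i _; have [->|gi] := posnP (g i); first by rewrite expr0 oner_eq0.
by rewrite expf_neq0 // gx.
Qed.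

Lemma monomial_lamv g p (r : R) : 0 < r -> (forall i, p 0 i != 0 -> r < `|p 0 i|) ->
 exists (g' : 'I_N -> nat) (w : 'rV[R]_N -> R),
  [/\ ganalytic w, forall s, w s != 0 & forall s, monomial g (lamv r p s) = monomial g' s * w s].
Proof.
move=> r0 rp; exists (fun i => if p 0 i == 0 then g i else 0%N).
exists (fun s => \prod_i (if p 0 i == 0 then (r * lamu (s 0 i)) ^+ g i else (p 0 i + r * lam (s 0 i)) ^+ g i)).
split.
- apply: ganalytic_prod => i _; case: eqP => _; apply: ganalyticX.
  by apply: ganalyticZ; exact: ganalytic_lamu.
 by apply: ganalyticD; [exact: ganalytic_cst | apply: ganalyticZ; exact: ganalytic_lam].
- move=> s; apply/prodf_neq0 => i _; case: (eqVneq (p 0 i) 0) => [_|pi]; apply: expf_neq0.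
  by rewrite mulf_neq0 ?gt_eqF // lamu_gt0.
 apply/eqP => /eqP; rewrite addr_eq0 => /eqP E; have := rp i pi; rewrite E normrN normrM gtr0_norm //.
 by rewrite ltNge ler_piMr ?(ltW r0) ?lam_le1.
move=> s; rewrite /monomial -big_split; apply: eq_bigr => i _ /=; rewrite mxE.
by case: eqP => [->|_]; rewrite ?expr0 ?mul1r // add0r /lam mulrCA exprMn.
Qed.

Lemma small_radius p (e : R) : 0 < e -> exists2 r : R, 0 < r <= e & forall i, p 0 i != 0 -> r < `|p 0 i|.
Proof.
move=> e0; pose r := \big[Num.min/e]_(i < N | p 0 i != 0) (`|p 0 i| / 2).
have r0 : 0 < r.
 by apply: lt_bigmin => // i pi; rewrite divr_gt0 // normr_gt0.
exists r; first by rewrite r0 /r bigmin_le_id.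
move=> i pi; apply: (@le_lt_trans _ _ (`|p 0 i| / 2)); first by apply: bigmin_le_cond.
by rewrite ltr_pdivrMr // ltr_pMr ?ltr1n // normr_gt0.
Qed.

Lemma ganalyticv_scoord (i : 'I_N) (c : R) : ganalyticv (scoord i c).
Proof.
move=> j; under eq_fun do rewrite scoordE; case: eqP => _; last exact: ganalytic_coord.
by apply: ganalyticZ; exact: ganalytic_coord.
Qed.

Lemma coord_cancel (j : 'I_N) (f h : 'rV[R]_N -> R) : ganalytic f -> ganalytic h ->
 (forall x, x 0 j * f x = x 0 j * h x) -> forall x, f x = h x.
Proof.
move=> af ah E.
have aB : ganalytic (fun x => f x - h x) by exact: ganalyticB.
have [//|/(_ (\row__ 1))/eqP|H x] := ganalytic_domain (ganalytic_coord j) aB.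
- by move=> x; rewrite mulrBr E subrr.
- by rewrite mxE oner_eq0.
by apply/eqP; rewrite -subr_eq0; apply/eqP.
Qed.

Lemma monomial_factor (A B U : 'rV[R]_N -> R) g : ganalytic A -> ganalytic B -> ganalytic U ->
 (forall x, U x != 0) -> (forall x, A x * B x = monomial g x * U x) ->
 exists (g' : 'I_N -> nat) (V : 'rV[R]_N -> R),
  [/\ ganalytic V, forall x, V x != 0 & forall x, A x = monomial g' x * V x].
Proof.
move=> + + aU U0; move En : (\sum_i g i)%N => n.
elim: n g A B En => [|n IHn] g A B En aA aB E.
 have g0 i : g i = 0%N by move/eqP: En; rewrite sum_nat_eq0 => /forallP /(_ i) /eqP.
 exists (fun=> 0%N), A; split=> // x; last by rewrite monomial0 mul1r.
 have := U0 x; apply: contraNneq => A0; have := E x; rewrite A0 mul0r.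
 have -> : monomial g x = 1 by rewrite -(monomial0 x); congr monomial; apply/funext => i; rewrite g0.
 by rewrite mul1r => <-.
have [j gj] : exists j, (0 < g j)%N.
 apply: contrapT => no; move: En; rewrite big1 // => i _; apply/eqP; rewrite -leqn0 leqNgt.
 by apply/negP => gi; apply: no; exists i.
pose g1 i := (g i - (i == j))%N.
have En1 : (\sum_i g1 i)%N = n.
 move: En; rewrite (bigD1 j) //= [in X in _ -> X](bigD1 j) //= /g1 eqxx subn1 -(prednK gj) addSn => -[<-].
 by congr (_ + _)%N; apply: eq_bigr => i /negPf ->; rewrite subn0.
pose pr := @scoord R N j 0.
have pr0 x : pr x 0 j = 0 by rewrite scoordE eqxx mul0r.
have aAp : ganalytic (A \o pr) := ganalytic_comp aA (ganalyticv_scoord j 0).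
have aBp : ganalytic (B \o pr) := ganalytic_comp aB (ganalyticv_scoord j 0).
have aM : ganalytic (fun x => monomial g1 x * U x) by apply: ganalyticM => //; exact: ganalytic_monomial.
have [x /=|Ap|Bp] := ganalytic_domain aAp aBp.
- by rewrite E (monomial_split _ gj) pr0 !mul0r.
- have AE x : A x = x 0 j * hadamard j A x by rewrite {1}(hadamard_spec j A x) -[A _]/((A \o pr) x) Ap add0r.
 have aH := ganalytic_hadamard j aA.
 have E1 : forall x, hadamard j A x * B x = monomial g1 x * U x.
  apply: (coord_cancel (j := j)) => // [|x]; first exact: ganalyticM.
  by rewrite mulrA -AE E (monomial_split _ gj) mulrA.
 have [g' [V [aV V0 VE]]] := IHn g1 _ _ En1 aH aB E1.
 exists (fun i => (g' i + (if i == j then 1 else 0))%N), V; split=> // x.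
 by rewrite AE VE monomialD monomial_delta expr1; ring.
have BE x : B x = x 0 j * hadamard j B x by rewrite {1}(hadamard_spec j B x) -[B _]/((B \o pr) x) Bp add0r.
have aH := ganalytic_hadamard j aB.
have E1 : forall x, A x * hadamard j B x = monomial g1 x * U x.
 apply: (coord_cancel (j := j)) => // [|x]; first exact: ganalyticM.
 by rewrite mulrCA -BE E (monomial_split _ gj) mulrA.
exact: IHn g1 _ _ En1 aA aH E1.
Qed.

End Monomials.

Section Monomialization.
Context {R : realType}.

Definition monchart {N} (h : 'rV[R]_N -> R) (x : 'rV[R]_N) (r : R) (pi : 'rV[R]_N -> 'rV[R]_N) : Prop :=
 [/\ ganalyticv pi, forall s, `|pi s - x| < r &
  exists (g : 'I_N -> nat) (u : 'rV[R]_N -> R),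
   [/\ ganalytic u, forall s, u s != 0 & forall s, h (pi s) = monomial g s * u s]].

Definition monz {N} (h : 'rV[R]_N -> R) (x : 'rV[R]_N) : Prop :=
 forall r : R, 0 < r -> exists2 L : seq ('rV[R]_N -> 'rV[R]_N),
  (forall pi, pi \in L -> monchart h x r pi) &
  exists2 e : R, 0 < e & forall y, `|y - x| < e -> exists pi s, [/\ pi \in L, `|s| <= 1 & pi s = y].

Lemma finite_subcover N (K : set 'rV[R]_N) (e : 'rV[R]_N -> R) : compact K -> (forall p, K p -> 0 < e p) ->
 exists2 P : seq 'rV[R]_N, (forall p, p \in P -> K p) &
  forall q, K q -> exists2 p, p \in P & ball p (e p) q.
Proof.
move=> cK e0; have := cK; rewrite compact_cover => /(_ 'rV[R]_N K (fun p => ball p (e p))).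
case=> [p _|q Kq|D DK KD]; first exact: ball_open.
 by exists q => //; apply: ballxx; exact: e0.
exists (finmap.enum_fset D) => [p pD|q Kq]; first by have := DK p pD; rewrite inE.
by have [p pD Bp] := KD q Kq; exists p.
Qed.

Lemma monz_blow N (h : 'rV[R]_N -> R) x :
 (forall r : R, 0 < r -> exists (m : nat) (th : 'I_m -> 'rV[R]_N -> 'rV[R]_N) (K : 'I_m -> set 'rV[R]_N),
  (forall k, [/\ ganalyticv (th k), compact (K k) &
    forall p, K k p -> `|th k p - x| < r /\ monz (h \o th k) p]) /\
  forall W : 'I_m -> set 'rV[R]_N, (forall k, open (W k) /\ K k `<=` W k) ->
   exists2 e : R, 0 < e & forall y, `|y - x| < e -> exists k q, W k q /\ th k q = y) ->
 monz h x.
Proof.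
move=> H r r0; have [m [th [K [thP cov]]]] := H r r0.
have /choice [F FP] : forall kp : 'I_m * 'rV[R]_N, exists Le : seq ('rV[R]_N -> 'rV[R]_N) * R, K kp.1 kp.2 ->
  [/\ 0 < Le.2, (forall pi, pi \in Le.1 -> monchart h x r (th kp.1 \o pi)) &
  forall y, `|y - kp.2| < Le.2 -> exists pi s, [/\ pi \in Le.1, `|s| <= 1 & pi s = y]].
 move=> [k p] /=; have [Kp|nKp] := pselect (K k p); last by exists ([::], 0).
 have [ath _ /(_ p Kp) [thr mz]] := thP k.
 have cth : {for p, continuous (th k)} := smooth_continuous (ganalyticv_smooth ath) I.
 have r1 : 0 < r - `|th k p - x| by rewrite subr_gt0.
 have /cvgrPdist_lt /(_ _ r1) /nbhs_ballP [e /= e0 eP] := cth.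
 have [L LP [e1 e10 e1P]] := mz e e0; exists (L, e1) => _ /=; split=> // pi piL.
 have [api pie [g [u [au u0 uE]]]] := LP pi piL; split.
 - exact: ganalyticv_comp.
 - move=> s /=; have : ball p e (pi s) by rewrite ballE.
  move=> /eP; rewrite ltrBrDr => H1; apply: le_lt_trans H1.
  by apply: le_trans (ler_distD (th k p) _ _) _; rewrite distrC.
 - by exists g, u.
have /choice [P PP] : forall k, exists P : seq 'rV[R]_N, (forall p, p \in P -> K k p) /\
  forall q, K k q -> exists2 p, p \in P & ball p (F (k, p)).2 q.
 move=> k; have [_ cK _] := thP k.
 have [|P P1 P2] := finite_subcover (e := fun p => (F (k, p)).2) cK; last by exists P.
 by move=> p Kp; have [] := FP (k, p) Kp.
pose W k := [set q | exists2 p, p \in P k & ball p (F (k, p)).2 q].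
have [|e e0 eP] := cov W.
 move=> k; split=> [|q Kq]; last by have [p ? ?] := (PP k).2 q Kq; exists p.
 rewrite openE => q [p pP Bq]; rewrite /interior.
 have : nbhs q (ball p (F (k, p)).2) by apply: open_nbhs_nbhs; split => //; exact: ball_open.
 by apply: filterS => q' Bq'; exists p.
exists (flatten [seq flatten [seq [seq th k \o pi | pi <- (F (k, p)).1] | p <- P k] | k <- enum 'I_m]).
 move=> pi /flattenP [l /mapP [k _ ->]] /flattenP [l' /mapP [p pP ->]] /mapP [pi' pi'L ->].
 by have [_ LP _] := FP (k, p) ((PP k).1 p pP); exact: LP.
exists e => // y /eP [k [q [[p pP Bq] qy]]].
have [_ _ /(_ q) [|pi [s [piL s1 pis]]]] := FP (k, p) ((PP k).1 p pP).
 by move: Bq; rewrite ballE.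
exists (th k \o pi), s; split=> //; last by rewrite /= pis.
apply/flattenP; exists (flatten [seq [seq th k \o pi | pi <- (F (k, p)).1] | p <- P k]).
 by apply/mapP; exists k => //; rewrite mem_enum.
apply/flattenP; exists [seq th k \o pi | pi <- (F (k, p)).1].
 by apply/mapP; exists p.
by apply/mapP; exists pi.
Qed.

Lemma monz_blow1 N (h : 'rV[R]_N -> R) x (th : 'rV[R]_N -> 'rV[R]_N) q : ganalyticv th -> th q = x ->
 monz (h \o th) q ->
 (forall e : R, 0 < e -> exists2 e' : R, 0 < e' & forall y, `|y - x| < e' ->
   exists2 s, `|s - q| < e & th s = y) -> monz h x.
Proof.
move=> ath thq mz cov; apply: monz_blow => r r0.
exists 1%N, (fun=> th), (fun=> [set q]); split.
 move=> _; split=> //; first exact: compact_set1.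
 by move=> p ->; rewrite thq subrr normr0.
move=> W WP; have [oW qW] := WP ord0.
have /nbhs_ballP [e /= e0 eP] : nbhs q (W ord0) by apply: open_nbhs_nbhs; split => //; exact: qW.
have [e' e'0 e'P] := cov e e0; exists e' => // y /e'P [s sq sy]; exists ord0, s; split=> //.
by apply: eP; rewrite ballE.
Qed.

Lemma monz_shift N (h : 'rV[R]_N -> R) p : monz (fun s => h (s + p)) 0 -> monz h p.
Proof.
move=> mz; apply: (@monz_blow1 N h p (fun s => s + p) 0) => //; last 1 first.
- move=> e e0; exists e => // y ye; exists (y - p); first by rewrite subr0.
 by rewrite subrK.
- move=> i; under eq_fun do rewrite mxE.
 by apply: ganalyticD; [exact: ganalytic_coord | exact: ganalytic_cst].
- by rewrite add0r.
Qed.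

Lemma monz_unit N (h V : 'rV[R]_N -> R) (g : 'I_N -> nat) p : ganalytic V -> V p != 0 ->
 (forall x, h x = monomial g x * V x) -> monz h p.
Proof.
move=> aV Vp hE r r0.
have [e e0 eP] := continuous_neq0_ball (smooth_continuous aV.1 (I : setT p)) Vp.
have m0 : 0 < Num.min (r / 2) (e / 2) by rewrite lt_min !divr_gt0.
have [q /andP[q0 qm] qp] := small_radius p m0.
have qr : q < r by apply: le_lt_trans qm _; rewrite gt_min ltr_pdivrMr // ltr_pMr ?ltr1n.
have e2 : e / 2 < e by rewrite ltr_pdivrMr // ltr_pMr ?ltr1n.
have qe : q < e by apply: le_lt_trans qm _; rewrite gt_min e2 orbT.
have [g' [w [aw w0 wE]]] := monomial_lamv g q0 qp.
exists [:: lamv q p] => [pi|].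
 rewrite mem_seq1 => /eqP ->; split.
 - exact: ganalyticv_lamv.
 - by move=> s; apply: le_lt_trans qr; exact: lamv_dist (ltW q0).
 exists g', (fun s => w s * V (lamv q p s)); split.
 - apply: ganalyticM => //; exact: (ganalytic_comp aV (ganalyticv_lamv q p)).
 - move=> s; rewrite mulf_neq0 //; apply: eP; rewrite ballE.
  by apply: le_lt_trans qe; exact: lamv_dist (ltW q0).
 - by move=> s; rewrite hE wE mulrA.
exists q => // y yq; have [s s1 sy] := lamv_onto q0 (ltW yq).
exists (lamv q p), s; split=> //; first by rewrite mem_seq1.
by apply: le_trans s1 _; rewrite ler_pdivrMr // mul1r ltW.
Qed.

Lemma tube N (K W : set 'rV[R]_N) : compact K -> open W -> K `<=` W ->
 exists2 e : R, 0 < e & forall p q, K p -> `|q - p| < e -> W q.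
Proof.
move=> cK oW KW.
have /choice [e eP] : forall p, exists e : R, K p -> 0 < e /\ ball p (e + e) `<=` W.
 move=> p; have [Kp|nKp] := pselect (K p); last by exists 1.
 have /nbhs_ballP [e /= e0 eW] : nbhs p W by apply: open_nbhs_nbhs; split => //; exact: KW.
 by exists (e / 2) => _; rewrite divr_gt0 // -splitr.
have [|P PK PP] := finite_subcover (e := e) cK; first by move=> p /eP [].
have [r r0 rP] : exists2 r : R, 0 < r & forall p, p \in P -> r <= e p.
 elim: P PK {PP} => [|p P IHP] PK; first by exists 1.
 have [q qP|r r0 rP] := IHP; first by apply: PK; rewrite inE qP orbT.
 have [e0 _] := eP p (PK p (mem_head _ _)).
 exists (Num.min r (e p)); first by rewrite lt_min r0.
 move=> q; rewrite inE => /orP[/eqP ->|/rP rq]; first by rewrite ge_min lexx orbT.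
 by rewrite ge_min rq.
exists r => // p q Kp qp; have [p' p'P Bp] := PP p Kp; have [e0 eW] := eP p' (PK p' p'P).
apply: eW; rewrite -ball_normE /ball_ /=; apply: le_lt_trans (ler_distD p _ _) _.
have re := rP p' p'P.
by move: Bp; rewrite -ball_normE /ball_ /= => Bp; rewrite [`|p - q|]distrC; lra.
Qed.

End Monomialization.

Section VerticalDerivatives.
Context {R : realType}.

Lemma Dw_embed_dir k N (iota : 'rV[R]_k -> 'rV[R]_N) (i : 'I_k) (j : 'I_N) (F : 'rV[R]_N -> R) m x :
 (forall (h : R) x, iota (h *: delta_mx 0 i + x) = h *: delta_mx 0 j + iota x) ->
 Dw (nseq m i) (F \o iota) x = Dw (nseq m j) F (iota x).
Proof.
move=> E; elim: m x => [//|m IHm] x; rewrite /= !Dw_cons.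
by rewrite (_ : Dw (nseq m i) (F \o iota) = Dw (nseq m j) F \o iota); [exact: derive_embed | exact/funext].
Qed.

Lemma Dw_poly (q : {poly R}) k (t : 'rV[R]_1) :
 Dw (nseq k ord0) (fun t : 'rV[R]_1 => q.[t 0 0]) t = (q^`(k)).[t 0 0].
Proof.
have sq (p : {poly R}) : smooth_on setT (fun t : 'rV[R]_1 => p.[t 0 0]).
 elim/poly_ind: p => [|p c IHp].
  by under eq_fun do rewrite horner0; exact: smooth_cst.
 under eq_fun do rewrite hornerMXaddC.
 exact: (smoothD openT (smoothM openT IHp (smooth_coord (0 : 'I_1) openT)) (smooth_cst setT c)).
have D1 (p : {poly R}) t' : Dw [:: ord0] (fun t : 'rV[R]_1 => p.[t 0 0]) t' = p^`().[t' 0 0].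
 elim/poly_ind: p => [|p c IHp].
  by under eq_fun do rewrite horner0; rewrite Dw_cst deriv0 horner0.
 under eq_fun do rewrite hornerMXaddC.
 have sc := smooth_coord (R := R) (0 : 'I_1) openT.
 rewrite (DwD openT [:: ord0] (smoothM openT (sq p) sc) (smooth_cst setT c) I) Dw_cst addr0.
 rewrite (DwM1 ord0 (sq p) sc I) IHp Dw1_coord eqxx mulr1.
 by rewrite derivD derivM derivX derivC addr0 mulr1 hornerD hornerM hornerX.
elim: k t => [|k IHk] t; first by rewrite Dw_nil derivn0.
rewrite /= -cat1s Dw_cat; have -> : Dw (nseq k ord0) (fun t : 'rV[R]_1 => q.[t 0 0]) = fun t => q^`(k).[t 0 0].
 by apply/funext => t'; exact: IHk.
by rewrite D1.
Qed.

Context {n : nat}.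
Implicit Types (x : 'rV[R]_(1 + n)) (y : 'rV[R]_n).

Lemma zy_shift (h : R) x : zy (h + zc x) (yc x) = h *: delta_mx 0 (@z0 n) + x.
Proof.
apply/esym/zyP; first by rewrite /zc !mxE !eqxx mulr1.
apply/rowP => i; rewrite !mxE [_ == z0](_ : _ = false) ?andbF ?mulr0 ?add0r //.
Qed.

Lemma yc_shift (h : R) x : yc (h *: delta_mx 0 (@z0 n) + x) = yc x.
Proof. by rewrite -zy_shift yc_zy. Qed.

Lemma zc_shift (h : R) x : zc (h *: delta_mx 0 (@z0 n) + x) = h + zc x.
Proof. by rewrite -zy_shift zc_zy. Qed.

Lemma Dz_axis (H : 'rV[R]_(1 + n) -> R) k y (t : 'rV[R]_1) :
 Dw (nseq k z0) H (zy (t 0 0) y) = Dw (nseq k ord0) (fun t : 'rV[R]_1 => H (zy (t 0 0) y)) t.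
Proof.
rewrite -[RHS]/(Dw (nseq k ord0) (H \o (fun t : 'rV[R]_1 => zy (t 0 0) y)) t).
rewrite (@Dw_embed_dir _ _ (fun t : 'rV[R]_1 => zy (t 0 0) y) ord0 z0) // => h s.
apply/esym/zyP; rewrite ?zc_shift ?yc_shift ?zc_zy ?yc_zy //.
by rewrite !mxE eqxx mulr1.
Qed.

Lemma Dz_yc (a : 'rV[R]_n -> R) k x : Dw (nseq k.+1 z0) (fun x => a (yc x)) x = 0.
Proof.
rewrite -[x]zy_eta; have := Dz_axis (fun x => a (yc x)) k.+1 (yc x) (\row__ zc x).
rewrite mxE => ->; under eq_fun do rewrite yc_zy.
by rewrite Dw_cst.
Qed.

Lemma Dz_mulz (w : 'rV[R]_(1 + n) -> R) k x : smooth_on setT w ->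
 Dw (nseq k.+1 z0) (fun x => zc x * w x) x = zc x * Dw (nseq k.+1 z0) w x + k.+1%:R * Dw (nseq k z0) w x.
Proof.
move=> sw; have sz : smooth_on setT (@zc R n) := smooth_coord z0 openT.
have D1 v x' : smooth_on setT v -> Dw [:: z0] (fun x => zc x * v x) x' = zc x' * Dw [:: z0] v x' + v x'.
 by move=> sv; rewrite (DwM1 z0 sz sv I) Dw1_coord eqxx mul1r addrC.
elim: k x => [|k IHk] x; first by rewrite [LHS]D1 // mul1r Dw_nil.
rewrite -[nseq k.+2 z0]/([:: z0] ++ nseq k.+1 z0) Dw_cat.
have -> : Dw (nseq k.+1 z0) (fun x => zc x * w x) =
  fun x => zc x * Dw (nseq k.+1 z0) w x + k.+1%:R * Dw (nseq k z0) w x by apply/funext => x'; exact: IHk.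
have s1 := Dw_smooth (nseq k.+1 z0) sw; have s2 := Dw_smooth (nseq k z0) sw.
rewrite (DwD openT [:: z0] (smoothM openT sz s1) (smoothZ openT _ s2) I) D1 // (DwZ openT [:: z0] _ s2 I) -!Dw_cat /=.
by rewrite -[in RHS]natr1; ring.
Qed.

Lemma Dz_form m (a : nat -> 'rV[R]_n -> R) (w : 'rV[R]_(1 + n) -> R) k y :
 (forall i, ganalytic (a i)) -> ganalytic w -> (k < m)%N ->
 Dw (nseq k z0) (fun x => \sum_(i < m) a i (yc x) * zc x ^+ i + zc x ^+ m * w x) (zy 0 y) = k`!%:R * a k y.
Proof.
elim: m a k => // m IHm a k aa aw km.
pose f x := \sum_(i < m) a i.+1 (yc x) * zc x ^+ i + zc x ^+ m * w x.
have af : ganalytic f.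
 apply: ganalyticD; last by apply: ganalyticM => //; apply: ganalyticX; exact: ganalytic_zc.
 apply: ganalytic_sum => i _; apply: ganalyticM; last by apply: ganalyticX; exact: ganalytic_zc.
 exact: (ganalytic_comp (aa _) (@ganalyticv_yc R n)).
have -> : (fun x => \sum_(i < m.+1) a i (yc x) * zc x ^+ i + zc x ^+ m.+1 * w x) =
  (fun x => a 0%N (yc x) + zc x * f x).
 apply/funext => x; rewrite big_ord_recl /= expr0 mulr1 -addrA; congr (_ + _).
 rewrite /f mulrDr mulr_sumr exprS -!mulrA; congr (_ + _).
 by apply: eq_bigr => i _; rewrite exprS; ring.
case: k km => [|k] km; first by rewrite Dw_nil mul1r zc_zy mul0r addr0 yc_zy.
have sa : smooth_on setT (fun x => a 0%N (yc x)) := (ganalytic_comp (aa _) (@ganalyticv_yc R n)).1.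
rewrite (DwD openT (nseq k.+1 z0) sa (smoothM openT (smooth_coord z0 openT) af.1) I) Dz_yc add0r.
by rewrite (Dz_mulz _ _ af.1) zc_zy mul0r add0r (IHm (fun i => a i.+1)) // factS natrM mulrA.
Qed.

Lemma vertical_taylor (H : 'rV[R]_(1 + n) -> R) m : ganalytic H ->
 exists (a : nat -> 'rV[R]_n -> R) (u : 'rV[R]_(1 + n) -> R),
  [/\ forall i, ganalytic (a i), ganalytic u,
   forall x, H x = \sum_(i < m) a i (yc x) * zc x ^+ i + zc x ^+ m * u x,
   forall k y, (k < m)%N -> Dw (nseq k z0) H (zy 0 y) = k`!%:R * a k y &
   forall y, Dw (nseq m z0) H (zy 0 y) = m`!%:R * u (zy 0 y)].
Proof.
elim: m H => [|m IHm] H aH.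
 exists (fun=> fun=> 0), H; split=> //.
 - by move=> i; exact: ganalytic_cst.
 - by move=> x; rewrite big_ord0 add0r expr0 mul1r.
 - by move=> y; rewrite mul1r Dw_nil.
have aH1 := ganalytic_hadamard z0 aH; have [a [u [aa au uE uk um]]] := IHm _ aH1.
pose a0 y := H (zy 0 y).
have az : @ganalyticv R n (1 + n) (fun y => zy 0 y).
 by apply: ganalyticv_zy; [exact: ganalytic_cst | exact: ganalytic_coord].
have sc0 x : scoord z0 0 x = zy 0 (yc x).
 apply: zyP; first by rewrite /zc scoordE eqxx mul0r.
 apply/rowP => i; rewrite ycE scoordE [_ == z0](_ : _ = false) ?ycE //.
have HE x : H x = a0 (yc x) + zc x * hadamard z0 H x by rewrite {1}(hadamard_spec z0 H x) sc0.
have DH k y : Dw (nseq k.+1 z0) H (zy 0 y) = k.+1%:R * Dw (nseq k z0) (hadamard z0 H) (zy 0 y).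
 have HE' : (fun x => a0 (yc x) + zc x * hadamard z0 H x) = H by apply/funext => x; rewrite -HE.
 transitivity (Dw (nseq k.+1 z0) (fun x => a0 (yc x) + zc x * hadamard z0 H x) (zy 0 y)); first by rewrite HE'.
 have sa : smooth_on setT (fun x => a0 (yc x)).
  exact: (ganalytic_comp (ganalytic_comp aH az) (@ganalyticv_yc R n)).1.
 rewrite (DwD openT (nseq k.+1 z0) sa (smoothM openT (smooth_coord z0 openT) aH1.1) I) Dz_yc add0r.
 by rewrite (Dz_mulz _ _ aH1.1) zc_zy mul0r add0r.
exists (fun i => if i is i'.+1 then a i' else a0), u; split=> //.
- case=> [|i] //; exact: (ganalytic_comp aH az).
- move=> x; rewrite HE uE big_ord_recl /= expr0 mulr1 -addrA; congr (_ + _).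
 rewrite mulrDr mulr_sumr exprS -!mulrA; congr (_ + _).
 by apply: eq_bigr => i _; rewrite exprS; ring.
- case=> [|k] y km; first by rewrite Dw_nil mul1r.
 by rewrite DH uk // factS natrM mulrA.
- by move=> y; rewrite DH um factS natrM mulrA.
Qed.

End VerticalDerivatives.

Lemma blow_exponent (m i g : nat) : (i <= m)%N -> (0 < g)%N -> ((m - i) * g + i = m + (m - i) * g.-1)%N.
Proof. by move=> im; case: g => // g _; rewrite mulnS addnAC subnK. Qed.

Section BlowUps.
Context {R : realType} {n : nat}.
Implicit Types (x : 'rV[R]_(1 + n)) (y : 'rV[R]_n) (H : 'rV[R]_(1 + n) -> R) (g : 'rV[R]_n -> R).

Definition monz_order (mu : nat) : Prop := forall H g, ganalytic H -> ganalytic g -> (exists y, g y != 0) ->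
 Dw (nseq mu z0) H 0 != 0 -> monz (fun x => H x * g (yc x)) 0.

Definition gzy (k : nat) (g : 'I_n -> nat) (j : 'I_(1 + n)) : nat :=
 match fintype.split j with inl _ => k | inr i => g i end.

Lemma monomial_gzy k (g : 'I_n -> nat) x : monomial (gzy k g) x = zc x ^+ k * monomial g (yc x).
Proof.
rewrite /monomial big_split_ord /= big_ord1 /gzy.
have -> : @fintype.split 1 n (lshift n ord0) = inl ord0 by exact: (@unsplitK 1 n (inl ord0)).
congr (_ * _); apply: eq_bigr => i _.
have -> : @fintype.split 1 n (rshift 1 i) = inr i by exact: (@unsplitK 1 n (inr i)).
by rewrite ycE.
Qed.

Lemma monomial_times_nonzero (b : 'I_n -> nat) (v : 'rV[R]_n -> R) : ganalytic v -> v 0 != 0 ->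
 exists y, monomial b y * v y != 0.
Proof.
move=> av v0; apply: contrapT => no.
have E y : monomial b y * v y = 0 by apply/eqP; apply: contrapT => /negP ne; apply: no; exists y.
have [/(_ (\row__ 1))/eqP|/(_ 0)/eqP] := ganalytic_domain (ganalytic_monomial b) av E; last by rewrite (negPf v0).
by rewrite (negPf (monomial_neq0 _)) // => i _; rewrite mxE oner_eq0.
Qed.

Definition blowA (j : 'I_n) x : 'rV[R]_(1 + n) := zy (yc x 0 j * zc x) (yc x).
Definition scalej (j : 'I_n) (z : R) y : 'rV[R]_n := \row_i (if i == j then y 0 i * z else y 0 i).
Definition blowB (j : 'I_n) x : 'rV[R]_(1 + n) := zy (zc x) (scalej j (zc x) (yc x)).

Lemma ganalyticv_blowA j : ganalyticv (blowA j).
Proof.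
apply: ganalyticv_zy; last exact: ganalyticv_yc.
by apply: ganalyticM; [exact: ganalyticv_yc | exact: ganalytic_zc].
Qed.

Lemma ganalyticv_scalej j : ganalyticv (fun x => scalej j (zc x) (yc x)).
Proof.
move=> i; under eq_fun do rewrite mxE; case: eqP => _; last exact: ganalyticv_yc.
by apply: ganalyticM; [exact: ganalyticv_yc | exact: ganalytic_zc].
Qed.

Lemma ganalyticv_blowB j : ganalyticv (blowB j).
Proof. by apply: ganalyticv_zy; [exact: ganalytic_zc | exact: ganalyticv_scalej]. Qed.

Lemma monomial_scalej (g : 'I_n -> nat) j (z : R) y :
 monomial g (scalej j z y) = z ^+ g j * monomial g y.
Proof.
rewrite /monomial (bigD1 j) //= [in RHS](bigD1 j) //= mxE eqxx exprMn mulrA [z ^+ _ * _]mulrC; congr (_ * _).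
by apply: eq_bigr => i /negPf ij; rewrite mxE ij.
Qed.

Lemma monz_pair (h : 'rV[R]_(1 + n) -> R) x (tA tB : 'rV[R]_(1 + n) -> 'rV[R]_(1 + n)) (KA KB : set 'rV[R]_(1 + n)) :
 ganalyticv tA -> ganalyticv tB -> compact KA -> compact KB ->
 (forall p, KA p -> tA p = x /\ monz (h \o tA) p) -> (forall p, KB p -> tB p = x /\ monz (h \o tB) p) ->
 (forall WA WB, open WA -> open WB -> KA `<=` WA -> KB `<=` WB -> exists2 e : R, 0 < e &
   forall x1, `|x1 - x| < e -> (exists2 q, WA q & tA q = x1) \/ (exists2 q, WB q & tB q = x1)) ->
 monz h x.
Proof.
move=> aA aB cA cB hA hB cov; apply: monz_blow => r r0.
exists 2%N, (fun k => if k == ord0 then tA else tB), (fun k => if k == ord0 then KA else KB); split.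
 by move=> k; case: ifP => _; split=> // p Kp; [have [-> ?] := hA p Kp | have [-> ?] := hB p Kp];
  rewrite subrr normr0.
move=> W WP; have [oA KWA] := WP ord0; have [oB KWB] := WP (lift ord0 ord0).
have [e e0 eP] := cov _ _ oA oB KWA KWB; exists e => // y /eP [[q Wq qy]|[q Wq qy]].
 by exists ord0, q.
by exists (lift ord0 ord0), q.
Qed.

Lemma segment_image_compact N (f : R -> 'rV[R]_N) (c : R) : smooth_on setT f ->
 compact (f @` [set s : R | - c <= s <= c]).
Proof.
move=> sf; apply: continuous_compact.
 by apply: continuous_subspaceT => s; exact: (smooth_continuous sf I).
have := @segment_compact R (- c) c; congr compact.
Qed.

Lemma smooth_axes (j : 'I_n) : smooth_on setT (fun s : R => zy s (0 : 'rV[R]_n)) /\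
 smooth_on setT (fun s : R => zy (0 : R) (s *: (delta_mx 0 j : 'rV[R]_n))).
Proof.
split; first by apply: smooth_zy; [exact: openT | exact: smooth_idR | exact: smooth_cst].
apply: smooth_zy; [exact: openT | exact: smooth_cst | apply/(smooth_on_row _ openT) => i].
under eq_fun do rewrite mxE mulrC; exact: (smoothZ openT _ smooth_idR).
Qed.

Lemma blow_cover j (C : R) (WA WB : set 'rV[R]_(1 + n)) : 0 < C -> open WA -> open WB ->
 [set zy s 0 | s in [set s : R | - C <= s <= C]] `<=` WA ->
 [set zy 0 (s *: delta_mx 0 j) | s in [set s : R | - C^-1 <= s <= C^-1]] `<=` WB ->
 exists2 e : R, 0 < e & forall x, `|x - 0| < e ->
  (exists2 q, WA q & blowA j q = x) \/ (exists2 q, WB q & blowB j q = x).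
Proof.
move=> C0 oA oB KA KB.
have [s1 s2] := smooth_axes j.
have [eA eA0 eAP] := tube (segment_image_compact (c := C) s1) oA KA.
have [eB eB0 eBP] := tube (segment_image_compact (c := C^-1) s2) oB KB.
exists (Num.min eA eB); first by rewrite lt_min eA0.
move=> x; rewrite subr0 lt_min => /andP[xA xB].
have yx : `|yc x| <= `|x| := yc_le x; have zx : `|zc x| <= `|x| := zc_le x.
have [zC|zC] := leP `|zc x| (C * `|yc x 0 j|).
 left; pose s := zc x / yc x 0 j; exists (zy s (yc x)).
  apply: (eAP (zy s 0)); last first.
   by rewrite zyB subrr subr0; apply: zy_lt; rewrite ?normr0 //; apply: le_lt_trans yx xA.
  exists s => //=; rewrite -ler_norml /s normrM normfV.
  have [->|yj] := eqVneq (yc x 0 j) 0; first by rewrite normr0 invr0 mulr0 ltW.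
  by rewrite ler_pdivrMr // normr_gt0.
 rewrite /blowA yc_zy zc_zy /s; have [yj|yj] := eqVneq (yc x 0 j) 0; last by rewrite mulrCA divff // mulr1 zy_eta.
 rewrite yj mul0r; move: zC; rewrite yj normr0 mulr0 normr_le0 => /eqP zx0.
 by apply/esym/zyP.
right; have zn : zc x != 0.
 by rewrite -normr_gt0; apply: le_lt_trans zC; rewrite mulr_ge0 // ltW.
pose s := yc x 0 j / zc x; pose y' : 'rV[R]_n := \row_i (if i == j then s else yc x 0 i).
exists (zy (zc x) y').
 apply: (eBP (zy 0 (s *: delta_mx 0 j))).
  exists s => //=; rewrite -ler_norml /s normrM normfV ler_pdivrMr ?normr_gt0 //.
  by rewrite mulrC ler_pdivlMr // mulrC ltW.
 rewrite zyB subr0; apply: zy_lt; first exact: le_lt_trans zx xB.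
 apply: row_norm_lt => // i; rewrite !mxE.
 case: eqP => _; first by rewrite mulr1 subrr normr0.
 by rewrite mulr0 subr0 -ycE; apply: le_lt_trans (coord_le_norm _ _) _; apply: le_lt_trans yx xB.
rewrite /blowB zc_zy yc_zy; apply/esym/zyP => //; apply/rowP => i; rewrite !mxE.
by case: eqP => [->|_]; rewrite ?ycE // /s ycE divfK.
Qed.

Section WeierstrassForm.
Variables (mu : nat).
Hypothesis IHmu : forall i, (i < mu)%N -> monz_order i.

Let pform (b : nat -> 'rV[R]_n -> R) (u : 'rV[R]_(1 + n) -> R) (gam : 'I_n -> nat) x : R :=
 \sum_(i < mu.-1) b i (yc x) * monomial (fun l => (mu - i) * gam l)%N (yc x) * zc x ^+ i + zc x ^+ mu * u x.

Let ganalytic_pform b u gam : (forall i, ganalytic (b i)) -> ganalytic u -> ganalytic (pform b u gam).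
Proof.
move=> ab au; have yv := @ganalyticv_yc R n; have zv := @ganalytic_zc R n.
apply: ganalyticD; last by apply: ganalyticM => //; exact: ganalyticX.
apply: ganalytic_sum => i _; apply: ganalyticM; last exact: ganalyticX.
apply: ganalyticM; first exact: (ganalytic_comp (ab i) yv).
exact: (ganalytic_comp (ganalytic_monomial _) yv).
Qed.

Let blowA_pform j b u gam x : (0 < gam j)%N ->
 pform b u gam (blowA j x) =
 yc x 0 j ^+ mu * pform b (u \o blowA j) (fun l => gam l - (l == j))%N x.
Proof.
move=> gj; rewrite /pform /blowA zc_zy yc_zy mulrDr mulr_sumr exprMn -mulrA; congr (_ + _).
apply: eq_bigr => i _; have im : (i <= mu)%N by rewrite (leq_trans (ltnW (ltn_ord i))) // leq_pred.
have -> : monomial (fun l => (mu - i) * gam l)%N (yc x) =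
  yc x 0 j ^+ (mu - i) * monomial (fun l => (mu - i) * (gam l - (l == j)))%N (yc x).
 rewrite -(monomial_delta j (mu - i)) -monomialD; congr monomial; apply/funext => l.
 case: eqP => [->|_]; last by rewrite subn0 add0n.
 by rewrite -mulnS subn1 prednK.
rewrite exprMn -[in X in _ = X * _](subnK im) exprD.
by move: (yc x 0 j ^+ _) (yc x 0 j ^+ _) (zc x ^+ _) => *; ring.
Qed.

Let VB j (b : nat -> 'rV[R]_n -> R) u gam x : R := u (blowB j x) +
 \sum_(i < mu.-1) b i (scalej j (zc x) (yc x)) *
   (zc x ^+ ((mu - i) * (gam j).-1) * monomial (fun l => (mu - i) * gam l)%N (yc x)).

Let blowB_pform j b u gam x : (0 < gam j)%N ->
 pform b u gam (blowB j x) = zc x ^+ mu * VB j b u gam x.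
Proof.
move=> gj; rewrite /pform /VB {1 2 3}/blowB mulrDr addrC zc_zy; congr (_ + _); rewrite mulr_sumr.
apply: eq_bigr => i _; have im : (i <= mu)%N by rewrite (leq_trans (ltnW (ltn_ord i))) // leq_pred.
rewrite yc_zy monomial_scalej.
have E : zc x ^+ ((mu - i) * gam j) * zc x ^+ i = zc x ^+ mu * zc x ^+ ((mu - i) * (gam j).-1).
 by rewrite -!exprD blow_exponent.
have -> : b i (scalej j (zc x) (yc x)) * (zc x ^+ ((mu - i) * gam j) *
  monomial (fun l => ((mu - i) * gam l)%N) (yc x)) * zc x ^+ i =
 b i (scalej j (zc x) (yc x)) * monomial (fun l => (mu - i) * gam l)%N (yc x) *
  (zc x ^+ ((mu - i) * gam j) * zc x ^+ i).
 by move: (zc x ^+ _) (zc x ^+ _) (monomial _ _) => *; ring.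
by rewrite E; move: (zc x ^+ _) (zc x ^+ _) (monomial _ _) => *; ring.
Qed.

Lemma monz_form (gam : 'I_n -> nat) (b : nat -> 'rV[R]_n -> R) (u : 'rV[R]_(1 + n) -> R) (bet : 'I_n -> nat)
  (v : 'rV[R]_n -> R) (i0 : nat) :
 (forall i, ganalytic (b i)) -> ganalytic u -> u 0 != 0 -> (i0 < mu.-1)%N -> b i0 0 != 0 ->
 ganalytic v -> v 0 != 0 ->
 monz (fun x => pform b u gam x * (monomial bet (yc x) * v (yc x))) 0.
Proof.
move=> ab + + i0mu bi0 av v0.
have mu2 : (i0 < mu)%N by apply: leq_trans i0mu _; exact: leq_pred.
have mu0 : (0 < mu)%N by exact: leq_ltn_trans mu2.
have mu1 : (mu.-1 < mu)%N by rewrite prednK.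
move En : (\sum_i gam i)%N => m; elim: m gam bet u En => [|m IHm] gam bet u En au u0.
 have g0 i : gam i = 0%N by move/eqP: En; rewrite sum_nat_eq0 => /forallP /(_ i) /eqP.
 have ag : ganalytic (fun y => monomial bet y * v y).
  by apply: ganalyticM => //; exact: ganalytic_monomial.
 apply: (IHmu mu2 (ganalytic_pform gam ab au) ag (monomial_times_nonzero bet av v0)).
 pose a i y := b i y * monomial (fun l => (mu - i) * gam l)%N y.
 have aa i : ganalytic (a i) by apply: ganalyticM => //; exact: ganalytic_monomial.
 have azu : ganalytic (fun x => zc x * u x) by apply: ganalyticM => //; exact: ganalytic_zc.
 have -> : pform b u gam = fun x => \sum_(i < mu.-1) a i (yc x) * zc x ^+ i + zc x ^+ mu.-1 * (zc x * u x).
  by apply/funext => x; rewrite mulrA -exprSr prednK.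
 rewrite -zy00 (Dz_form _ aa azu) //; apply: mulf_neq0; first by rewrite pnatr_eq0 -lt0n fact_gt0.
 rewrite /a mulf_neq0 //; apply: monomial_neq0 => l; by rewrite g0 muln0.
have [j gj] : exists j, (0 < gam j)%N.
 apply: contrapT => no; move: En; rewrite big1 // => i _; apply/eqP; rewrite -leqn0 leqNgt.
 by apply/negP => gi; apply: no; exists i.
pose gam1 l := (gam l - (l == j))%N.
have En1 : (\sum_l gam1 l)%N = m.
 move: En; rewrite (bigD1 j) //= [in X in _ -> X](bigD1 j) //= /gam1 eqxx subn1 -(prednK gj) addSn => -[<-].
 by congr (_ + _)%N; apply: eq_bigr => i /negPf ->; rewrite subn0.
have un0 : 0 < `|u 0| by rewrite normr_gt0.
pose SB := \sum_(i < mu.-1) `|b i 0|.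
have SB0 : 0 <= SB by exact: sumr_ge0.
pose C := 1 + SB * 2 / `|u 0|.
have C1 : 1 <= C by rewrite lerDl divr_ge0 ?mulr_ge0.
have C0 : 0 < C by exact: lt_le_trans C1.
have [s1 s2] := smooth_axes j.
apply: (@monz_pair _ 0 (blowA j) (blowB j) _ _ (ganalyticv_blowA j) (ganalyticv_blowB j)
 (segment_image_compact (c := C) s1) (segment_image_compact (c := C^-1) s2)); last first.
- by move=> WA WB oA oB KA KB; exact: blow_cover C0 oA oB KA KB.
- move=> _ [s /= sC <-]; split.
  rewrite /blowB zc_zy yc_zy -zy00; congr zy; apply/rowP => i; rewrite !mxE.
  by case: eqP => _ //=; rewrite ?mulr0.
 have aVB : ganalytic (VB j b u gam).
  apply: ganalyticD; first exact: (ganalytic_comp au (ganalyticv_blowB j)).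
  apply: ganalytic_sum => i _; apply: ganalyticM; first exact: (ganalytic_comp (ab i) (ganalyticv_scalej j)).
  apply: ganalyticM; first by apply: ganalyticX; exact: ganalytic_zc.
  exact: (ganalytic_comp (ganalytic_monomial _) (@ganalyticv_yc R n)).
 have sc0 : scalej j 0 (s *: delta_mx 0 j) = 0.
  by apply/rowP => i; rewrite !mxE; case: eqP => _ //=; rewrite ?mulr0.
 have s1' : `|s| <= C^-1 by rewrite ler_norml.
 have sle1 : `|s| <= 1 by apply: le_trans s1' _; rewrite invf_le1.
 apply: (@monz_unit _ _ _ (fun x => VB j b u gam x * v (scalej j (zc x) (yc x))) (gzy (mu + bet j) bet)).
 + by apply: ganalyticM => //; exact: (ganalytic_comp av (ganalyticv_scalej j)).
 + rewrite mulf_neq0 //; last by rewrite zc_zy yc_zy sc0.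
  rewrite /VB /blowB zc_zy yc_zy sc0 zy00; apply/eqP => /eqP; rewrite addr_eq0 => /eqP E.
  have : `|u 0| <= SB * C^-1.
   rewrite E normrN mulr_suml; apply: le_trans (ler_norm_sum _ _ _) _; apply: ler_sum => i _.
   rewrite normrM; apply: ler_wpM2l => //; rewrite normrM; apply: le_trans s1'.
   have im : (i < mu)%N by apply: leq_trans (ltn_ord i) _; exact: leq_pred.
   apply: (@le_trans _ _ (1 * `|s|)); last by rewrite mul1r.
   apply: ler_pM => //.
    by rewrite normrX normr0 expr0n; case: (_ == _).
   rewrite /monomial normr_prod (bigD1 j) //= !mxE !eqxx mulr1 normrX.
   apply: (@le_trans _ _ (`|s| * 1)); last by rewrite mulr1.
   apply: ler_pM => //; first exact: prodr_ge0.
    rewrite -[leRHS]expr1; apply: ler_wiXn2l => //; by rewrite muln_gt0 subn_gt0 im.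
   apply: (@le_trans _ _ (\prod_(l < n | l != j) 1)); last by rewrite big1.
   apply: ler_prod => l lj; rewrite normr_ge0 /= !mxE (negPf lj) andbF mulr0 normrX normr0 expr0n.
   by case: (_ == _).
  have : SB * C^-1 <= `|u 0| / 2.
   rewrite ler_pdivrMr // /C mulrDr mulr1; apply: (@le_trans _ _ (`|u 0| / 2 * (SB * 2 / `|u 0|))).
    by apply: le_eq; field; rewrite gt_eqF.
   by rewrite lerDr divr_ge0.
  by move: un0; lra.
 + move=> x; rewrite /= blowB_pform // monomial_gzy exprD {1 2}/blowB yc_zy monomial_scalej.
  by move: (zc x ^+ _) (zc x ^+ _) (monomial _ _) => *; ring.
- move=> _ [s /= sC <-]; split; first by rewrite /blowA zc_zy yc_zy mxE mul0r zy00.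
 have au1 : ganalytic (u \o blowA j) := ganalytic_comp au (ganalyticv_blowA j).
 have bA0 : blowA j 0 = 0 by rewrite -zy00 /blowA zc_zy yc_zy mxE mul0r.
 pose bet1 l := (bet l + (if l == j then mu else 0))%N.
 have E x : pform b u gam (blowA j x) * (monomial bet (yc (blowA j x)) * v (yc (blowA j x))) =
   pform b (u \o blowA j) gam1 x * (monomial bet1 (yc x) * v (yc x)).
  rewrite blowA_pform // {2 3}/blowA yc_zy /bet1 monomialD monomial_delta -/gam1.
  by move: (yc x 0 j ^+ _) (monomial _ _) (pform _ _ _ _) => *; ring.
 have -> : ((fun x => pform b u gam x * (monomial bet (yc x) * v (yc x))) \o blowA j) =
   (fun x => pform b (u \o blowA j) gam1 x * (monomial bet1 (yc x) * v (yc x))).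
  by apply/funext => x; exact: E.
 have [->|sn0] := eqVneq s 0.
  by rewrite zy00; apply: IHm => //; rewrite /= bA0.
 apply: monz_shift.
 have ycs x : yc (x + zy s 0) = yc x.
  by apply/rowP => i; rewrite ycE mxE zy_r mxE addr0 ycE.
 under eq_fun do rewrite ycs.
 have ash : @ganalyticv R (1 + n) (1 + n) (fun x => x + zy s 0).
  by move=> i; under eq_fun do rewrite mxE; apply: ganalyticD; [exact: ganalytic_coord | exact: ganalytic_cst].
 have aP := ganalytic_pform gam1 ab au1.
 have ag : ganalytic (fun y => monomial bet1 y * v y).
  by apply: ganalyticM => //; exact: ganalytic_monomial.
 apply: (IHmu mu1 (H := fun x => pform b (u \o blowA j) gam1 (x + zy s 0)) (ganalytic_comp aP ash) ag
   (monomial_times_nonzero bet1 av v0)).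
 have -> : (fun x => pform b (u \o blowA j) gam1 (x + zy s 0)) = (fun x => pform b (u \o blowA j) gam1 (x - (- zy s 0))).
  by apply/funext => x; rewrite opprK.
 rewrite (Dw_shift (pform b (u \o blowA j) gam1) (- zy s 0)) opprK add0r.
 have := Dz_axis (pform b (u \o blowA j) gam1) mu.-1 0 (\row__ s); rewrite mxE => ->.
 pose q : {poly R} := \sum_(i < mu.-1) (b i 0 * monomial (fun l => (mu - i) * gam1 l)%N 0) *: 'X^i + u 0 *: 'X^mu.
 have -> : (fun t : 'rV[R]_1 => pform b (u \o blowA j) gam1 (zy (t 0 0) 0)) = (fun t : 'rV[R]_1 => q.[t 0 0]).
  apply/funext => t; rewrite /pform /q zc_zy yc_zy hornerD hornerZ hornerXn horner_sum; congr (_ + _).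
   by apply: eq_bigr => i _; rewrite hornerZ hornerXn.
  by rewrite /= {1}/blowA zc_zy yc_zy mxE mul0r zy00 mulrC.
 rewrite Dw_poly mxE /q derivnD derivn_poly0 ?add0r; last first.
  apply: (leq_trans (size_sum _ _ _)); apply/bigmax_leqP => i _.
  by rewrite (leq_trans (size_scale_leq _ _)) // size_polyXn.
 rewrite derivnZ derivnXn hornerZ hornerMn hornerXn.
 have -> : (mu - mu.-1 = 1)%N by rewrite -{1}(prednK mu0) subSnn.
 rewrite expr1 mulf_neq0 // -mulr_natr mulf_neq0 // pnatr_eq0 -lt0n ffact_gt0; exact: leq_pred.
Qed.

End WeierstrassForm.

End BlowUps.

Section ProductsAndPowers.
Context {R : realType} {n : nat}.
Implicit Types (y t : 'rV[R]_n).

Lemma ganalytic_prod_nonzero (I : Type) (r : seq I) (P : pred I) (F : I -> 'rV[R]_n -> R) :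
 (forall i, P i -> ganalytic (F i) /\ exists y, F i y != 0) -> exists y, \prod_(i <- r | P i) F i y != 0.
Proof.
move=> FP; elim: r => [|i r IHr]; first by exists 0; rewrite big_nil oner_eq0.
have [Pi|nPi] := boolP (P i); last first.
 by have [y yP] := IHr; exists y; rewrite big_cons (negPf nPi).
have [aF [y1 Fy]] := FP i Pi; have [y2 y2P] := IHr.
have aG : ganalytic (fun y => \prod_(i <- r | P i) F i y).
 by apply: ganalytic_prod => k Pk; have [] := FP k Pk.
apply: contrapT => no.
have E y : F i y * \prod_(i <- r | P i) F i y = 0.
 by apply/eqP; apply: contrapT => /negP ne; apply: no; exists y; rewrite big_cons Pi.
have [/(_ y1)/eqP|/(_ y2)/eqP] := ganalytic_domain aF aG E; first by rewrite (negPf Fy).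
by rewrite (negPf y2P).
Qed.

Lemma monomial_cancel (g : 'I_n -> nat) (f h : 'rV[R]_n -> R) : ganalytic f -> ganalytic h ->
 (forall y, monomial g y * f y = monomial g y * h y) -> forall y, f y = h y.
Proof.
move=> af ah E.
have aB : ganalytic (fun x => f x - h x) by exact: ganalyticB.
have [//|/(_ (\row__ 1))/eqP|H x] := ganalytic_domain (ganalytic_monomial g) aB.
- by move=> x; rewrite mulrBr E subrr.
- by rewrite (negPf (monomial_neq0 _)) // => i _; rewrite mxE oner_eq0.
by apply/eqP; rewrite -subr_eq0; apply/eqP.
Qed.

Lemma even_sum_exponents m (Q : pred 'I_m) (e : 'I_m -> nat) (A w : 'I_m -> 'rV[R]_n -> R)
  (al : 'I_m -> 'I_n -> nat) (sg : 'I_n -> nat) (wS : 'rV[R]_n -> R) :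
 (forall i, ~~ odd (e i)) -> (forall i, Q i -> (0 < e i)%N) ->
 (forall i, Q i -> [/\ ganalytic (w i), forall t, w i t != 0 & forall t, A i t = monomial (al i) t * w i t]) ->
 ganalytic wS -> (forall t, wS t != 0) ->
 (forall t, \sum_(i | Q i) A i t ^+ e i = monomial sg t * wS t) ->
 (forall i, Q i -> forall l, (sg l <= e i * al i l)%N) /\
 exists2 i, Q i & forall l, (e i * al i l = sg l)%N.
Proof.
move=> eo e0 AP aS S0 SE.
have le_exp i : Q i -> forall l, (sg l <= e i * al i l)%N.
 move=> Qi l; rewrite leqNgt; apply/negP => lt; have [aw w0 AE] := AP i Qi.
 have [M M0 MP] := smooth_bounded (r := 1) [::] aS.1 (fun _ _ => I).
 have aV := ganalyticV (ganalyticX (e i) aw) (fun t => expf_neq0 (e i) (w0 t)).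
 have [B B0 BP] := smooth_bounded (r := 1) [::] aV.1 (fun _ _ => I).
 pose tau : R := (M * B + 1)^-1.
 have MB : 0 <= M * B by exact: mulr_ge0.
 have tau0 : 0 < tau by rewrite invr_gt0 ltr_wpDl.
 have tau1 : tau <= 1 by rewrite invf_le1 ?ltr_wpDl // lerDr.
 pose t : 'rV[R]_n := \row_k (if k == l then tau else 1).
 have t1 : `|t| <= 1.
  apply: row_norm_le => // k; rewrite mxE.
  by case: eqP => _; rewrite ?normr1 // gtr0_norm.
 have mt (g : 'I_n -> nat) : monomial g t = tau ^+ g l.
  rewrite /monomial (bigD1 l) //= mxE eqxx big1 ?mulr1 // => k /negPf kl.
  by rewrite mxE kl expr1n.
 have le1 : A i t ^+ e i <= monomial sg t * wS t.
  rewrite -SE (bigD1 i) //= lerDl; apply: sumr_ge0 => k _.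
  by rewrite exprn_even_ge0.
 move: le1; rewrite AE !mt exprMn -exprM [(al i l * _)%N]mulnC => le1.
 have p0 : 0 < w i t ^+ e i by rewrite exprn_even_gt0 // w0 orbT.
 have := BP t t1; rewrite Dw_nil normfV gtr0_norm // => Bt.
 have := MP t t1; rewrite Dw_nil => Mt.
 have wS0 : 0 <= wS t.
  by move: (le_trans (ltW (mulr_gt0 (exprn_gt0 _ tau0) p0)) le1); rewrite pmulr_rge0 // exprn_gt0.
 have {}le1 : w i t ^+ e i <= tau * M.
  rewrite -(ler_pM2l (exprn_gt0 (e i * al i l) tau0)); apply: le_trans le1 _.
  rewrite mulrA -exprSr; apply: ler_pM; rewrite ?exprn_ge0 ?(ltW tau0) //.
  - by apply: ler_wiXn2l => //; exact: ltW.
  - exact: le_trans (ler_norm _) Mt.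
 have : 1 <= tau * M * B.
  rewrite -(divff (lt0r_neq0 p0)); apply: ler_pM => //; first exact: ltW.
  by rewrite invr_ge0 ltW.
 by rewrite -mulrA /tau mulrC ler_pdivlMr ?ltr_wpDl // mul1r leNgt ltrDl ltr01.
split=> //; apply: contrapT => no.
pose Qf i t := monomial (fun l => e i * al i l - sg l)%N t * w i t ^+ e i.
have aQ i : Q i -> ganalytic (Qf i).
 move=> Qi; have [aw _ _] := AP i Qi.
 by apply: ganalyticM; [exact: ganalytic_monomial | exact: ganalyticX].
have E : forall t, wS t = \sum_(i | Q i) Qf i t.
 apply: (@monomial_cancel sg) => //; first by apply: ganalytic_sum.
 move=> t; rewrite -SE mulr_sumr; apply: eq_bigr => i Qi; have [_ _ AE] := AP i Qi.
 rewrite AE exprMn -monomialX /Qf mulrA -monomialD; congr (monomial _ _ * _).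
 by apply/funext => l; rewrite subnKC // le_exp.
have /eqP := S0 0; apply; rewrite E big1 // => i Qi.
have [l lP] : exists l, (sg l < e i * al i l)%N.
 apply: contrapT => nol; apply: no; exists i => // l; apply/eqP; rewrite eqn_leq (le_exp i Qi) andbT leqNgt.
 by apply/negP => h; apply: nol; exists l.
rewrite /Qf (monomial_split (j := l)) ?subn_gt0 // mxE !mul0r //.
Qed.

Lemma monomial_signed_power (g : 'I_n -> nat) (D : nat) (eps : 'I_n -> bool) y :
 monomial g (\row_l ((-1) ^+ eps l * y 0 l ^+ D)) =
 monomial (fun l => D * g l)%N y * \prod_l ((-1) ^+ eps l) ^+ g l.
Proof.
rewrite /monomial -big_split; apply: eq_bigr => l _ /=; rewrite mxE exprMn mulrC.
by rewrite [y 0 l ^+ (D * _)]exprM.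
Qed.

End ProductsAndPowers.

Section Base.
Context {R : realType} {n : nat}.
Implicit Types (x : 'rV[R]_(1 + n)) (s : 'rV[R]_n).

Lemma monz_base (h : 'rV[R]_(1 + n) -> R) (G : 'rV[R]_n -> R) (r1 : R) : 0 < r1 -> monz G 0 ->
 (forall pi, monchart G 0 r1 pi -> forall s, `|s| <= 1 ->
  monz (h \o (fun x => zy (zc x) (pi (yc x)))) (zy 0 s)) -> monz h 0.
Proof.
move=> r10 mG H; apply: monz_blow => r r0.
have m0 : 0 < Num.min r r1 by rewrite lt_min r0.
have [L LP [e e0 eP]] := mG _ m0.
pose th (k : 'I_(size L)) x := zy (zc x) (nth id L k (yc x)).
have thP (k : 'I_(size L)) : monchart G 0 (Num.min r r1) (nth id L k) by apply: LP; apply: mem_nth.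
pose K0 : set 'rV[R]_(1 + n) := zy 0 @` [set s | `|s| <= 1].
have cK0 : compact K0.
 apply: continuous_compact; last exact: closed_ball0_compact.
 apply: continuous_subspaceT => s.
 have sz : smooth_on setT (fun s : 'rV[R]_n => zy (0 : R) s).
  by apply: smooth_zy; [exact: openT | exact: smooth_cst | exact: smooth_id openT].
 exact: (smooth_continuous sz I).
exists (size L), th, (fun=> K0); split.
 move=> k; have [api pir gu] := thP k; split=> //.
  apply: ganalyticv_zy; first exact: ganalytic_zc.
  exact: (ganalyticv_comp api (@ganalyticv_yc R n)).
 move=> _ [s /= s1 <-]; split.
  rewrite subr0 /th zc_zy yc_zy; apply: zy_lt; first by rewrite normr0.
  by have := pir s; rewrite subr0 lt_min => /andP[].
 apply: H => //; split=> // s'; apply: lt_le_trans (pir s') _.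
 by rewrite ge_min lexx orbT.
move=> W WP.
have /choice [eW eWP] : forall k, exists eW : R, 0 < eW /\ forall p q, K0 p -> `|q - p| < eW -> W k q.
 by move=> k; have [oW KW] := WP k; have [eW ? ?] := tube cK0 oW KW; exists eW.
pose e1 := \big[Num.min/e]_(k < size L) eW k.
have e10 : 0 < e1 by apply: lt_bigmin => // k _; exact: (eWP k).1.
have e1k k : e1 <= eW k by exact: bigmin_le_cond.
exists e1 => // x; rewrite subr0 => xe1.
have xe : `|yc x - 0| < e.
 rewrite subr0; apply: le_lt_trans (yc_le _) _; apply: lt_le_trans xe1 _; exact: bigmin_le_id.
have [pi [s [piL s1 pis]]] := eP _ xe.
have kL : (index pi L < size L)%N by rewrite index_mem.
exists (Ordinal kL), (zy (zc x) s); split.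
 apply: ((eWP (Ordinal kL)).2 (zy 0 s)); first by exists s.
 rewrite zyB subr0 subrr; apply: lt_le_trans (e1k _); apply: zy_lt; rewrite ?normr0 //.
 by apply: le_lt_trans (zc_le _) xe1.
by rewrite /th zc_zy yc_zy nth_index // pis zy_eta.
Qed.

End Base.

Lemma sum_ord_pred (V : nmodType) (F : nat -> V) m : (0 < m)%N ->
 \sum_(i < m) F i = \sum_(i < m.-1) F i + F m.-1.
Proof. by case: m => // m _; rewrite big_ord_recr. Qed.

Lemma ganalytic_mul_nonzero {R : realType} {n} (f g : 'rV[R]_n -> R) : ganalytic f -> ganalytic g ->
 (exists y, f y != 0) -> (exists y, g y != 0) -> exists y, f y * g y != 0.
Proof.
move=> af ag [y1 fy] [y2 gy]; apply: contrapT => no.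
have E y : f y * g y = 0 by apply/eqP; apply: contrapT => /negP ne; apply: no; exists y.
have [/(_ y1)/eqP|/(_ y2)/eqP] := ganalytic_domain af ag E; first by rewrite (negPf fy).
by rewrite (negPf gy).
Qed.

Section Ramification.
Context {R : realType} {n : nat}.

Definition ramify (rho : R) (s0 : 'rV[R]_n) (D : nat) (eps : {ffun 'I_n -> bool}) (y : 'rV[R]_n) : 'rV[R]_n :=
 lamv rho s0 (\row_l ((-1) ^+ eps l * y 0 l ^+ D)).

Lemma ganalyticv_signed_power (D : nat) (eps : {ffun 'I_n -> bool}) :
 @ganalyticv R n n (fun y => \row_l ((-1) ^+ eps l * y 0 l ^+ D)).
Proof.
move=> i; under eq_fun do rewrite mxE; apply: ganalyticZ; apply: ganalyticX; exact: ganalytic_coord.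
Qed.

Lemma ganalyticv_ramify rho s0 D eps : ganalyticv (ramify rho s0 D eps).
Proof. exact: (ganalyticv_comp (ganalyticv_lamv rho s0) (ganalyticv_signed_power D eps)). Qed.

Lemma ramify0 rho s0 D eps : (0 < D)%N -> ramify rho s0 D eps 0 = s0.
Proof.
move=> D0; rewrite /ramify; have -> : \row_l ((-1) ^+ eps l * (0 : 'rV[R]_n) 0 l ^+ D) = 0.
 by apply/rowP => l; rewrite !mxE expr0n gtn_eqF // mulr0.
exact: lamv_at0.
Qed.

Lemma ramify_onto (rho : R) s0 D (e : R) : 0 < rho -> (0 < D)%N -> 0 < e ->
 exists2 e' : R, 0 < e' & forall y, `|y - s0| < e' -> exists eps y', `|y'| < e /\ ramify rho s0 D eps y' = y.
Proof.
move=> rho0 D0 e0; have e2 : 0 < e / 2 by rewrite divr_gt0.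
pose e' := rho * Num.min 1 ((e / 2) ^+ D).
have m0 : 0 < Num.min 1 ((e / 2) ^+ D) by rewrite lt_min ltr01 exprn_gt0.
exists e'; first exact: mulr_gt0.
move=> y ye; have yr : `|y - s0| <= rho.
 by apply: le_trans (ltW ye) _; rewrite /e' ler_piMr ?ge_min ?lexx // ltW.
have [t t1 tE] := lamv_onto rho0 yr.
have te i : `|t 0 i| <= (e / 2) ^+ D.
 apply: le_trans (coord_le_norm _ _) _; apply: le_trans t1 _; rewrite ler_pdivrMr // mulrC.
 apply: le_trans (ltW ye) _; apply: ler_wpM2l; first exact: ltW.
 by rewrite ge_min lexx orbT.
have /choice [z zP] : forall i, exists z : R, `|z| <= e / 2 /\ z ^+ D = `|t 0 i|.
 move=> i; have [t0|tn0] := eqVneq (t 0 i) 0.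
  by exists 0; rewrite t0 !normr0 expr0n gtn_eqF // ltW.
 have tp : 0 < `|t 0 i| by rewrite normr_gt0.
 have [z [z0 ze zD]] := powR_root D0 tp (ltW e2) (te i).
 by exists z; split => //; rewrite gtr0_norm.
exists [ffun i => t 0 i < 0], (\row_i z i); split.
 apply: (@le_lt_trans _ _ (e / 2)); last by rewrite ltr_pdivrMr // ltr_pMr ?ltr1n.
 apply: row_norm_le => [|i]; first exact: ltW.
 by rewrite mxE (zP i).1.
rewrite /ramify -tE; congr (lamv _ _ _); apply/rowP => i; rewrite !mxE ffunE (zP i).2.
case: ltP => ti; first by rewrite expr1 mulN1r ltr0_norm // opprK.
by rewrite expr0 mul1r ger0_norm.
Qed.

Lemma monomial_ramify (rho : R) s0 (D : nat) eps (g' : 'I_n -> nat) (f w : 'rV[R]_n -> R) :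
 ganalytic w -> (forall t, w t != 0) -> (forall t, f (lamv rho s0 t) = monomial g' t * w t) ->
 exists2 w' : 'rV[R]_n -> R, ganalytic w' /\ (forall y, w' y != 0) &
  forall y, f (ramify rho s0 D eps y) = monomial (fun l => D * g' l)%N y * w' y.
Proof.
move=> aw w0 fE.
exists (fun y => \prod_l ((-1) ^+ eps l) ^+ g' l * w (\row_l ((-1) ^+ eps l * y 0 l ^+ D))).
 split; last first.
  move=> y; rewrite mulf_neq0 //; apply/prodf_neq0 => l _.
  by rewrite expf_neq0 // expf_neq0 // oppr_eq0 oner_eq0.
 by apply: ganalyticZ; exact: (ganalytic_comp aw (ganalyticv_signed_power D eps)).
by move=> y; rewrite /ramify fE monomial_signed_power mulrA.
Qed.

End Ramification.

Section Induction.
Context {R : realType} {n : nat}.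
Hypothesis IHn : forall g : 'rV[R]_n -> R, ganalytic g -> (exists y, g y != 0) -> forall p, monz g p.
Implicit Types (x : 'rV[R]_(1 + n)) (y : 'rV[R]_n).

Lemma monz_order0 : @monz_order R n 0.
Proof.
move=> H g aH ag g0; rewrite Dw_nil => H0.
have [r1 r10 r1P] := continuous_neq0_ball (smooth_continuous aH.1 (I : setT 0)) H0.
apply: (monz_base r10 (IHn ag g0 0)) => pi [api pir [gm [u [au u0 uE]]]] s s1.
have ath : ganalyticv (fun x => zy (zc x) (pi (yc x))).
 by apply: ganalyticv_zy; [exact: ganalytic_zc | exact: (ganalyticv_comp api (@ganalyticv_yc R n))].
apply: (@monz_unit _ _ _ (fun x => H (zy (zc x) (pi (yc x))) * u (yc x)) (gzy 0 gm)).
- apply: ganalyticM; first exact: (ganalytic_comp aH ath).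
 exact: (ganalytic_comp au (@ganalyticv_yc R n)).
- rewrite mulf_neq0 //; apply: r1P; rewrite ball0E zc_zy yc_zy.
 by apply: zy_lt; rewrite ?normr0 //; have := pir s; rewrite subr0.
- by move=> x; rewrite /= yc_zy uE monomial_gzy expr0 mul1r mulrCA.
Qed.

Section Step.
Variable mu : nat.
Hypotheses (mu0 : (0 < mu)%N) (IHmu : forall i, (i < mu)%N -> @monz_order R n i).

Let D := (2 * mu`!)%N.
Let D0 : (0 < D)%N. Proof. by rewrite muln_gt0 fact_gt0. Qed.
Let e_ (i : nat) := (D %/ (mu - i))%N.

Let eE (i : 'I_mu.-1) : (e_ i * (mu - i) = D)%N /\ ~~ odd (e_ i) /\ (0 < e_ i)%N.
Proof.
have im : (i < mu)%N by rewrite (leq_trans (ltn_ord i)) // leq_pred.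
have d1 : (mu - i %| mu`!)%N by rewrite dvdn_fact // subn_gt0 im leq_subr.
have d2 : (mu - i %| D)%N by rewrite dvdn_mull.
split; first by rewrite /e_ divnK.
split; first by rewrite /e_ /D -muln_divA // oddM.
by rewrite divn_gt0 ?subn_gt0 // dvdn_leq.
Qed.

Lemma monz_centred (H : 'rV[R]_(1 + n) -> R) (g : 'rV[R]_n -> R) : ganalytic H -> ganalytic g ->
 (exists y, g y != 0) -> (forall y, Dw (nseq mu.-1 z0) H (zy 0 y) = 0) -> Dw (nseq mu z0) H 0 != 0 ->
 monz (fun x => H x * g (yc x)) 0.
Proof.
move=> aH ag g0 Hc Hmu.
have [a [u [aa au HE ak um]]] := vertical_taylor mu aH.
have a1 y : a mu.-1 y = 0.
 have := ak mu.-1 y; rewrite Hc prednK // leqnn => /(_ isT) /esym/eqP; rewrite mulf_eq0 => /orP[|/eqP//].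
 by rewrite pnatr_eq0 -leqn0 leqNgt fact_gt0.
have {}HE x : H x = \sum_(i < mu.-1) a i (yc x) * zc x ^+ i + zc x ^+ mu * u x.
 by rewrite HE (sum_ord_pred (fun i => a i (yc x) * zc x ^+ i) mu0) a1 mul0r addr0.
have u0 : u 0 != 0.
 by move: Hmu; rewrite -zy00 um mulf_eq0 => /norP[].
have [r1 r10 r1P] := continuous_neq0_ball (smooth_continuous au.1 (I : setT 0)) u0.
pose Q : pred 'I_mu.-1 := fun i => `[< exists y, a i y != 0 >].
have nQ (i : 'I_mu.-1) : ~~ Q i -> forall y, a i y = 0.
 move=> /asboolPn no y; apply/eqP; apply: contrapT => /negP ne; apply: no; by exists y.
pose S y := \sum_(i | Q i) a i y ^+ e_ i.
have aS : ganalytic S by apply: ganalytic_sum => i _; exact: ganalyticX.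
have thE (pi : 'rV[R]_n -> 'rV[R]_n) : ganalyticv pi -> ganalyticv (fun x => zy (zc x) (pi (yc x))).
 by move=> api; apply: ganalyticv_zy; [exact: ganalytic_zc | exact: (ganalyticv_comp api (@ganalyticv_yc R n))].
have unz (pi : 'rV[R]_n -> 'rV[R]_n) s : (forall s, `|pi s - 0| < r1) -> u (zy 0 (pi s)) != 0.
 move=> pir; apply: r1P; rewrite ball0E.
 by apply: zy_lt; rewrite ?normr0 //; have := pir s; rewrite subr0.
have [Qe|/existsPn Q0] := boolP [exists i, Q i]; last first.
 apply: (monz_base r10 (IHn ag g0 0)) => pi [api pir [gm [v [av v0 vE]]]] s s1.
 apply: (@monz_unit _ _ _ (fun x => u (zy (zc x) (pi (yc x))) * v (yc x)) (gzy mu gm)).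
 - apply: ganalyticM; first exact: (ganalytic_comp au (thE pi api)).
  exact: (ganalytic_comp av (@ganalyticv_yc R n)).
 - by rewrite mulf_neq0 // zc_zy yc_zy unz.
 - move=> x; rewrite /= yc_zy vE monomial_gzy HE big1 ?add0r; last first.
   by move=> i _; rewrite nQ ?mul0r.
  by rewrite zc_zy; move: (zc x ^+ _) (monomial _ _) => *; ring.
have {Qe} [j Qj] : exists j, Q j by exact/existsP.
have S0 : exists y, S y != 0.
 have /asboolP [y ay] := Qj; exists y; rewrite gt_eqF // /S (bigD1 j) //=.
 have [_ [eo ep]] := eE j; rewrite ltr_pwDl //; first by rewrite exprn_even_gt0 // ay orbT.
 by apply: sumr_ge0 => i _; rewrite exprn_even_ge0 // (eE i).2.1.
pose Pa y := \prod_(i | Q i) a i y.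
have aPa : ganalytic Pa by exact: ganalytic_prod.
have Pa0 : exists y, Pa y != 0.
 by apply: ganalytic_prod_nonzero => i /asboolP Qi.
pose G y := g y * (Pa y * S y).
have aG : ganalytic G by apply: ganalyticM => //; exact: ganalyticM.
have G0 : exists y, G y != 0.
 apply: ganalytic_mul_nonzero => //; first exact: ganalyticM.
 exact: ganalytic_mul_nonzero.
apply: (monz_base r10 (IHn aG G0 0)) => pi [api pir [Gm [U [aU U0 UE]]]] s0 s1.
have ac f : ganalytic f -> ganalytic (f \o pi) by move=> af; exact: ganalytic_comp af api.
have [rho /andP[rho0 _] rhos] := small_radius s0 ltr01.
have reloc f (B : 'rV[R]_n -> R) : ganalytic f -> ganalytic B -> (forall s, f (pi s) * B s = G (pi s)) ->
  exists (g' : 'I_n -> nat) (w : 'rV[R]_n -> R), [/\ ganalytic w, forall t, w t != 0 &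
   forall t, f (pi (lamv rho s0 t)) = monomial g' t * w t].
 move=> af aB fB; have [|g1 [V [aV V0 VE]]] := @monomial_factor R n (f \o pi) B U Gm (ac f af) aB aU U0.
  by move=> s; rewrite /= fB UE.
 have [g' [w [aw w0 wE]]] := monomial_lamv g1 rho0 rhos.
 exists g', (fun t => w t * V (lamv rho s0 t)); split.
 - by apply: ganalyticM => //; exact: (ganalytic_comp aV (ganalyticv_lamv rho s0)).
 - by move=> t; rewrite mulf_neq0.
 - by move=> t; have /= -> := VE (lamv rho s0 t); rewrite wE mulrA.
have [||gg [wg [awg wg0 wgE]]] := reloc g (fun s => Pa (pi s) * S (pi s)) ag => //.
 by apply: ganalyticM; exact: ac.
have [||sg [wS [awS wS0 wSE]]] := reloc S (fun s => g (pi s) * Pa (pi s)) aS.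
- by apply: ganalyticM; exact: ac.
- by move=> s; rewrite /G; ring.
have /choice [al alP] : forall i : 'I_mu.-1, exists gw : ('I_n -> nat) * ('rV[R]_n -> R), Q i ->
  [/\ ganalytic gw.2, forall t, gw.2 t != 0 & forall t, a i (pi (lamv rho s0 t)) = monomial gw.1 t * gw.2 t].
 move=> i; have [Qi|nQi] := boolP (Q i); last by exists (fun=> 0%N, fun=> 0).
 have [||g' [w wP]] := reloc (a i) (fun s => g (pi s) * (\prod_(k | Q k && (k != i)) a k (pi s) * S (pi s))) (aa i).
 - apply: ganalyticM; first exact: ac.
  apply: ganalyticM; last exact: ac.
  by apply: ganalytic_prod => k _; exact: (ac (a k)).
 - by move=> s; rewrite /G /Pa [\prod_(k | Q k) _](bigD1 i) //= -!mulrA mulrCA.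
 by exists (g', w).
have [le_exp [i0 Qi0 eq_exp]] := @even_sum_exponents R n mu.-1 Q e_ (fun i t => a i (pi (lamv rho s0 t)))
  (fun i => (al i).2) (fun i => (al i).1) sg wS (fun i => (eE i).2.1) (fun i _ => (eE i).2.2) alP awS wS0
  (fun t => esym (esym (wSE t))).
pose ram eps y := ramify rho s0 D eps y.
have aram eps : ganalyticv (ram eps) by exact: ganalyticv_ramify.
pose th eps x := zy (zc x) (ram eps (yc x)).
have ath eps : ganalyticv (th eps) by exact: thE.
have th0 eps : th eps 0 = zy 0 s0 by rewrite /th /ram -zy00 zc_zy yc_zy ramify0.
apply: monz_blow => r r0.
exists #|{: {ffun 'I_n -> bool}}|, (fun k => th (enum_val k)), (fun=> [set 0]); split; last first.
 move=> W WP.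
 have /choice [eW eWP] : forall k, exists eW : R, 0 < eW /\ forall q, `|q| < eW -> W k q.
  move=> k; have [oW KW] := WP k.
  have /nbhs_ballP [e /= e0 eP]  : nbhs (0 : 'rV[R]_(1 + n)) (W k) by apply: open_nbhs_nbhs; split => //; exact: KW.
  by exists e; split=> // q qe; apply: eP; rewrite ball0E.
 pose e := \big[Num.min/1]_(k < #|{: {ffun 'I_n -> bool}}|) eW k.
 have e0 : 0 < e by apply: lt_bigmin => // k _; exact: (eWP k).1.
 have ek k : e <= eW k by exact: bigmin_le_cond.
 have [e' e'0 e'P] := ramify_onto s0 rho0 D0 e0.
 exists (Num.min e e'); first by rewrite lt_min e0.
 move=> x; rewrite lt_min -[x]zy_eta zyB subr0 => /andP[xe xe'].
 have ye' : `|yc x - s0| < e' by apply: le_lt_trans xe'; have := yc_le (zy (zc x) (yc x - s0)); rewrite yc_zy.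
 have ze : `|zc x| < e by apply: le_lt_trans xe; have := zc_le (zy (zc x) (yc x - s0)); rewrite zc_zy.
 have [eps [y' [y'e y'E]]] := e'P _ ye'.
 exists (enum_rank eps), (zy (zc x) y'); split.
  by apply: (eWP _).2; apply: lt_le_trans (ek _); exact: zy_lt.
 by rewrite /th enum_rankK zc_zy yc_zy /ram y'E.
move=> k; set eps := enum_val k; split=> //; first exact: compact_set1.
move=> _ ->; rewrite th0 subrr normr0; split=> //.
have [v [av v0] vE] := @monomial_ramify R n rho s0 D eps gg (g \o pi) wg awg wg0 wgE.
have /choice [b bP] : forall i : nat, exists b : 'rV[R]_n -> R, ganalytic b /\ forall im : (i < mu.-1)%N,
  (forall y, a i (pi (ram eps y)) = b y * monomial (fun l => (mu - i) * sg l)%N y) /\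
  (Ordinal im = i0 -> b 0 != 0).
 move=> i; have [im|nim] := pselect (i < mu.-1)%N; last by exists (fun=> 0); split; [exact: ganalytic_cst | move=> im; case: nim].
 pose oi := Ordinal im; have [Qi|nQi] := boolP (Q oi); last first.
  exists (fun=> 0); split; [exact: ganalytic_cst | move=> im'].
  have -> : Ordinal im' = oi by exact: val_inj.
  split=> [y|oi0]; first by rewrite mul0r (nQ oi nQi).
  by move: nQi; rewrite oi0 Qi0.
 have [aw w0 wE] := alP oi Qi; have [w' [aw' w'0] w'E] := @monomial_ramify R n rho s0 D eps _ (a i \o pi) _ aw w0 wE.
 have [eD _] := eE oi.
 have le1 l : ((mu - i) * sg l <= D * (al oi).1 l)%N.
  by rewrite -eD mulnC mulnAC leq_mul2r (le_exp oi Qi) orbT.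
 exists (fun y => monomial (fun l => D * (al oi).1 l - (mu - i) * sg l)%N y * w' y); split.
  by apply: ganalyticM => //; exact: ganalytic_monomial.
 move=> im'; have -> : Ordinal im' = oi by exact: val_inj.
 split=> [y|oi0].
  have /= -> := w'E y; rewrite mulrAC -monomialD; congr (monomial _ _ * _).
  by apply/funext => l; rewrite subnK.
 rewrite mulf_neq0 //; apply: monomial_neq0 => l.
 suff -> : (D * (al oi).1 l - (mu - i) * sg l = 0)%N by [].
 by rewrite -eD (mulnC (e_ oi)) -mulnA -mulnBr oi0 eq_exp subnn muln0.
pose u' x := u (zy (zc (th eps x)) (pi (yc (th eps x)))).
have au' : ganalytic u' := ganalytic_comp (ganalytic_comp au (thE pi api)) (ath eps).
have u'0 : u' 0 != 0 by rewrite /u' th0 zc_zy yc_zy unz.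
have [_ bi0] := (bP i0).2 (ltn_ord i0).
have {}bi0 : b i0 0 != 0 by apply: bi0; exact: val_inj.
have := @monz_form R n mu IHmu sg b u' (fun l => D * gg l)%N v i0 (fun i => (bP i).1) au' u'0 (ltn_ord i0) bi0 av (v0 0).
congr (monz _ 0); apply/funext => x; rewrite /= yc_zy HE zc_zy yc_zy {1 2 3 4 5}/th !zc_zy !yc_zy -/(ram eps _); have /= -> := vE (yc x); congr (_ * _).
have -> : u' x = u (zy (zc x) (pi (ram eps (yc x)))) by rewrite /u' /th zc_zy yc_zy.
congr (_ + _); apply: eq_bigr => i _.
by have [-> _] := (bP i).2 (ltn_ord i).
Qed.

Lemma monz_order_step : @monz_order R n mu.
Proof.
move=> H g aH ag g0 Hmu.
have mu1 : (mu.-1 < mu)%N by rewrite prednK.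
have [H1|H1] := eqVneq (Dw (nseq mu.-1 z0) H 0) 0; last exact: (IHmu mu1 aH ag g0 H1).
pose k := Dw (nseq mu.-1 z0) H; have ak : ganalytic k by exact: ganalytic_Dw.
have kz : Dw [:: z0] k 0 != 0 by rewrite -Dw_cat; have := Hmu; rewrite -{1}(prednK mu0).
have [r [psi [r0 apsi psi0 kpsi _]]] := implicit_graph ak H1 kz.
pose th x := zy (zc x + psi (yc x)) (lamv r 0 (yc x)).
have ath : ganalyticv th.
 apply: ganalyticv_zy; last exact: (ganalyticv_comp (ganalyticv_lamv r 0) (@ganalyticv_yc R n)).
 by apply: ganalyticD; [exact: ganalytic_zc | exact: (ganalytic_comp apsi (@ganalyticv_yc R n))].
have th0 : th 0 = 0 by rewrite /th -zy00 zc_zy yc_zy psi0 addr0 lamv_at0.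
have DH m x : Dw (nseq m z0) (H \o th) x = Dw (nseq m z0) H (th x).
 apply: (@Dw_embed_dir R _ _ th z0 z0) => h x'; apply/esym/zyP; rewrite ?zc_shift ?yc_shift /th ?zc_zy ?yc_zy //.
  by rewrite addrA.
apply: (@monz_blow1 R _ _ 0 th 0 ath th0).
 have ag' : ganalytic (g \o lamv r 0) := ganalytic_comp ag (ganalyticv_lamv r 0).
 have -> : ((fun x => H x * g (yc x)) \o th) = (fun x => (H \o th) x * (g \o lamv r 0) (yc x)).
  by apply/funext => x; rewrite /= /th yc_zy.
 apply: monz_centred => //.
 - exact: ganalytic_comp aH ath.
 - have [y By gy] := ganalytic_near_nonzero 0 ag r0 g0.
  have yr : `|y - 0| <= r by move: By; rewrite ballE => /ltW.
  by have [s _ sy] := lamv_onto r0 yr; exists s; rewrite /= sy.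
 - by move=> y; rewrite DH /th zc_zy yc_zy add0r; exact: kpsi.
 - by rewrite DH th0.
move=> e e0; have cpsi : {for 0, continuous psi} := smooth_continuous apsi.1 I.
have e2 : 0 < e / 2 by rewrite divr_gt0.
have /cvgrPdist_lt /(_ _ e2) /nbhs_ballP [d /= d0 dP] := cpsi.
pose m := Num.min 1 (Num.min (e / 2) d / 2).
have m0 : 0 < m by rewrite lt_min ltr01 divr_gt0 // lt_min e2.
exists (Num.min (e / 2) (r * m)); first by rewrite lt_min e2 mulr_gt0.
move=> x; rewrite subr0 lt_min => /andP[xe xr].
have yr : `|yc x - 0| <= r.
 rewrite subr0; apply: le_trans (yc_le _) _; apply: le_trans (ltW xr) _.
 by rewrite ler_piMr ?(ltW r0) // ge_min lexx.
have [s s1 sE] := lamv_onto r0 yr.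
have sm : `|s| <= m.
 apply: le_trans s1 _; rewrite subr0 ler_pdivrMr // mulrC; apply: le_trans (yc_le _) (ltW xr).
have sd : `|s| < d /\ `|s| < e.
 have : `|s| <= Num.min (e / 2) d / 2 by apply: le_trans sm _; rewrite ge_min lexx orbT.
 have : Num.min (e / 2) d <= e / 2 by rewrite ge_min lexx.
 have : Num.min (e / 2) d <= d by rewrite ge_min lexx orbT.
 by move: e0 d0; move: (Num.min _ _) => q *; split; lra.
exists (zy (zc x - psi s) s).
 rewrite subr0; apply: zy_lt; last exact: sd.2.
 have : `|psi 0 - psi s| < e / 2 by apply: dP; rewrite ball0E sd.1.
 rewrite psi0 sub0r normrN => ps; apply: le_lt_trans (ler_normB _ _) _.
 by have := zc_le x; lra.
by rewrite /th zc_zy yc_zy subrK sE zy_eta.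
Qed.

End Step.

Lemma monz_order_all mu : @monz_order R n mu.
Proof.
elim/ltn_ind: mu => -[|mu] IH; first exact: monz_order0.
exact: monz_order_step.
Qed.

Lemma monomialization_step (h : 'rV[R]_(1 + n) -> R) : ganalytic h -> (exists x, h x != 0) -> forall p, monz h p.
Proof.
move=> ah h0 p; apply: monz_shift; set h1 := fun s => h (s + p).
have ah1 : ganalytic h1.
 apply: (ganalytic_comp ah) => i; under eq_fun do rewrite mxE.
 by apply: ganalyticD; [exact: ganalytic_coord | exact: ganalytic_cst].
have h10 : exists x, h1 x != 0 by have [x hx] := h0; exists (x - p); rewrite /h1 subrK.
have z1 : exists x, @zc R n x != 0 by exists (zy 1 0); rewrite zc_zy oner_eq0.
have [v] := ganalytic_mul_nonzero ah1 (@ganalytic_zc R n) h10 z1.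
rewrite mulf_eq0 => /norP[hv zv].
pose phi (t : 'rV[R]_1) := h1 (t 0 0 *: v).
have aphi : ganalytic phi.
 apply: (ganalytic_comp ah1) => i; under eq_fun do rewrite mxE mulrC.
 by apply: ganalyticZ; exact: ganalytic_coord.
have [w phw] : exists w, Dw w phi 0 != 0.
 apply: contrapT => no; have := ganalytic_flat0 aphi (p := 0) _ (\row__ 1).
 rewrite /phi mxE scale1r => H; move/eqP: hv; apply; apply: H => w.
 by apply/eqP; apply: contrapT => /negP ne; apply: no; exists w.
pose mu := size w; have wE : w = nseq mu ord0.
 by rewrite /mu; elim: (w) => //= i w' <-; rewrite (ord1 i).
pose e := zy 1 (0 : 'rV[R]_n); pose L x := x + zc x *: (v - e).
have aL : ganalyticv L.
 move=> i; under eq_fun do rewrite 2!mxE; apply: ganalyticD; first exact: ganalytic_coord.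
 by under eq_fun do rewrite mulrC; apply: ganalyticZ; exact: ganalytic_zc.
have L0 : L 0 = 0 by rewrite /L /zc mxE scale0r addr0.
have Lt t : L (zy t 0) = t *: v.
 rewrite /L zc_zy scalerBr; have -> : zy t 0 = t *: e.
  by apply/esym/zyP; [rewrite /zc mxE -/(zc e) zc_zy mulr1 | apply/rowP => i; rewrite ycE mxE zy_r !mxE mulr0].
 by rewrite addrCA subrr addr0.
apply: (@monz_blow1 R _ _ 0 L 0 aL L0).
 have -> : h1 \o L = fun x => (h1 \o L) x * (fun=> 1) (yc x) by apply/funext => x; rewrite mulr1.
 apply: (monz_order_all (mu := mu) (ganalytic_comp ah1 aL) (ganalytic_cst n 1)).
  by exists 0; rewrite oner_eq0.
 rewrite -zy00; have := Dz_axis (h1 \o L) mu 0 0; rewrite mxE => ->.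
 have -> : (fun t : 'rV[R]_1 => (h1 \o L) (zy (t 0 0) 0)) = phi.
  by apply/funext => t; rewrite /= Lt.
 by rewrite -wE.
move=> d d0; pose C := 1 + `|v - e| / `|zc v|.
have C0 : 0 < C by rewrite ltr_pwDl // divr_ge0.
exists (d / C); first by rewrite divr_gt0.
move=> x; rewrite subr0 ltr_pdivlMr // => xd.
pose c := zc x / zc v; exists (x - c *: (v - e)).
 rewrite subr0; apply: le_lt_trans xd; apply: le_normB.
 rewrite /C mulrDr mulr1 lerD2l normrZ /c normrM normfV.
 have -> : `|zc x| / `|zc v| * `|v - e| = `|zc x| * (`|v - e| / `|zc v|) by ring.
 by apply: ler_wpM2r; rewrite ?divr_ge0 // zc_le.
have zcE : zc (x - c *: (v - e)) = c.
 rewrite zcB; have -> : zc (c *: (v - e)) = c * (zc v - 1).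
  by rewrite /zc mxE -/(zc (v - e)) zcB zc_zy.
 by rewrite /c mulrBr mulr1 divfK // opprB addrCA subrr addr0.
by rewrite /L zcE subrK.
Qed.

End Induction.

Theorem monomialization {R : realType} {N : nat} (h : 'rV[R]_N -> R) : ganalytic h ->
 (exists x, h x != 0) -> forall p, monz h p.
Proof.
elim: N h => [|n IHn] h ah h0 p; last exact: (@monomialization_step R n IHn h ah h0 p).
have [x hx] := h0; have -> : p = x by apply/rowP => -[].
by apply: (@monz_unit R 0 h h (fun=> 0%N)) => // y; rewrite monomial0 mul1r.
Qed.

Lemma closed_near (R : realType) N (V : normedModType R) (f : 'rV[R]_N -> V) (y : V) (c : R) :
 smooth_on setT f -> closed [set s | `|f s - y| <= c].
Proof.
move=> sf; rewrite (_ : [set s | _] = (fun s => `|f s - y|) @^-1` [set z | z <= c]) //.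
apply: closed_comp; last exact: closed_le.
move=> s _; have cB : {for s, continuous (fun s => f s - y)}.
 exact: (cvgB (smooth_continuous sf (I : setT s) : f @ s --> f s) (@cvg_cst V y _ (nbhs s) _)).
exact: (continuous_comp cB (@norm_continuous R V (f s - y))).
Qed.

Section ChartCovers.
Context {R : realType} {N : nat}.
Implicit Types (h : 'rV[R]_N -> R) (s y : 'rV[R]_N).

Lemma continuous_box_image {d : nat} (Phi : 'rV[R]_N -> 'rV[R]_d) : smooth_on setT Phi ->
 compact [set y | exists2 s, `|s| <= 1 & Phi s = y].
Proof.
move=> sP; have -> : [set y | exists2 s, `|s| <= 1 & Phi s = y] = Phi @` [set s | `|s| <= 1].
 by apply/seteqP; split=> y [s s1 <-]; exists s.
apply: continuous_compact; last exact: closed_ball0_compact.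
by apply: continuous_subspaceT => s; exact: (smooth_continuous sP).
Qed.

Lemma monomial_cover h : ganalytic h -> (exists x, h x != 0) ->
 exists2 L : seq ('rV[R]_N -> 'rV[R]_N),
  (forall pi, pi \in L -> [/\ ganalyticv pi, forall s, `|pi s| < 3 / 2 &
    exists (g : 'I_N -> nat) (u : 'rV[R]_N -> R),
     [/\ ganalytic u, forall s, u s != 0 & forall s, h (pi s) = monomial g s * u s]]) &
  forall y, `|y| <= 1 -> exists pi s, [/\ pi \in L, `|s| <= 1 & pi s = y].
Proof.
move=> ah h0.
have /choice [L LP] : forall p, exists Le : seq ('rV[R]_N -> 'rV[R]_N) * R,
  [/\ (forall pi, pi \in Le.1 -> monchart h p (1 / 2) pi), 0 < Le.2 &
   forall y, `|y - p| < Le.2 -> exists pi s, [/\ pi \in Le.1, `|s| <= 1 & pi s = y]].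
 move=> p; have [|L LP [e e0 eP]] := monomialization ah h0 p (r := 1 / 2); first by rewrite divr_gt0.
 by exists (L, e).
have [||P P1 Pc] := @finite_subcover R N [set x | `|x| <= 1] (fun p => (L p).2).
- exact: closed_ball0_compact.
- by move=> p _; have [] := LP p.
exists (flatten [seq (L p).1 | p <- P]).
 move=> pi /flatten_mapP [p pP piL]; have [/(_ pi piL) [api pir mon] _ _] := LP p; split=> // s.
 have -> : 3 / 2 = 1 / 2 + 1 :> R by lra.
 rewrite -[pi s](subrK p); apply: lt_normD.
 by apply: ltr_leD; [exact: pir | exact: (P1 p pP)].
move=> y y1; have [p pP] := Pc y y1; rewrite ballE => yp.
have [_ _ /(_ y yp) [pi [s [piL s1 E]]]] := LP p.
by exists pi, s; split=> //; apply/flatten_mapP; exists p.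
Qed.

Lemma zero_faces h : ganalytic h -> (exists x, h x != 0) ->
 exists2 L : seq (('rV[R]_N -> 'rV[R]_N) * 'I_N),
  (forall q, q \in L -> [/\ ganalyticv q.1, forall s, `|q.1 s| < 3 / 2 &
    forall s, s 0 q.2 = 0 -> h (q.1 s) = 0]) &
  forall y, `|y| <= 1 -> h y = 0 -> exists q s, [/\ q \in L, `|s| <= 1, s 0 q.2 = 0 & q.1 s = y].
Proof.
move=> ah h0; have [L LP Lc] := monomial_cover ah h0.
exists [seq q <- allpairs pair L (enum 'I_N) | `[< forall s, s 0 q.2 = 0 -> h (q.1 s) = 0 >]].
 move=> q; rewrite mem_filter => /andP[/asboolP qh /allpairsP [[pi l] [/= piL _ qE]]].
 by move: qh; rewrite qE /=; have [] := LP pi piL.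
move=> y y1 hy; have [pi [s [piL s1 E]]] := Lc y y1; have [_ _ [g [u [_ u0 hE]]]] := LP pi piL.
have : monomial g s == 0.
 by move: (hE s); rewrite E hy => /esym/eqP; rewrite mulf_eq0 (negPf (u0 s)) orbF.
move=> /prodf_eq0 [l _]; rewrite expf_eq0 => /andP[gl /eqP sl].
exists (pi, l), s; split=> //; rewrite mem_filter /=; apply/andP; split; last first.
 by apply/allpairsP; exists (pi, l); rewrite piL mem_enum.
apply/asboolP => s' s'l; rewrite hE /monomial (bigD1 l) //= s'l expr0n.
by move: gl; case: (g l) => // k _; rewrite !mul0r.
Qed.

End ChartCovers.

Section NowhereDense.
Context {R : realType} {d : nat}.
Implicit Types (S : set 'rV[R]_d) (x y z : 'rV[R]_d).

Definition nowhere_dense S := forall x (e : R), 0 < e ->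
 exists y (e' : R), 0 < e' /\ forall z, `|z - y| < e' -> `|z - x| < e /\ ~ S z.

Lemma nowhere_dense_union (T : eqType) (L : seq T) (F : T -> set 'rV[R]_d) :
 (forall k, k \in L -> nowhere_dense (F k)) -> nowhere_dense [set z | exists2 k, k \in L & F k z].
Proof.
elim: L => [_ x e e0|k L IHL Lk x e e0].
 by exists x, e; split=> // z ze; split=> // -[k]; rewrite in_nil.
have [|y [e1 [e10 yP]]] := IHL _ x e e0; first by move=> k' k'L; apply: Lk; rewrite inE k'L orbT.
have [y' [e2 [e20 y'P]]] := Lk k (mem_head _ _) y e1 e10.
exists y', e2; split=> // z /y'P [zy nF]; have [zx nL] := yP z zy; split=> // -[k'].
by rewrite inE => /orP[/eqP -> //|k'L F']; apply: nL; exists k'.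
Qed.

Lemma nowhere_dense_closed S : closed S ->
 (forall x (e : R), 0 < e -> exists2 y, `|y - x| < e & ~ S y) -> nowhere_dense S.
Proof.
move=> cS H x e e0; have [y yx nSy] := H x e e0.
have : nbhs y (~` S) by apply: open_nbhs_nbhs; split=> //; exact: closed_openC.
move=> /nbhs_ballP [e' /= e'0 e'P]; exists y, (Num.min e' (e - `|y - x|)); split.
 by rewrite lt_min e'0 subr_gt0.
move=> z; rewrite lt_min => /andP[ze' zx]; split; last by apply: e'P; rewrite ballE.
by rewrite -[z - x](subrKA y); apply: lt_normD; rewrite -ltrBrDr.
Qed.

End NowhereDense.

Section Jacobian.
Context {R : realType}.

Definition jac {N d : nat} (Phi : 'rV[R]_N -> 'rV[R]_d) x : 'M[R]_(d, N) :=
 \matrix_(i, j) Dw [:: j] (fun y => Phi y 0 i) x.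

Definition gram {N d : nat} (Phi : 'rV[R]_N -> 'rV[R]_d) x : R := \det (jac Phi x *m (jac Phi x)^T).

Lemma gramP N d (Phi : 'rV[R]_N -> 'rV[R]_d) x :
 gram Phi x = 0 <-> exists2 v : 'rV[R]_d, v != 0 & v *m jac Phi x = 0.
Proof.
rewrite /gram; set A := jac Phi x; split=> [/eqP/det0P [v v0 vA]|[v v0 vA]]; last by apply/eqP/det0P; exists v => //; rewrite mulmxA vA mul0mx.
exists v => //; have : v *m A *m (v *m A)^T = 0 by rewrite trmx_mul mulmxA -[v *m A *m A^T]mulmxA vA mul0mx.
move/matrixP/(_ 0 0); rewrite mxE [RHS]mxE => /eqP; rewrite psumr_eq0 => [/allP vA0|j _]; last by rewrite [X in _ * X]mxE -expr2 sqr_ge0.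
apply/rowP => j; rewrite [RHS]mxE; apply/eqP; have := vA0 j (mem_index_enum _).
by rewrite [X in _ * X]mxE mulf_eq0 orbb.
Qed.

Lemma ganalytic_det N d (M : 'rV[R]_N -> 'M[R]_d) : (forall i j, ganalytic (fun x => M x i j)) ->
 ganalytic (fun x => \det (M x)).
Proof.
move=> aM; apply: ganalytic_sum => p _; apply: ganalyticZ.
by apply: ganalytic_prod => i _; exact: aM.
Qed.

Lemma ganalytic_gram_entry N d (Phi : 'rV[R]_N -> 'rV[R]_d) i j : ganalyticv Phi ->
 ganalytic (fun x => (jac Phi x *m (jac Phi x)^T) i j).
Proof.
move=> aP; under eq_fun do rewrite mxE; apply: ganalytic_sum => k _.
by under eq_fun do rewrite !mxE; apply: ganalyticM; apply: ganalytic_Dw1; exact: aP.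
Qed.

Lemma ganalytic_gram N d (Phi : 'rV[R]_N -> 'rV[R]_d) : ganalyticv Phi -> ganalytic (gram Phi).
Proof. by move=> aP; apply: ganalytic_det => i j; exact: ganalytic_gram_entry. Qed.

Lemma jac_comp N M d (Phi : 'rV[R]_N -> 'rV[R]_d) (g : 'rV[R]_M -> 'rV[R]_N) y :
 ganalyticv Phi -> ganalyticv g -> jac (Phi \o g) y = jac Phi (g y) *m jac g y.
Proof.
move=> aP ag; apply/matrixP => i j; rewrite !mxE.
rewrite (@Dw1_comp R _ _ setT setT (fun y => Phi y 0 i) g j y openT (fun _ _ => I) (aP i).1 (ganalyticv_smooth ag) I).
by apply: eq_bigr => k _; rewrite !mxE.
Qed.

Definition ins {n : nat} (i : 'I_n.+1) (c : R) (y : 'rV[R]_n) : 'rV[R]_n.+1 :=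
 \row_k (if unlift i k is Some k' then y 0 k' else c).

Lemma ins_i n (i : 'I_n.+1) c (y : 'rV[R]_n) : ins i c y 0 i = c.
Proof. by rewrite mxE unlift_none. Qed.

Lemma ins_lift n (i : 'I_n.+1) c (y : 'rV[R]_n) k : ins i c y 0 (lift i k) = y 0 k.
Proof. by rewrite mxE liftK. Qed.

Lemma ins_col' n (i : 'I_n.+1) (x : 'rV[R]_n.+1) : ins i (x 0 i) (col' i x) = x.
Proof. by apply/rowP => k; rewrite mxE; case: unliftP => [k' ->|->] //; rewrite mxE. Qed.

Lemma ganalyticv_ins n (i : 'I_n.+1) c : ganalyticv (ins i c : 'rV[R]_n -> _).
Proof.
move=> k; under eq_fun do rewrite mxE.
by case: (unlift i k) => [k'|]; [exact: ganalytic_coord | exact: ganalytic_cst].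
Qed.

Lemma col'_norm n (i : 'I_n.+1) (x : 'rV[R]_n.+1) : `|col' i x| <= `|x|.
Proof. by apply: row_norm_le => // k; rewrite mxE; exact: coord_le_norm. Qed.

End Jacobian.

Section Sard.
Context {R : realType}.

Lemma implicit_graph_at n (k : 'rV[R]_n.+1 -> R) (j : 'I_n.+1) p :
 ganalytic k -> k p = 0 -> Dw [:: j] k p != 0 ->
 exists G : 'rV[R]_n -> 'rV[R]_n.+1, [/\ ganalyticv G, G 0 = p, forall y, k (G y) = 0 &
  exists2 e : R, 0 < e & forall q, `|q - p| < e -> k q = 0 -> exists2 y, `|y| <= 1 & G y = q].
Proof.
move=> ak kp kj; pose i0 : 'I_n.+1 := @z0 n.
pose T (x : 'rV[R]_n.+1) : 'rV[R]_n.+1 := \row_l x 0 (tperm i0 j l).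
have TT x : T (T x) = x by apply/rowP => l; rewrite !mxE tpermK.
have aT : ganalyticv (fun x => T x + p).
 move=> l; under eq_fun do rewrite 2!mxE.
 by apply: ganalyticD; [exact: ganalytic_coord | exact: ganalytic_cst].
have T0 : T 0 = 0 by apply/rowP => l; rewrite !mxE.
have [|||r [psi [r0 apsi psi0 psiE [e e0 eP]]]] := @implicit_graph R n (k \o (fun x => T x + p)).
- exact: ganalytic_comp ak aT.
- by rewrite /= T0 add0r.
- rewrite (@Dw1_comp R _ _ setT setT k _ _ 0 openT (fun _ _ => I) ak.1 (ganalyticv_smooth aT) I).
 have dT l : Dw [:: i0] (fun y => (T y + p) 0 l) 0 = (tperm i0 j l == i0)%:R.
  have -> : (fun y => (T y + p) 0 l) = fun y => y 0 (tperm i0 j l) + p 0 l by apply/funext => y; rewrite !mxE.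
  rewrite (DwD openT [:: i0] (smooth_coord (tperm i0 j l) openT) (smooth_cst setT (p 0 l))) //.
  by rewrite (Dw_cst [:: i0]) Dw1_coord addr0.
 rewrite (bigD1 j) //= big1 ?addr0 => [|l lj]; rewrite -/i0 dT; first by rewrite tpermR eqxx mulr1 T0 add0r.
 case: eqP => [E|_]; last by rewrite mulr0.
 by move: lj; rewrite -(tpermK i0 j l) E tpermL eqxx.
exists (fun y => T (zy (psi y) (lamv r 0 y)) + p); split.
- have := ganalyticv_comp aT (ganalyticv_zy apsi (ganalyticv_lamv r 0)); exact.
- by rewrite psi0 lamv_at0 zy00 T0 add0r.
- exact: psiE.
exists e => // q qp kq; have [||y y1 yE] := eP (T (q - p)); last 1 first.
- by exists y => //; rewrite -yE TT subrK.
- apply: le_lt_trans qp; apply: row_norm_le => // l; rewrite mxE; exact: coord_le_norm.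
- by rewrite /= TT subrK.
Qed.

Lemma ganalytic_grad0 N (f : 'rV[R]_N -> R) : ganalytic f -> (forall j x, Dw [:: j] f x = 0) -> forall x, f x = f 0.
Proof.
move=> af df x; apply/subr0_eq.
have [s _ ->] := MVT_gradient openT af.1 (fun _ _ => I) (a := 0) (b := x).
by rewrite big1 // => i _; rewrite df mulr0.
Qed.

Lemma avoid_point d (x p v : 'rV[R]_d) (e : R) : v != 0 -> 0 < e -> exists2 y, `|y - x| < e & y != p.
Proof.
move=> v0 e0; have [->|xp] := eqVneq x p; last by exists x => //; rewrite subrr normr0.
have v1 : 0 < `|v| by rewrite normr_gt0.
exists ((e / 2 / `|v|) *: v + p).
 by rewrite addrK normrZ gtr0_norm ?divr_gt0 // divfK ?gt_eqF //; lra.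
by rewrite -subr_eq0 addrK scaler_eq0 negb_or v0 gt_eqF // !divr_gt0.
Qed.

Lemma sard N d (Phi : 'rV[R]_N -> 'rV[R]_d) : ganalyticv Phi -> (forall x, gram Phi x = 0) ->
 nowhere_dense [set y | exists2 s, `|s| <= 1 & Phi s = y].
Proof.
elim: N d Phi => [|n IHn] d Phi aP lowP; (apply: nowhere_dense_closed => [|x e e0];
 first by apply: compact_closed; [exact: norm_hausdorff | exact: continuous_box_image (ganalyticv_smooth aP)]);
 have [v v0 _] := (gramP _ 0).1 (lowP 0).
 have [y yx y0] := avoid_point x (Phi 0) v0 e0; exists y => //= -[s _ sy].
 by move: y0; rewrite -sy; have -> : s = 0 by [apply/rowP => -[]]; rewrite eqxx.
have [allc|] := pselect (forall i j x, Dw [:: j] (fun y => Phi y 0 i) x = 0).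
 have [y yx y0] := avoid_point x (Phi 0) v0 e0; exists y => //= -[s _ sy].
 by case/eqP: y0; rewrite -sy; apply/rowP => i; exact: (ganalytic_grad0 (aP i) (allc i)).
move=> /existsNP [i /existsNP [j /existsNP [x1 /eqP Jx1]]].
case: d => [|d] in Phi aP lowP x v v0 i Jx1 *; first by case: (i) => ?.
clear v v0.
pose J := Dw [:: j] (fun y => Phi y 0 i).
have aJ : ganalytic J := ganalytic_Dw1 j (aP i).
have [L LP Lc] := zero_faces aJ (ex_intro _ x1 Jx1).
have low_comp m (g : 'rV[R]_m -> 'rV[R]_n.+1) y : ganalyticv g -> gram (Phi \o g) y = 0.
 move=> ag; apply/gramP; have [v v0 vA] := (gramP _ _).1 (lowP (g y)).
 by exists v => //; rewrite jac_comp // mulmxA vA mul0mx.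
have nZ : nowhere_dense [set z | exists2 q, q \in L & exists2 s, `|s| <= 1 & (Phi \o (q.1 \o ins q.2 0)) s = z].
 apply: nowhere_dense_union => q qL; have [aq _ _] := LP q qL.
 have ag : ganalyticv (q.1 \o ins q.2 0) := ganalyticv_comp aq (ganalyticv_ins q.2 0).
 by apply: IHn => [|y]; [exact: ganalyticv_comp aP ag | exact: low_comp].
have [y0 [e1 [e10 y0P]]] := nZ x e e0; pose c := y0 0 i.
pose K := [set s | `|s| <= 1] `&` [set s | `|Phi s - y0| <= e1 / 2 /\ Phi s 0 i = c].
have cK : compact K.
 apply: compact_closedI; first exact: closed_ball0_compact.
 have -> : [set s | `|Phi s - y0| <= e1 / 2 /\ Phi s 0 i = c] =
   [set s | `|Phi s - y0| <= e1 / 2] `&` [set s | `|Phi s 0 i - c| <= 0].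
  by apply/seteqP; split=> s [sy sc]; split=> //=; move: sc => /=; [move=> ->; rewrite subrr normr0 | rewrite normr_le0 subr_eq0 => /eqP].
 by apply: closedI; apply: closed_near; [exact: ganalyticv_smooth | exact: (aP i).1].
have KJ s : K s -> J s != 0.
 move=> [s1 [sy sc]]; apply/eqP => Js; have [q [t [qL t1 tq qt]]] := Lc s s1 Js.
 have [|_ ] := y0P (Phi s); first by apply: le_lt_trans sy _; lra.
 apply; exists q => //; exists (col' q.2 t); first exact: le_trans (col'_norm _ _) t1.
 by rewrite /= -qt -{2}[t](ins_col' q.2) tq.
have /choice [Ge GeP] : forall p, exists Ge : ('rV[R]_n -> 'rV[R]_n.+1) * R, K p ->
  [/\ ganalyticv Ge.1, Ge.1 0 = p, forall y, Phi (Ge.1 y) 0 i = c & 0 < Ge.2 /\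
   forall q, `|q - p| < Ge.2 -> Phi q 0 i = c -> exists2 y, `|y| <= 1 & Ge.1 y = q].
 move=> p; have [Kp|nKp] := pselect (K p); last by exists (fun=> 0, 0).
 have [s1 [sy sc]] := Kp.
 have [|||G [aG G0 kG [e' e'0 e'P]]] := @implicit_graph_at n (fun y => Phi y 0 i - c) j p.
 - by apply: ganalyticB; [exact: aP | exact: ganalytic_cst].
 - by rewrite sc subrr.
 - rewrite (DwB openT [:: j] (aP i).1 (smooth_cst setT c)) // (Dw_cst [:: j]) subr0; exact: KJ.
 exists (G, e') => _; split=> // [y|]; first by apply/eqP; rewrite -subr_eq0; apply/eqP; exact: kG.
 by split=> // q qp qc; apply: e'P => //; rewrite qc subrr.
have [p Kp|P PK Pc] := @finite_subcover R _ K (fun p => (Ge p).2) cK; first by have [_ _ _ []] := GeP p Kp.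
pose Psi p := (fun y : 'rV[R]_d.+1 => col' i y) \o (Phi \o (Ge p).1).
have nP : nowhere_dense [set z | exists2 p, p \in P & exists2 s, `|s| <= 1 & Psi p s = z].
 apply: nowhere_dense_union => p pP; have Kp := PK p pP; have [aG G0 Gc _] := GeP p Kp.
 have aPG : ganalyticv (Phi \o (Ge p).1) := ganalyticv_comp aP aG.
 have aPsi : ganalyticv (Psi p) by move=> k; under eq_fun do rewrite mxE; exact: aPG.
 apply: IHn => // y.
 have [|||gr0|J0] := @ganalytic_domain R _ (gram (Psi p)) (J \o (Ge p).1).
 - exact: ganalytic_gram.
 - exact: ganalytic_comp.
 - move=> {}y; have [JG|JG] := eqVneq (J ((Ge p).1 y)) 0; first by rewrite /= JG mulr0.
  suff -> : gram (Psi p) y = 0 by rewrite mul0r.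
  have [v v0 vA] := (gramP _ _).1 (lowP ((Ge p).1 y)); apply/gramP; exists (col' i v).
   apply: contraNneq v0 => cv; rewrite -[v](ins_col' i) cv.
   suff -> : v 0 i = 0 by apply/eqP/rowP => k; rewrite mxE; case: (unlift i k) => [k'|]; rewrite !mxE.
   move/rowP/(_ j): vA; rewrite mxE (bigD1_ord i) //= big1 => [|k _].
    by rewrite addr0 [in RHS]mxE mxE => /eqP; rewrite mulf_eq0 (negPf JG) orbF => /eqP.
   by move/rowP/(_ k): cv; rewrite !mxE => ->; rewrite mul0r.
  have : v *m jac (Phi \o (Ge p).1) y = 0 by rewrite jac_comp // mulmxA vA mul0mx.
  move=> E; apply/rowP => k; move/rowP/(_ k): E; rewrite mxE (bigD1_ord i) //= [in jac _ _ _ _]mxE.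
  have -> : (fun y0 : 'rV[R]_n => (Phi \o (Ge p).1) y0 0 i) = cst c by apply/funext => z; exact: Gc.
  rewrite (Dw_cst [:: k]) mulr0 add0r => E; rewrite mxE -[RHS]E; apply: eq_bigr => l _.
  rewrite [col' i v _ _]mxE [jac _ _ _ _]mxE [jac _ _ _ _]mxE; congr (_ * Dw _ _ _).
  by apply/funext => z; rewrite /= mxE.
 - exact: gr0.
 - by have := KJ p Kp; have /= := J0 0; rewrite G0 => ->; rewrite eqxx.
have [|y1 [e2 [e20 y1P]]] := nP (col' i y0) (e1 / 2); first by rewrite divr_gt0.
have [|y1y0 ny1] := y1P y1; first by rewrite subrr normr0.
have yy0 : `|ins i c y1 - y0| < e1 / 2.
 apply: row_norm_lt => [|k]; first by rewrite divr_gt0.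
 have [k' ->|->] := unliftP i k.
  by rewrite [X in `|X|]mxE ins_lift; apply: le_lt_trans y1y0; have := coord_le_norm (y1 - col' i y0) k'; rewrite !mxE.
 by rewrite [X in `|X|]mxE ins_i mxE subrr normr0 divr_gt0.
exists (ins i c y1); first by have [] := y0P (ins i c y1); [apply: lt_trans yy0 _; lra | ].
move=> [s s1 sE]; have Ks : K s by split=> //; split; rewrite sE ?ins_i //; exact: ltW.
have [p pP] := Pc s Ks; rewrite ballE => sp.
have [_ _ _ [_ /(_ s sp)]] := GeP p (PK p pP); rewrite sE ins_i => /(_ erefl) [y y_1 yE].
apply: ny1; exists p => //; exists y => //; rewrite /Psi /= yE sE.
by apply/rowP => k; rewrite mxE ins_lift.
Qed.

End Sard.

Lemma nonzero_dense {R : realType} {N : nat} (w : 'rV[R]_N) (e : R) : 0 < e ->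
 exists2 w' : 'rV[R]_N, `|w' - w| < e & forall i, w' 0 i != 0.
Proof.
move=> e0; have [q /andP[q0 qe] qP] := small_radius w (divr_gt0 e0 (@ltr0Sn R 1)).
exists (const_mx q + w).
 rewrite addrK; apply: row_norm_lt => // i; rewrite mxE gtr0_norm //; apply: le_lt_trans qe _; lra.
move=> i; rewrite !mxE; have [w0|w0] := eqVneq (w 0 i) 0; first by rewrite w0 addr0 gt_eqF.
apply: contraTneq (qP i w0) => E; have -> : w 0 i = - q by apply/eqP; rewrite -addr_eq0 addrC E.
by rewrite normrN gtr0_norm // ltxx.
Qed.

Section Sheets.
Context {R : realType}.

Lemma nonvanishing_sign N (V : 'rV[R]_N -> R) s s' : smooth_on setT V -> (forall t, V t != 0) -> 0 < V s' / V s.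
Proof.
move=> sV V0; pose g (t : R) := V (t *: (s' - s) + s).
have cg : {within `[(0 : R), 1], continuous g}.
 apply: continuous_subspaceT => t; have cl : {for t, continuous (fun t : R => t *: (s' - s) + s)}.
  by apply: cvgD; [apply: cvgZr_tmp; exact: cvg_id | exact: cvg_cst].
 exact: (continuous_comp cl (smooth_continuous sV (I : setT (t *: (s' - s) + s)))).
have g0 : g 0 = V s by rewrite /g scale0r add0r.
have g1 : g 1 = V s' by rewrite /g scale1r subrK.
have nz t : g t != 0 := V0 _.
rewrite lt_neqAle eq_sym mulf_neq0 ?invr_neq0 //= leNgt; apply/negP => lt0.
have [|t _ gt] := @IVT R g 0 1 0 ler01 cg; last by have := nz t; rewrite gt eqxx.
rewrite g0 g1 ge_min le_max; have sV0 := V0 s; have sV1 := V0 s'.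
have [ps|ns] := ltP 0 (V s).
 by move: lt0; rewrite pmulr_llt0 ?invr_gt0 // => /ltW ->; rewrite orbT (ltW ps).
have {}ns : V s < 0 by rewrite lt_neqAle sV0.
by move: lt0; rewrite nmulr_llt0 ?invr_lt0 // => /ltW ->; rewrite orbT.
Qed.

Lemma seq_min_radius (T : eqType) (L : seq T) (P : T -> R -> Prop) (r0 : R) : 0 < r0 ->
 (forall g, g \in L -> exists2 r, 0 < r & forall r', 0 < r' <= r -> P g r') ->
 exists2 r : R, 0 < r <= r0 & forall g, g \in L -> P g r.
Proof.
move=> r00 LP; suff [r /andP[r1 r2] rP] : exists2 r : R, 0 < r <= r0 & forall r', 0 < r' <= r -> forall g, g \in L -> P g r'.
 by exists r; [rewrite r1 | apply: rP; rewrite r1 lexx].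
elim: L LP => [|g L IHL] LP; first by exists r0; rewrite ?r00 ?lexx.
have [|r /andP[r1 r2] rP] := IHL _; first by move=> h hL; apply: LP; rewrite inE hL orbT.
have [r' r'0 r'P] := LP g (mem_head _ _); exists (Num.min r r').
 by rewrite lt_min r1 r'0 ge_min r2.
move=> q /andP[q0]; rewrite le_min => /andP[qr qr'] h; rewrite inE => /orP[/eqP ->|hL].
 by apply: r'P; rewrite q0.
by apply: rP => //; rewrite q0.
Qed.

Definition signed_squares {N : nat} (tau : {ffun 'I_N -> 'I_3}) (w : 'rV[R]_N) : 'rV[R]_N :=
 \row_i (((tau i)%:R - 1) * w 0 i ^+ 2).

Lemma ganalyticv_signed_squares N (tau : {ffun 'I_N -> 'I_3}) : ganalyticv (signed_squares tau).
Proof.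
by move=> i; under eq_fun do rewrite mxE; apply: ganalyticZ; apply: ganalyticX; exact: ganalytic_coord.
Qed.

Lemma signed_squares_onto N (s : 'rV[R]_N) : `|s| <= 1 -> exists (tau : {ffun 'I_N -> 'I_3}) w,
 [/\ `|w| <= 1, signed_squares tau w = s &
  forall w' : 'rV[R]_N, (forall i, w' 0 i != 0) -> exists2 c : 'rV[R]_N, (forall i, 0 < c 0 i) &
   signed_squares tau w' = \row_i (s 0 i * c 0 i)].
Proof.
move=> s1; pose tau : {ffun 'I_N -> 'I_3} := [ffun i => if s 0 i < 0 then inord 0 else if 0 < s 0 i then inord 2 else inord 1].
have tauE i : (tau i)%:R - 1 = Num.sg (s 0 i) :> R.
 rewrite /tau ffunE; case: (ltgtP (s 0 i) 0) => s0; rewrite inordK //.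
 - by rewrite ltr0_sg // sub0r.
 - by rewrite gtr0_sg //; lra.
 - by rewrite s0 sgr0 subrr.
exists tau, (\row_i Num.sqrt `|s 0 i|); split.
- apply: row_norm_le => // i; rewrite mxE ger0_norm ?sqrtr_ge0 // -[leRHS]sqrtr1 ler_sqrt //.
 exact: le_trans (coord_le_norm s i) s1.
- by apply/rowP => i; rewrite 2!mxE tauE sqr_sqrtr // -numEsg.
move=> w' w'0; exists (\row_i (if s 0 i == 0 then 1 else w' 0 i ^+ 2 / `|s 0 i|)).
 move=> i; rewrite mxE; case: eqP => [_|/eqP si]; first exact: ltr01.
 by rewrite divr_gt0 ?normr_gt0 // lt_neqAle sqr_ge0 eq_sym sqrf_eq0 w'0.
apply/rowP => i; rewrite !mxE tauE; case: eqP => [->|/eqP si]; first by rewrite sgr0 !mul0r.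
by rewrite [X in _ = X * _]numEsg -mulrA; congr (_ * _); rewrite mulrCA divff ?mulr1 ?normr_eq0.
Qed.

Lemma semianalytic_sheets_at N (B : set 'rV[R]_N) b : semianalytic B ->
 exists2 L : seq ('rV[R]_N -> 'rV[R]_N),
  (forall Th, Th \in L -> ganalyticv Th /\ forall w, closure B (Th w)) &
  exists2 e : R, 0 < e & forall y, B y -> `|y - b| < e -> exists Th w, [/\ Th \in L, `|w| <= 1 & Th w = y].
Proof.
move=> /(_ b) [V [oV Vb [fs [fsP BV]]]].
pose Fs := flatten [seq fg.1 :: fg.2 | fg <- fs].
have Fs1 fg : fg \in fs -> fg.1 \in Fs by move=> fgs; apply/flatten_mapP; exists fg => //; exact: mem_head.
have Fs2 fg g : fg \in fs -> g \in fg.2 -> g \in Fs.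
 by move=> fgs gf; apply/flatten_mapP; exists fg => //; rewrite inE gf orbT.
have FsV g : g \in Fs -> analytic_on V g.
 move=> /flatten_mapP [fg fgs]; have [f1 f2] := fsP fg fgs.
 by rewrite inE => /orP[/eqP ->|/f2].
have /nbhs_ballP [r1 /= r10 r1V] : nbhs b V by exact: open_nbhs_nbhs.
pose Q (g : 'rV[R]_N -> R) (r : R) := smooth_on (ball b r) g /\ exists2 C : R, 0 <= C & forall y, ball b r y -> abound C g y.
have [|r /andP[r0 rr1] rP] := @seq_min_radius _ Fs Q r1 r10.
 move=> g /FsV ag; have [r [C [r0 C0 sg Cg]]] := analytic_local ag Vb; exists r => // r' /andP[r'0 r'r].
 have sub : ball b r' `<=` ball b r by exact: le_ball.
 by split; [exact: smooth_on_sub sub sg | exists C => // y /sub; exact: Cg].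
pose rho := r / 2; have rho0 : 0 < rho by rewrite divr_gt0.
pose la := lamv rho b; have ala : ganalyticv la by exact: ganalyticv_lamv.
have lab s : ball b r (la s).
 by rewrite ballE; apply: le_lt_trans (lamv_dist b s (ltW rho0)) _; rewrite /rho; lra.
have laV s : V (la s) by apply: r1V; exact: le_ball rr1 _ (lab s).
have aF g : g \in Fs -> ganalytic (g \o la).
 move=> /rP [sg [C C0 Cg]]; apply: (ganalytic_comp_on (ball_open b r) sg lab ala) => K.
 by exists C => // x _; exact: Cg.
pose Nz := [seq g <- Fs | `[< exists s, g (la s) != 0 >]].
have NzP g : g \in Nz -> ganalytic (g \o la) /\ exists s, (g \o la) s != 0.
 by rewrite mem_filter => /andP[/asboolP g0 /aF].
pose H s := \prod_(g <- Nz | g \in Nz) (g \o la) s.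
have aH : ganalytic H by apply: ganalytic_prod => g /NzP [].
have H0 : exists s, H s != 0 := ganalytic_prod_nonzero Nz NzP.
have [L0 L0P [e e0 eP]] := monomialization aH H0 0 (r := 1) ltr01.
have scale pi g (s c : 'rV[R]_N) : pi \in L0 -> g \in Fs -> (forall i, 0 < c 0 i) ->
  exists2 k, 0 < k & g (la (pi (\row_i (s 0 i * c 0 i)))) = k * g (la (pi s)).
 move=> piL gF c0; have [api _ [G [u [au u0 uE]]]] := L0P pi piL.
 have [gN|] := boolP (g \in Nz); last first.
  rewrite mem_filter gF andbT => /asboolPn g0; exists 1 => //.
  have z t : g (la t) = 0 by apply/eqP/negPn/negP => gt; apply: g0; exists t.
  by rewrite !z mulr0.
 have [|||gam [W [aW W0 WE]]] := @monomial_factor R N ((g \o la) \o pi)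
  ((fun s => \prod_(f <- rem g Nz | f \in Nz) (f \o la) s) \o pi) u G _ _ au u0.
 - exact: (ganalytic_comp (aF g gF) api).
 - by apply: (ganalytic_comp _ api); apply: ganalytic_prod => f /NzP [].
 - by move=> t; rewrite -uE /H (big_rem g gN) /= gN.
 pose s' := \row_i (s 0 i * c 0 i); exists (monomial gam c * (W s' / W s)).
  apply: mulr_gt0; last exact: nonvanishing_sign aW.1 W0.
  by apply: prodr_gt0 => i _; exact: exprn_gt0.
 have /= -> := WE s'; have /= -> := WE s.
 have -> : monomial gam s' = monomial gam s * monomial gam c.
  by rewrite /monomial -big_split; apply: eq_bigr => i _; rewrite mxE exprMn.
 have := W0 s; move: (monomial _ _) (monomial _ _) (W s) (W s') => x y z t z0; by field.
pose Th (q : ('rV[R]_N -> 'rV[R]_N) * {ffun 'I_N -> 'I_3}) := la \o (q.1 \o signed_squares q.2).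
exists [seq T <- [seq Th q | q <- allpairs pair L0 (enum {: {ffun 'I_N -> 'I_3}})] |
     `[< ganalyticv T /\ forall w, closure B (T w) >]].
 by move=> T; rewrite mem_filter => /andP[/asboolP].
exists (rho * Num.min 1 e); first by rewrite mulr_gt0 // lt_min ltr01.
move=> y By yb; have ybr : `|y - b| / rho < Num.min 1 e by rewrite ltr_pdivrMr // mulrC.
move: (ybr); rewrite lt_min => /andP[yb1 ybe].
have [|s0 s0b s0E] := @lamv_onto R N rho b y rho0; first by rewrite -[leRHS]mul1r -ler_pdivrMr // ltW.
have [|pi [s [piL s1 sE]]] := eP s0; first by rewrite subr0; exact: le_lt_trans ybe.
have [tau [w [w1 wE tauP]]] := signed_squares_onto s1.
have [api _ _] := L0P pi piL.
have aTh : ganalyticv (Th (pi, tau)) := ganalyticv_comp ala (ganalyticv_comp api (ganalyticv_signed_squares tau)).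
exists (Th (pi, tau)), w; split=> //; last by rewrite /Th /= wE sE.
rewrite mem_filter; apply/andP; split; last first.
 by apply/mapP; exists (pi, tau) => //; apply/allpairsP; exists (pi, tau); rewrite mem_enum.
apply/asboolP; split=> // w'.
have ThB (v : 'rV[R]_N) : (forall i, v 0 i != 0) -> B (Th (pi, tau) v).
 move=> /tauP [c c0 E]; have : (B `&` V) y by split=> //; rewrite -s0E.
 rewrite BV => -[_ [fg fgs [f0 gp]]].
 suff : (B `&` V) (Th (pi, tau) v) by case.
 rewrite BV; split; first exact: laV.
 have yE : y = la (pi s) by rewrite sE.
 exists fg => //; split=> [|g gf].
  have [k _] := scale pi fg.1 s c piL (Fs1 fg fgs) c0.
  by rewrite -yE f0 mulr0 /Th /= E.
 have [k k0] := scale pi g s c piL (Fs2 fg g fgs gf) c0.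
 by rewrite -yE /Th /= E => ->; rewrite mulr_gt0 // gp.
move=> W /nbhs_ballP [e1 /= e10 e1W].
have /= := smooth_continuous (ganalyticv_smooth aTh) (I : setT w').
move=> /cvgrPdist_lt /(_ e1 e10) /nbhs_ballP [e2 /= e20 e2P].
have [v vw v0] := nonzero_dense w' e20; exists (Th (pi, tau) v); split; first exact: ThB.
by apply: e1W; rewrite -ball_normE /=; apply: e2P; rewrite ballE.
Qed.

Lemma subanalytic_sheets d (X : set 'rV[R]_d) x0 : closed X -> subanalytic X ->
 exists (N : nat) (L : seq ('rV[R]_N -> 'rV[R]_d)) (e : R),
  [/\ 0 < e, (forall Phi, Phi \in L -> ganalyticv Phi /\ forall w, X (Phi w)) &
   forall y, X y -> `|y - x0| < e -> exists Phi w, [/\ Phi \in L, `|w| <= 1 & Phi w = y]].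
Proof.
move=> cX /(_ x0) [V [oV Vx0 [m [B [sB [K0 [_ K0P]] XV]]]]].
have BK z : B z -> `|z| <= K0 + 1 by apply: K0P; rewrite ltrDl.
have /choice [L LP] : forall b, exists Le : seq ('rV[R]_(d + m) -> 'rV[R]_(d + m)) * R,
  [/\ (forall Th, Th \in Le.1 -> ganalyticv Th /\ forall w, closure B (Th w)), 0 < Le.2 &
   forall y, B y -> `|y - b| < Le.2 -> exists Th w, [/\ Th \in Le.1, `|w| <= 1 & Th w = y]].
 by move=> b; have [L LP [e e0 eP]] := semianalytic_sheets_at b sB; exists (L, e).
have [b _|P _ Pc] := finite_subcover (closed_ball0_compact (r := K0 + 1)) (e := fun b => (L b).2).
 by have [] := LP b.
have /nbhs_ballP [r /= r0 rV] : nbhs x0 V by exact: open_nbhs_nbhs.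
exists (d + m)%N, [seq (fun w => lsubmx (Th w)) | Th <- flatten [seq (L b).1 | b <- P]], r; split=> //.
 move=> _ /mapP [Th /flatten_mapP [b bP ThL] ->]; have [/(_ Th ThL) [aTh cTh] _ _] := LP b; split.
  by move=> i; under eq_fun do rewrite mxE; exact: aTh.
 move=> w; apply: cX => W nW.
 have [|z [Bz Wz]] := cTh w (lsubmx @^-1` W).
  have /nbhs_ballP [e1 /= e10 e1W] := nW; apply/nbhs_ballP; exists e1 => //= z zb.
  apply: e1W; move: zb; rewrite -!ball_normE /= => zb.
  apply: row_norm_lt => // i; apply: le_lt_trans zb; have := coord_le_norm (Th w - z) (lshift m i).
  by rewrite !mxE.
 exists (lsubmx z); split=> //.
 have : (@proj_first R d m @` B) (lsubmx z) by exists z.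
 by rewrite -XV => -[].
move=> y Xy yx; have : (X `&` V) y by split=> //; apply: rV; rewrite ballE.
rewrite XV => -[z Bz zy]; have [b bP] := Pc z (BK z Bz); rewrite ballE => zb.
have [_ _ /(_ z Bz zb) [Th [w [ThL w1 wz]]]] := LP b.
exists (fun w => lsubmx (Th w)), w; split=> //; last by rewrite wz.
by apply/mapP; exists Th => //; apply/flatten_mapP; exists b.
Qed.

End Sheets.

Section OpenMapping.
Context {R : realType}.

(* A minimiser v of |psi - y| lies inside the ball, where the step -t u G^-1 with u = psi v - y would decrease it. *)
Lemma almost_linear_onto d (psi : 'rV[R]_d -> 'rV[R]_d) (G : 'M[R]_d) (rho C e : R) :
 0 < rho -> 0 < C -> 0 <= e -> \det G != 0 -> C * e <= `|\det G| / 2 ->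
 (forall u : 'rV[R]_d, `|u *m \adj G| <= C * `|u|) -> smooth_on setT psi ->
 (forall v v', `|v| <= rho -> `|v'| <= rho -> `|psi v - psi v' - (v - v') *m G| <= e * `|v - v'|) ->
 forall y, `|y - psi 0| < rho * `|\det G| / (4 * C) -> exists v, psi v = y.
Proof.
move=> rho0 C0 e0 J0 Ce adjC spsi lin y yp; set J := \det G in J0 Ce yp *.
have J1 : 0 < `|J| by rewrite normr_gt0.
have low (u : 'rV[R]_d) : `|u| * `|J| <= C * `|u *m G|.
 by apply: le_trans (adjC _); rewrite -mulmxA mul_mx_adj -scalemx1 -scalemxAr mulmx1 normrZ mulrC.
have [|||v] := @EVT_min_rV R d (fun v => `|psi v - y|) [set v | `|v| <= rho].
- by exists 0; rewrite /= normr0 ltW.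
- exact: closed_ball0_compact.
- apply: continuous_subspaceT => v; have cB : {for v, continuous (fun v => psi v - y)}.
  exact: (cvgB (smooth_continuous spsi (I : setT v) : psi @ v --> psi v) (@cvg_cst _ y _ (nbhs v) _)).
 exact: (continuous_comp cB (@norm_continuous R _ (psi v - y))).
rewrite inE /= => vr vmin; exists v; apply/eqP; rewrite -subr_eq0; apply/negPn/negP => u0.
have {}vmin v' : `|v'| <= rho -> `|psi v - y| <= `|psi v' - y| by move=> v'r; apply: vmin; rewrite inE.
have r0 : `|0 : 'rV[R]_d| <= rho by rewrite normr0 ltW.
have {vr}vr : `|v| < rho.
 have h1 : `|psi v - psi 0| <= 2 * `|y - psi 0|.
  rewrite -[psi v - psi 0](subrKA y); apply: le_normD.
  by rewrite mulr_natl mulr2n lerD2r; apply: le_trans (vmin 0 r0) _; rewrite distrC.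
 have h2 := lin v 0 vr r0; rewrite subr0 in h2.
 have h3 : `|v *m G| <= `|psi v - psi 0| + e * `|v|.
  have -> : v *m G = (psi v - psi 0) - (psi v - psi 0 - v *m G) by rewrite opprB addrCA subrr addr0.
  by apply: le_normB; rewrite lerD2l.
 have h4 := le_trans (low v) (ler_wpM2l (ltW C0) h3).
 have h5 : `|v| * `|J| / 2 < rho * `|J| / 2.
  have h6 : C * e * `|v| <= `|J| / 2 * `|v| by apply: ler_wpM2r.
  have h7 : 2 * C * `|y - psi 0| < rho * `|J| / 2.
   have -> : rho * `|J| / 2 = 2 * C * (rho * `|J| / (4 * C)) by field; rewrite gt_eqF.
   by rewrite ltr_pM2l // mulr_gt0.
  have h8 : C * `|psi v - psi 0| <= C * (2 * `|y - psi 0|) by rewrite ler_pM2l.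
  by move: h4 h6 h7 h8; rewrite mulrDr mulrA; move: (`|v|) (`|J|) => a b; lra.
 by move: h5; rewrite -!mulrA ltr_pM2r // divr_gt0.
set u := psi v - y in u0 vmin; have u1 : 0 < `|u| by rewrite normr_gt0.
pose w := J^-1 *: (u *m \adj G).
have wG : w *m G = u by rewrite /w -scalemxAl -mulmxA mul_adj_mx -/J mul_mx_scalar scalerA mulVf // scale1r.
have wJ : `|w| * `|J| <= C * `|u| by rewrite -[X in _ <= _ * `|X|]wG; exact: low.
have [t /andP[t0 t1] tw] : exists2 t : R, 0 < t < 1 & `|v| + t * `|w| <= rho.
 have dn : 0 < (rho - `|v|) + `|w| + 1 by rewrite ltr_wpDl // addr_ge0 // subr_ge0 ltW.
 exists ((rho - `|v|) / ((rho - `|v|) + `|w| + 1)).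
  by rewrite divr_gt0 ?subr_gt0 // ltr_pdivrMr // mul1r -addrA ltrDl ltr_wpDl.
 rewrite -lerBrDl -mulrAC ler_pdivrMr //; apply: ler_wpM2l; first by rewrite subr_ge0 ltW.
 by have : `|v| < rho by []; lra.
have v'r : `|v - t *: w| <= rho.
 by apply: le_normB; rewrite normrZ gtr0_norm.
have := vmin _ v'r; rewrite leNgt => /negP; apply.
have := lin (v - t *: w) v v'r (ltW vr).
have -> : v - t *: w - v = - (t *: w) by rewrite addrAC subrr add0r.
rewrite normrN normrZ gtr0_norm // mulNmx opprK -scalemxAl wG => err.
have -> : psi (v - t *: w) - y = (1 - t) *: u + (psi (v - t *: w) - psi v + t *: u).
 by rewrite /u; move: (psi _) (psi _) => a b; apply/rowP => i; rewrite !mxE; ring.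
apply: lt_normD; rewrite normrZ gtr0_norm ?subr_gt0 //.
have h : e * (t * `|w|) <= t * `|u| / 2.
 suff h : e * `|w| <= `|u| / 2 by have := ler_wpM2l (ltW t0) h; move: (`|w|) (`|u|) => p q; lra.
 rewrite -(ler_pM2r J1) -mulrA; apply: le_trans (ler_wpM2l e0 wJ) _.
 by rewrite mulrA [e * C]mulrC [leRHS]mulrAC -mulrA; apply: le_trans (ler_wpM2r (ltW u1) Ce) _; lra.
have tu : 0 < t * `|u| by exact: mulr_gt0.
by move: (le_trans err h) tu; rewrite mulrBl mul1r; lra.
Qed.

Lemma gram_ball N d (Phi : 'rV[R]_N -> 'rV[R]_d) (K : R) : ganalyticv Phi ->
 exists2 kap : R, 0 < kap & forall s, `|s| <= K -> forall y,
  `|y - Phi s| < kap * gram Phi s ^+ 2 -> exists s', Phi s' = y.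
Proof.
move=> aP; have [M M0 MP] := ganalyticv_bound K aP.
pose M1 := M ^+ 2; have M10 : 0 <= M1 by exact: sqr_ge0.
have jacM s i j : `|s| <= K -> `|jac Phi s i j| <= M1.
 by move=> sK; rewrite mxE; have := MP s i sK [:: j]; rewrite [X in _ <= _ * X](_ : _ = 1) // mulr1.
pose D := d%:R * M1; have D0 : 0 <= D by exact: mulr_ge0.
have [M' M'0 M'P] := ganalyticv_bound (K + D) aP.
pose M2 := M' ^+ 3 * 2; have M20 : 0 <= M2 by rewrite mulr_ge0 // exprn_ge0.
have DwM2 x i j k : `|x| <= K + D -> `|Dw [:: k] (Dw [:: j] (fun y => Phi y 0 i)) x| <= M2.
 by move=> xK; rewrite -Dw_cat; exact: M'P x i xK [:: k; j].
have /choice [Ma MaP] : forall ki : 'I_d * 'I_d, exists Ma : R, 0 <= Ma /\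
  forall s, `|s| <= K -> `|(\adj (jac Phi s *m (jac Phi s)^T)) ki.1 ki.2| <= Ma.
 move=> [k i] /=; have [_ aP'] : ganalytic (fun s => (\adj (jac Phi s *m (jac Phi s)^T)) k i).
  under eq_fun do rewrite mxE /cofactor; apply: ganalyticZ; apply: ganalytic_det => a b.
  by under eq_fun do rewrite !mxE; have := ganalytic_gram_entry (lift i a) (lift k b) aP; under eq_fun do rewrite mxE.
 have [Ma Ma0 MaP] := aP' K; exists Ma; split=> // s sK.
 by have := MaP s sK [::]; rewrite Dw_nil fact0 mulr1.
pose Mb := \sum_ki Ma ki; have Mb0 : 0 <= Mb by apply: sumr_ge0 => ki _; have [] := MaP ki.
have adjM s k i : `|s| <= K -> `|(\adj (jac Phi s *m (jac Phi s)^T)) k i| <= Mb.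
 move=> sK; have [_ /(_ s sK) /= h] := MaP (k, i); apply: le_trans h _.
 by rewrite /Mb (bigD1 (k, i)) //= lerDl; apply: sumr_ge0 => ki _; have [] := MaP ki.
have [_ /(_ K) [MJ MJ0 MJP]] := ganalytic_gram aP.
have JM s : `|s| <= K -> `|gram Phi s| <= MJ by move=> sK; have := MJP s sK [::]; rewrite Dw_nil fact0 mulr1.
pose C := d%:R * Mb + 1; have C0 : 0 < C by rewrite ltr_wpDl // mulr_ge0.
pose C2 := N%:R * D * (N%:R * M2 * D); have C20 : 0 <= C2 by rewrite !mulr_ge0.
pose C3 := C * C2 + MJ + 1; have C30 : 0 < C3 by rewrite ltr_wpDl // addr_ge0 // mulr_ge0 // ltW.
exists (8 * C3 * C)^-1; first by rewrite invr_gt0 !mulr_gt0.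
move=> s sK y; set J := gram Phi s => yJ.
have J0 : J != 0 by apply: contraTneq yJ => ->; rewrite expr0n mulr0 ltNge normr_ge0.
have J1 : 0 < `|J| by rewrite normr_gt0.
pose A := jac Phi s; pose rho := `|J| / (2 * C3).
have rho0 : 0 < rho by rewrite divr_gt0 // mulr_gt0.
have rho1 : rho <= 1.
 rewrite ler_pdivrMr ?mulr_gt0 // mul1r; apply: le_trans (JM s sK) _.
 have : 0 <= C * C2 by rewrite mulr_ge0 // ltW.
 by rewrite /C3; lra.
have vA (v : 'rV[R]_d) : `|v *m A| <= D * `|v| by apply: mulmx_bound => // i j; exact: jacM.
have asA : ganalyticv (fun v : 'rV[R]_d => v *m A + s).
 move=> i; under eq_fun do rewrite 2!mxE; apply: ganalyticD; last exact: ganalytic_cst.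
 by apply: ganalytic_sum => k _; under eq_fun do rewrite mulrC; apply: ganalyticZ; exact: ganalytic_coord.
have [||||| |v vE] := @almost_linear_onto d (Phi \o (fun v => v *m A + s)) (A *m A^T) rho C (C2 * rho) rho0 C0 _ J0 _ _ _ _ y.
- by rewrite mulr_ge0 // ltW.
- rewrite -/(gram Phi s) -/J /rho.
 have -> : C * (C2 * (`|J| / (2 * C3))) = `|J| / 2 * (C * C2 / C3) by field; rewrite gt_eqF.
 rewrite -[leRHS]mulr1; apply: ler_wpM2l; first by rewrite divr_ge0.
 by rewrite ler_pdivrMr // mul1r /C3; lra.
- move=> u; apply: (@le_trans _ _ (d%:R * Mb * `|u|)); first by apply: mulmx_bound => // i j; exact: adjM.
 by apply: ler_wpM2r => //; rewrite /C lerDl.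
- exact: ganalyticv_smooth (ganalyticv_comp aP asA).
- move=> v v' vr v'r; apply: row_norm_le => [|i]; first by apply: mulr_ge0 => //; apply: mulr_ge0 => //; exact: ltW.
 pose x := v *m A + s; pose x' := v' *m A + s.
 have [tau /andP[tau0 tau1] E] := @MVT_gradient R N setT (fun y => Phi y 0 i) x' x openT (aP i).1 (fun _ _ => I).
 have xx' : x - x' = (v - v') *m A by rewrite /x /x' opprD addrACA subrr addr0 mulmxBl.
 have -> : ((Phi \o (fun v => v *m A + s)) v - (Phi \o (fun v => v *m A + s)) v' - (v - v') *m (A *m A^T)) 0 i =
   \sum_j (x - x') 0 j * (Dw [:: j] (fun y => Phi y 0 i) (tau *: (x - x') + x') - Dw [:: j] (fun y => Phi y 0 i) s).
  have rB (a b c : 'rV[R]_d) : (a - b - c) 0 i = a 0 i - b 0 i - c 0 i by rewrite !mxE.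
  rewrite rB mulmxA -xx' /= -/x -/x' E [((x - x') *m _) _ _]mxE.
  rewrite [X in _ = X](eq_bigr (fun j => (x - x') 0 j * Dw [:: j] (fun y => Phi y 0 i) (tau *: (x - x') + x') - (x - x') 0 j * (A^T) j i)); last first.
   by move=> j _; rewrite mulrBr /A [A^T _ _]mxE [jac _ _ _ _]mxE.
  by rewrite sumrB.
 have xis : `|tau *: (x - x') + x' - s| <= D * rho.
  have -> : tau *: (x - x') + x' - s = (tau *: (v - v') + v') *m A.
   by rewrite [RHS]mulmxDl -[in RHS]scalemxAl -xx' {2}/x' addrA addrK.
  apply: le_trans (vA _) _; apply: ler_wpM2l => //; apply: le_norm_segment => //; exact/andP.
 apply: le_trans (ler_norm_sum _ _ _) _.
 apply: (@le_trans _ _ (\sum_(j < N) (D * `|v - v'|) * (N%:R * M2 * (D * rho)))).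
  apply: ler_sum => j _; rewrite normrM; apply: ler_pM => //.
   by apply: le_trans (coord_le_norm _ _) _; rewrite xx'; exact: vA.
  apply: (@le_trans _ _ (N%:R * M2 * `|tau *: (x - x') + x' - s|)); last by apply: ler_wpM2l => //; rewrite mulr_ge0.
  apply: (@gradient_segment_bound R N setT (Dw [:: j] (fun y => Phi y 0 i)) s _ M2 openT).
  + exact: (ganalytic_Dw1 j (aP i)).1.
  + by [].
  + move=> t /andP[t0 t1] k; apply: DwM2; apply: le_normD; rewrite addrC; apply: lerD => //.
   rewrite normrZ ger0_norm //; apply: le_trans (ler_piMl (normr_ge0 _) t1) _; apply: le_trans xis _.
   by rewrite ler_piMr.
 rewrite sumr_const card_ord -mulr_natl /C2; apply: le_eq; ring.
- rewrite /= mul0mx add0r; apply: lt_le_trans yJ _; rewrite -/(gram Phi s) -/J /rho.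
 apply: le_eq; rewrite -[J ^+ 2]ger0_norm ?sqr_ge0 // normrX; field.
 by rewrite !gt_eqF.
by exists (v *m A + s).
Qed.

End OpenMapping.

Section GoodSheets.
Context {R : realType}.

(* In the coordinates zy t w, the slice t = 0 is the sheet itself; the parameter t pushes it into the interior of X. *)
Definition good_sheet {N d : nat} (X : set 'rV[R]_d) (E : 'rV[R]_(1 + N) -> 'rV[R]_d) : Prop :=
 [/\ ganalyticv E, forall x, X (E x),
  exists (kap : R) (k : nat), 0 < kap /\ forall (t : R) (w : 'rV[R]_N), `|t| <= 2 -> `|w| <= 2 ->
   forall y, `|y - E (zy t w)| < kap * (t ^+ 2) ^+ k -> X y &
  forall w : 'rV[R]_N, `|w| <= 2 -> (forall i, w 0 i != 0) -> interior X (E (zy 0 w))].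

Lemma monomial_ge N (g : 'I_N -> nat) (s : 'rV[R]_N) (t : R) : 0 <= t -> (forall i, t <= `|s 0 i|) ->
 t ^+ (\sum_i g i) <= `|monomial g s|.
Proof.
move=> t0 ts; rewrite /monomial normr_prod -[leLHS]prodrXr.
by apply: ler_prod => i _; rewrite exprn_ge0 //= normrX lerXn2r ?nnegrE // (le_trans t0).
Qed.

Definition fold_sheet {N d : nat} (Psi : 'rV[R]_N -> 'rV[R]_d) (tau : {ffun 'I_N -> bool}) (x : 'rV[R]_(1 + N)) :=
 Psi (\row_i ((-1) ^+ tau i * (yc x 0 i ^+ 2 + zc x ^+ 2))).

Lemma fold_sheet_good N d (X : set 'rV[R]_d) (Phi : 'rV[R]_N -> 'rV[R]_d) pi g (u : 'rV[R]_N -> R) tau :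
 ganalyticv Phi -> (forall w, X (Phi w)) -> ganalyticv pi -> (forall s, `|pi s| < 3 / 2) ->
 ganalytic u -> (forall s, u s != 0) -> (forall s, gram Phi (pi s) = monomial g s * u s) ->
 good_sheet X (fold_sheet (Phi \o pi) tau).
Proof.
move=> aP XP api pi2 au u0 uE.
have [kap kap0 kapP] := gram_ball (3 / 2) aP.
have ball_sub s y : `|y - Phi (pi s)| < kap * gram Phi (pi s) ^+ 2 -> X y.
 by move=> h; have [s' <-] := kapP (pi s) (ltW (pi2 s)) y h.
pose S (x : 'rV[R]_(1 + N)) : 'rV[R]_N := \row_i ((-1) ^+ tau i * (yc x 0 i ^+ 2 + zc x ^+ 2)).
have aS : ganalyticv S.
 move=> i; under eq_fun do rewrite mxE; apply: ganalyticZ; apply: ganalyticD; apply: ganalyticX.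
  exact: ganalyticv_yc.
 exact: ganalytic_zc.
have Sabs x i : `|S x 0 i| = yc x 0 i ^+ 2 + zc x ^+ 2.
 by rewrite mxE normrM normrX normrN normr1 expr1n mul1r ger0_norm // addr_ge0 // sqr_ge0.
split; first exact: (ganalyticv_comp (ganalyticv_comp aP api) aS).
- by move=> x; exact: XP.
- have cu : {within [set s : 'rV[R]_N | `|s| <= 8], continuous (fun s => `|u s|)}.
  apply: continuous_subspaceT => s.
  exact: (continuous_comp (smooth_continuous au.1 (I : setT s)) (@norm_continuous R R (u s))).
 have [|s0 _ s0P] := EVT_min_rV _ (closed_ball0_compact (r := 8)) cu; first by exists 0; rewrite /= normr0.
 have us0 : 0 < `|u s0| by rewrite normr_gt0.
 exists (kap * `|u s0| ^+ 2), (\sum_i g i + \sum_i g i)%N; split; first by rewrite mulr_gt0 // exprn_gt0.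
 move=> t w t2 w2 y; rewrite /fold_sheet /= -/(S _) => yE; apply: (@ball_sub (S (zy t w))).
 apply: lt_le_trans yE _; rewrite -mulrA; apply: ler_wpM2l; first exact: ltW.
 set m := monomial g (S (zy t w)); set v := u (S (zy t w)); set x := (t ^+ 2) ^+ (\sum_i g i).
 have x0 : 0 <= x by rewrite exprn_ge0 // sqr_ge0.
 have xm : x <= `|m| by apply: monomial_ge => [|i]; rewrite ?sqr_ge0 // Sabs zc_zy lerDr sqr_ge0.
 rewrite uE exprD -/x -/m -/v.
 have -> : (m * v) ^+ 2 = `|v| ^+ 2 * (`|m| * `|m|).
  by rewrite -[`|m| * _]expr2 !real_normK ?num_real // exprMn mulrC.
 apply: ler_pM; rewrite ?sqr_ge0 ?mulr_ge0 //; last by apply: ler_pM.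
 rewrite lerXn2r ?nnegrE //; apply: s0P; rewrite inE /=; apply: row_norm_le => // i.
 rewrite Sabs zc_zy yc_zy; have wi := le_trans (coord_le_norm w i) w2.
 have h (a : R) : `|a| <= 2 -> a ^+ 2 <= 4.
  by rewrite -[a ^+ 2]ger0_norm ?sqr_ge0 // normrX => a2; apply: le_trans (lerXn2r 2 _ _ a2) _; rewrite ?nnegrE //; lra.
 by have := h _ wi; have := h _ t2; lra.
- move=> w w2 w0; rewrite /fold_sheet /= -/(S _).
 have r0 : 0 < kap * gram Phi (pi (S (zy 0 w))) ^+ 2.
  rewrite mulr_gt0 // exprn_even_gt0 //= uE mulf_neq0 //; apply: monomial_neq0 => i _.
  by rewrite -normr_gt0 Sabs zc_zy yc_zy expr0n addr0 exprn_even_gt0 //= w0.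
 by apply/nbhs_ballP; eexists; first exact: r0; move=> y; rewrite ballE => /ball_sub.
Qed.

Lemma closed_seq_union (T : eqType) d (L : seq T) (F : T -> set 'rV[R]_d) : (forall k, k \in L -> closed (F k)) ->
 closed [set z | exists2 k, k \in L & F k z].
Proof.
elim: L => [_|k L IHL LF].
 by rewrite (_ : [set z | _] = set0); [exact: closed0 | apply/seteqP; split=> z // [k]; rewrite in_nil].
rewrite (_ : [set z | _] = F k `|` [set z | exists2 k, k \in L & F k z]).
 apply: closedU; first by apply: LF; exact: mem_head.
 by apply: IHL => k' k'L; apply: LF; rewrite inE k'L orbT.
apply/seteqP; split=> z.
 by move=> [k']; rewrite inE => /orP[/eqP -> Fz|k'L Fz]; [left | right; exists k'].
by move=> [Fz|[k' k'L Fz]]; [exists k => //; exact: mem_head | exists k' => //; rewrite inE k'L orbT].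
Qed.

Lemma good_sheets d (X : set 'rV[R]_d) x0 : fat_closed X -> subanalytic X ->
 exists (N : nat) (L : seq ('rV[R]_(1 + N) -> 'rV[R]_d)) (e : R),
  [/\ 0 < e, (forall E, E \in L -> good_sheet X E) &
   forall y, X y -> `|y - x0| < e -> exists E w, [/\ E \in L, `|w| <= 1 & E (zy 0 w) = y]].
Proof.
move=> [cX [fX _]] sX; have [N [L [e [e0 LP Lc]]]] := subanalytic_sheets x0 cX sX.
pose full (Phi : 'rV[R]_N -> 'rV[R]_d) := `[< exists x, gram Phi x != 0 >].
have /choice [C CP] : forall Phi : 'rV[R]_N -> 'rV[R]_d, exists C : seq ('rV[R]_(1 + N) -> 'rV[R]_d),
  Phi \in L -> full Phi -> (forall E, E \in C -> good_sheet X E) /\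
  forall s, `|s| <= 1 -> exists E w, [/\ E \in C, `|w| <= 1 & E (zy 0 w) = Phi s].
 move=> Phi; have [PhiL|nL] := pselect (Phi \in L); last by exists [::].
 have [/asboolP gPhi|/negP ng] := boolP (full Phi); last by exists [::].
 have [aP XP] := LP Phi PhiL; have [Pi PiP Pic] := monomial_cover (ganalytic_gram aP) gPhi.
 exists [seq fold_sheet (Phi \o q.1) q.2 | q <- allpairs pair Pi (enum {: {ffun 'I_N -> bool}})] => _ _; split.
  move=> _ /mapP [q /allpairsP [[pi tau] [/= piP _ ->]] ->] /=.
  have [api pi2 [g [u [au u0 uE]]]] := PiP pi piP; exact: fold_sheet_good uE.
 move=> s s1; have [pi [s' [piP s'1 s'E]]] := Pic s s1.
 pose tau : {ffun 'I_N -> bool} := [ffun i => s' 0 i < 0].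
 exists (fold_sheet (Phi \o pi) tau), (\row_i Num.sqrt `|s' 0 i|); split.
 - by apply/mapP; exists (pi, tau) => //; apply/allpairsP; exists (pi, tau); rewrite mem_enum.
 - apply: row_norm_le => // i; rewrite mxE ger0_norm ?sqrtr_ge0 // -[leRHS]sqrtr1 ler_sqrt //.
  exact: le_trans (coord_le_norm s' i) s'1.
 rewrite /fold_sheet /= -s'E; congr (Phi (pi _)); apply/rowP => i.
 rewrite mxE zc_zy yc_zy mxE expr0n addr0 sqr_sqrtr // ffunE [RHS]realEsign ?num_real //.
exists N, (flatten [seq C Phi | Phi <- L & full Phi]), e; split=> //.
 by move=> E /flatten_mapP [Phi]; rewrite mem_filter => /andP[fP PL] EC; have [/(_ E EC)] := CP Phi PL fP.
move=> y Xy yx0; pose L1 := [seq Phi <- L | full Phi].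
pose im (Phi : 'rV[R]_N -> 'rV[R]_d) := [set z | exists2 s, `|s| <= 1 & Phi s = z].
have cL1 : closed [set z | exists2 Phi, Phi \in L1 & im Phi z].
 apply: closed_seq_union => Phi; rewrite mem_filter => /andP[_ PL]; have [aP _] := LP Phi PL.
 by apply: compact_closed; [exact: norm_hausdorff | exact: continuous_box_image (ganalyticv_smooth aP)].
have nL2 : nowhere_dense [set z | exists2 Phi, Phi \in [seq Phi <- L | ~~ full Phi] & im Phi z].
 apply: nowhere_dense_union => Phi; rewrite mem_filter => /andP[/asboolPn nf PL].
 have [aP _] := LP Phi PL; apply: sard => // x; apply/eqP/negPn/negP => gx; apply: nf; by exists x.
have [|Phi PL [s s1 sE]] := cL1 y; last first.
 have := PL; rewrite mem_filter => /andP[fP PL']; have [_ /(_ s s1)] := CP Phi PL' fP.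
 move=> [E [w [EC w1 wE]]]; exists E, w; split=> //; last by rewrite wE.
 by apply/flatten_mapP; exists Phi.
move=> W /nbhs_ballP [r /= r0 rW].
have : closure (interior X) y by rewrite -fX.
pose r1 := Num.min r (e - `|y - x0|); have r10 : 0 < r1 by rewrite lt_min r0 subr_gt0.
move=> /(_ (ball y r1) (nbhsx_ballx _ _ r10)) [z [zX zy]].
have /nbhs_ballP [r2 /= r20 r2X] : nbhs z (interior X `&` ball y r1).
 by apply: open_nbhs_nbhs; split=> //; apply: openI; [exact: open_interior | exact: ball_open].
have [p [r3 [r30 pP]]] := nL2 z r2 r20; have [|pz np] := pP p; first by rewrite subrr normr0.
have [pX py] : (interior X `&` ball y r1) p by apply: r2X; rewrite ballE.
move: py; rewrite -ball_normE /= lt_min distrC => /andP[pr pe].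
have [|Phi [s [PL s1 sE]]] := Lc p (interior_subset pX).
 by rewrite -[p - x0](subrKA y); apply: lt_normD; rewrite -ltrBrDr.
exists p; split; last by apply: rW; rewrite ballE.
have [fP|nf] := boolP (full Phi); first by exists Phi; [rewrite mem_filter fP | exists s].
by case: np; exists Phi; [rewrite mem_filter nf | exists s].
Qed.

End GoodSheets.

Section Jets.
Context {R : realType} {N : nat}.
Local Notation B2 := (ball (0 : 'rV[R]_(1 + N)) 2).

Lemma hadamard_smooth_ball (i : 'I_(1 + N)) (G : 'rV[R]_(1 + N) -> R) : smooth_on B2 G -> smooth_on B2 (hadamard i G).
Proof.
move=> sG; apply: smooth_on_locally => x /ball0P x2; pose r := (`|x| + 2) / 2.
exists (ball 0 r); first by split; [exact: ball_open | apply/ball0P; rewrite /r; lra].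
apply: (hadamard_smooth i (ball_open _ _) sG) => y yr; apply/ball0P; apply: le_lt_trans yr _; rewrite /r; lra.
Qed.

Lemma divide_power (M : nat) (G : 'rV[R]_(1 + N) -> R) : smooth_on B2 G ->
 (forall w : 'rV[R]_N, `|w| < 2 -> (forall i, w 0 i != 0) -> exists2 g : R -> R, {for 0, continuous g} &
   forall t : R, t != 0 -> `|t| < 2 -> G (zy t w) = t ^+ M * g t) ->
 exists2 H, smooth_on B2 H & forall x, B2 x -> G x = zc x ^+ M * H x.
Proof.
elim: M G => [|M IHM] G sG GP; first by exists G => // x _; rewrite expr0 mul1r.
have cG x : B2 x -> {for x, continuous G} by move=> Bx; exact: smooth_continuous sG Bx.
have czy (t : R) (w : 'rV[R]_N) : {for t, continuous (fun t : R => zy t w)}.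
 exact: (smooth_continuous (smooth_zy openT smooth_idR (smooth_cst setT w)) (I : setT t)).
have czw (w : 'rV[R]_N) : {for w, continuous (fun w : 'rV[R]_N => zy 0 w : 'rV[R]_(1 + N))}.
 exact: (smooth_continuous (smooth_zy openT (smooth_cst setT 0) (smooth_id openT)) (I : setT w)).
have B0 w : `|w| < 2 -> B2 (zy 0 w) by move=> w2; apply/ball0P; apply: zy_lt; rewrite ?normr0.
have G0 (w : 'rV[R]_N) : `|w| < 2 -> (forall i, w 0 i != 0) -> G (zy 0 w) = 0.
 move=> w2 w0; have [g cg gP] := GP w w2 w0.
 rewrite -[RHS](_ : 0 ^+ M.+1 * g 0 = 0); last by rewrite expr0n mul0r.
 apply: (@limit_eq R R (fun t => G (zy t w)) (fun t => t ^+ M.+1 * g t) 0).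
 - exact: (continuous_comp (czy 0 w) (cG _ (B0 w w2))).
 - by apply: cvgM; [exact: exprn_continuous | exact: cg].
 move=> e e0; pose t := Num.min (e / 2) 1.
 have t0 : 0 < t by rewrite lt_min divr_gt0 //=.
 exists t; first by rewrite subr0 gtr0_norm // gt_min; apply/orP; left; lra.
 by apply: gP; rewrite ?gt_eqF // gtr0_norm // gt_min ltr1n orbT.
have {}G0 w : `|w| < 2 -> G (zy 0 w) = 0.
 move=> w2; apply: (@limit_eq R _ (fun w => G (zy 0 w)) (fun=> 0) w).
 - exact: (continuous_comp (czw w) (cG _ (B0 w w2))).
 - exact: (smooth_continuous (smooth_cst setT (0 : R)) (I : setT w)).
 move=> e e0; have [|w' w'w w'0] := nonzero_dense w (e := Num.min e (2 - `|w|)).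
  by rewrite lt_min e0 subr_gt0.
 move: w'w; rewrite lt_min => /andP[w'e w'2]; exists w' => //; apply: G0 => //.
 by rewrite -[w'](subrK w); apply: lt_normD; rewrite -ltrBrDr.
pose H1 := hadamard z0 G.
have GH x : B2 x -> G x = zc x * H1 x.
 move=> /ball0P x2; rewrite (hadamard_spec z0 G x); have -> : scoord z0 0 x = zy 0 (yc x).
  apply: zyP; first by rewrite /zc scoordE eqxx mul0r.
  by apply/rowP => i; rewrite !ycE scoordE.
 by rewrite G0 ?add0r // (le_lt_trans (yc_le x)).
have [||H sH HE] := IHM H1; first exact: hadamard_smooth_ball.
 move=> w w2 w0; have [g cg gP] := GP w w2 w0; exists g => // t t0 t2.
 have Bt : B2 (zy t w) by apply/ball0P; exact: zy_lt.
 by apply: (mulfI t0); rewrite mulrA -exprS -gP // GH // zc_zy.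
by exists H => // x Bx; rewrite GH // HE // mulrA -exprS.
Qed.

Context {d : nat}.
Implicit Types (X : set 'rV[R]_d) (f : 'rV[R]_d -> R) (E : 'rV[R]_(1 + N) -> 'rV[R]_d).

Lemma good_sheet_inside X E x : good_sheet X E -> B2 x -> zc x != 0 -> interior X (E x).
Proof.
move=> [_ _ [kap [k [kap0 kP]]] _] /ball0P x2 t0.
have r0 : 0 < kap * (zc x ^+ 2) ^+ k by rewrite mulr_gt0 // exprn_gt0 // exprn_even_gt0.
apply/nbhs_ballP; exists (kap * (zc x ^+ 2) ^+ k) => //= y; rewrite ballE => yx.
apply: (kP (zc x) (yc x)); rewrite ?zy_eta //; first exact: le_trans (zc_le x) (ltW x2).
exact: le_trans (yc_le x) (ltW x2).
Qed.

Lemma good_sheet_dense x (e : R) : 0 < e -> B2 x -> exists2 x', `|x' - x| < e & B2 x' /\ zc x' != 0.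
Proof.
move=> e0 /ball0P x2; have [|x' x'x x'0] := nonzero_dense x (e := Num.min e (2 - `|x|)).
 by rewrite lt_min e0 subr_gt0.
move: x'x; rewrite lt_min => /andP[x'e x'2]; exists x' => //; split; last exact: x'0.
by apply/ball0P; rewrite -[x'](subrK x); apply: lt_normD; rewrite -ltrBrDr.
Qed.

Lemma good_sheet_pushed X E f w : testable X f -> good_sheet X E ->
 exists (kap : R) (M : nat) (G : 'rV[R]_(1 + N) -> R), [/\ 0 < kap, smooth_on B2 G &
  forall x, B2 x -> zc x != 0 -> G x = kap * zc x ^+ M * Dw w f (E x)].
Proof.
move=> tf gE; have [aE XE [kap [k [kap0 kP]]] _] := gE.
pose tc (z : 'rV[R]_(1 + N + d)) : R := kap * (zc (lsubmx z) ^+ 2) ^+ k.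
pose C (z : 'rV[R]_(1 + N + d)) : 'rV[R]_d := E (lsubmx z) + tc z *: rsubmx z.
pose P := [set z : 'rV[R]_(1 + N + d) | `|lsubmx z| < 2 /\ `|rsubmx z| < 1].
have sl i : smooth_on setT (fun z : 'rV[R]_(1 + N + d) => lsubmx z 0 i).
 by under eq_fun do rewrite mxE; exact: smooth_coord openT.
have sr i : smooth_on setT (fun z : 'rV[R]_(1 + N + d) => rsubmx z 0 i).
 by under eq_fun do rewrite mxE; exact: smooth_coord openT.
have sL : smooth_on setT (fun z : 'rV[R]_(1 + N + d) => lsubmx z) by apply/smooth_on_row; [exact: openT | exact: sl].
have sR : smooth_on setT (fun z : 'rV[R]_(1 + N + d) => rsubmx z) by apply/smooth_on_row; [exact: openT | exact: sr].
have oP : open P.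
 have -> : P = (fun z : 'rV[R]_(1 + N + d) => lsubmx z : 'rV[R]_(1 + N)) @^-1` B2 `&`
   (fun z : 'rV[R]_(1 + N + d) => rsubmx z : 'rV[R]_d) @^-1` ball 0 1.
  by apply/seteqP; split=> z [/ball0P zl /ball0P zr]; split=> //; apply/ball0P.
 apply: openI; apply: open_comp; try exact: ball_open.
  by move=> z _; exact: smooth_continuous sL _.
 by move=> z _; exact: smooth_continuous sR _.
have sC : smooth_on setT C.
 apply/smooth_on_row; first exact: openT.
 move=> i; under eq_fun do rewrite /C !mxE; apply: (smoothD openT).
  exact: (smooth_comp openT openT (fun _ _ => I) (aE i).1 sL).
 apply: (smoothM openT); last by have := sr i; under eq_fun do rewrite mxE.
 by apply: (smoothZ openT); apply: (smoothX openT); apply: (smoothX openT); exact: sl.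
have XC z : P z -> X (C z).
 move=> [zl zr]; have t0 : 0 <= tc z by apply: mulr_ge0; [exact: ltW | apply: exprn_ge0; exact: sqr_ge0].
 have [tz|tz] := eqVneq (tc z) 0; first by rewrite /C tz scale0r addr0; exact: XE.
 apply: (kP (zc (lsubmx z)) (yc (lsubmx z))).
 - exact: le_trans (zc_le _) (ltW zl).
 - exact: le_trans (yc_le _) (ltW zl).
 have -> : C z - E (zy (zc (lsubmx z)) (yc (lsubmx z))) = tc z *: rsubmx z by rewrite zy_eta /C [_ + _ *: _]addrC addrK.
 by rewrite normrZ ger0_norm // -/(tc z) -[ltRHS]mulr1 ltr_pM2l // lt_neqAle eq_sym tz.
have sfC : smooth_on P (f \o C) := tf _ P C oP (smooth_on_sub (fun _ _ => I) sC) XC.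
pose io (x : 'rV[R]_(1 + N)) : 'rV[R]_(1 + N + d) := row_mx x 0.
have sio : smooth_on setT io.
 apply/smooth_on_row; first exact: openT.
 move=> i; case: (split_ordP i) => j ->; under eq_fun do rewrite ?row_mxEl ?row_mxEr.
  exact: smooth_coord openT.
 exact: smooth_cst.
have Pio x : B2 x -> P (io x) by move=> /ball0P x2; split; rewrite ?row_mxKl ?row_mxKr ?normr0.
pose G := Dw (map (@rshift (1 + N) d) w) (f \o C) \o io.
exists (kap ^+ size w), (2 * k * size w)%N, G; split; first exact: exprn_gt0.
 apply: (smooth_comp oP (ball_open _ _) Pio (Dw_smooth _ sfC)); exact: smooth_on_sub sio.
move=> x Bx t0; pose c := kap * (zc x ^+ 2) ^+ k.
have c0 : 0 < c by rewrite mulr_gt0 // exprn_gt0 // exprn_even_gt0.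
have oU : open (interior X) := open_interior X.
have dU u : ball (0 : 'rV[R]_d) 1 u -> interior X (diagmap (fun=> c) (fun j => E x 0 j) u).
 move=> /ball0P u1; have x2 : `|x| < 2 by apply/ball0P.
 have -> : diagmap (fun=> c) (fun j => E x 0 j) u = E x + c *: u by apply/rowP => j; rewrite !mxE addrC.
 apply/nbhs_ballP; exists (c * (1 - `|u|)); first by rewrite /= mulr_gt0 // subr_gt0.
 move=> y; rewrite -ball_normE /= => yb.
 apply: (kP (zc x) (yc x)); rewrite ?zy_eta -/c; first exact: le_trans (zc_le x) (ltW x2).
  exact: le_trans (yc_le x) (ltW x2).
 have -> : y - E x = c *: u - (E x + c *: u - y) by apply/rowP => j; rewrite !mxE; ring.
 apply: le_lt_trans (ler_normB _ _) _; rewrite normrZ gtr0_norm //.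
 by move: yb; rewrite mulrBr mulr1; lra.
have sf : smooth_on (interior X) f := testable_smooth tf oU (@interior_subset _ X).
have eI i (h : R) (u : 'rV[R]_d) : row_mx x (h *: delta_mx 0 i + u) = h *: delta_mx 0 (@rshift (1 + N) d i) + row_mx x u.
 apply/rowP => j; rewrite [RHS]mxE [X in _ = X + _]mxE; case: (split_ordP j) => l ->.
  by rewrite !row_mxEl mxE eqxx eq_lrshift mulr0 add0r.
 by rewrite !row_mxEr !mxE !eqxx eq_rshift.
have := @Dw_embed R d (1 + N + d) (fun u => row_mx x u) (@rshift (1 + N) d) (f \o C) w 0 eI.
rewrite /G /= -/(io x) => <-.
have -> : (f \o C) \o (fun u : 'rV[R]_d => row_mx x u) = f \o diagmap (fun=> c) (fun j => E x 0 j).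
 apply/funext => u /=; congr f; rewrite /C /tc row_mxKl row_mxKr -/c.
 by apply/rowP => j; rewrite !mxE addrC.
rewrite (Dw_diagmap w oU (ball_open _ _) dU sf (ballxx _ ltr01)).
have -> : diagmap (fun=> c) (fun j => E x 0 j) 0 = E x by apply/rowP => j; rewrite !mxE mulr0 add0r.
by rewrite big_const_seq count_predT iter_mulr_1 /c exprMn -!exprM.
Qed.

Lemma good_sheet_jets X E f : testable X f -> good_sheet X E ->
 exists F : seq 'I_d -> 'rV[R]_(1 + N) -> R,
  [/\ forall w, smooth_on B2 (F w),
   forall w x, B2 x -> interior X (E x) -> F w x = Dw w f (E x) &
   forall w j x, B2 x -> Dw [:: j] (F w) x = \sum_i F (i :: w) x * Dw [:: j] (fun y => E y 0 i) x].
Proof.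
move=> tf gE; have [aE XE _ E0] := gE; have oU : open (interior X) := open_interior X.
have sf : smooth_on (interior X) f := testable_smooth tf oU (@interior_subset _ X).
have cE x : {for x, continuous E} := smooth_continuous (ganalyticv_smooth aE) (I : setT x).
have cf w x : interior X (E x) -> {for x, continuous (fun x => Dw w f (E x))}.
 by move=> Ux; exact: (continuous_comp (cE x) (smooth_continuous (Dw_smooth w sf) Ux)).
have /choice [F FP] : forall w, exists F : 'rV[R]_(1 + N) -> R, smooth_on B2 F /\
  forall x, B2 x -> zc x != 0 -> F x = Dw w f (E x).
 move=> w; have [kap [M [G [kap0 sG GE]]]] := good_sheet_pushed w tf gE.
 have [|H sH HE] := @divide_power M G sG.
  move=> v v2 v0; exists (fun t => kap * Dw w f (E (zy t v))).
   have cv : {for (0 : R), continuous (fun t : R => zy t v)}.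
    exact: (smooth_continuous (smooth_zy openT smooth_idR (smooth_cst setT v)) (I : setT 0)).
   apply: cvgM; first exact: cvg_cst.
   exact: (continuous_comp cv (cf w (zy 0 v) (E0 v (ltW v2) v0))).
  move=> t t0 t2; rewrite GE ?zc_zy //; last by apply/ball0P; exact: zy_lt.
  by rewrite mulrCA mulrA.
 exists (fun x => kap^-1 * H x); split; first exact: (smoothZ (ball_open _ _)).
 move=> x Bx x0; apply: (mulfI (lt0r_neq0 kap0)); rewrite mulrA mulfV ?gt_eqF // mul1r.
 by apply: (mulfI (expf_neq0 M x0)); rewrite -HE // GE // mulrA [_ * kap]mulrC.
have FE w x : B2 x -> interior X (E x) -> F w x = Dw w f (E x).
 move=> Bx Ux; apply: (@limit_eq R _ (F w) (fun x => Dw w f (E x)) x); first exact: (smooth_continuous (FP w).1 Bx).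
  exact: cf.
 move=> e e0; have [x' x'e [Bx' x'0]] := good_sheet_dense e0 Bx; exists x' => //; exact: (FP w).2.
exists F; split=> [w||w j x Bx] //; first exact: (FP w).1.
apply: (@limit_eq R _ (Dw [:: j] (F w)) (fun x => \sum_i F (i :: w) x * Dw [:: j] (fun y => E y 0 i) x) x).
- exact: (smooth_continuous (Dw_smooth _ (FP w).1) Bx).
- apply: (smooth_continuous (A := B2)) => //; apply: (smooth_sum (ball_open _ _)) => i.
 apply: (smoothM (ball_open _ _)); first exact: (FP _).1.
 by apply: Dw_smooth; exact: smooth_on_sub (aE i).1.
move=> e e0; have [x' x'e [Bx' x'0]] := good_sheet_dense e0 Bx; exists x' => //.
pose A := B2 `&` [set x | zc x != 0].
have oA : open A.
 apply: openI; first exact: ball_open.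
 apply: (@open_comp _ _ (@zc R N) [set r : R | r != 0]); last exact: open_neq0.
 by move=> z _; exact: coord_continuous.
have AU z : A z -> interior X (E z) by move=> [Bz z0]; exact: good_sheet_inside gE Bz z0.
have Ax' : A x' by [].
rewrite (@Dw_ext R _ A (F w) (Dw w f \o E) [:: j] x' oA) //; last by move=> z Az; apply: FE; [exact: Az.1 | exact: AU].
rewrite (Dw1_comp j oU AU (Dw_smooth w sf) (smooth_on_sub (fun _ _ => I) (ganalyticv_smooth aE)) Ax').
by apply: eq_bigr => i _; rewrite /= FE ?Dw_cons ?Dw1 //; exact: AU.
Qed.

End Jets.

Section Fibres.
Context {R : realType} {N d : nat}.
Local Notation B2 := (ball (0 : 'rV[R]_(1 + N)) 2).
Implicit Types (X : set 'rV[R]_d) (f : 'rV[R]_d -> R) (E : 'rV[R]_(1 + N) -> 'rV[R]_d)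
 (F : seq 'I_d -> 'rV[R]_(1 + N) -> R).

Definition sheet_jets X f E F : Prop :=
 [/\ forall w, smooth_on B2 (F w),
  forall w x, B2 x -> interior X (E x) -> F w x = Dw w f (E x) &
  forall w j x, B2 x -> Dw [:: j] (F w) x = \sum_i F (i :: w) x * Dw [:: j] (fun y => E y 0 i) x].

Lemma is_derive_gradient (W : set 'rV[R]_(1 + N)) (g : 'rV[R]_(1 + N) -> R) (c : R -> 'rV[R]_(1 + N)) (t : R) :
 open W -> smooth_on W g -> smooth_on setT c -> W (c t) ->
 is_derive t 1 (g \o c) (\sum_j ('D_1 c t) 0 j * Dw [:: j] g (c t)).
Proof.
move=> oW sg sc Wc; apply: (is_derive_comp oW Wc).
- by move=> x i Wx; exact: smooth_derivable sg Wx.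
- by move=> i; exact: (smooth_continuous (smooth_derive _ sg) Wc).
- exact: (smooth_derivable sc (I : setT t)).
Qed.

Lemma jet_path X f E F w (c : R -> 'rV[R]_(1 + N)) (t : R) : ganalyticv E -> sheet_jets X f E F ->
 smooth_on setT c -> B2 (c t) ->
 is_derive t 1 (F w \o c) (\sum_i ('D_1 (E \o c) t) 0 i * F (i :: w) (c t)).
Proof.
move=> aE [sF _ chain] sc Bc.
suff -> : \sum_i ('D_1 (E \o c) t) 0 i * F (i :: w) (c t) = \sum_j ('D_1 c t) 0 j * Dw [:: j] (F w) (c t).
 exact: is_derive_gradient (ball_open _ _) (sF w) sc Bc.
have sEc : smooth_on setT (E \o c) := smooth_on_comp openT openT (fun _ _ => I) (ganalyticv_smooth aE) sc.
rewrite (derive_mx (@smooth_derivable R R setT _ (E \o c) t 1 sEc I)).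
under eq_bigr => i _.
 rewrite mxE (@derive_val _ _ _ _ _ _ _ (is_derive_gradient openT (aE i).1 sc (I : setT (c t)))) mulr_suml.
 over.
rewrite exchange_big; apply: eq_bigr => j _; rewrite chain // mulr_sumr; apply: eq_bigr => i _.
by rewrite -mulrA; congr (_ * _); rewrite mulrC.
Qed.

Lemma jet_cst_path X f E F w (c : R -> 'rV[R]_(1 + N)) y : ganalyticv E -> sheet_jets X f E F ->
 smooth_on setT c -> (forall t, E (c t) = y) -> (forall t : R, 0 <= t <= 1 -> B2 (c t)) -> F w (c 1) = F w (c 0).
Proof.
move=> aE jF sc Ec Bc.
have dF (t : R) : 0 <= t <= 1 -> is_derive t 1 (F w \o c) 0.
 move=> t01; have := jet_path w aE jF sc (Bc t t01); congr is_derive; apply: big1 => i _.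
 have -> : E \o c = cst y by apply/funext.
 by rewrite derive_cst mxE mul0r.
have [|t t01] := @MVT_line R R (F w \o c) 0 1 1 ler01.
 by move=> s s01; rewrite /GRing.scale /= mulr1 addr0; have [] := dF s s01.
rewrite /GRing.scale /= !mulr1 !addr0 mul1r.
by rewrite (@derive_val _ _ _ _ _ _ _ (dF t t01)) => /subr0_eq.
Qed.

(* The fibre is covered by finitely many star-shaped faces, on each of which F w is constant. *)
Lemma fibre_values X f E F w y : ganalyticv E -> sheet_jets X f E F ->
 exists V : seq R, forall x, `|x| <= 1 -> E x = y -> F w x \in V.
Proof.
move=> aE jF; pose h x := \sum_i (E x 0 i - y 0 i) ^+ 2.
have ah : ganalytic h.
 by apply: ganalytic_sum => i _; apply: ganalyticX; apply: ganalyticB; [exact: aE | exact: ganalytic_cst].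
have hE x : h x = 0 <-> E x = y.
 split=> [/eqP|Ex]; last by rewrite /h big1 // => i _; rewrite Ex subrr expr0n.
 rewrite psumr_eq0 => [/allP h0|i _]; last exact: sqr_ge0.
 by apply/rowP => i; have := h0 i (mem_index_enum _); rewrite sqrf_eq0 subr_eq0 => /eqP.
have sl (x : 'rV[R]_(1 + N)) : smooth_on setT (fun t : R => t *: x).
 apply/smooth_on_row => [|i]; first exact: openT.
 under eq_fun do rewrite mxE mulrC; apply: (smoothZ openT); exact: smooth_idR.
have [[x0 hx0]|h0] := pselect (exists x, h x != 0); last first.
 exists [:: F w 0] => x x1 _; rewrite inE; apply/eqP.
 have := @jet_cst_path X f E F w (fun t => t *: x) y aE jF (sl x); rewrite scale1r scale0r; apply.
  by move=> t; apply/hE/eqP/negPn/negP => ht; apply: h0; exists (t *: x).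
 move=> t /andP[t0 t1]; apply/ball0P; rewrite normrZ ger0_norm //.
 by apply: (@le_lt_trans _ _ 1); [rewrite mulr_ile1 | rewrite ltr1n].
have [Q QP Qc] := zero_faces ah (ex_intro _ x0 hx0).
exists [seq F w (q.1 0) | q <- Q] => x x1 /hE hx; have [q [s [qQ s1 sq qE]]] := Qc x x1 hx.
apply/mapP; exists q => //; have [aq q2 qh] := QP q qQ; rewrite -qE.
have sc : smooth_on setT (fun t : R => q.1 (t *: s)) := smooth_on_comp openT openT (fun _ _ => I) (ganalyticv_smooth aq) (sl s).
have := @jet_cst_path X f E F w _ y aE jF sc; rewrite scale1r scale0r; apply.
 by move=> t; apply/hE/qh; rewrite mxE sq mulr0.
by move=> t _; apply/ball0P; apply: lt_trans (q2 _) _; lra.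
Qed.

Lemma sheet_approach X f E F w x (O : set 'rV[R]_d) (e : R) : good_sheet X E -> sheet_jets X f E F -> B2 x ->
 nbhs (E x) O -> 0 < e -> exists z, [/\ O z, interior X z & `|F w x - Dw w f z| < e].
Proof.
move=> gE [sF FE _] Bx nO e0; have [aE _ _ _] := gE.
have cE := smooth_continuous (ganalyticv_smooth aE) (I : setT x).
have /nbhs_ballP [r1 /= r10 r1P] := cE _ nO.
have /cvgrPdist_lt /(_ e e0) /nbhs_ballP [r2 /= r20 r2P] := smooth_continuous (sF w) Bx.
have [|x' x'x [Bx' x'0]] := good_sheet_dense (e := Num.min r1 r2) (x := x) _ Bx; first by rewrite lt_min r10.
move: x'x; rewrite lt_min distrC => /andP[x1 x2].
have Ux' := good_sheet_inside gE Bx' x'0.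
exists (E x'); split=> //; first by apply: r1P; rewrite -ball_normE.
by rewrite -FE //; apply: r2P; rewrite -ball_normE.
Qed.

Lemma closed_level_image E (g : 'rV[R]_(1 + N) -> R) (c : R) : ganalyticv E -> smooth_on B2 g ->
 closed [set z | exists2 x, `|x| <= 1 & E x = z /\ g x = c].
Proof.
move=> aE sg; pose G x := (E x, g x).
have cK : compact (G @` [set x | `|x| <= 1]).
 apply: continuous_compact; last exact: closed_ball0_compact.
 apply: continuous_in_subspaceT => x; rewrite inE /= => x1.
 have Bx : B2 x by apply/ball0P; apply: le_lt_trans x1 _; rewrite ltr1n.
 have cE := smooth_continuous (ganalyticv_smooth aE) (I : setT x); have cg := smooth_continuous sg Bx.
 exact: (cvg_pair cE cg).
have := compact_closed (@norm_hausdorff R _) cK.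
move=> /(@closed_comp _ _ (fun z : 'rV[R]_d => (z, c))).
rewrite (_ : _ @^-1` _ = [set z | exists2 x, `|x| <= 1 & E x = z /\ g x = c]); last first.
 by apply/seteqP; split=> z [x x1]; [move=> [Ez gc]; exists x | move=> [Ez gc]; exists x => //; rewrite /G Ez gc].
apply=> z _; have c1 := smooth_continuous (smooth_id (@openT 'rV[R]_d)) (I : setT z).
exact: (cvg_pair c1 (smooth_continuous (smooth_cst setT c) (I : setT z))).
Qed.

End Fibres.

Lemma exists_between {R : realType} (a b : R) (V : seq R) : a < b -> exists c, [/\ a < c, c < b & c \notin V].
Proof.
move=> ab; elim: V a b ab => [|v V IHV] a b ab.
 by exists ((a + b) / 2); split=> //; lra.
have [c [ac cb cV]] := IHV a b ab; have [cv|cv] := eqVneq c v; last by exists c; rewrite inE negb_or cv.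
have [c' [ac' cb' cV']] := IHV a c ac; exists c'; split=> //; first exact: lt_trans cb' cb.
by rewrite inE negb_or cV' -cv lt_eqF.
Qed.

Section FibreEquality.
Context {R : realType} {N d : nat} {X : set 'rV[R]_d} {f : 'rV[R]_d -> R} {x0 : 'rV[R]_d}.
Context {L : seq ('rV[R]_(1 + N) -> 'rV[R]_d)} {F : ('rV[R]_(1 + N) -> 'rV[R]_d) -> seq 'I_d -> 'rV[R]_(1 + N) -> R} {e : R}.
Local Notation B2 := (ball (0 : 'rV[R]_(1 + N)) 2).
Hypotheses (sX : simple_set X) (tf : testable X f) (LP : forall E, E \in L -> good_sheet X E /\ sheet_jets X f E (F E)).
Hypothesis Lc : forall y, X y -> `|y - x0| < e -> exists E x, [/\ E \in L, `|x| <= 1 & E x = y].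

Lemma fibre_le w E E' x x' : E \in L -> E' \in L -> B2 x -> B2 x' -> E x = E' x' -> `|E x - x0| < e ->
 F E' w x' <= F E w x.
Proof.
move=> EL E'L Bx Bx' EE' Ee; set y := E x in EE' Ee; rewrite leNgt; apply/negP => ab.
have [gE jE] := LP EL; have [gE' jE'] := LP E'L.
have /choice [V VP] : forall E1, exists V : seq R, E1 \in L -> forall x, `|x| <= 1 -> E1 x = y -> F E1 w x \in V.
 move=> E1; have [E1L|nE1] := pselect (E1 \in L); last by exists [::].
 have [[aE1 _ _ _] jE1] := LP E1L; have [V VP] := fibre_values w y aE1 jE1; by exists V.
have [c [ac cb cV]] := exists_between (flatten [seq V E1 | E1 <- L]) ab.
pose Z := [set z | exists2 E1, E1 \in L & exists2 x, `|x| <= 1 & E1 x = z /\ F E1 w x = c].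
have cZ : closed Z.
 apply: closed_seq_union => E1 E1L; have [[aE1 _ _ _] [sF1 _ _]] := LP E1L; exact: closed_level_image.
have nZy : ~ Z y.
 move=> [E1 E1L [x1 x11 [Ex1 Fx1]]]; move/negP: cV; apply; apply/flatten_mapP; exists E1 => //.
 by rewrite -Fx1; exact: VP.
have Xy : X y by have [_ XE _ _] := gE; exact: XE.
have nW : nbhs y (~` Z `&` [set z | `|z - x0| < e]).
 apply: filterI; first by apply: open_nbhs_nbhs; split=> //; exact: closed_openC.
 apply/nbhs_ballP; exists (e - `|y - x0|); first by rewrite /= subr_gt0.
 move=> z; rewrite ballE /= => zy; rewrite -[z - x0](subrKA y).
 by apply: lt_normD; rewrite -ltrBrDr.
have [Q [nQ QW cQ]] := sX Xy nW.
have oU : open (interior X) := open_interior X.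
have sf : smooth_on (interior X) f := testable_smooth tf oU (@interior_subset _ X).
have : is_interval (Dw w f @` (Q `&` interior X)).
 apply/connected_intervalP; apply: connected_continuous_connected => //.
 apply: continuous_in_subspaceT => z; rewrite inE => -[_ Uz]; exact: smooth_continuous (Dw_smooth w sf) Uz.
have [z [Qz Uz zF]] := sheet_approach w gE jE Bx nQ (e := c - F E w x) (ltac:(by rewrite subr_gt0)).
have nQ' : nbhs (E' x') Q by rewrite -EE'.
have [z' [Qz' Uz' zF']] := sheet_approach w gE' jE' Bx' nQ' (e := F E' w x' - c) (ltac:(by rewrite subr_gt0)).
move=> /(_ (Dw w f z) (Dw w f z')) I.
have [||| v [Qv Uv] vc] := I _ _ c.
- by exists z.
- by exists z'.
- move: zF zF'; rewrite !ltr_norml => /andP[z1 z2] /andP[z'1 z'2]; apply/andP; split; lra.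
have [nZv vx] := QW v Qv; apply: nZv; have [E1 [x1 [E1L x11 Ex1]]] := Lc (interior_subset Uv) vx.
exists E1 => //; exists x1 => //; split=> //; have [_ [_ FE _]] := LP E1L.
by rewrite FE ?Ex1 //; apply/ball0P; apply: le_lt_trans x11 _; rewrite ltr1n.
Qed.

Lemma fibre_eq w E E' x x' : E \in L -> E' \in L -> B2 x -> B2 x' -> E x = E' x' -> `|E x - x0| < e ->
 F E w x = F E' w x'.
Proof.
move=> EL E'L Bx Bx' EE' Ee; apply/eqP; rewrite eq_le; apply/andP; split; last exact: fibre_le.
by apply: fibre_le => //; rewrite -EE'.
Qed.

End FibreEquality.

Section Lojasiewicz.
Context {R : realType} {N : nat}.
Implicit Types (h : 'rV[R]_N -> R) (s y : 'rV[R]_N).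

Definition near_zero h (P : nat) (C : R) y : Prop :=
 (exists y0, [/\ `|y0| < 3 / 2, h y0 = 0 & (`|y - y0| / 3) ^+ P <= C * `|h y|]) \/ 1 <= C * `|h y|.

Lemma near_zero_le h (P P' : nat) (C C' : R) y : (P <= P')%N -> C <= C' -> `|y| <= 1 ->
 near_zero h P C y -> near_zero h P' C' y.
Proof.
move=> PP CC y1 [[y0 [y02 hy0 le]]|le]; last by right; apply: le_trans le _; exact: ler_wpM2r.
left; exists y0; split=> //; apply: (@le_trans _ _ ((`|y - y0| / 3) ^+ P)).
 apply: ler_wiXn2l => //.
 by rewrite ler_pdivrMr // mul1r; apply: le_normB; lra.
by apply: le_trans le _; exact: ler_wpM2r.
Qed.

Lemma seq_max_bound (T : eqType) (L : seq T) (Q : T -> nat -> R -> Prop) :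
 (forall k P P' C C', (P <= P')%N -> C <= C' -> Q k P C -> Q k P' C') ->
 (forall k, k \in L -> exists P C, Q k P C) ->
 exists (P : nat) (C : R), [/\ (0 < P)%N, 0 <= C & forall k, k \in L -> Q k P C].
Proof.
move=> mono; elim: L => [_|k L IHL LQ]; first by exists 1%N, 0.
have [|P [C [P0 C0 PC]]] := IHL; first by move=> k' k'L; apply: LQ; rewrite inE k'L orbT.
have [P' [C' Q']] := LQ k (mem_head _ _); exists (P + P')%N, (C + `|C'|); split.
- by rewrite addn_gt0 P0.
- by rewrite addr_ge0.
move=> k'; rewrite inE => /orP[/eqP ->|k'L].
 by apply: mono Q'; [exact: leq_addl | apply: le_trans (ler_norm _) _; rewrite lerDr].
by apply: mono (PC k' k'L); [exact: leq_addr | rewrite lerDl].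
Qed.

(* Killing the smallest coordinate that occurs in the monomial moves to a zero, at a cost controlled by the monomial. *)
Lemma lojasiewicz h : ganalytic h -> exists (P : nat) (C : R), forall y, `|y| <= 1 -> near_zero h P C y.
Proof.
move=> ah; have [h0|h0] := pselect (exists x, h x != 0); last first.
 exists 1%N, 0 => y y1; left; exists y; split; first by lra.
  by apply/eqP/negPn/negP => hy; apply: h0; exists y.
 by rewrite subrr normr0 mul0r expr1 mul0r.
have [L LP Lc] := monomial_cover ah h0.
pose Q (pi : 'rV[R]_N -> 'rV[R]_N) P C := forall s, `|s| <= 1 -> `|pi s| <= 1 -> near_zero h P C (pi s).
have [||P [C [_ _ PC]]] := @seq_max_bound _ L Q.
- by move=> pi P P' C C' PP CC q s s1 p1; exact: near_zero_le (q s s1 p1).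
- move=> pi piL; have [api pi2 [g [u [au u0 hE]]]] := LP pi piL.
 have [M M0 MP] := ganalyticv_bound 1 api; pose Lam := N%:R * M ^+ 2.
 have Lam0 : 0 <= Lam by rewrite mulr_ge0 // sqr_ge0.
 have lip s s' : `|s| <= 1 -> `|s'| <= 1 -> `|pi s - pi s'| <= Lam * `|s - s'|.
  move=> s1 s'1; apply: row_norm_le => [|i]; first by rewrite mulr_ge0.
  rewrite [(pi s - pi s') 0 i]mxE [(- pi s') 0 i]mxE; apply: (gradient_segment_bound openT (api i).1) => // t t01 k.
  have := MP _ i (le_norm_segment t01 s'1 s1) [:: k]; rewrite [X in _ <= _ * X](_ : _ = 1) // mulr1; exact.
 have cu : {within [set s : 'rV[R]_N | `|s| <= 1], continuous (fun s => `|u s|)}.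
  apply: continuous_subspaceT => s.
  exact: (continuous_comp (smooth_continuous au.1 (I : setT s)) (@norm_continuous R R (u s))).
 have [|s0 _ s0P] := EVT_min_rV _ (closed_ball0_compact (r := 1)) cu; first by exists 0; rewrite /= normr0.
 have us0 : 0 < `|u s0| by rewrite normr_gt0.
 have {}s0P s : `|s| <= 1 -> `|u s0| <= `|u s| by move=> s1; apply: s0P; rewrite inE.
 pose G := (\sum_i g i)%N; pose Z := (1 + Lam) ^+ G.
 have Z1 : 1 <= Z by apply: exprn_ege1; rewrite lerDl.
 exists G, (Z / `|u s0|) => s s1 p1.
 have hs : `|h (pi s)| = `|monomial g s| * `|u s| by rewrite hE normrM.
 have hm : Z * `|monomial g s| <= Z / `|u s0| * `|h (pi s)|.
  rewrite hs -mulrA; apply: ler_wpM2l; first exact: le_trans Z1.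
  by rewrite mulrC -mulrA; apply: ler_peMr => //; rewrite ler_pdivlMr // mul1r; exact: s0P.
 have [/existsP [l0 gl0]|/existsPn g0] := boolP [exists l, (0 < g l)%N]; last first.
  right; apply: le_trans hm; rewrite (_ : monomial g s = 1) ?normr1 ?mulr1 //.
  by rewrite /monomial big1 // => i _; have := g0 i; rewrite -eqn0Ngt => /eqP ->; rewrite expr0.
 left; have [l gl lmin] := @arg_minP _ R 'I_N l0 (fun l => (0 < g l)%N) (fun l => `|s 0 l|) gl0.
 pose s' := scoord l 0 s; have s'1 : `|s'| <= 1 by apply: le_trans s1; apply: scoord_norm; rewrite lexx ler01.
 exists (pi s'); split; first exact: pi2.
  rewrite hE (_ : monomial g s' = 0) ?mul0r // /monomial (bigD1 l) //= scoordE eqxx mul0r expr0n.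
  by move: gl; case: (g l) => // k _; rewrite mul0r.
 apply: le_trans hm; have ss' : `|s - s'| <= `|s 0 l|.
  apply: row_norm_le => // i; rewrite [(s - s') 0 i]mxE [(- s') 0 i]mxE scoordE; case: eqP => [->|_].
   by rewrite mul0r subr0.
  by rewrite subrr normr0.
 apply: (@le_trans _ _ (((1 + Lam) * `|s 0 l|) ^+ G)).
  apply: lerXn2r; rewrite ?nnegrE ?divr_ge0 ?mulr_ge0 ?addr_ge0 //.
  rewrite ler_pdivrMr //; apply: le_trans (lip s s' s1 s'1) _; apply: (@le_trans _ _ (Lam * `|s 0 l|)).
   exact: ler_wpM2l.
  have h3 (u' v : R) : 0 <= u' -> 0 <= v -> u' * v <= (1 + u') * v * 3.
   by move=> u'0 v0; have := mulr_ge0 u'0 v0; rewrite mulrDl mul1r; move: (u' * v) => c; lra.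
  exact: h3.
 rewrite exprMn; apply: ler_wpM2l; first exact: le_trans Z1.
 rewrite /monomial normr_prod -[leLHS]prodrXr; apply: ler_prod => i _; rewrite exprn_ge0 //= normrX.
 by have [->|gi] := posnP (g i); [rewrite !expr0 | apply: lerXn2r; rewrite ?nnegrE //; exact: lmin].
by exists P, C => y y1; have [pi [s [piL s1 sE]]] := Lc y y1; rewrite -sE; apply: PC => //; rewrite sE.
Qed.

End Lojasiewicz.

Section SheetPaths.
Context {R : realType} {N d : nat}.
Implicit Types (E : 'rV[R]_(1 + N) -> 'rV[R]_d) (x y : 'rV[R]_(1 + N)).

Definition seg x y (t : R) := t *: (y - x) + x.

Lemma seg_smooth x y : smooth_on setT (seg x y).
Proof.
apply/smooth_on_row => [|i]; first exact: openT.
under eq_fun do rewrite 2!mxE mulrC; apply: (smoothD openT); last exact: smooth_cst.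
by apply: (smoothZ openT); exact: smooth_idR.
Qed.

Lemma derive_seg x y (t : R) : 'D_1 (seg x y) t = y - x.
Proof.
have d1 : derivable (id : 'rV[R]_(1 + N) -> 'rV[R]_(1 + N)) (t *: (y - x) + x) (y - x) by exact: derivable_id.
by have := @derive_val _ _ _ _ _ _ _ (is_derive_line d1); rewrite derive_id.
Qed.

Definition speed_bound E (Lam : R) : Prop := forall x y, `|x| <= 3 / 2 -> `|y| <= 3 / 2 ->
 `|E y - E x| <= Lam * `|y - x| /\ forall t : R, 0 <= t <= 1 -> `|'D_1 (E \o seg x y) t| <= Lam * `|y - x|.

Lemma sheet_speed E : ganalyticv E -> exists Lam, speed_bound E Lam.
Proof.
move=> aE; have [M M0 MP] := ganalyticv_bound (3 / 2) aE; exists ((1 + N)%:R * M ^+ 2) => x y x1 y1.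
have dM t i k : 0 <= t <= 1 -> `|Dw [:: k] (fun y => E y 0 i) (seg x y t)| <= M ^+ 2.
 by move=> t01; have := MP _ i (le_norm_segment t01 x1 y1) [:: k]; rewrite [X in _ <= _ * X](_ : _ = 1) // mulr1.
have n0 : 0 <= (1 + N)%:R * M ^+ 2 * `|y - x| by rewrite !mulr_ge0 // sqr_ge0.
split=> [|t t01]; apply: row_norm_le => // i.
 rewrite [(E y - E x) 0 i]mxE [(- E x) 0 i]mxE; apply: (gradient_segment_bound openT (aE i).1) => // t t01 k.
 exact: dM.
have sEc : smooth_on setT (E \o seg x y).
 exact: smooth_on_comp openT openT (fun _ _ => I) (ganalyticv_smooth aE) (seg_smooth x y).
rewrite (derive_mx (@smooth_derivable R R setT _ (E \o seg x y) t 1 sEc I)) mxE.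
rewrite (@derive_val _ _ _ _ _ _ _ (is_derive_gradient openT (aE i).1 (seg_smooth x y) (I : setT (seg x y t)))) derive_seg.
rewrite -mulrA; apply: norm_sum_le => j; rewrite normrM mulrC; apply: ler_pM => //; first exact: dM.
exact: coord_le_norm.
Qed.

Lemma sheet_path (X : set 'rV[R]_d) f E F (Lam : R) (c : seq 'I_d -> R) a x y (q : nat) (B l : R) :
 ganalyticv E -> sheet_jets X f E F -> 0 <= Lam -> speed_bound E Lam -> `|x| <= 3 / 2 -> `|y| <= 3 / 2 ->
 symm_words c -> 0 <= B -> 0 <= l ->
 (forall j w, (j + size w <= q)%N -> `|F w x - Tp c j w (E x - a)| <= B * l ^+ j) ->
 (forall w z, (size w <= q)%N -> `|z| <= 3 / 2 -> `|F w z - c w| <= B) ->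
 forall j w, (j + size w <= q)%N -> `|F w y - Tp c j w (E y - a)| <= B * (l + d%:R * (Lam * `|y - x|)) ^+ j.
Proof.
move=> aE jF Lam0 speed x1 y1 sc B0 l0 start bnd j w jq.
have [_ dE] := speed x y x1 y1.
have c0 : seg x y 0 = x by rewrite /seg scale0r add0r.
have c1 : seg x y 1 = y by rewrite /seg scale1r subrK.
have sEc : smooth_on setT (E \o seg x y).
 exact: smooth_on_comp openT openT (fun _ _ => I) (ganalyticv_smooth aE) (seg_smooth x y).
have cB t : 0 <= t <= 1 -> `|seg x y t| <= 3 / 2 by move=> t01; exact: le_norm_segment.
have := @path_estimate R d c a (E \o seg x y) (fun t => 'D_1 (E \o seg x y) t) (fun w t => F w (seg x y t)) q B l
 (Lam * `|y - x|) sc B0 l0 (mulr_ge0 Lam0 (normr_ge0 _)) _ dE _ _ _ j w 1 jq; rewrite /= c0 c1; apply.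
- by move=> t _; apply/derivableP; exact: (@smooth_derivable R R setT _ (E \o seg x y) t 1 sEc I).
- move=> v t t01; apply: (jet_path v aE jF (seg_smooth x y)); apply/ball0P; apply: le_lt_trans (cB t t01) _; lra.
- exact: start.
- by move=> v t vq t01; apply: bnd => //; exact: cB.
- by rewrite ler01 lexx.
Qed.

End SheetPaths.

Section Subanalytic.
Context {R : realType} {d : nat} {X : set 'rV[R]_d} {f : 'rV[R]_d -> R} {x0 : 'rV[R]_d}.
Hypotheses (sX : simple_set X) (tf : testable X f).
Context {N : nat} {L : seq ('rV[R]_(1 + N) -> 'rV[R]_d)} {F : ('rV[R]_(1 + N) -> 'rV[R]_d) -> seq 'I_d -> 'rV[R]_(1 + N) -> R} {e : R}.
Local Notation B2 := (ball (0 : 'rV[R]_(1 + N)) 2).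
Hypotheses (e0 : 0 < e) (LP : forall E, E \in L -> good_sheet X E /\ sheet_jets X f E (F E)).
Hypothesis Lc : forall y, X y -> `|y - x0| < e -> exists E x, [/\ E \in L, `|x| <= 1 & E x = y].

Let U := interior X.
Let oU : open U := open_interior X.
Let sf : smooth_on U f := testable_smooth tf oU (@interior_subset _ X).

Let aL E : E \in L -> ganalyticv E. Proof. by move=> /LP [[]]. Qed.
Let B32 x : `|x| <= 3 / 2 -> B2 x.
Proof. by move=> x1; apply/ball0P; apply: le_lt_trans x1 _; lra. Qed.

Lemma jets_bounded (q : nat) : exists2 M : R, 0 <= M &
 forall E w x, E \in L -> (size w <= q)%N -> `|x| <= 3 / 2 -> `|F E w x| <= M.
Proof.
pose Q E (P : nat) (C : R) := forall w x, (size w <= q)%N -> `|x| <= 3 / 2 -> `|F E w x| <= C.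
have [||P [C [_ C0 PC]]] := @seq_max_bound R _ L Q.
- by move=> E P P' C C' _ CC QE w x wq x1; exact: le_trans (QE w x wq x1) CC.
- move=> E EL; have [_ [sF _ _]] := LP EL.
 have /choice [M MP] : forall w, exists M : R, forall x, `|x| <= 3 / 2 -> `|F E w x| <= M.
  by move=> w; have [M _ MP] := smooth_bounded [::] (sF w) (fun x => @B32 x); exists M.
 have [M' _ M'P] := words_bound M q; exists 0%N, M' => w x wq x1.
 by apply: le_trans (MP w x x1) _; apply: le_trans (ler_norm _) _; exact: M'P.
by exists C => // E w x EL; exact: PC.
Qed.

Let hh (p : ('rV[R]_(1 + N) -> 'rV[R]_d) * ('rV[R]_(1 + N) -> 'rV[R]_d)) (z : 'rV[R]_(1 + N + (1 + N))) : R :=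
 \sum_i (p.1 (lsubmx z) 0 i - p.2 (rsubmx z) 0 i) ^+ 2.

Let hh_le p x x' : `|p.1 x - p.2 x'| <= 1 -> `|hh p (row_mx x x')| <= d%:R * `|p.1 x - p.2 x'|.
Proof.
move=> h1; rewrite /hh row_mxKl row_mxKr; apply: norm_sum_le => i; have := coord_le_norm (p.1 x - p.2 x') i; rewrite !mxE normrX => h.
by rewrite expr2; apply: (@le_trans _ _ (`|p.1 x - p.2 x'| * 1)); [apply: ler_pM => //; exact: le_trans h h1 | rewrite mulr1].
Qed.

Lemma sheets_whitney : exists (rho C : R) (P : nat), [/\ 0 < rho, 0 <= C, (0 < P)%N &
 forall q : nat, exists2 B, 0 <= B & forall a b, U a -> U b -> `|a - x0| < rho -> `|b - x0| < rho ->
  exists2 l, 0 <= l /\ l ^+ P <= C * `|a - b| & forall j w, (j + size w <= q)%N ->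
   `|Dw w f b - Tp (fun u => Dw u f a) j w (b - a)| <= B * l ^+ j].
Proof.
have [||_ [Lam [_ Lam0 LamP]]] := @seq_max_bound R _ L (fun E _ C => speed_bound E C).
- move=> E _ _ C C' _ CC sE x y x1 y1; have [s1 s2] := sE x y x1 y1.
 by split=> [|t t01]; [apply: le_trans s1 _ | apply: le_trans (s2 t t01) _]; exact: ler_wpM2r.
- by move=> E /aL /sheet_speed [Lam LamP]; exists 0%N, Lam.
have [||P [C [P0 C0 PC]]] := @seq_max_bound R _ (allpairs pair L L)
  (fun p P C => forall z, `|z| <= 1 -> near_zero (hh p) P C z).
- by move=> p P P' C C' PP CC h z z1; exact: near_zero_le (h z z1).
- move=> p /allpairsP [[E E'] [/= EL E'L ->]]; apply: lojasiewicz.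
 apply: ganalytic_sum => i _; apply: ganalyticX; apply: ganalyticB => /=.
  have al : ganalyticv (fun z : 'rV[R]_(1 + N + (1 + N)) => lsubmx z).
   by move=> k; under eq_fun do rewrite mxE; exact: ganalytic_coord.
  exact: (ganalytic_comp (aL EL i) al).
 have ar : ganalyticv (fun z : 'rV[R]_(1 + N + (1 + N)) => rsubmx z).
  by move=> k; under eq_fun do rewrite mxE; exact: ganalytic_coord.
 exact: (ganalytic_comp (aL E'L i) ar).
pose d1 : R := d%:R + 1; have d10 : 0 < d1 by rewrite ltr_wpDl.
pose rho := Num.min (e / 2) (2 * d1)^-1.
have rho0 : 0 < rho by rewrite lt_min divr_gt0 //= invr_gt0 mulr_gt0.
pose r0 := e / (6 * (Lam + 1)); have L1 : 0 < Lam + 1 by rewrite ltr_wpDl.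
have r00 : 0 < r0 by rewrite divr_gt0 // mulr_gt0.
pose D := 6 * d%:R * Lam; have D0 : 0 <= D by rewrite !mulr_ge0.
pose K := 1 + r0^-1 ^+ P + D ^+ P.
have i0 : 0 <= r0^-1 ^+ P by rewrite exprn_ge0 // invr_ge0 ltW.
have DP0 : 0 <= D ^+ P by rewrite exprn_ge0.
exists rho, (K * (C * d%:R)), P; split=> //; first by rewrite !mulr_ge0 // !addr_ge0.
move=> q; have [M M0 MP] := jets_bounded q; exists (q.+2%:R * M); first exact: mulr_ge0.
move=> a b Ua Ub ar br.
have ae : `|a - x0| < e / 2 by apply: lt_le_trans ar _; rewrite ge_min lexx.
have be : `|b - x0| < e / 2 by apply: lt_le_trans br _; rewrite ge_min lexx.
have ab : `|b - a| * d1 <= 1.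
 have h : `|b - a| <= d1^-1.
  have -> : d1^-1 = (2 * d1)^-1 + (2 * d1)^-1 by field; rewrite gt_eqF.
  rewrite -[b - a](subrKA x0); apply: le_normD; apply: lerD.
   by apply: ltW; apply: lt_le_trans br _; rewrite ge_min lexx orbT.
  by rewrite distrC; apply: ltW; apply: lt_le_trans ar _; rewrite ge_min lexx orbT.
 by rewrite -ler_pdivlMr // mul1r.
have n0 : 0 <= `|b - a| by []; have nd : 0 <= `|b - a| * d%:R by rewrite mulr_ge0.
have ab1 : `|b - a| <= 1 by move: ab; rewrite /d1 mulrDr mulr1; lra.
have dab : d%:R * `|b - a| <= 1 by move: ab; rewrite /d1 mulrDr mulr1 mulrC; lra.
have e2 : e / 2 < e by move: e0; lra.
have [E [x [EL x1 xa]]] := Lc (interior_subset Ua) (lt_trans ae e2).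
have [E' [x' [E'L x'1 xb]]] := Lc (interior_subset Ub) (lt_trans be e2).
have [_ jE] := LP EL; have [_ jE'] := LP E'L.
have h32 (z : 'rV[R]_(1 + N)) : `|z| <= 1 -> `|z| <= 3 / 2 by lra.
have FA w : F E w x = Dw w f a by have [_ FE _] := jE; rewrite -xa; apply: FE; rewrite ?xa //; exact/B32/h32.
have FB w : F E' w x' = Dw w f b by have [_ FE _] := jE'; rewrite -xb; apply: FE; rewrite ?xb //; exact/B32/h32.
have hab : `|hh (E, E') (row_mx x x')| <= d%:R * `|a - b|.
 by rewrite -xa -xb; apply: hh_le; rewrite /= xa xb distrC.
have K1 : 1 <= K by rewrite /K -addrA lerDl addr_ge0.
have far : 1 <= K * (C * d%:R) * `|a - b| -> exists2 l, 0 <= l /\ l ^+ P <= K * (C * d%:R) * `|a - b| &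
  forall j w, (j + size w <= q)%N -> `|Dw w f b - Tp (fun u => Dw u f a) j w (b - a)| <= q.+2%:R * M * l ^+ j.
 move=> h; exists 1; first by rewrite expr1n.
 move=> j w jq; rewrite expr1n mulr1; apply: le_normB.
 have hb : `|Dw w f b| <= M.
  by rewrite -FB; apply: MP => //; [exact: leq_trans (leq_addl _ _) jq | exact: h32].
 have ht : `|Tp (fun u => Dw u f a) j w (b - a)| <= j.+1%:R * M.
  by apply: Tp_bound => // u uq; rewrite -FA; apply: MP => //; [exact: leq_trans uq jq | exact: h32].
 have : j.+1%:R * M <= q.+1%:R * M.
  by apply: ler_wpM2r => //; rewrite ler_nat ltnS; exact: leq_trans (leq_addr _ _) jq.
 by rewrite -[q.+2]addn1 natrD mulrDl mul1r; move: ht hb; move: (j.+1%:R * M) (q.+1%:R * M) => u v; lra.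
have zP : `|row_mx x x' : 'rV[R]_(1 + N + (1 + N))| <= 1.
 apply: row_norm_le => // i; case: (split_ordP i) => k ->; rewrite ?row_mxEl ?row_mxEr.
  exact: le_trans (coord_le_norm _ _) x1.
 exact: le_trans (coord_le_norm _ _) x'1.
have EE' : (E, E') \in allpairs pair L L by apply/allpairsP; exists (E, E').
have ChC : C * `|hh (E, E') (row_mx x x')| <= C * d%:R * `|a - b| by rewrite -mulrA; exact: ler_wpM2l.
have nCd : 0 <= C * d%:R * `|a - b| by rewrite !mulr_ge0.
have [[z [z2 hz zr]]|h1] := PC (E, E') EE' _ zP; last first.
 by apply: far; rewrite -mulrA; apply: le_trans (le_trans h1 ChC) _; exact: ler_peMl.
set r := `|row_mx x x' - z| / 3 in zr; have rr : 0 <= r by rewrite divr_ge0.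
have {zr ChC} zr : r ^+ P <= C * d%:R * `|a - b| := le_trans zr ChC.
have [rge|rlt] := leP r0 r.
 apply: far; rewrite -mulrA; apply: (@le_trans _ _ (r0^-1 ^+ P * (C * d%:R * `|a - b|))); last first.
  by apply: ler_wpM2r => //; rewrite /K; lra.
 apply: le_trans (ler_wpM2l i0 zr); rewrite -exprMn; apply: exprn_ege1.
 by rewrite mulrC ler_pdivlMr // mul1r.
pose y := lsubmx z; pose y' := rsubmx z.
have y2 : `|y| <= 3 / 2.
 apply: ltW; apply: le_lt_trans z2; apply: row_norm_le => // i; rewrite mxE; exact: coord_le_norm.
have y'2 : `|y'| <= 3 / 2.
 apply: ltW; apply: le_lt_trans z2; apply: row_norm_le => // i; rewrite mxE; exact: coord_le_norm.
have r3 : `|row_mx x x' - z| = 3 * r by rewrite /r mulrC divfK.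
have yx : `|y - x| <= 3 * r.
 rewrite -r3 distrC; have -> : x - y = lsubmx (row_mx x x' - z) by rewrite linearB /= row_mxKl.
 by apply: row_norm_le => // i; rewrite mxE; exact: coord_le_norm.
have yx' : `|x' - y'| <= 3 * r.
 rewrite -r3; have -> : x' - y' = rsubmx (row_mx x x' - z) by rewrite linearB /= row_mxKr.
 by apply: row_norm_le => // i; rewrite mxE; exact: coord_le_norm.
have Eyy' : E y = E' y'.
 move/eqP: hz; rewrite psumr_eq0 => [/allP h0|i _]; last exact: sqr_ge0.
 by apply/rowP => i; have := h0 i (mem_index_enum _); rewrite sqrf_eq0 subr_eq0 => /eqP.
have Ey : `|E y - x0| < e.
 have [h _] := LamP E EL x y (h32 _ x1) y2; rewrite xa in h.
 rewrite -[E y - x0](subrKA a); apply: lt_normD.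
 have h2 : Lam * `|y - x| <= Lam * (3 * r) by exact: ler_wpM2l.
 have h3 : Lam * (3 * r) <= e / 2.
  have : (Lam + 1) * r <= e / 6.
   have -> : e / 6 = (Lam + 1) * r0 by rewrite /r0; field; rewrite gt_eqF.
   by rewrite ler_pM2l // ltW.
  have gen (u v E0 : R) : 0 <= v -> (u + 1) * v <= E0 / 6 -> u * (3 * v) <= E0 / 2.
   by move=> v0; rewrite mulrDl mul1r mulrCA; move: (u * v) => c; lra.
  exact: gen.
 by move: h h2 h3 ae; lra.
exists (D * r); first split; first exact: mulr_ge0.
 rewrite exprMn -mulrA; apply: (@le_trans _ _ (D ^+ P * (C * d%:R * `|a - b|))); first exact: ler_wpM2l.
 by apply: ler_wpM2r => //; rewrite /K; lra.
have sc : symm_words (fun u => Dw u f a) by move=> v i j w; exact: Dw_swap oU sf Ua.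
have B0 : 0 <= q.+2%:R * M by exact: mulr_ge0.
have bnd E1 w v : E1 \in L -> (size w <= q)%N -> `|v| <= 3 / 2 -> `|F E1 w v - Dw w f a| <= q.+2%:R * M.
 move=> E1L wq v2; apply: le_normB; rewrite -FA.
 have h1 := MP E1 w v E1L wq v2; have h2 := MP E w x EL wq (h32 _ x1).
 have : 2 * M <= q.+2%:R * M by apply: ler_wpM2r => //; rewrite ler_nat.
 by move: h1 h2; move: (q.+2%:R * M) => u; lra.
pose l1 := d%:R * (Lam * `|y - x|).
have p1 : forall j w, (j + size w <= q)%N ->
  `|F E w y - Tp (fun u => Dw u f a) j w (E y - a)| <= q.+2%:R * M * l1 ^+ j.
 move=> j w jq; have := sheet_path (aL EL) jE Lam0 (LamP E EL) (h32 _ x1) y2 sc B0 (lexx 0) _ _ jq (a := a).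
 rewrite add0r -/l1; apply=> [{jq} j {}w jq|{jq}w v wq v2]; last exact: bnd.
 by rewrite xa subrr Tp0 FA subrr normr0 mulr_ge0 // exprn_ge0.
have l10 : 0 <= l1 by rewrite !mulr_ge0.
move=> j w jq; have := sheet_path (aL E'L) jE' Lam0 (LamP E' E'L) y'2 (h32 _ x'1) sc B0 l10 _ _ jq (a := a).
rewrite xb FB => h; apply: le_trans (h _ _) _.
- move=> j' w' jq'; rewrite -(fibre_eq sX tf LP Lc w' EL E'L (B32 y2) (B32 y'2) Eyy' Ey) -Eyy'; exact: p1.
- by move=> v u vq u2; exact: bnd.
apply: ler_wpM2l => //; apply: lerXn2r; rewrite ?nnegrE ?mulr_ge0 ?addr_ge0 ?mulr_ge0 //.
have -> : D * r = d%:R * (Lam * (3 * r)) + d%:R * (Lam * (3 * r)) by rewrite /D; ring.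
by apply: lerD; apply: ler_wpM2l => //; exact: ler_wpM2l.
Qed.

Lemma sheets_extension : exists W G, [/\ open W, W x0, smooth_on W G & forall y, W y -> U y -> G y = f y].
Proof.
by have [rho [C [P [rho0 C0 P0 wh]]]] := sheets_whitney; exact: whitney_local wh.
Qed.

End Subanalytic.

Lemma subanalytic_Cinf {R : realType} n m (p : 'rV[R]_n -> 'rV[R]_m) d (X : set 'rV[R]_d) (f : 'rV[R]_d -> 'rV[R]_n) :
 pseudo_immersion p -> fat_closed X -> simple_set X -> subanalytic X ->
 {within X, continuous f} -> Cinf X (p \o f) -> Cinf X f.
Proof.
move=> ip fX sX aX cf pf; have [_ [Xc _]] := fX.
apply: (Cinf_of_extensions cf (@interior_subset _ X)); first by rewrite -Xc.
move=> x0 i _; have tf := pseudo_immersion_testable i ip cf pf.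
have [N [L [e [e0 LP Lc]]]] := good_sheets x0 fX aX.
have /choice [F FP] : forall E, exists F, E \in L -> sheet_jets X (fun x => f x 0 i) E F.
 move=> E; have [EL|nE] := pselect (E \in L); last by exists (fun _ _ => 0).
 by have [F FP] := good_sheet_jets tf (LP E EL); exists F.
have [||W [G [oW Wx sG GE]]] := @sheets_extension R d X _ x0 sX tf N L F e e0.
- by move=> E EL; split; [exact: LP | exact: FP].
- by move=> y Xy yx; have [E [w [EL w1 wE]]] := Lc y Xy yx; exists E, (zy 0 w); split=> //; apply: zy_le; rewrite ?normr0.
by exists W, G.
Qed.

Theorem theorem9p6 (R : realType) (n m : nat) (p : 'rV[R]_n -> 'rV[R]_m) :
  pseudo_immersion p ->
  (forall (d : nat) (X : set 'rV[R]_d), Ainf_admissible X ->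
     forall f : 'rV[R]_d -> 'rV[R]_n,
       {within X, continuous f} -> Cinf X (p \o f) -> Cinf X f) /\
  (forall (d : nat) (X : set 'rV[R]_d.+1), holder_set X ->
     forall f : 'rV[R]_d.+1 -> 'rV[R]_n,
       {within X, continuous f} -> Cinf X (p \o f) -> Cinf X f) /\
  (forall (d : nat) (X : set 'rV[R]_d),
     fat_closed X -> simple_set X -> subanalytic X ->
     forall f : 'rV[R]_d -> 'rV[R]_n,
       {within X, continuous f} -> Cinf X (p \o f) -> Cinf X f).
Proof.
move=> ip; split; [|split].
- by move=> d X aX f cf pf; exact: admissible_Cinf ip aX cf pf.
- by move=> d X hX f cf pf; exact: holder_Cinf ip hX cf pf.
- by move=> d X fX sX aX f cf pf; exact: subanalytic_Cinf ip fX sX aX cf pf.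
Qed.
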